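(* Let $X\subsetneq\mathbb{C}^n$ be a proper complex analytic subvariety which is not a finite set. Let $G$ be a Lie group acting effectively on $X$. Then there exists an embedding $j:X\to\mathbb{C}^n$ such that for no element $g\in G\setminus\{e\}$ the automorphism of $j(X)$ induced by $g$ can be extended to a holomorphic automorphism of $\mathbb{C}^n$; that is, for no $g\in G\setminus\{e\}$ is there a holomorphic automorphism $\Phi$ of $\mathbb{C}^n$ with $\Phi(j(x))=j(g\cdot x)$ for all $x\in X$.
   Context: Embedding means proper holomorphic embedding: a proper holomorphic map which is injective and immersive. Lie groups are real Lie groups, by convention locally compact with countable topology (second countable). A $G$-action on $X$ is a continuous action $G\times X\to X$ by holomorphic automorphisms of $X$; it is effective if only $e$ acts as the identity. *)

(* Defs.v *)
From HB Require Import structures.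
From mathcomp Require Import all_boot all_order all_algebra.
From mathcomp Require Import all_classical all_reals all_analysis.
From mathcomp Require Export complex.
Export numFieldNormedType.Exports.

Set Implicit Arguments.
Unset Strict Implicit.
Unset Printing Implicit Defensive.

Local Open Scope classical_set_scope.
Local Open Scope ring_scope.

(* The library topologizes abstract num fields and, separately, matrices over
   them; the concrete type R[i] needs its own instance, taken from R[i]^o, so
   that 'rV[R[i]]_n is a normed space over R[i]. Over this scalar field,
   [differentiable] means complex differentiable. *)
Set Warnings "-redundant-canonical-projection".
HB.instance Definition _ (R : realType) := NormedModule.copy R[i] R[i]^o.
Set Warnings "redundant-canonical-projection".

(* C^k and smooth maps on an open set U of a finite-dimensional normed space;
   there, C^(k+1) amounts to differentiability together with all directional
   derivatives being C^k. *)
Fixpoint Ck_on (R : realType) (V W : normedModType R) (k : nat) (U : set V)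
    (f : V -> W) : Prop :=
  match k with
  | 0 => {within U, continuous f}
  | k'.+1 => (forall x, U x -> differentiable f x) /\
             (forall v, Ck_on k' U (fun x => 'D_v f x))
  end.

Definition smooth_on (R : realType) (V W : normedModType R) (U : set V)
    (f : V -> W) : Prop :=
  forall k, Ck_on k U f.

(* A homeomorphism from an open subset of M onto an open subset of R^d; the
   values of the two total functions outside these sets are irrelevant. *)
Record chart (R : realType) (d : nat) (M : topologicalType) := Chart {
  chart_dom : set M;
  chart_cod : set 'rV[R]_d;
  chart_map : M -> 'rV[R]_d;
  chart_inv : 'rV[R]_d -> M;
  chart_dom_open : open chart_dom;
  chart_cod_open : open chart_cod;
  chart_map_cod : forall x, chart_dom x -> chart_cod (chart_map x);
  chart_inv_dom : forall u, chart_cod u -> chart_dom (chart_inv u);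
  chart_mapK : forall x, chart_dom x -> chart_inv (chart_map x) = x;
  chart_invK : forall u, chart_cod u -> chart_map (chart_inv u) = u;
  chart_map_continuous : {within chart_dom, continuous chart_map};
  chart_inv_continuous : {within chart_cod, continuous chart_inv} }.

HB.mixin Record isLieGroup (R : realType) (d : nat) G
    of Group G & Topological G := {
  lie_hausdorff : hausdorff_space G;
  lie_second_countable : @second_countable G;
  lie_atlas : set (chart R d G);
  lie_atlas_cover : forall x : G,
    exists2 a, lie_atlas a & chart_dom a x;
  lie_atlas_compatible : forall a b, lie_atlas a -> lie_atlas b ->
    smooth_on [set u | chart_cod a u /\ chart_dom b (chart_inv a u)]
      (fun u => chart_map b (chart_inv a u));
  lie_mul_continuous : continuous (fun p : G * G => (p.1 * p.2)%g);
  lie_inv_continuous : continuous (fun x : G => x^-1%g);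
  lie_mul_smooth : forall a b c, lie_atlas a -> lie_atlas b -> lie_atlas c ->
    smooth_on
      [set p : 'rV[R]_d * 'rV[R]_d | [/\ chart_cod a p.1, chart_cod b p.2 &
        chart_dom c (chart_inv a p.1 * chart_inv b p.2)%g]]
      (fun p : 'rV[R]_d * 'rV[R]_d =>
        chart_map c (chart_inv a p.1 * chart_inv b p.2)%g);
  lie_inv_smooth : forall a b, lie_atlas a -> lie_atlas b ->
    smooth_on
      [set u | chart_cod a u /\ chart_dom b ((chart_inv a u)^-1)%g]
      (fun u => chart_map b ((chart_inv a u)^-1)%g) }.

#[short(type="lieGroupType")]
HB.structure Definition LieGroup (R : realType) (d : nat) :=
  {G of isLieGroup R d G & Group G & Topological G}.

Section ComplexAnalytic.
Context {R : realType}.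
Local Notation C := (R[i]).

(* Only used for open U. *)
Definition holomorphic_on (n : nat) (W : normedModType C)
    (U : set 'rV[C]_n) (f : 'rV[C]_n -> W) : Prop :=
  forall x, U x -> differentiable f x.

Definition analytic_subvariety (n : nat) (X : set 'rV[C]_n) : Prop :=
  forall p : 'rV[C]_n,
    exists (U : set 'rV[C]_n) (k : nat) (f : 'I_k -> 'rV[C]_n -> C),
      [/\ open U, U p, forall i, holomorphic_on U (f i) &
          X `&` U = [set q | U q /\ forall i, f i q = 0]].

Section Subvariety.
Variables (n : nat) (X : set 'rV[C]_n).

Definition local_extension (m : nat) (f : X -> 'rV[C]_m) (x : X)
    (U : set 'rV[C]_n) (F : 'rV[C]_n -> 'rV[C]_m) : Prop :=
  [/\ open U, U (set_val x), holomorphic_on U F &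
      forall y : X, U (set_val y) -> f y = F (set_val y)].

(* Holomorphic maps out of X, as a reduced complex space. *)
Definition holomorphic_map (m : nat) (f : X -> 'rV[C]_m) : Prop :=
  forall x : X, exists U F, local_extension f x U F.

(* Zariski tangent space: the common kernel of the differentials at p of the
   germs of holomorphic functions vanishing on X. *)
Definition tangent_space (p : 'rV[C]_n) : set 'rV[C]_n :=
  [set v | forall (U : set 'rV[C]_n) (f : 'rV[C]_n -> C),
     open U -> U p -> holomorphic_on U f ->
     (forall q, X q -> U q -> f q = 0) -> 'd f p v = 0].

(* The differential of a holomorphic map on X is the restriction to the
   Zariski tangent space of that of any local extension; it does not depend on
   the extension. *)
Definition immersive (m : nat) (f : X -> 'rV[C]_m) : Prop :=
  forall (x : X) U F, local_extension f x U F ->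
    forall v, tangent_space (set_val x) v -> 'd F (set_val x) v = 0 -> v = 0.

Definition proper_map (m : nat) (f : X -> 'rV[C]_m) : Prop :=
  forall K : set 'rV[C]_m, compact K -> compact (f @^-1` K).

Definition embedding (m : nat) (f : X -> 'rV[C]_m) : Prop :=
  [/\ holomorphic_map f, proper_map f, injective f & immersive f].

(* The inverse of [act g] is [act g^-1], so that each [act g] is a holomorphic
   automorphism of X. *)
Record holomorphic_action (d : nat) (G : lieGroupType R d)
    (act : G -> X -> X) : Prop := HolomorphicAction {
  act1 : forall x, act 1%g x = x;
  actM : forall g h x, act (g * h)%g x = act g (act h x);
  act_continuous : continuous (fun p : G * X => act p.1 p.2);
  act_holomorphic : forall g, holomorphic_map (fun x => set_val (act g x)) }.

Definition effective (d : nat) (G : lieGroupType R d)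
    (act : G -> X -> X) : Prop :=
  forall g : G, (forall x, act g x = x) -> g = 1%g.

End Subvariety.

Definition holomorphic_automorphism (n : nat)
    (Phi : 'rV[C]_n -> 'rV[C]_n) : Prop :=
  holomorphic_on setT Phi /\
  exists Psi : 'rV[C]_n -> 'rV[C]_n,
    [/\ holomorphic_on setT Psi, cancel Phi Psi & cancel Psi Phi].

End ComplexAnalytic.

(* Main.v *)
(* The holomorphic automorphism extending the action of g maps j(x) to j(g x), so
   it suffices that the set j(X) has no such symmetries.

   For n >= 2, j is the restriction to X of a limit of automorphisms Th_s of C^n.
   Step s fixes, up to a small error, a polydisc B_s and the part of X treated so
   far, and moves a far away point x_s of X close to a prescribed target e_s just
   outside B_s. It is a composition of shears approximating the flow of a field
   along a line from Th_s(x_s) to e_s; the field is large on this line and tiny on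
   B_s and X because it is multiplied by a power of a polynomial with this
   property, which is found by counting coefficients as in Siegel's lemma. As x_s
   is chosen after B_s, no g in the s-th compact part of G maps to x_s a point
   which j sends into B_s. Hence an automorphism Phi extending the action of some
   g maps no point of B_s to j(x_s), for all large s, and the same holds for its
   inverse. Following Rosay and Rudin, the targets are prescribed as finer and
   finer nets in thin shells r < |z - c| < r + delta with r tending to infinity:
   if an image Phi(|z - c| < r) crosses the shell, then it covers a ball of fixed
   radius around some point of the shell, hence a point of the net. Thus Phi and
   its inverse map |z - c| < r - eta into |z - c| < r + delta for r large, so that
   Phi is affine and fixes c, and n + 1 centres c give Phi = id.

   For n = 1, X is discrete and j sends it into the natural numbers. An
   automorphism of C is affine, and an affine bijection of an infinite set of
   natural numbers onto itself is increasing, hence the identity. *)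
Require Import Defs.
From HB Require Import structures.
From mathcomp Require Import all_boot all_order all_algebra.
From mathcomp Require Import all_classical all_reals all_analysis.
From mathcomp Require Import perm.
From mathcomp Require Import zify ring lra.

Set Implicit Arguments.
Unset Strict Implicit.
Unset Printing Implicit Defensive.
Import Order.TTheory GRing.Theory Num.Theory.

Local Open Scope classical_set_scope.
Local Open Scope ring_scope.
Local Open Scope complex_scope.
Local Notation Re := complex.Re.
Local Notation Im := complex.Im.

(** * Complex differentiation and Cauchy estimates *)

Section ComplexModulus.
Context {R : realType}.
Local Notation C := (R[i]).
Implicit Types z w : C.

(** The obstacle is that [X] is an arbitrary analytic set: no polynomial convexity is at hand to
    approximate a field that is large on a line and tiny on [X]. The approximation is quantitative
    instead. For polynomials of degree below [T] in each of the n variables, every estimate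
    (interpolation, Schwarz lemma, distance to the roots) loses only a factor [C ^+ T]. Near each of
    its points, [X] lies in the zero set of a function prepared in one variable, so a function on
    [X] amounts to finitely many functions of n - 1 variables. Making these vanish on a grid costs a
    multiple of [T ^ (n - 1)] conditions, out of [T ^ n] coefficients, and gives decay like [a ^- T]
    for any prescribed rate [a]; this rate is chosen after the constants of the losses and beats
    them. The norm is the maximum norm, so that a point outside a polydisc sticks out in a single
    coordinate. In the rigidity argument, the radius of the ball covered by Phi depends on a bound
    for Phi which is not known in advance. It is supplied by the next larger shell, and for a very
    large shell by continuity, which is why the induction over the shells goes downwards. *)

Definition cn z : R := Re `|z|.

Lemma cnE z : `|z| = (cn z)%:C.
Proof. by rewrite /cn RRe_real ?normr_real. Qed.

Lemma cn_ge0 z : 0 <= cn z.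
Proof. by rewrite -ler0c -cnE. Qed.

Lemma cnM z w : cn (z * w) = cn z * cn w.
Proof. by apply: complexI; rewrite -cnE normrM !cnE rmorphM. Qed.

Lemma cnD z w : cn (z + w) <= cn z + cn w.
Proof. by rewrite -lecR rmorphD -!cnE ler_normD. Qed.

Lemma cnN z : cn (- z) = cn z.
Proof. by rewrite /cn normrN. Qed.

Lemma cnB z w : cn (z - w) = cn (w - z).
Proof. by rewrite -opprB cnN. Qed.

Lemma cn0 : cn 0 = 0.
Proof. by rewrite /cn normr0. Qed.

Lemma cn1 : cn 1 = 1.
Proof. by rewrite /cn normr1. Qed.

Lemma cn_eq0 z : (cn z == 0) = (z == 0).
Proof. by rewrite -[RHS]normr_eq0 cnE (inj_eq (@complexI R) _ 0). Qed.

Lemma cn_gt0 z : (0 < cn z) = (z != 0).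
Proof. by rewrite lt0r cn_eq0 cn_ge0 andbT. Qed.

Lemma cnV z : cn z^-1 = (cn z)^-1.
Proof. by apply: complexI; rewrite -cnE normfV cnE fmorphV. Qed.

Lemma cnX z k : cn (z ^+ k) = cn z ^+ k.
Proof. by elim: k => [|k IH]; rewrite ?expr0 ?cn1 // !exprS cnM IH. Qed.

Lemma cn_real (x : R) : cn x%:C = `|x|.
Proof. by rewrite /cn normc_def /= expr0n addr0 sqrtr_sqr. Qed.

Lemma cn_i : cn (Complex 0 1) = 1.
Proof. by rewrite /cn normc_def /= expr0n add0r expr1n sqrtr1. Qed.

Lemma cn_sqr z : cn z ^+ 2 = Re z ^+ 2 + Im z ^+ 2.
Proof. by apply: complexI; rewrite rmorphXn /= -cnE add_Re2_Im2. Qed.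

Lemma cn_Re z : `|Re z| <= cn z.
Proof.
rewrite -(@ler_pXn2r _ 2) ?nnegrE ?cn_ge0 // cn_sqr real_normK ?num_real //.
by rewrite lerDl sqr_ge0.
Qed.

Lemma cn_Im z : `|Im z| <= cn z.
Proof.
rewrite -(@ler_pXn2r _ 2) ?nnegrE ?cn_ge0 // cn_sqr real_normK ?num_real //.
by rewrite lerDr sqr_ge0.
Qed.

Lemma cn_le z : cn z <= `|Re z| + `|Im z|.
Proof.
rewrite {1}(complexE z); apply: (le_trans (cnD _ _)).
by rewrite cnM cn_i mul1r !cn_real.
Qed.

Lemma cn_sum (I : Type) (r : seq I) (P : pred I) (F : I -> C) :
  cn (\sum_(i <- r | P i) F i) <= \sum_(i <- r | P i) cn (F i).
Proof.
elim/big_rec2: _ => [|i y x _ h]; first by rewrite cn0.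
by apply: (le_trans (cnD _ _)); rewrite lerD2l.
Qed.

Lemma cn_prod (I : Type) (r : seq I) (P : pred I) (F : I -> C) :
  cn (\prod_(i <- r | P i) F i) = \prod_(i <- r | P i) cn (F i).
Proof. by elim/big_rec2: _ => [|i y x _ <-]; rewrite ?cn1 ?cnM. Qed.

Lemma cn_dist z w : cn z <= cn w + cn (z - w).
Proof. by rewrite -{1}(subrK w z) addrC; apply: le_trans (cnD _ _) _. Qed.

Lemma cn_distD a z w : cn (z - w) <= cn (z - a) + cn (a - w).
Proof. by have := cnD (z - a) (a - w); rewrite addrA subrK. Qed.

Lemma cn_inj z : cn z = 0 -> z = 0.
Proof. by move/eqP; rewrite cn_eq0 => /eqP. Qed.

Lemma cn_small z : (forall e : R, 0 < e -> cn z <= e) -> z = 0.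
Proof.
move=> h; apply: cn_inj; apply/eqP; rewrite eq_le cn_ge0 andbT.
by apply/ler_addgt0Pr => e e0; rewrite add0r h.
Qed.

End ComplexModulus.

(** * Complex derivatives with explicit error bounds *)

Section Cdiff.
Context {R : realType}.
Local Notation C := (R[i]).
Implicit Types (f g : C -> C) (a z w d : C).

(** With explicit radii and the real-valued modulus, the one-variable theory becomes a matter of
    inequalities in [R]. [cdiff_slice] obtains this derivative from [differentiable] on complex
    lines. *)
Definition cdiff f a d := forall e : R, 0 < e -> exists2 r : R, 0 < r &
  forall h, cn h < r -> cn (f (a + h) - f a - d * h) <= e * cn h.

Definition rdiff (K : R -> C) (x : R) d := forall e : R, 0 < e ->
  exists2 r : R, 0 < r &
  forall h : R, `|h| < r -> cn (K (x + h) - K x - d * h%:C) <= e * `|h|.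

Definition hol a (r : R) f := forall z, cn (z - a) < r -> exists d, cdiff f z d.

Lemma cdiff_line f (a b : C) (x : R) d :
  cdiff f (a + x%:C * b) d -> rdiff (fun t => f (a + t%:C * b)) x (d * b).
Proof.
move=> df e e0.
have M0 : 0 < cn b + 1 by rewrite ltr_wpDl // cn_ge0.
have [r r0 hr] := df (e / (cn b + 1)) (divr_gt0 e0 M0).
exists (r / (cn b + 1)); first exact: divr_gt0.
move=> h hh.
have hb : cn (h%:C * b) < r.
  rewrite cnM cn_real; apply: le_lt_trans (_ : `|h| * (cn b + 1) < r).
    by rewrite ler_wpM2l // lerDl.
  by rewrite -ltr_pdivlMr.
have := hr _ hb.
rewrite rmorphD /= mulrDl addrA -[d * b * _]mulrA [b * _]mulrC.
move/le_trans; apply; rewrite cnM cn_real mulrCA.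
rewrite mulrAC -mulrA [leRHS]mulrC; apply: ler_wpM2l => //.
rewrite ler_piMr ?ltW //.
by rewrite ltr_pdivrMr // mul1r ltrDl.
Qed.

Lemma cdiff_cont f a d : cdiff f a d -> forall e : R, 0 < e -> exists2 r : R, 0 < r &
  forall z, cn (z - a) < r -> cn (f z - f a) <= e.
Proof.
move=> df e e0; have [r r0 hr] := df 1 ltr01.
have M0 : 0 < cn d + 1 by rewrite ltr_wpDl // cn_ge0.
exists (Num.min r (e / (cn d + 1))); first by rewrite lt_min r0 divr_gt0.
move=> z; rewrite lt_min => /andP[zr ze].
have := hr _ zr; rewrite [a + _]addrC subrK mul1r => h1.
have -> : f z - f a = (f z - f a - d * (z - a)) + d * (z - a) by rewrite subrK.
apply: (le_trans (cnD _ _)); rewrite cnM.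
move: ze; rewrite ltr_pdivlMr // => ze.
nra.
Qed.

Lemma cdiff_cst c a : cdiff (fun=> c) a 0.
Proof. by move=> e e0; exists 1 => // h _; rewrite subrr mul0r subrr cn0 mulr_ge0 ?cn_ge0 ?ltW. Qed.

Lemma cdiff_id a : cdiff id a 1.
Proof.
move=> e e0; exists 1 => // h _.
by rewrite [a + h]addrC addrK mul1r subrr cn0 mulr_ge0 ?cn_ge0 ?ltW.
Qed.

Lemma cdiffD f g a d d' : cdiff f a d -> cdiff g a d' ->
  cdiff (fun z => f z + g z) a (d + d').
Proof.
move=> df dg e e0; have e2 : 0 < e / 2 by rewrite divr_gt0.
have [r r0 hr] := df _ e2; have [s s0 hs] := dg _ e2.
exists (Num.min r s); first by rewrite lt_min r0.
move=> h; rewrite lt_min => /andP[/hr h1 /hs h2].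
have -> : f (a + h) + g (a + h) - (f a + g a) - (d + d') * h =
  (f (a + h) - f a - d * h) + (g (a + h) - g a - d' * h) by ring.
apply: (le_trans (cnD _ _)); lra.
Qed.

Lemma cdiffM f g a d d' : cdiff f a d -> cdiff g a d' ->
  cdiff (fun z => f z * g z) a (d * g a + f a * d').
Proof.
move=> df dg e e0.
pose M := cn (f a) + cn (g a) + cn d + 3.
have M0 : 0 < M by rewrite /M; have := cn_ge0 (f a); have := cn_ge0 (g a); have := cn_ge0 d; lra.
have eM : 0 < Num.min 1 (e / M) by rewrite lt_min ltr01 divr_gt0.
have [r r0 hr] := df _ eM; have [s s0 hs] := dg _ eM.
have [t t0 ht] := cdiff_cont dg eM.
exists (Num.min r (Num.min s t)); first by rewrite !lt_min r0 s0.
move=> h; rewrite !lt_min => /and3P[/hr h1 /hs h2 h3].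
have {h3} /ht h3 : cn (a + h - a) < t by rewrite [a + h]addrC addrK.
have -> : f (a + h) * g (a + h) - f a * g a - (d * g a + f a * d') * h =
  (f (a + h) - f a - d * h) * (g (a + h) - g a + g a) +
  f a * (g (a + h) - g a - d' * h) + d * h * (g (a + h) - g a) by ring.
have := cnD ((f (a + h) - f a - d * h) * (g (a + h) - g a + g a) +
  f a * (g (a + h) - g a - d' * h)) (d * h * (g (a + h) - g a)).
have := cnD ((f (a + h) - f a - d * h) * (g (a + h) - g a + g a))
  (f a * (g (a + h) - g a - d' * h)).
have := cnD (g (a + h) - g a) (g a).
rewrite !cnM.
move: h1 h2 h3.
set x := cn (_ - _ - _); set y := cn (_ - _ - _); set u := cn (g (a + h) - g a).
set v := cn (g (a+h) - g a + g a).
set E := Num.min _ _ => h1 h2 h3 h4 h5 h6; apply: (le_trans h6).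
apply: (le_trans (lerD h5 (lexx _))).
have E1 : E <= 1 by rewrite /E ge_min lexx.
have EM : E * M <= e by rewrite -ler_pdivlMr // /E ge_min lexx orbT.
have x0 : 0 <= x := cn_ge0 _. have y0 : 0 <= y := cn_ge0 _.
have u0 : 0 <= u := cn_ge0 _. have v0 : 0 <= v := cn_ge0 _.
have H0 := cn_ge0 h. have F0 := cn_ge0 (f a). have G0 := cn_ge0 (g a).
have D0 := cn_ge0 d.
apply: le_trans (_ : E * cn h * (1 + cn (g a)) + cn (f a) * (E * cn h) + cn d * cn h * E <= _).
  apply: lerD; [apply: lerD|].
  - by apply: ler_pM => //; lra.
  - exact: ler_wpM2l.
  - by apply: ler_wpM2l => //; rewrite mulr_ge0.
have -> : E * cn h * (1 + cn (g a)) + cn (f a) * (E * cn h) + cn d * cn h * E = E * (M - 2) * cn h.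
  by rewrite /M; ring.
apply: ler_wpM2r => //; apply: le_trans EM.
by apply: ler_wpM2l; [exact: ltW|lra].
Qed.

Lemma cdiff_comp f g a d d' : cdiff g a d -> cdiff f (g a) d' ->
  cdiff (f \o g) a (d' * d).
Proof.
move=> dg df e e0.
pose M := cn d + cn d' + 2.
have M0 : 0 < M by rewrite /M; have := cn_ge0 d; have := cn_ge0 d'; lra.
have eM : 0 < Num.min 1 (e / M) by rewrite lt_min ltr01 divr_gt0.
have [r r0 hr] := df _ eM; have [s s0 hs] := dg _ eM.
have r2 : 0 < r / 2 by rewrite divr_gt0.
have [t t0 ht] := cdiff_cont dg r2.
exists (Num.min s t); first by rewrite !lt_min s0.
move=> h; rewrite !lt_min => /andP[/hs h2 h3] /=.
have {h3}/ht h3 : cn (a + h - a) < t by rewrite [a + h]addrC addrK.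
have /hr : cn (g (a + h) - g a) < r by apply: (le_lt_trans h3); lra.
rewrite [g a + _]addrC subrK => h1.
have -> : f (g (a + h)) - f (g a) - d' * d * h =
  (f (g (a + h)) - f (g a) - d' * (g (a + h) - g a)) + d' * (g (a + h) - g a - d * h) by ring.
apply: (le_trans (cnD _ _)); rewrite cnM.
have h4 : cn (g (a + h) - g a) <= (Num.min 1 (e / M) + cn d) * cn h.
  have -> : g (a + h) - g a = (g (a + h) - g a - d * h) + d * h by rewrite subrK.
  by apply: (le_trans (cnD _ _)); rewrite cnM mulrDl lerD2r.
move: h1 h2 h4; set E := Num.min _ _ => h1 h2 h4.
have E1 : E <= 1 by rewrite /E ge_min lexx.
have EM : E * M <= e by rewrite -ler_pdivlMr // /E ge_min lexx orbT.
have H0 := cn_ge0 h. have D'0 := cn_ge0 d'. have D0 := cn_ge0 d.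
apply: le_trans (_ : E * ((1 + cn d) * cn h) + cn d' * (E * cn h) <= _).
  apply: lerD; last exact: ler_wpM2l.
  apply: (le_trans h1); apply: ler_wpM2l; first exact: ltW.
  by apply: (le_trans h4); apply: ler_wpM2r => //; rewrite lerD2r.
have -> : E * ((1 + cn d) * cn h) + cn d' * (E * cn h) = E * (M - 1) * cn h by rewrite /M; ring.
apply: ler_wpM2r => //; apply: le_trans EM.
by apply: ler_wpM2l; [exact: ltW|lra].
Qed.

Lemma cdiff_inv a : a != 0 -> cdiff (fun z => z^-1) a (- a^-2).
Proof.
move=> a0 e e0; have A0 : 0 < cn a by rewrite cn_gt0.
exists (Num.min (cn a / 2) (e * cn a ^+ 3 / 2)).
  by rewrite lt_min !divr_gt0 // mulr_gt0 // exprn_gt0.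
move=> h; rewrite lt_min => /andP[h1 h2].
have ah : cn a / 2 <= cn (a + h).
  have := cn_dist a (a + h); rewrite cnB [a + h]addrC addrK.
  by lra.
have ah0 : a + h != 0 by rewrite -cn_gt0; apply: lt_le_trans ah; rewrite divr_gt0.
have -> : (a + h)^-1 - a^-1 - - a^-2 * h = h * h / (a ^+ 2 * (a + h)).
  by field; rewrite ah0.
rewrite cnM cnV cnM -mulrA [leRHS]mulrC; apply: ler_wpM2l; first exact: cn_ge0.
rewrite ler_pdivrMr ?cn_gt0 ?mulf_neq0 ?expf_neq0 // cnM cnX.
apply: (le_trans (ltW h2)).
have -> : e * cn a ^+ 3 / 2 = e * (cn a ^+ 2 * (cn a / 2)) by ring.
by rewrite !ler_pM2l ?exprn_gt0.
Qed.

Lemma cdiff_uniq f a d d' : cdiff f a d -> cdiff f a d' -> d = d'.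
Proof.
move=> h1 h2; apply/eqP; rewrite -subr_eq0; apply/eqP/cn_small => e e0.
have e2 : 0 < e / 2 by rewrite divr_gt0.
have [r r0 hr] := h1 _ e2; have [s s0 hs] := h2 _ e2.
pose t := Num.min r s / 2.
have m0 : 0 < Num.min r s by rewrite lt_min r0.
have t0 : 0 < t by rewrite divr_gt0.
have ht : cn t%:C = t by rewrite cn_real gtr0_norm.
have tm : t < Num.min r s by rewrite /t ltr_pdivrMr // mulr_natr mulr2n ltrDl.
have := hr t%:C; rewrite ht => /(_ (lt_le_trans tm _)) H1.
have := hs t%:C; rewrite ht => /(_ (lt_le_trans tm _)) H2.
have {}H1 := H1 (ltac:(by rewrite ge_min lexx)).
have {}H2 := H2 (ltac:(by rewrite ge_min lexx orbT)).
have : cn ((d - d') * t%:C) <= e * t.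
  have -> : (d - d') * t%:C = (f (a + t%:C) - f a - d' * t%:C) + - (f (a + t%:C) - f a - d * t%:C) by ring.
  by apply: (le_trans (cnD _ _)); rewrite cnN; lra.
by rewrite cnM ht ler_pM2r.
Qed.

Lemma cdiff_ext f g a d (r : R) : 0 < r -> (forall z, cn (z - a) < r -> f z = g z) ->
  cdiff f a d -> cdiff g a d.
Proof.
move=> r0 fg df e /df[s s0 hs]; exists (Num.min r s); first by rewrite lt_min r0.
move=> h; rewrite lt_min => /andP[h1 h2].
rewrite -!fg ?subrr ?cn0 //; first exact: hs.
by rewrite [a + h]addrC addrK.
Qed.

End Cdiff.

(** * Mean value inequality and antiderivatives on real intervals *)

Section RealIntegration.
Context {R : realType}.
Local Notation C := (R[i]).

(** Cousin's lemma, a form of the compactness of a segment: the supremum of the [x] with [Q a x] can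
    be overstepped unless it equals [b]. It serves for the mean value inequality and for the
    propagation of zeros along a segment. *)
Lemma cousin (Q : R -> R -> Prop) (a b : R) : a <= b ->
  (forall x y z, a <= x -> x <= y -> y <= z -> z <= b -> Q x y -> Q y z -> Q x z) ->
  (forall x, a <= x -> x <= b -> exists2 d : R, 0 < d &
     forall y z, a <= y -> y <= x -> x <= z -> z <= b -> x - d < y -> z < x + d -> Q y z) ->
  Q a b.
Proof.
move=> ab Qt Ql; pose S := [set x | [/\ a <= x, x <= b & Q a x]].
have Sa : S a.
  by split => //; have [d d0] := Ql a (lexx _) ab; apply=> //; rewrite ?ltrBlDr ?ltrDl.
have Sub : ubound S b by move=> x [].
have Ssup : has_sup S by split; [exists a | exists b].
have as' : a <= sup S by by apply: ub_le_sup => //; exists b.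
have sb : sup S <= b by apply: ge_sup => //; exists a.
have [d d0 hd] := Ql _ as' sb.
have [x [ax xb Qx] xs] := sup_adherent d0 Ssup.
have xs' : x <= sup S by apply: ub_le_sup; [exists b|split].
pose z := Num.min b (sup S + d / 2).
have d2 : 0 < d / 2 by rewrite divr_gt0.
have sz : sup S <= z by rewrite le_min sb lerDl ltW.
have zb : z <= b by rewrite ge_min lexx.
have Qz : Q a z.
  apply: (Qt a x z) => //; first exact: le_trans sz.
  apply: hd => //; rewrite /z gt_min; apply/orP; right; lra.
have : z <= sup S by apply: ub_le_sup; [exists b|split => //; exact: le_trans sz].
rewrite ge_min => /orP[bs|]; last by rewrite gerDl leNgt d2.
by have <- : z = b by apply/le_anti; rewrite zb /= (le_trans bs).
Qed.

(** With [M + e'] in place of [M], the inequality adds up over adjacent intervals and holds locally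
    by the definition of the derivative, so Cousin's lemma applies. *)
Lemma rdiff_mvi (K k : R -> C) (a b M : R) : a <= b ->
  (forall x, a <= x -> x <= b -> rdiff K x (k x)) ->
  (forall x, a <= x -> x <= b -> cn (k x) <= M) ->
  cn (K b - K a) <= M * (b - a).
Proof.
move=> ab dK kM; apply/ler_addgt0Pr => e e0.
have ba0 : 0 < b - a + 1 by lra.
pose e' := e / (b - a + 1); have e'0 : 0 < e' by rewrite divr_gt0.
apply: le_trans (_ : (M + e') * (b - a) <= _); last first.
  rewrite mulrDl lerD2l /e' mulrAC ler_pdivrMr //; apply: ler_wpM2l; lra.
apply: (cousin (Q := fun x y => cn (K y - K x) <= (M + e') * (y - x)) ab).
  move=> x y z _ xy yz _ h1 h2.
  by apply: (le_trans (cn_distD (K y) _ _)); lra.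
move=> x ax xb; have [d d0 hd] := dK x ax xb e' e'0.
exists d => // y z ay yx xz zb yd zd.
have H t : `|t - x| < d -> cn (K t - K x) <= (M + e') * `|t - x|.
  move=> /hd; rewrite [x + _]addrC subrK => h.
  rewrite -(subrK (k x * (t - x)%:C) (K t - K x)).
  apply: (le_trans (cnD _ _)); rewrite cnM cn_real mulrDl addrC; apply: lerD => //.
  by apply: ler_wpM2r => //; exact: kM.
apply: (le_trans (cn_distD (K x) _ _)); rewrite [cn (K x - _)]cnB.
have := H z; have := H y.
rewrite (ger0_norm (_ : 0 <= z - x)) ?subr_ge0 // (ler0_norm (_ : y - x <= 0)) ?subr_le0 //.
move=> /(_ _) h1 /(_ _) h2.
have := h1 (ltac:((clear -yd; lra))); have := h2 (ltac:((clear -zd; lra))); clear; lra.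
Qed.

Lemma rdiffD (K L : R -> C) x k l : rdiff K x k -> rdiff L x l ->
  rdiff (fun t => K t + L t) x (k + l).
Proof.
move=> df dg e e0; have e2 : 0 < e / 2 by rewrite divr_gt0.
have [r r0 hr] := df _ e2; have [s s0 hs] := dg _ e2.
exists (Num.min r s); first by rewrite lt_min r0.
move=> h; rewrite lt_min => /andP[/hr h1 /hs h2].
have -> : K (x + h) + L (x + h) - (K x + L x) - (k + l) * h%:C =
  (K (x + h) - K x - k * h%:C) + (L (x + h) - L x - l * h%:C) by ring.
apply: (le_trans (cnD _ _)); lra.
Qed.

Lemma rdiffZ (K : R -> C) c x k : rdiff K x k -> rdiff (fun t => c * K t) x (c * k).
Proof.
move=> df e e0; have M0 : 0 < cn c + 1 by rewrite ltr_wpDl // cn_ge0.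
have [r r0 hr] := df _ (divr_gt0 e0 M0).
exists r => // h /hr h1.
have -> : c * K (x + h) - c * K x - c * k * h%:C = c * (K (x + h) - K x - k * h%:C) by ring.
rewrite cnM; apply: le_trans (_ : (cn c + 1) * (e / (cn c + 1) * `|h|) <= _).
  by apply: ler_pM; rewrite ?cn_ge0 // lerDl.
by rewrite mulrA [_ * (e / _)]mulrC divfK // gt_eqF.
Qed.

Lemma rdiff_ext (K L : R -> C) x k : (forall t, K t = L t) -> rdiff K x k -> rdiff L x k.
Proof. by move=> KL h e /h[r r0 hr]; exists r => // t; rewrite -!KL; exact: hr. Qed.

(** Lebesgue integration enters only here. Afterwards an integral is always the increment of an
    antiderivative, estimated by [rdiff_mvi]. *)
Lemma antiderivative_real (k : R -> R) (a u : R) : a < u ->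
  (forall x, a <= x -> x <= u -> {for x, continuous k}) ->
  exists K : R -> R, forall x, a < x -> x < u -> derivable K x 1 /\ derive1 K x = k x.
Proof.
move=> au kc.
exists (fun x => \int[@lebesgue_measure R]_(t in `[a, x]) k t)%R => x ax xu.
apply: (continuous_FTC1_closed xu _ ax); last exact: kc (ltW _) (ltW _).
apply: continuous_compact_integrable; first exact: segment_compact.
apply: continuous_in_subspaceT => y; rewrite inE /= in_itv /= => /andP[ay yu].
exact: kc.
Qed.

Lemma derivable_rdiff (K : R -> R) (x : R) : derivable K x 1 ->
  rdiff (fun t => (K t)%:C) x (derive1 K x)%:C.
Proof.
move=> /derivable_nbhsP /eqaddoP hK e e0.
have /nbhs_ballP[r /= r0 hr] := hK e e0.
exists r => // h hh; have := hr h.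
rewrite /ball /= sub0r normrN => /(_ hh) /=.
rewrite /cst /shift /= !fctE /= [h *: 1]mulr1 [h + x]addrC opprD addrA -derive1E -[_ *: _]/(h * _) [h * _]mulrC.
by rewrite -rmorphM -!rmorphB cn_real.
Qed.

Lemma antiderivative (k : R -> C) (a u : R) : a < u ->
  (forall x, a <= x -> x <= u -> forall e : R, 0 < e -> exists2 d : R, 0 < d &
     forall y, `|y - x| < d -> cn (k y - k x) <= e) ->
  exists K : R -> C, forall x, a < x -> x < u -> rdiff K x (k x).
Proof.
move=> au kc.
have H (p : C -> R) : (forall z w, p (z - w) = p z - p w) -> (forall z, `|p z| <= cn z) ->
    exists K : R -> R, forall x, a < x -> x < u -> derivable K x 1 /\ derive1 K x = p (k x).
  move=> pB pc; apply: antiderivative_real => // x ax xu.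
  apply/(@cvgrPdist_le _ R^o) => e e0.
  have [d d0 hd] := kc x ax xu e e0.
  near=> y; rewrite -pB; apply: le_trans (pc _) _; rewrite cnB; apply: hd.
  near: y; apply/nbhs_ballP; exists d => // z; by rewrite /ball /= distrC.
have [K1 h1] := H (@complex.Re R) (ltac:(by move=> [? ?] [? ?])) (@cn_Re R).
have [K2 h2] := H (@complex.Im R) (ltac:(by move=> [? ?] [? ?])) (@cn_Im R).
exists (fun t => (K1 t)%:C + (Complex 0 1) * (K2 t)%:C) => x ax xu.
rewrite (complexE (k x)).
have [/derivable_rdiff d1 <-] := h1 x ax xu.
have [/derivable_rdiff d2 <-] := h2 x ax xu.
by apply: rdiffD => //; exact: rdiffZ.
Unshelve. all: by end_near. Qed.

Lemma rdiff_cont (K : R -> C) x k : rdiff K x k ->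
  forall e : R, 0 < e -> exists2 d : R, 0 < d & forall y, `|y - x| < d -> cn (K y - K x) <= e.
Proof.
move=> df e e0; have [r r0 hr] := df 1 ltr01.
have M0 : 0 < cn k + 1 by rewrite ltr_wpDl // cn_ge0.
exists (Num.min r (e / (cn k + 1))); first by rewrite lt_min r0 divr_gt0.
move=> z; rewrite lt_min => /andP[zr ze].
have := hr _ zr; rewrite [x + _]addrC subrK mul1r => h1.
have -> : K z - K x = (K z - K x - k * (z - x)%:C) + k * (z - x)%:C by rewrite subrK.
apply: (le_trans (cnD _ _)); rewrite cnM cn_real.
move: ze; rewrite ltr_pdivlMr // => ze.
nra.
Qed.

End RealIntegration.

(** * Goursat's theorem for rectangles *)

Section Goursat.
Context {R : realType}.
Local Notation C := (R[i]).
Local Notation I := (Complex 0 1 : C).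

(** The left ends of successively chosen halves increase, and their supremum lies in all the
    intervals. *)
Lemma nested_corner (x : nat -> R) (w : R) : 0 <= w ->
  (forall k, x k.+1 = x k \/ x k.+1 = x k + w / 2 ^+ k.+1) ->
  exists p, forall k, x k <= p /\ p <= x k + w / 2 ^+ k.
Proof.
move=> w0 hx.
have w2 k : w / 2 ^+ k = w / 2 ^+ k.+1 + w / 2 ^+ k.+1.
  rewrite exprS invfM mulrA; field; exact: expf_neq0.
have wk k : 0 <= w / 2 ^+ k by rewrite divr_ge0 // exprn_ge0.
have mono k m : x k <= x (k + m)%N /\ x (k + m)%N + w / 2 ^+ (k + m) <= x k + w / 2 ^+ k.
  elim: m => [|m [IH1 IH2]]; first by rewrite addn0.
  have := w2 (k + m)%N; have := wk (k + m).+1; rewrite addnS.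
  by case: (hx (k + m)%N) => ->; lra.
have ub k : ubound (range x) (x k + w / 2 ^+ k).
  move=> _ [m _ <-]; have [km|/ltnW mk] := leqP k m.
    have [_] := mono k (m - k)%N; rewrite subnKC //; have := wk m; lra.
  have [+ _] := mono m (k - m)%N; rewrite subnKC //; have := wk k; lra.
exists (sup (range x)) => k; split.
  by apply: ub_le_sup; [exists (x 0%N + w / 2 ^+ 0); exact: ub|exists k].
by apply: ge_sup; [exists (x 0%N), 0%N|exact: ub].
Qed.

(* [D x y w h] is a quantity attached to the rectangle with lower left corner
   (x, y), width w and height h. *)
Lemma bisection (D : R -> R -> R -> R -> C) (x y w h : R) : 0 <= w -> 0 <= h ->
  (forall x' y' w' h', x <= x' -> y <= y' -> 0 <= w' -> 0 <= h' ->
     x' + (w' + w') <= x + w -> y' + (h' + h') <= y + h ->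
     D x' y' (w' + w') (h' + h') = D x' y' w' h' + D (x' + w') y' w' h' +
       (D x' (y' + h') w' h' + D (x' + w') (y' + h') w' h')) ->
  (forall p q, x <= p -> p <= x + w -> y <= q -> q <= y + h ->
     forall e : R, 0 < e -> exists2 d : R, 0 < d &
     forall x' y' w' h', x <= x' -> y <= y' -> x' + w' <= x + w -> y' + h' <= y + h ->
       x' <= p -> p <= x' + w' -> y' <= q -> q <= y' + h' ->
       w' < d -> h' < d -> cn (D x' y' w' h') <= e * (w' + h') ^+ 2) ->
  D x y w h = 0.
Proof.
move=> w0 h0 split loc.
pose W k := w / 2 ^+ k; pose H k := h / 2 ^+ k.
have W2 k : W k = W k.+1 + W k.+1.
  by rewrite /W exprS invfM mulrA; field; exact: expf_neq0.
have H2 k : H k = H k.+1 + H k.+1.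
  by rewrite /H exprS invfM mulrA; field; exact: expf_neq0.
have Wk k : 0 <= W k by rewrite divr_ge0 // exprn_ge0.
have Hk k : 0 <= H k by rewrite divr_ge0 // exprn_ge0.
pose ok k (p : R * R) := [/\ x <= p.1, y <= p.2, p.1 + W k <= x + w & p.2 + H k <= y + h].
have step k (p : R * R) : exists q : R * R,
    [/\ q.1 = p.1 \/ q.1 = p.1 + W k.+1, q.2 = p.2 \/ q.2 = p.2 + H k.+1 &
     ok k p -> cn (D p.1 p.2 (W k) (H k)) <= 4 * cn (D q.1 q.2 (W k.+1) (H k.+1))].
  have [okp|nok] := pselect (ok k p); last first.
    by exists p; split; [left|left|].
  case: okp => a1 a2 a3 a4.
  have := split p.1 p.2 (W k.+1) (H k.+1) a1 a2 (Wk _) (Hk _).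
  rewrite -W2 -H2 => /(_ a3 a4) E.
  pose A := D p.1 p.2 (W k.+1) (H k.+1). pose B := D (p.1 + W k.+1) p.2 (W k.+1) (H k.+1).
  pose A' := D p.1 (p.2 + H k.+1) (W k.+1) (H k.+1).
  pose B' := D (p.1 + W k.+1) (p.2 + H k.+1) (W k.+1) (H k.+1).
  have T : cn (D p.1 p.2 (W k) (H k)) <= cn A + cn B + (cn A' + cn B').
    by rewrite E; apply: (le_trans (cnD _ _)); apply: lerD; exact: cnD.
  have [h1|h1] := leP (cn (D p.1 p.2 (W k) (H k))) (4 * cn A).
    by exists p; split; [left|left|].
  have [h2|h2] := leP (cn (D p.1 p.2 (W k) (H k))) (4 * cn B).
    by exists (p.1 + W k.+1, p.2); split; [right|left|].
  have [h3|h3] := leP (cn (D p.1 p.2 (W k) (H k))) (4 * cn A').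
    by exists (p.1, p.2 + H k.+1); split; [left|right|].
  exists (p.1 + W k.+1, p.2 + H k.+1); split; [by right|by right|move=> _ /=].
  rewrite -/B'; lra.
pose f := fix f k := if k is k'.+1 then projT1 (cid (step k' (f k'))) else (x, y).
have fS k : [/\ (f k.+1).1 = (f k).1 \/ (f k.+1).1 = (f k).1 + W k.+1,
    (f k.+1).2 = (f k).2 \/ (f k.+1).2 = (f k).2 + H k.+1 &
     ok k (f k) -> cn (D (f k).1 (f k).2 (W k) (H k)) <= 4 * cn (D (f k.+1).1 (f k.+1).2 (W k.+1) (H k.+1))].
  exact: projT2 (cid (step k (f k))).
have okf k : ok k (f k).
  elim: k => [|k [a1 a2 a3 a4]]; first by split=> //=; rewrite /W /H expr0 divr1.
  have [b1 b2 _] := fS k.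
  have := W2 k; have := H2 k; have := Wk k.+1; have := Hk k.+1.
  by case: b1 => b1; case: b2 => b2; split; rewrite ?b1 ?b2; clear -H1 H0 a4 a3 a2 a1 H4 H3; lra.
have [p hp] := @nested_corner (fun k => (f k).1) w w0 (fun k => let: And3 a _ _ := fS k in a).
have [q hq] := @nested_corner (fun k => (f k).2) h h0 (fun k => let: And3 _ a _ := fS k in a).
have big k : cn (D x y w h) <= 4 ^+ k * cn (D (f k).1 (f k).2 (W k) (H k)).
  elim: k => [|k IH]; first by rewrite expr0 mul1r /= /W /H expr0 !divr1.
  apply: (le_trans IH); rewrite exprSr -mulrA; apply: ler_wpM2l; first exact: exprn_ge0.
  by have [_ _] := fS k; apply.
apply: cn_small => e e0.
have M0 : 0 < (w + h) ^+ 2 + 1 by rewrite ltr_wpDl // sqr_ge0.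
have [p1 p2] := hp 0%N; have [q1 q2] := hq 0%N.
rewrite /= expr0 !divr1 in p1 p2 q1 q2.
have [d d0 hd] := loc p q p1 p2 q1 q2 _ (divr_gt0 e0 M0).
have [k kd] : exists k, (w + h) / 2 ^+ k < d.
  have wh : 0 <= w + h by rewrite addr_ge0.
  have := archi_boundP (divr_ge0 wh (ltW d0)).
  set k := Num.bound _ => hk; exists k.
  rewrite ltr_pdivrMr ?exprn_gt0 //; rewrite ltr_pdivrMr // mulrC in hk.
  apply: (lt_trans hk); rewrite ltr_pM2l // -natrX ltr_nat; exact: ltn_expl.
have WH : W k + H k = (w + h) / 2 ^+ k by rewrite /W /H -mulrDl.
have [a1 a2 a3 a4] := okf k.
have {}hd := hd _ _ _ _ a1 a2 a3 a4 (hp k).1 (hp k).2 (hq k).1 (hq k).2.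
have {}hd := hd (ltac:(have := Hk k; (clear -kd WH; lra))) (ltac:(have := Wk k; (clear -kd WH; lra))).
apply: (le_trans (big k)); apply: (le_trans (ler_wpM2l (exprn_ge0 _ _) hd)) => //.
rewrite WH expr_div_n -exprM mulnC exprM.
have -> : (2 : R) ^+ 2 = 4 by rewrite -natrX.
have -> : 4 ^+ k * (e / ((w + h) ^+ 2 + 1) * ((w + h) ^+ 2 / 4 ^+ k)) = e * ((w + h) ^+ 2 / ((w + h) ^+ 2 + 1)) :> R.
  by field; rewrite expf_neq0 ?pnatr_eq0 //= gt_eqF.
by rewrite ler_piMr ?ltW // ltr_pdivrMr // mul1r ltrDl.
Qed.

(** Affine functions have explicit antiderivatives; in [goursat_rectangle] these cancel the
    first-order part of [G] near a point. *)
Lemma rdiff_affine (a b c : C) (x : R) :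
  rdiff (fun t => a * t%:C + b * (t%:C - c) ^+ 2 / 2) x (a + b * (x%:C - c)).
Proof.
move=> e e0; have M0 : 0 < cn (b / 2) + 1 by rewrite ltr_wpDl // cn_ge0.
exists (e / (cn (b / 2) + 1)); first exact: divr_gt0.
move=> h; rewrite ltr_pdivlMr // => hh.
have -> : a * (x + h)%:C + b * ((x + h)%:C - c) ^+ 2 / 2 - (a * x%:C + b * (x%:C - c) ^+ 2 / 2) -
   (a + b * (x%:C - c)) * h%:C = b / 2 * h%:C * h%:C.
  by rewrite rmorphD /=; field.
rewrite !cnM cn_real; apply: ler_wpM2r => //.
by apply: le_trans (ltW hh); rewrite -cnM mulrC ler_wpM2l // lerDl.
Qed.

Lemma rdiffB (K L : R -> C) x k l : rdiff K x k -> rdiff L x l ->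
  rdiff (fun t => K t - L t) x (k - l).
Proof.
move=> hK /(rdiffZ (-1)); rewrite mulN1r => /(rdiffD hK).
by apply: rdiff_ext => t; rewrite mulN1r.
Qed.

(** [H t] and [V s] are antiderivatives of [G] along horizontal and vertical lines, and replace
    contour integrals. The boundary integral is additive under subdivision; near a point it is of
    smaller order than the squared size of the rectangle, because the integral of the affine part of
    [G] vanishes. *)
Lemma goursat_rectangle (G : C -> C) (H V : R -> R -> C) (x y w h : R) :
  0 <= w -> 0 <= h ->
  (forall s t, x <= s -> s <= x + w -> y <= t -> t <= y + h ->
    [/\ rdiff (H t) s (G (s%:C + I * t%:C)), rdiff (V s) t (G (s%:C + I * t%:C)) &
     exists d, cdiff G (s%:C + I * t%:C) d]) ->
  H y (x + w) - H y x + I * (V (x + w) (y + h) - V (x + w) y) =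
  H (y + h) (x + w) - H (y + h) x + I * (V x (y + h) - V x y).
Proof.
move=> w0 h0 hG; apply/eqP; rewrite -subr_eq0; apply/eqP.
pose D x y w h := H y (x + w) - H y x + I * (V (x + w) (y + h) - V (x + w) y) -
  (H (y + h) (x + w) - H (y + h) x + I * (V x (y + h) - V x y)).
apply: (bisection (D := D)) => //.
  move=> x' y' w' h' _ _ _ _ _ _; rewrite /D !addrA; ring.
move=> p q xp pw yq qh e e0.
have [_ _ [b hb]] := hG p q xp pw yq qh.
pose a := G (p%:C + I * q%:C).
have e2 : 0 < e / 2 by rewrite divr_gt0.
have [r r0 hr] := hb _ e2.
exists (r / 2); first exact: divr_gt0.
move=> x' y' w' h' xx yy xw yh px pw' qy qh' wr hr'.
have w'0 : 0 <= w' by lra.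
have h'0 : 0 <= h' by lra.
pose e' := e / 2 * (w' + h').
have est s t : x' <= s -> s <= x' + w' -> y' <= t -> t <= y' + h' ->
    cn (G (s%:C + I * t%:C) - a - b * (s%:C + I * t%:C - (p%:C + I * q%:C))) <= e'.
  move=> s1 s2 t1 t2.
  have E : s%:C + I * t%:C - (p%:C + I * q%:C) = (s - p)%:C + I * (t - q)%:C.
    by rewrite !rmorphB /=; ring.
  have n1 : cn ((s - p)%:C + I * (t - q)%:C) <= w' + h'.
    apply: (le_trans (cnD _ _)); rewrite cnM cn_i mul1r !cn_real.
    by apply: lerD; rewrite ler_norml; apply/andP; split; clear -t2 t1 s2 s1 qh' qy pw' px; lra.
  rewrite E; have := hr ((s - p)%:C + I * (t - q)%:C).
  have -> : p%:C + I * q%:C + ((s - p)%:C + I * (t - q)%:C) = s%:C + I * t%:C by rewrite -E; ring.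
  move=> /(_ (ltac:((clear -n1 hr' wr; lra)))) /le_trans; apply.
  by rewrite /e' ler_pM2l.
have hor t : y' <= t -> t <= y' + h' ->
    cn ((H t (x' + w') - (a * (x' + w')%:C + b * ((x' + w')%:C - (p%:C + I * (q - t)%:C)) ^+ 2 / 2)) -
        (H t x' - (a * x'%:C + b * (x'%:C - (p%:C + I * (q - t)%:C)) ^+ 2 / 2))) <= e' * w'.
  move=> t1 t2.
  have -> : e' * w' = e' * (x' + w' - x') by rewrite addrAC subrr add0r.
  apply: (rdiff_mvi (K := fun s => H t s - (a * s%:C + b * (s%:C - (p%:C + I * (q - t)%:C)) ^+ 2 / 2))
    (k := fun s => G (s%:C + I * t%:C) - (a + b * (s%:C - (p%:C + I * (q - t)%:C))))).
  - by lra.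
  - move=> s s1 s2; have [d1 _ _] := hG s t (ltac:(lra)) (ltac:(lra)) (ltac:(lra)) (ltac:(lra)).
    by apply: rdiffB => //; exact: rdiff_affine.
  - move=> s s1 s2; have := est s t s1 s2 t1 t2; congr (cn _ <= _).
    by rewrite rmorphB /=; ring.
have ver s : x' <= s -> s <= x' + w' ->
    cn ((V s (y' + h') - (a * (y' + h')%:C + b * I * ((y' + h')%:C - (q%:C + I * (s - p)%:C)) ^+ 2 / 2)) -
        (V s y' - (a * y'%:C + b * I * (y'%:C - (q%:C + I * (s - p)%:C)) ^+ 2 / 2))) <= e' * h'.
  move=> s1 s2.
  have -> : e' * h' = e' * (y' + h' - y') by rewrite addrAC subrr add0r.
  apply: (rdiff_mvi (K := fun t => V s t - (a * t%:C + b * I * (t%:C - (q%:C + I * (s - p)%:C)) ^+ 2 / 2))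
    (k := fun t => G (s%:C + I * t%:C) - (a + b * I * (t%:C - (q%:C + I * (s - p)%:C))))).
  - by lra.
  - move=> t t1 t2; have [_ d1 _] := hG s t (ltac:(lra)) (ltac:(lra)) (ltac:(lra)) (ltac:(lra)).
    by apply: rdiffB => //; exact: rdiff_affine.
  - move=> t t1 t2; have := est s t s1 s2 t1 t2; congr (cn _ <= _).
    have II : I * I = -1 by rewrite -expr2 sqr_i.
    have -> : b * I * (t%:C - (q%:C + I * (s - p)%:C)) = b * I * (t - q)%:C - b * (I * I) * (s - p)%:C.
      by rewrite rmorphB /=; ring.
    by rewrite II !rmorphB /=; ring.
have y1 : y' <= y' + h' by lra. have x1 : x' <= x' + w' by (clear -w'0; lra).
have := hor _ (lexx y') y1; have := hor _ y1 (lexx _).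
have := ver _ (lexx x') x1; have := ver _ x1 (lexx _).
set v1 := (X in cn X <= _); set v2 := (X in _ -> cn X <= _ -> _).
set u1 := (X in _ -> _ -> cn X <= _ -> _); set u2 := (X in _ -> _ -> _ -> cn X <= _ -> _) => k1 k2 k3 k4.
have -> : D x' y' w' h' = u2 + I * v1 - (u1 + I * v2).
  rewrite /D /u2 /v1 /u1 /v2.
  have II : I ^+ 2 + 1 = 0 by rewrite sqr_i addNr.
  rewrite !rmorphB !rmorphD /=; apply/eqP; rewrite -subr_eq0; apply/eqP.
  (* The contributions of the affine part add up to a multiple of [I ^+ 2 + 1]. *)
  transitivity (- (I ^+ 2 + 1) * (I * b * h'%:C * w'%:C)); last by rewrite II oppr0 mul0r.
  by field.
apply: (le_trans (cnD _ _)); rewrite cnN.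
have c1 := cnD u2 (I * v1); have c2 := cnD u1 (I * v2).
move: c1 c2; rewrite !cnM cn_i !mul1r => c1 c2.
have -> : e * (w' + h') ^+ 2 = e' * w' + e' * h' + (e' * w' + e' * h') by rewrite /e'; field.
clear -c2 c1 k4 k3 k2 k1; lra.
Qed.
End Goursat.

(** * The complex exponential and the unit circle *)

Section Exponential.
Context {R : realType}.
Local Notation C := (R[i]).
Local Notation I := (Complex 0 1 : C).

Definition cexp (z : C) : C := (expR (Re z))%:C * Complex (cos (Im z)) (sin (Im z)).

Lemma cexpD z w : cexp (z + w) = cexp z * cexp w.
Proof.
case: z => a b; case: w => c d; rewrite /cexp /= expRD cosD sinD rmorphM /=.
by apply/eqP; rewrite eq_complex /=; apply/andP; split; apply/eqP; ring.
Qed.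

Lemma cn_cos_sin (t : R) : cn (Complex (cos t) (sin t)) = 1.
Proof. by rewrite /cn normc_def /= cos2Dsin2 sqrtr1. Qed.

Lemma cn_cexp z : cn (cexp z) = expR (Re z).
Proof. by rewrite /cexp cnM cn_cos_sin mulr1 cn_real ger0_norm // expR_ge0. Qed.

(** By the functional equation the derivative at 0 suffices; there it comes from the first-order
    expansions of the real exponential, cosine and sine. *)
Lemma cdiff_cexp z : cdiff cexp z (cexp z).
Proof.
have D0 : cdiff cexp 0 1.
  move=> e e0; pose e' := Num.min 1 (e / 8).
  have e'0 : 0 < e' by rewrite lt_min ltr01 divr_gt0.
  have [e'1 e'e] : e' <= 1 /\ e' <= e / 8 by rewrite /e' !ge_min !lexx orbT.
  clearbody e'.
  have der (f : R -> R) (d : R) : is_derive (0 : R) 1 f d -> exists2 r : R, 0 < r &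
      forall h, `|h| < r -> `|f h - f 0 - d * h| <= e' * `|h|.
    case=> fd fE; have [r r0 hr] := derivable_rdiff fd e'0; exists r => // h /hr.
    by rewrite add0r derive1E fE -rmorphM -!rmorphB cn_real.
  have [r1 r10 h1] := der _ _ (is_derive_expR 0).
  have [r2 r20 h2] := der _ _ (is_derive_cos 0).
  have [r3 r30 h3] := der _ _ (is_derive_sin 0).
  exists (Num.min (Num.min r1 e') (Num.min r2 r3)); first by rewrite !lt_min r10 r20 r30 e'0.
  move=> h; rewrite !lt_min => /andP[/andP[k1 k4] /andP[k2 k3]].
  have re := cn_Re h; have im := cn_Im h.
  have := h1 _ (le_lt_trans re k1); have := h2 _ (le_lt_trans im k2).
  have := h3 _ (le_lt_trans im k3).
  rewrite expR0 cos0 sin0 oppr0 mul0r !subr0 !mul1r addr0 => H3 H2 H1.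
  pose x := Re h; pose y := Im h; pose u : C := Complex (cos y) (sin y).
  have hE : h = x%:C + I * y%:C by exact: complexE.
  have u1 : cn (u - 1 - I * y%:C) <= 2 * e' * cn h.
    have -> : u - 1 - I * y%:C = (cos y - 1)%:C + I * (sin y - y)%:C.
      by apply/eqP; rewrite eq_complex /=; apply/andP; split; apply/eqP; ring.
    apply: (le_trans (cnD _ _)); rewrite cnM cn_i mul1r !cn_real.
    have : e' * `|y| <= e' * cn h by rewrite ler_pM2l.
    rewrite -/y in H2 H3; clear -H3 H2; lra.
  have u2 : cn (u - 1) <= 3 * cn h.
    have -> : u - 1 = (u - 1 - I * y%:C) + I * y%:C by rewrite subrK.
    apply: (le_trans (cnD _ _)); rewrite cnM cn_i mul1r cn_real.
    have : e' * cn h <= 1 * cn h by apply: ler_wpM2r => //; exact: cn_ge0.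
    rewrite -/y in im; clear -im u1; lra.
  have -> : cexp (0 + h) - cexp 0 - h = (expR x - 1 - x)%:C * u + (u - 1 - I * y%:C) + x%:C * (u - 1).
    rewrite add0r; have -> : cexp (0 : C) = 1 by rewrite /cexp /= expR0 cos0 sin0 mul1r.
    have -> : cexp h = (expR x)%:C * u by [].
    by rewrite [X in _ - 1 - X]hE !rmorphB rmorph1; ring.
  apply: (le_trans (cnD _ _)); apply: (le_trans (lerD (cnD _ _) (lexx _))).
  rewrite !cnM cn_cos_sin mulr1 !cn_real.
  have : `|x| * cn (u - 1) <= cn h * (3 * e').
    have : `|x| * cn (u - 1) <= cn h * (3 * cn h) by apply: ler_pM; rewrite ?cn_ge0.
    move/le_trans; apply; apply: ler_wpM2l; first exact: cn_ge0.
    by rewrite ler_pM2l //; exact: ltW.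
  have : e' * `|x| <= e' * cn h by rewrite ler_pM2l.
  have : e' * cn h <= e / 8 * cn h by apply: ler_wpM2r => //; exact: cn_ge0.
  have : 0 <= e * cn h by rewrite mulr_ge0 ?cn_ge0 ?ltW.
  rewrite -/x in H1; clear -H1 u1; lra.
move=> e e0.
have E0 : 0 < expR (Re z) := expR_gt0 _.
have [r r0 hr] := D0 _ (divr_gt0 e0 E0); exists r => // h /hr.
rewrite add0r mul1r => k.
have -> : cexp (z + h) - cexp z - cexp z * h = cexp z * (cexp h - cexp 0 - h).
  have -> : cexp 0 = 1 by rewrite /cexp /= expR0 cos0 sin0 mul1r.
  by rewrite cexpD; ring.
rewrite cnM cn_cexp; apply: (le_trans (ler_wpM2l (ltW E0) k)).
by rewrite mulrA mulrCA divff ?mulr1 // gt_eqF.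
Qed.

Definition circ (t : R) : C := cexp (I * t%:C).

Lemma cn_circ t : cn (circ t) = 1.
Proof. by rewrite /circ cn_cexp /= mul0r mul1r subr0 expR0. Qed.

Lemma cexp_2pi s : cexp (s%:C + I * (pi *+ 2)%:C) = cexp s%:C.
Proof. by rewrite /cexp /= !(mul0r, mul1r, subr0, add0r, addr0) cos2pi sin2pi cos0 sin0. Qed.

Lemma cexp_ln (r t : R) : 0 < r -> cexp ((ln r)%:C + I * t%:C) = r%:C * circ t.
Proof. by move=> r0; rewrite cexpD -/(circ t) {1}/cexp /= lnK // cos0 sin0 mulr1. Qed.

End Exponential.

(** * Mean values over circles *)

Section CircleMean.
Context {R : realType}.
Local Notation C := (R[i]).
Local Notation I := (Complex 0 1 : C).
Implicit Types (f g : C -> C) (a : C) (r : R).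

(* The mean value m is encoded by an antiderivative K along the circle. *)
Definition circle_mean a r f (m : C) := exists2 K : R -> C,
  forall t, 0 <= t -> t <= pi *+ 2 -> rdiff K t (f (a + r%:C * circ t)) &
  K (pi *+ 2) - K 0 = m * (pi *+ 2)%:C.

Let pi2_gt0 : 0 < pi *+ 2 :> R.
Proof. by rewrite pmulrn_lgt0 // pi_gt0. Qed.

Lemma circle_mean_bound a r f m (M : R) : circle_mean a r f m ->
  (forall t, cn (f (a + r%:C * circ t)) <= M) -> cn m <= M.
Proof.
move=> [K dK Km] fM.
have := rdiff_mvi (ltW pi2_gt0) dK (fun x _ _ => fM x).
by rewrite Km subr0 cnM cn_real gtr0_norm // ler_pM2r.
Qed.

Lemma circle_meanB a r f g m l : circle_mean a r f m -> circle_mean a r g l ->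
  circle_mean a r (fun z => f z - g z) (m - l).
Proof.
move=> [K dK Km] [L dL Ll]; exists (fun t => K t - L t).
  by move=> t t0 t1; apply: rdiffB; [exact: dK|exact: dL].
by rewrite mulrBl -Km -Ll; ring.
Qed.

Lemma circle_meanZ a r f c m : circle_mean a r f m ->
  circle_mean a r (fun z => c * f z) (c * m).
Proof.
move=> [K dK Km]; exists (fun t => c * K t).
  by move=> t t0 t1; apply: rdiffZ; exact: dK.
by rewrite -mulrA -Km mulrBr.
Qed.

Lemma circle_mean_cst a r c : circle_mean a r (fun=> c) c.
Proof.
exists (fun t => c * t%:C) => [t _ _ e e0|]; last by rewrite mulr0 subr0.
exists 1 => // h _; rewrite -mulrBr rmorphD /= addrAC subrr add0r subrr cn0.
by rewrite mulr_ge0 // ltW.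
Qed.

Lemma circle_mean_uniq a r f m l : circle_mean a r f m -> circle_mean a r f l -> m = l.
Proof.
move=> hm /(circle_meanB hm) h; apply/eqP; rewrite -subr_eq0; apply/eqP/cn_small => e e0.
by apply: circle_mean_bound h _ => t; rewrite subrr cn0 ltW.
Qed.

Lemma circle_lip (t u : R) : exists2 d : R, 0 < d &
  forall y, `|y - t| < d -> cn (circ y - circ t) <= 2 * `|y - t|.
Proof.
have := cdiff_cexp (0 + t%:C * I) => /cdiff_line /(_ 1 ltr01)[d d0 hd].
exists d => // y yt; have := hd _ yt.
have -> : t + (y - t) = y by ring.
rewrite !add0r ![_%:C * I]mulrC -!/(circ _) mul1r => h.
rewrite -(subrK (circ t * I * (y - t)%:C) (circ y - circ t)).
apply: (le_trans (cnD _ _)); rewrite 2!cnM cn_circ cn_i cn_real; lra.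
Qed.

Lemma circle_mean_ex a r f :
  (forall t e, 0 < e -> exists2 d : R, 0 < d & forall z, cn (z - (a + r%:C * circ t)) < d ->
     cn (f z - f (a + r%:C * circ t)) <= e) ->
  exists m, circle_mean a r f m.
Proof.
move=> fc.
have [||K hK] := @antiderivative R (fun t => f (a + r%:C * circ t)) (-1) (pi *+ 2 + 1).
- by have := pi2_gt0; lra.
- move=> t _ _ e e0; have [d d0 hd] := fc t e e0.
  have [d1 d10 h1] := circle_lip t 0.
  have M0 : 0 < 2 * `|r| + 1 by rewrite ltr_wpDl // mulr_ge0.
  exists (Num.min d1 (d / (2 * `|r| + 1))); first by rewrite lt_min d10 divr_gt0.
  move=> y; rewrite lt_min => /andP[/h1 k1]; rewrite ltr_pdivlMr // => k2.
  apply: hd; have -> : a + r%:C * circ y - (a + r%:C * circ t) = r%:C * (circ y - circ t) by ring.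
  rewrite cnM cn_real; apply: le_lt_trans k2.
  apply: (le_trans (ler_wpM2l (normr_ge0 _) k1)).
  have := normr_ge0 (y - t); have := normr_ge0 r; nra.
exists ((K (pi *+ 2) - K 0) / (pi *+ 2)%:C); exists K; last first.
  by rewrite divfK // -cn_gt0 cn_real normr_gt0 gt_eqF.
by move=> t t0 t1; apply: hK; lra.
Qed.

(** In the coordinate w with z = a + exp w the annulus becomes a rectangle of height 2 pi. Its
    horizontal sides cancel by periodicity, so Goursat's theorem equates the vertical ones, which
    are the two circles. *)
Lemma circle_mean_radius a (rho r s : R) f m : 0 < r -> r < rho -> 0 < s -> s < rho ->
  (forall z, 0 < cn (z - a) -> cn (z - a) < rho -> exists d, cdiff f z d) ->
  circle_mean a r f m -> circle_mean a s f m.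
Proof.
wlog rs : r s m / r <= s.
  move=> W r0 r1 s0 s1 hf hm; have [rs|/ltW sr] := leP r s; first exact: (W r s).
  have [l hl] : exists l, circle_mean a s f l.
    apply: circle_mean_ex => t; have [||d /cdiff_cont] := hf (a + s%:C * circ t).
    - by rewrite addrAC subrr add0r cnM cn_real cn_circ mulr1 gtr0_norm.
    - by rewrite addrAC subrr add0r cnM cn_real cn_circ mulr1 gtr0_norm.
    - by move=> h e /h.
  by rewrite (circle_mean_uniq hm (W s r l sr s0 s1 r0 r1 hf hl)).
move=> r0 r1 s0 s1 hf hm.
pose G w := f (a + cexp w).
have GE (x t : R) : 0 < x -> G ((ln x)%:C + I * t%:C) = f (a + x%:C * circ t) by move=> x0; rewrite /G cexp_ln.
have rho0 : 0 < rho by apply: lt_trans r1.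
have dG (u t : R) : u < ln rho -> exists d, cdiff G (u%:C + I * t%:C) d.
  move=> ul.
  have c1 : cn (cexp (u%:C + I * t%:C)) = expR u.
    by rewrite cn_cexp /= !mul0r mulr0 subr0 addr0.
  have [||d hd] := hf (a + cexp (u%:C + I * t%:C)).
  - by rewrite addrAC subrr add0r c1 expR_gt0.
  - by rewrite addrAC subrr add0r c1 -(lnK rho0) ltr_expR.
  exists (d * (0 + cexp (u%:C + I * t%:C))).
  exact: (cdiff_comp (cdiffD (cdiff_cst a _) (cdiff_cexp _)) hd).
have lr : ln r <= ln s by rewrite ler_ln.
have ls : ln s < ln rho by rewrite ltr_ln.
(* The antiderivatives must be differentiable at [ln r] and [ln s] too, hence they are built on a
   larger interval. *)
pose u1 := (ln s + ln rho) / 2.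
have H t : exists K : R -> C, forall x, ln r - 1 < x -> x < u1 -> rdiff K x (G (x%:C + I * t%:C)).
  apply: antiderivative; first by rewrite /u1; lra.
  move=> x x1 x2; have [|d hd] := dG x t; first by move: x2; rewrite /u1; lra.
  have := hd; rewrite addrC -[x%:C]mulr1 => /cdiff_line; rewrite mulr1 => /rdiff_cont h e /h[d' d'0 h'].
  by exists d' => // y /h'; rewrite !mulr1 ![I * _ + _]addrC.
have V x : exists K : R -> C, ln r <= x -> x <= ln s ->
    forall t, 0 <= t -> t <= pi *+ 2 -> rdiff K t (G (x%:C + I * t%:C)).
  have [xs|xs] := leP x (ln s); last by exists (fun=> 0).
  have [||K hK] := @antiderivative R (fun t => G (x%:C + I * t%:C)) (-1) (pi *+ 2 + 1).
  - by have := pi2_gt0; lra.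
  - move=> t _ _; have [|d hd] := dG x t; first exact: le_lt_trans ls.
    have := hd; rewrite [I * _]mulrC => /cdiff_line /rdiff_cont h e /h[d' d'0 h'].
    by exists d' => // y /h'; rewrite ![_ * I]mulrC.
  by exists K => _ _ t t0 t1; apply: hK; lra.
pose HH t := projT1 (cid (H t)); pose VV x := projT1 (cid (V x)).
have hH t : forall x, ln r - 1 < x -> x < u1 -> rdiff (HH t) x (G (x%:C + I * t%:C)) := projT2 (cid (H t)).
have hV x : ln r <= x -> x <= ln s -> forall t, 0 <= t -> t <= pi *+ 2 ->
  rdiff (VV x) t (G (x%:C + I * t%:C)) := projT2 (cid (V x)).
have prem x t : ln r <= x -> x <= ln r + (ln s - ln r) -> 0 <= t -> t <= 0 + pi *+ 2 ->
  [/\ rdiff (HH t) x (G (x%:C + I * t%:C)), rdiff (VV x) t (G (x%:C + I * t%:C)) &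
      exists d, cdiff G (x%:C + I * t%:C) d].
  rewrite addrC subrK add0r => x1 x2 t1 t2; split; first by apply: hH; rewrite /u1; lra.
    exact: hV.
  by apply: dG; lra.
have lr0 : 0 <= ln s - ln r by rewrite subr_ge0.
have := goursat_rectangle lr0 (ltW pi2_gt0) prem.
rewrite add0r [ln r + _]addrC subrK.
have -> : HH (pi *+ 2) (ln s) - HH (pi *+ 2) (ln r) = HH 0 (ln s) - HH 0 (ln r).
  apply/eqP; rewrite -subr_eq0; apply/eqP/cn_small => e e0.
  have -> : HH (pi *+ 2) (ln s) - HH (pi *+ 2) (ln r) - (HH 0 (ln s) - HH 0 (ln r)) =
     (HH (pi *+ 2) (ln s) - HH 0 (ln s)) - (HH (pi *+ 2) (ln r) - HH 0 (ln r)) by ring.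
  apply: le_trans (_ : 0 * (ln s - ln r) <= e); last by rewrite mul0r ltW.
  apply: (@rdiff_mvi R (fun x => HH (pi *+ 2) x - HH 0 x) (fun=> 0)) => //; last by move=> *; rewrite cn0.
  move=> x x1 x2.
  have -> : 0 = G (x%:C + I * (pi *+ 2)%:C) - G (x%:C + I * 0%:C).
    by rewrite /G cexp_2pi mulr0 addr0 subrr.
  by apply: rdiffB; apply: hH; rewrite /u1; lra.
move=> /addrI /mulfI E.
have {}E : VV (ln s) (pi *+ 2) - VV (ln s) 0 = VV (ln r) (pi *+ 2) - VV (ln r) 0.
  by apply: E; rewrite -cn_gt0 cn_i.
have hm' : circle_mean a r f ((VV (ln r) (pi *+ 2) - VV (ln r) 0) / (pi *+ 2)%:C).
  exists (VV (ln r)); last by rewrite divfK // -cn_gt0 cn_real normr_gt0 gt_eqF.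
  by move=> t t0 t1; rewrite -GE //; exact: hV.
exists (VV (ln s)); last first.
  rewrite E (circle_mean_uniq hm hm') divfK // -cn_gt0 cn_real normr_gt0 gt_eqF //.
by move=> t t0 t1; rewrite -GE //; exact: hV.
Qed.

(** The mean does not depend on the radius, so it is the limit at the centre. Working on the
    punctured disc makes this applicable to the difference quotient, which yields Cauchy's formula
    for the derivative. *)
Lemma circle_mean_value a (rho r : R) f l : 0 < r -> r < rho ->
  (forall z, 0 < cn (z - a) -> cn (z - a) < rho -> exists d, cdiff f z d) ->
  (forall e : R, 0 < e -> exists2 d : R, 0 < d & forall z, 0 < cn (z - a) -> cn (z - a) < d -> cn (f z - l) <= e) ->
  circle_mean a r f l.
Proof.
move=> r0 r1 hf fl.
have [m hm] : exists l, circle_mean a r f l.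
  apply: circle_mean_ex => t; have [||d /cdiff_cont] := hf (a + r%:C * circ t).
  - by rewrite addrAC subrr add0r cnM cn_real cn_circ mulr1 gtr0_norm.
  - by rewrite addrAC subrr add0r cnM cn_real cn_circ mulr1 gtr0_norm.
  - by move=> h e /h.
suff -> : l = m by [].
apply/eqP; rewrite -subr_eq0; apply/eqP/cn_small => e e0.
have [d d0 hd] := fl e e0.
pose s := Num.min d rho / 2.
have m0 : 0 < Num.min d rho by rewrite lt_min d0 (lt_trans r0).
have s0 : 0 < s by rewrite divr_gt0.
have sm : s < Num.min d rho by rewrite /s; lra.
have [sd sr] : s < d /\ s < rho by apply/andP; rewrite -lt_min.
have hs := circle_mean_radius r0 r1 s0 sr hf hm.
have := circle_meanB hs (circle_mean_cst a s l).
rewrite cnB => /circle_mean_bound; apply => t.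
have E : cn (a + s%:C * circ t - a) = s.
  by rewrite addrAC subrr add0r cnM cn_real cn_circ mulr1 gtr0_norm.
by apply: hd; rewrite E.
Qed.

End CircleMean.

(** * Cauchy estimates, Taylor estimates and divided differences *)

Section Holomorphic.
Context {R : realType}.
Local Notation C := (R[i]).
Implicit Types (f g : C -> C) (a b z w p h d : C) (r rho B : R).

Definition cderiv f z : C := xget 0 [set d | cdiff f z d].

Definition bounded_by a r f B := forall z, cn (z - a) < r -> cn (f z) <= B.

Lemma cdiff_deriv f z d : cdiff f z d -> cdiff f z (cderiv f z).
Proof. by move=> fd; apply: (@xgetPex _ 0 [set d | cdiff f z d]); exists d. Qed.

Lemma hol_deriv_cdiff a r f z : hol a r f -> cn (z - a) < r -> cdiff f z (cderiv f z).
Proof. by move=> fh /fh[d /cdiff_deriv]. Qed.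

Lemma hol_sub a r b (s : R) f : hol a r f -> cn (b - a) + s <= r -> hol b s f.
Proof. move=> fh bs z zb; apply: fh; have := cn_distD b z a; lra. Qed.

Lemma bounded_by_sub a r b (s : R) f B : bounded_by a r f B -> cn (b - a) + s <= r ->
  bounded_by b s f B.
Proof. move=> fh bs z zb; apply: fh; have := cn_distD b z a; lra. Qed.

Lemma cn_circle a r t : 0 < r -> cn (a + r%:C * circ t - a) = r.
Proof. by move=> r0; rewrite addrAC subrr add0r cnM cn_real cn_circ mulr1 gtr0_norm. Qed.

Lemma circle_mean_hol a rho r f : 0 < r -> r < rho -> hol a rho f -> circle_mean a r f (f a).
Proof.
move=> r0 r1 fh; apply: (@circle_mean_value _ _ rho r) => // [z _|e e0]; first exact: fh.
have [|d /cdiff_cont /(_ _ e0)[s s0 hs]] := fh a; first by rewrite subrr cn0 (lt_trans r0).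
by exists s => // z _; exact: hs.
Qed.

Lemma cdiffB f g z d d' : cdiff f z d -> cdiff g z d' -> cdiff (fun w => f w - g w) z (d - d').
Proof.
move=> fd gd; have := cdiffD fd (cdiffM (cdiff_cst (-1) z) gd).
rewrite mul0r add0r !mulN1r; apply: (@cdiff_ext _ _ _ _ _ 1) => // w _.
by rewrite mulN1r.
Qed.

Lemma cdiff_eq f z d d' : cdiff f z d -> d = d' -> cdiff f z d'.
Proof. by move=> ? <-. Qed.

Lemma cdiff_quotient f a z d : z != a -> cdiff f z d -> exists d', cdiff (fun w => (f w - f a) / (w - a)) z d'.
Proof.
move=> za fd; eexists; apply: cdiffM; first exact: (cdiffB fd (cdiff_cst _ _)).
apply: (cdiff_comp (f := fun w => w^-1) (g := fun w => w - a)).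
  exact: (cdiffB (cdiff_id _) (cdiff_cst _ _)).
by apply: cdiff_inv; rewrite subr_eq0.
Qed.

Lemma quotient_cvg f a d (e : R) : cdiff f a d -> 0 < e -> exists2 r : R, 0 < r &
  forall z, 0 < cn (z - a) -> cn (z - a) < r -> cn ((f z - f a) / (z - a) - d) <= e.
Proof.
move=> fd e0; have [r r0 hr] := fd e e0; exists r => // z z0 zr.
have za : z - a != 0 by rewrite -cn_gt0.
have -> : (f z - f a) / (z - a) - d = (f z - f a - d * (z - a)) / (z - a) by field.
by rewrite cnM cnV ler_pdivrMr //; have := hr _ zr; rewrite [a + _]addrC subrK.
Qed.

Lemma circle_mean_deriv a rho r f : 0 < r -> r < rho -> hol a rho f ->
  circle_mean a r (fun z => (f z - f a) / (z - a)) (cderiv f a).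
Proof.
move=> r0 r1 fh; apply: (@circle_mean_value _ _ rho r) => // [z z0 z1|e e0].
  have [d fd] := fh z z1; apply: cdiff_quotient fd.
  by rewrite -subr_eq0 -cn_gt0.
apply: quotient_cvg => //; apply: hol_deriv_cdiff fh _.
by rewrite subrr cn0 (lt_trans r0).
Qed.

Definition ccont f q := forall e : R, 0 < e -> exists2 r : R, 0 < r &
  forall z, cn (z - q) < r -> cn (f z - f q) <= e.

Lemma ccont_cdiff f q d : cdiff f q d -> ccont f q.
Proof. exact: cdiff_cont. Qed.

Lemma ccontM f g q : ccont f q -> ccont g q -> ccont (fun z => f z * g z) q.
Proof.
move=> hf hg e e0.
pose M := cn (f q) + cn (g q) + 1.
have M0 : 0 < M by rewrite /M; have := cn_ge0 (f q); have := cn_ge0 (g q); lra.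
pose e' := Num.min 1 (e / M).
have e'0 : 0 < e' by rewrite lt_min ltr01 divr_gt0.
have e'1 : e' <= 1 by rewrite /e' ge_min lexx.
have e'M : e' * M <= e by rewrite -ler_pdivlMr // /e' ge_min lexx orbT.
have [r r0 hr] := hf e' e'0; have [s s0 hs] := hg e' e'0.
exists (Num.min r s); first by rewrite lt_min r0.
move=> z; rewrite lt_min => /andP[/hr h1 /hs h2].
have -> : f z * g z - f q * g q = (f z - f q) * (g z - g q) + (f z - f q) * g q + f q * (g z - g q) by ring.
apply: (le_trans (cnD _ _)); apply: (le_trans (lerD (cnD _ _) (lexx _))); rewrite !cnM.
have c1 : cn (f z - f q) * cn (g z - g q) <= e' * 1.
  by apply: ler_pM; rewrite ?cn_ge0 //; exact: le_trans e'1.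
have c2 : cn (f z - f q) * cn (g q) <= e' * cn (g q) by apply: ler_wpM2r; rewrite ?cn_ge0.
have c3 : cn (f q) * cn (g z - g q) <= cn (f q) * e' by apply: ler_wpM2l; rewrite ?cn_ge0.
rewrite /M in e'M; lra.
Qed.

Lemma circle_mean_shift a r f m : circle_mean a r f m -> circle_mean 0 r (fun w => f (a + w)) m.
Proof. by move=> [K h1 h2]; exists K => // t t0 t1; rewrite add0r; exact: h1. Qed.

Lemma cauchy_estimate a rho f B : 0 < rho -> hol a rho f -> bounded_by a rho f B ->
  cn (cderiv f a) <= 4 * B / rho.
Proof.
move=> rho0 fh fB; have r0 : 0 < rho / 2 by lra.
have r1 : rho / 2 < rho by lra.
have := circle_mean_deriv r0 r1 fh => /circle_mean_bound; apply=> t.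
rewrite cnM cnV cn_circle // ler_pdivrMr //.
apply: (le_trans (cnD _ _)); rewrite cnN.
have := fB a; rewrite subrr cn0 => /(_ rho0).
have := fB (a + (rho / 2)%:C * circ t); rewrite cn_circle // => /(_ r1).
have -> : 4 * B / rho * (rho / 2) = B + B by field; rewrite gt_eqF.
lra.
Qed.

Lemma cdiff_mvi f (f' : C -> C) a b (M : R) :
  (forall t : R, 0 <= t -> t <= 1 -> cdiff f (a + t%:C * (b - a)) (f' (a + t%:C * (b - a)))) ->
  (forall t : R, 0 <= t -> t <= 1 -> cn (f' (a + t%:C * (b - a))) <= M) ->
  cn (f b - f a) <= M * cn (b - a).
Proof.
move=> hd hM.
have := @rdiff_mvi R (fun t => f (a + t%:C * (b - a)))
  (fun t => f' (a + t%:C * (b - a)) * (b - a)) 0 1 (M * cn (b - a)) ler01.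
rewrite rmorph1 rmorph0 mul1r mul0r addr0 subr0 mulr1 [a + _]addrC subrK; apply=> t t0 t1.
  exact/cdiff_line/hd.
by rewrite cnM; apply: ler_wpM2r; [exact: cn_ge0|exact: hM].
Qed.

Lemma disc_segment c r a b t : cn (a - c) < r -> cn (b - c) < r -> 0 <= t -> t <= 1 ->
  cn (a + t%:C * (b - a) - c) < r.
Proof.
move=> ac bc t0 t1.
have -> : a + t%:C * (b - a) - c = (1 - t)%:C * (a - c) + t%:C * (b - c).
  by rewrite rmorphB rmorph1; ring.
apply: (le_lt_trans (cnD _ _)); rewrite !cnM !cn_real !ger0_norm ?subr_ge0 //.
have [->|tn] := eqVneq t 1; first by rewrite subrr mul0r mul1r add0r.
have t1' : 0 < 1 - t by rewrite subr_gt0 lt_neqAle tn.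
have : t * cn (b - c) <= t * r by apply: ler_wpM2l => //; exact: ltW.
have : (1 - t) * cn (a - c) < (1 - t) * r by rewrite ltr_pM2l.
lra.
Qed.

Lemma disc_mvi c r f (M : R) a b : hol c r f -> bounded_by c r (cderiv f) M ->
  cn (a - c) < r -> cn (b - c) < r -> cn (f b - f a) <= M * cn (b - a).
Proof.
move=> fh fM ac bc; apply: (cdiff_mvi (f' := cderiv f)) => t t0 t1.
  by apply: hol_deriv_cdiff fh _; exact: disc_segment.
by apply: fM; exact: disc_segment.
Qed.

Lemma deriv_bounded a rho f B : 0 < rho -> hol a rho f -> bounded_by a rho f B ->
  bounded_by a (rho / 2) (cderiv f) (8 * B / rho).
Proof.
move=> rho0 fh fB z za; have r0 : 0 < rho / 2 by lra.
have le : cn (z - a) + rho / 2 <= rho by lra.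
have := cauchy_estimate r0 (hol_sub fh le) (bounded_by_sub fB le).
by congr (_ <= _); field; rewrite gt_eqF.
Qed.

Lemma hol_lip a rho f B z w : 0 < rho -> hol a rho f -> bounded_by a rho f B ->
  cn (z - a) < rho / 2 -> cn (w - a) < rho / 2 ->
  cn (f z - f w) <= 8 * B / rho * cn (z - w).
Proof.
move=> rho0 fh fB za wa; apply: (disc_mvi (c := a) (r := rho / 2)) => //.
  by apply: hol_sub fh _; rewrite subrr cn0 add0r; lra.
exact: deriv_bounded.
Qed.

(** Both derivatives are means of difference quotients over circles of the same radius [rho / 4];
    the quotients differ by no more than the Lipschitz bound of [f] allows. *)
Lemma deriv_lip a rho f B z w : 0 < rho -> hol a rho f -> bounded_by a rho f B ->
  cn (z - a) < rho / 8 -> cn (w - a) < rho / 8 ->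
  cn (cderiv f z - cderiv f w) <= 64 * B / rho ^+ 2 * cn (z - w).
Proof.
move=> rho0 fh fB za wa.
have r0 : 0 < rho / 4 by lra.
have r1 : rho / 4 < rho / 3 by lra.
have hz : hol z (rho / 3) f by apply: hol_sub fh _; lra.
have hw : hol w (rho / 3) f by apply: hol_sub fh _; lra.
have mz := circle_mean_shift (circle_mean_deriv r0 r1 hz).
have mw := circle_mean_shift (circle_mean_deriv r0 r1 hw).
have := circle_mean_bound (circle_meanB mz mw); apply => t.
set u := (rho / 4)%:C * circ t; rewrite add0r [z + u]addrC [w + u]addrC !addrK.
have un : cn u = rho / 4 by rewrite /u cnM cn_real cn_circ mulr1 gtr0_norm.
have -> : (f (u + z) - f z) / u - (f (u + w) - f w) / u = ((f (u + z) - f (u + w)) - (f z - f w)) / u by ring.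
rewrite cnM cnV un ler_pdivrMr //.
apply: (le_trans (cnD _ _)); rewrite cnN.
have uz x : cn (x - a) < rho / 8 -> cn (u + x - a) < rho / 2.
  by move=> xa; rewrite -addrA; apply: (le_lt_trans (cnD _ _)); lra.
have := hol_lip rho0 fh fB (uz z za) (uz w wa).
have := @hol_lip a rho f B z w rho0 fh fB.
move=> /(_ (ltac:((clear -za rho0; lra))) (ltac:((clear -r0 wa; lra)))).
have -> : u + z - (u + w) = z - w by ring.
have -> : 64 * B / rho ^+ 2 * cn (z - w) * (rho / 4) = 8 * B / rho * cn (z - w) + 8 * B / rho * cn (z - w).
  by field; rewrite gt_eqF.
lra.
Qed.

Lemma hol_taylor1 a rho f B p h : 0 < rho -> hol a rho f -> bounded_by a rho f B ->
  cn (p - a) < rho / 16 -> cn h < rho / 16 ->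
  cn (f (p + h) - f p - cderiv f p * h) <= 64 * B / rho ^+ 2 * cn h ^+ 2.
Proof.
move=> rho0 fh fB pa hh.
have B0 : 0 <= B by apply: le_trans (cn_ge0 _) (fB a _); rewrite subrr cn0.
have in8 (t : R) : 0 <= t -> t <= 1 -> cn (p + t%:C * (p + h - p) - a) < rho / 8.
  move=> t0 t1; apply: disc_segment => //; first by lra.
  by rewrite addrAC; apply: (le_lt_trans (cnD _ _)); lra.
have := @cdiff_mvi (fun z => f z - cderiv f p * z) (fun z => cderiv f z - cderiv f p) p (p + h)
  (64 * B / rho ^+ 2 * cn h).
have -> : f (p + h) - cderiv f p * (p + h) - (f p - cderiv f p * p) = f (p + h) - f p - cderiv f p * h by ring.
have ph : p + h - p = h by rewrite addrC addKr.
rewrite ph in in8 *; rewrite [cn h ^+ 2]expr2 mulrA; apply=> t t0 t1; have {}in8 := in8 t t0 t1.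
  apply: cdiffB; first by apply: hol_deriv_cdiff fh _; lra.
  have := cdiffM (cdiff_cst (cderiv f p) (p + t%:C * h)) (cdiff_id _).
  by rewrite mul0r add0r mulr1.
apply: (le_trans (deriv_lip rho0 fh fB in8 _)); first by lra.
apply: ler_wpM2l; first by rewrite divr_ge0 ?sqr_ge0 ?mulr_ge0 //.
by rewrite addrAC subrr add0r cnM cn_real ger0_norm // ler_piMl // cn_ge0.
Qed.

Lemma hol_locally_bounded a rho f : 0 < rho -> hol a rho f ->
  exists r B, [/\ 0 < r, r <= rho & bounded_by a r f B].
Proof.
move=> rho0 fh; have [|d /cdiff_cont /(_ _ ltr01)[r r0 hr]] := fh a; first by rewrite subrr cn0.
exists (Num.min r rho), (cn (f a) + 1); split; rewrite ?lt_min ?r0 ?ge_min ?lexx ?orbT //.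
move=> z; rewrite lt_min => /andP[/hr za _].
by have := cn_dist (f z) (f a); lra.
Qed.

(** The candidate for the second derivative is the mean [m] of the difference quotient of [cderiv f]
    over a small circle. By Cauchy's formula for the first derivatives, the error is a mean of
    differences of two Taylor remainders of [f], which are quadratic in [h] by [hol_taylor1]. *)
Lemma cdiff_deriv_deriv a rho f : 0 < rho -> hol a rho f -> exists d, cdiff (cderiv f) a d.
Proof.
move=> rho0 fh0; have [r' [B [r'0 rr fB]]] := hol_locally_bounded rho0 fh0.
have fh : hol a r' f by apply: hol_sub fh0 _; rewrite subrr cn0 add0r.
have B0 : 0 <= B by apply: le_trans (cn_ge0 _) (fB a _); rewrite subrr cn0.
have r0 : 0 < r' / 64 by lra.
have aa : cn (a - a) = 0 by rewrite subrr cn0.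
have onc t : cn (a + (r' / 64)%:C * circ t - a) < r' / 16 by rewrite cn_circle //; lra.
have [m hm] : exists m, circle_mean a (r' / 64) (fun z => (cderiv f z - cderiv f a) / (z - a)) m.
  apply: circle_mean_ex => t e e0.
  pose q := a + (r' / 64)%:C * circ t.
  have qa : q - a != 0 by rewrite -cn_gt0 cn_circle.
  apply: (ccontM (f := fun z => cderiv f z - cderiv f a) (g := fun z => (z - a)^-1)) => //.
    move=> e' e'0; pose L := 64 * B / r' ^+ 2 + 1.
    have L0 : 0 < L by rewrite ltr_wpDl ?divr_ge0 ?sqr_ge0 ?mulr_ge0 //.
    exists (Num.min (r' / 64) (e' / L)); first by rewrite lt_min r0 divr_gt0.
    move=> z; rewrite lt_min => /andP[z1]; rewrite ltr_pdivlMr // => z2.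
    have -> : cderiv f z - cderiv f a - (cderiv f q - cderiv f a) = cderiv f z - cderiv f q by ring.
    have qa8 : cn (q - a) < r' / 8 by have := onc t; rewrite -/q; lra.
    have za8 : cn (z - a) < r' / 8 by have := onc t; have := cn_distD q z a; rewrite -/q; lra.
    apply: (le_trans (deriv_lip r'0 fh fB za8 qa8)).
    apply: le_trans (ltW z2); rewrite mulrC; apply: ler_wpM2l; first exact: cn_ge0.
    by rewrite /L lerDl.
  apply: ccont_cdiff; apply: (cdiff_comp (f := fun w => w^-1) (g := fun w => w - a)).
    exact: (cdiffB (cdiff_id _) (cdiff_cst _ _)).
  exact: cdiff_inv.
exists m => e e0.
pose L := 64 * B / r' ^+ 2.
have L0 : 0 <= L by rewrite divr_ge0 ?sqr_ge0 ?mulr_ge0 //.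
pose L' := (L + L) / (r' / 64) + 1.
have L'0 : 0 < L' by rewrite ltr_wpDl // divr_ge0 ?addr_ge0 // ltW.
exists (Num.min (r' / 64) (e / L')); first by rewrite lt_min r0 divr_gt0.
move=> h; rewrite lt_min => /andP[h1]; rewrite ltr_pdivlMr // => h2.
have r1 : r' / 64 < r' / 32 by lra.
have hah : hol (a + h) (r' / 32) f by apply: hol_sub fh _; rewrite addrAC subrr add0r; lra.
have haa : hol a (r' / 32) f by apply: hol_sub fh _; rewrite subrr cn0; lra.
have mz := circle_mean_shift (circle_mean_deriv r0 r1 hah).
have mw := circle_mean_shift (circle_mean_deriv r0 r1 haa).
have mm := circle_meanZ h (circle_mean_shift hm).
have := circle_mean_bound (circle_meanB (circle_meanB mz mw) mm).
rewrite [h * m]mulrC.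
apply: (fun H => _ : _) => H; apply: le_trans (_ : L' * cn h ^+ 2 <= _); last first.
  rewrite expr2 mulrA; apply: ler_wpM2r; first exact: cn_ge0.
  by rewrite mulrC ltW.
apply: H => t; set u := (r' / 64)%:C * circ t; rewrite add0r.
have un : cn u = r' / 64 by rewrite /u cnM cn_real cn_circ mulr1 gtr0_norm.
have u0 : u != 0 by rewrite -cn_gt0 un.
have -> : (f (a + h + u) - f (a + h)) / (a + h + u - (a + h)) - (f (a + u) - f a) / (a + u - a) -
   h * ((cderiv f (a + u) - cderiv f a) / (a + u - a)) =
   ((f (a + u + h) - f (a + u) - cderiv f (a + u) * h) - (f (a + h) - f a - cderiv f a * h)) / u.
  have -> : a + h + u - (a + h) = u by ring.
  have -> : a + u - a = u by ring.
  have -> : a + h + u = a + u + h by ring.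
  by ring.
rewrite cnM cnV un ler_pdivrMr //.
apply: (le_trans (cnD _ _)); rewrite cnN.
have h16 : cn h < r' / 16 by lra.
have := hol_taylor1 r'0 fh fB (onc t) h16; rewrite -/u -/L.
have := @hol_taylor1 a r' f B a h r'0 fh fB; rewrite aa -/L => /(_ (ltac:((clear -r'0; lra))) h16).
have -> : L' * cn h ^+ 2 * (r' / 64) = (L + L) * cn h ^+ 2 + cn h ^+ 2 * (r' / 64).
  by rewrite /L'; field; rewrite gt_eqF.
have : 0 <= cn h ^+ 2 * (r' / 64) by rewrite mulr_ge0 ?sqr_ge0 // ltW.
clear; lra.
Qed.

Definition divdiff f a z := if z == a then cderiv f a else (f z - f a) / (z - a).

Lemma divdiffE f a z : f z = f a + (z - a) * divdiff f a z.
Proof.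
rewrite /divdiff; case: eqP => [->|/eqP za]; first by rewrite subrr mul0r addr0.
by rewrite mulrC divfK ?subr_eq0 // addrC subrK.
Qed.

(** The removable singularity at [a] is treated directly: the derivative of the quotient there is
    half the second derivative of [f]. Iterated, this divides out zeros and produces Taylor
    coefficients. *)
Lemma divdiff_hol a0 rho f a : hol a0 rho f -> cn (a - a0) < rho -> hol a0 rho (divdiff f a).
Proof.
move=> fh aa z za; have [->|zna] := eqVneq z a; last first.
  have [d fd] := fh z za; have [d' fd'] := cdiff_quotient zna fd.
  exists d'; apply: (@cdiff_ext _ _ _ _ _ (cn (z - a))) fd' => [|w wz]; last first.
    rewrite /divdiff; case: eqP wz => // ->; rewrite cnB => wz.
    by have := ltxx (cn (z - a)); rewrite wz.
  by rewrite cn_gt0 subr_eq0.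
have r0 : 0 < rho - cn (a - a0) by rewrite subr_gt0.
have fha : hol a (rho - cn (a - a0)) f by apply: hol_sub fh _; lra.
have [c hc] := cdiff_deriv_deriv r0 fha.
exists (c / 2) => e e0; have [s s0 hs] := hc e e0.
exists (Num.min s (rho - cn (a - a0))); first by rewrite lt_min s0.
move=> h; rewrite lt_min => /andP[h1 h2].
have [->|h0] := eqVneq h 0; first by rewrite addr0 subrr mulr0 subr0 cn0 mulr0.
have ah : a + h != a by rewrite -subr_eq0 addrC addKr.
rewrite /divdiff eqxx (negbTE ah).
have -> : a + h - a = h by rewrite addrC addKr.
have -> : (f (a + h) - f a) / h - cderiv f a - c / 2 * h =
   (f (a + h) - f a - cderiv f a * h - c / 2 * h ^+ 2) / h by field.
rewrite cnM cnV ler_pdivrMr ?cn_gt0 //.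
have := @cdiff_mvi (fun z => f z - (cderiv f a * (z - a) + c / 2 * ((z - a) * (z - a))))
   (fun z => cderiv f z - (cderiv f a + c * (z - a))) a (a + h) (e * cn h).
have -> : a + h - a = h by rewrite addrC addKr.
rewrite !subrr !mulr0 !addr0 subr0.
have -> : f (a + h) - (cderiv f a * h + c / 2 * (h * h)) - f a =
  f (a + h) - f a - cderiv f a * h - c / 2 * h ^+ 2 by ring.
apply=> t t0 t1.
  have th : cn (a + t%:C * h - a) <= cn h.
    by rewrite addrAC subrr add0r cnM cn_real ger0_norm // ler_piMl // cn_ge0.
  apply: cdiffB; first by apply: hol_deriv_cdiff fha _; apply: le_lt_trans h2.
  have D := cdiffB (cdiff_id (a + t%:C * h)) (cdiff_cst a (a + t%:C * h)).
  have D1 := cdiffM (cdiff_cst (cderiv f a) (a + t%:C * h)) D.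
  have D2 := cdiffM (cdiff_cst (c / 2) (a + t%:C * h)) (cdiffM D D).
  by apply: cdiff_eq (cdiffD D1 D2) _; field.
have -> : a + t%:C * h - a = t%:C * h by rewrite addrC addKr.
have th : cn (t%:C * h) <= cn h by rewrite cnM cn_real ger0_norm // ler_piMl // cn_ge0.
have := hs (t%:C * h) (le_lt_trans th h1); rewrite opprD addrA => /le_trans; apply.
by rewrite ler_pM2l.
Qed.

End Holomorphic.

(** * Lagrange interpolation at equally spaced nodes *)

Section Lagrange.
Context {R : realType}.
Local Notation C := (R[i]).

Definition lnode (dl : R) (T l : nat) : R := dl * l%:R / T%:R.

(** The Lagrange basis polynomial of the node with index [l]. *)
Definition node_poly (dl : R) (T : nat) (l : 'I_T) : {poly C} :=
  \prod_(k < T | k != l) (((lnode dl T l - lnode dl T k)%:C)^-1 *: ('X - ((lnode dl T k)%:C)%:P)).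

Lemma node_polyE dl T (l : 'I_T) z : (node_poly dl l).[z] =
  \prod_(k < T | k != l) (((lnode dl T l - lnode dl T k)%:C)^-1 * (z - (lnode dl T k)%:C)).
Proof. by rewrite /lagrange horner_prod; apply: eq_bigr => k _; rewrite !hornerE. Qed.

Lemma lnode_diff dl T (l k : 'I_T) : lnode dl T l - lnode dl T k = dl / T%:R * (l%:R - k%:R).
Proof. by rewrite /lnode; ring. Qed.

Lemma lnode_inj dl T : dl != 0 -> injective (fun l : 'I_T => lnode dl T l).
Proof.
move=> d0 l k /eqP; rewrite -subr_eq0 lnode_diff; case: T l k => [[]//|T] l k.
rewrite !mulf_eq0 (negbTE d0) invr_eq0 pnatr_eq0 /= subr_eq0 eqr_nat => /eqP h.
exact: ord_inj.
Qed.

Lemma lnode_ge0 dl T (l : 'I_T) : 0 < dl -> 0 <= lnode dl T l /\ lnode dl T l < dl.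
Proof.
move=> d0; have T0 : 0 < T%:R :> R by rewrite ltr0n (leq_trans _ (ltn_ord l)).
split; first by rewrite /lnode divr_ge0 ?mulr_ge0 // ltW.
by rewrite /lnode ltr_pdivrMr // ltr_pM2l // ltr_nat.
Qed.

Lemma node_poly_node dl T (l k : 'I_T) : dl != 0 -> (node_poly dl l).[(lnode dl T k)%:C] = (k == l)%:R.
Proof.
move=> d0; rewrite node_polyE; have [->|kl] := eqVneq k l.
  apply: big1 => i il; rewrite -rmorphB /= mulVf // -cn_gt0 cn_real normr_gt0 subr_eq0.
  by apply: contra il => /eqP /(lnode_inj d0) ->.
by apply/eqP; rewrite (bigD1 k) //= subrr mulr0 mul0r.
Qed.

Lemma size_node_poly dl T (l : 'I_T) : (size (node_poly dl l) <= T)%N.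
Proof.
apply: (leq_trans (size_poly_prod_leq _ _)).
have h : (\sum_(k < T | k != l) size (((lnode dl T l - lnode dl T k)%:C)^-1 *: ('X - ((lnode dl T k)%:C)%:P)) <= \sum_(k < T | k != l) 2)%N.
  by apply: leq_sum => k _; apply: (leq_trans (size_scale_leq _ _)); rewrite size_XsubC.
rewrite leq_subLR; apply: (@leq_trans (\sum_(k < T | k != l) 2).+1) => //.
rewrite sum_nat_const muln2 -addnn.
have -> : #|[pred k | k != l]| = T.-1 by rewrite cardC1 card_ord.
by have := ltn_ord l; case: T l h => // T l _ _; rewrite /= addnS.
Qed.

Lemma node_interpolation dl T (p : {poly C}) z : dl != 0 -> (size p <= T)%N ->
  p.[z] = \sum_(l < T) p.[(lnode dl T l)%:C] * (node_poly dl l).[z].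
Proof.
move=> d0 sp; pose q := p - \sum_(l < T) p.[(lnode dl T l)%:C] *: node_poly dl l.
suff q0 : q = 0.
  move/eqP: q0; rewrite subr_eq0 => /eqP pE; rewrite {1}pE horner_sum.
  by apply: eq_bigr => l _; rewrite hornerZ.
apply: (@roots_geq_poly_eq0 _ _ [seq (lnode dl T l)%:C | l : 'I_T]).
- apply/allP => _ /mapP[k _ ->]; rewrite /root /q hornerD hornerN horner_sum (bigD1 k) //=.
  rewrite hornerZ node_poly_node // eqxx mulr1 big1 ?addr0 ?subrr // => l lk.
  by rewrite hornerZ node_poly_node // eq_sym (negbTE lk) mulr0.
- by rewrite map_inj_uniq ?enum_uniq // => l k /complexI /(lnode_inj d0).
- rewrite size_map size_enum_ord /q; apply: (leq_trans (size_polyD _ _)).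
  rewrite geq_max sp size_polyN /=; apply: (leq_trans (size_sum _ _ _)).
  by apply/bigmax_leqP => l _; apply: (leq_trans (size_scale_leq _ _)); exact: size_node_poly.
Qed.

Lemma prod_dist_nat T (l : nat) : (l < T)%N ->
  \prod_(k < T | k != l :> nat) `|l%:R - k%:R : R| = (l`! * (T.-1 - l)`!)%:R.
Proof.
move=> lT; rewrite -(big_mkord (fun k => k != l) (fun k => `|l%:R - k%:R : R|)).
rewrite (big_cat_nat (n := l)) //=; last exact: ltnW.
rewrite [X in _ * X]big_ltn_cond //= eqxx /= natrM; congr (_ * _).
  rewrite fact_prod natr_prod big_add1 /= big_nat_rev /= add0n.
  rewrite big_seq_cond [RHS]big_seq_cond; apply: eq_big => k; rewrite mem_index_iota ?andbT.
    by case: (ltnP k l) => kl //=; rewrite ?andbF // ltn_eqF // ltn_subrL (leq_trans _ kl).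
  move=> /andP[/andP[_ kl] _]; rewrite -natrB ?leq_subr // subKn // ger0_norm //.
rewrite -{1}[l.+1]/(1 + l)%N big_addn fact_prod natr_prod.
have -> : (T.-1 - l).+1 = (T - l)%N by case: T lT => // T; rewrite ltnS => lT; rewrite subSn.
rewrite big_seq_cond [RHS]big_seq_cond; apply: eq_big => k; rewrite mem_index_iota ?andbT.
  by case: (ltnP 0 k) => k0 //=; rewrite -[X in _ != X]add0n eqn_add2r gtn_eqF ?andbT.
by move=> _; rewrite natrD opprD addrCA subrr addr0 normrN normr_nat.
Qed.

(** [T ^ T] is at most a falling factorial of [T + T], which is the factorial of [T] times a
    binomial coefficient below [4 ^ T]. *)
Lemma expn_le_fact T : (T ^ T <= 4 ^ T * T`!)%N.
Proof.
have h : (T ^ T <= (T + T) ^_ T)%N.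
  rewrite ffact_prod -[X in (X <= _)%N](_ : \prod_(i < T) T = T ^ T)%N; last by rewrite prod_nat_const card_ord.
  by apply: leq_prod => i _; rewrite -addnBA ?leq_addr // ltnW.
apply: (leq_trans h); rewrite -bin_ffact leq_mul2r; apply/orP; right.
have -> : (4 ^ T = (1 + 1) ^ (T + T))%N by rewrite [(T + T)%N]addnn -mul2n expnM.
rewrite expnDn.
have TT : (T < (T + T).+1)%N by rewrite ltnS leq_addr.
rewrite (bigD1 (Ordinal TT)) //= !exp1n !muln1; exact: leq_addr.
Qed.

(** The product of the distances from one node to the others is a product of two factorials, up to
    the scale [dl / T]. Against [T ^ T] this loses at most [8 ^ T], and the sum over the [T] nodes
    another [2 ^ T]: the growth is purely exponential in [T]. *)
Lemma node_poly_bound dl T (r : R) z : 0 < dl -> dl <= r ->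
  (forall k : 'I_T, cn (z - (lnode dl T k)%:C) <= r) ->
  \sum_(l < T) cn (node_poly dl l).[z] <= (16 * r / dl) ^+ T.
Proof.
move=> d0 dr hz.
case: T hz => [|T] hz; first by rewrite big_ord0 expr0.
have r0 : 0 < r by apply: lt_le_trans dr.
have step (l : 'I_T.+1) : cn (node_poly dl l).[z] <= (8 * r / dl) ^+ T.+1.
  rewrite node_polyE cn_prod.
  apply: le_trans (_ : \prod_(k < T.+1 | k != l) (r * T.+1%:R / dl * `|l%:R - k%:R|^-1) <= _).
    apply: ler_prod => k kl; rewrite cn_ge0 /= cnM cnV cn_real lnode_diff normrM invfM.
    have T0 : 0 < dl / T.+1%:R by rewrite divr_gt0.
    rewrite (gtr0_norm T0) invfM invrK.
    rewrite mulrC; have -> : r * T.+1%:R / dl / `|l%:R - k%:R| = r * (dl^-1 * T.+1%:R / `|l%:R - k%:R|) by ring.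
    apply: ler_wpM2r => //; rewrite mulr_ge0 ?invr_ge0 // mulr_ge0 ?invr_ge0 // ltW //.
  rewrite big_split /= prodr_const cardC1 card_ord prodfV prod_dist_nat //=.
  rewrite !exprMn exprVn -natrX.
  have lT : (l <= T)%N by rewrite -ltnS.
  have b1 : (T`! <= 2 ^ T * (l`! * (T - l)`!))%N.
    rewrite -(bin_fact lT) leq_mul2r; apply/orP; right.
    rewrite -[2%N]/(1 + 1)%N expnDn (bigD1 l) //= !exp1n !muln1; exact: leq_addr.
  have b2 := expn_le_fact T.+1.
  have f0 : 0 < (l`! * (T - l)`!)%:R :> R by rewrite ltr0n muln_gt0 !fact_gt0.
  have b3 : (T.+1 ^ T <= 8 ^ T.+1 * (l`! * (T - l)`!))%N.
    rewrite -(leq_pmul2l (ltn0Sn T)) -expnS; apply: (leq_trans b2).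
    rewrite factS mulnCA leq_mul2l /=.
    apply: (leq_trans (leq_mul (leqnn _) b1)); rewrite mulnA leq_mul2r; apply/orP; right.
    by rewrite -[8%N]/(4 * 2)%N expnMn leq_mul2l leq_exp2l // leqnSn orbT.
  have rd : 1 <= r / dl by rewrite ler_pdivlMr // mul1r.
  have -> : r ^+ T * (T.+1 ^ T)%:R / dl ^+ T / (l`! * (T - l)`!)%:R = 
    (r / dl) ^+ T * ((T.+1 ^ T)%:R / (l`! * (T - l)`!)%:R).
    by rewrite expr_div_n; ring.
  rewrite -mulrA exprMn mulrC; apply: ler_pM.
  - by rewrite divr_ge0.
  - by rewrite -exprMn exprn_ge0 // divr_ge0 // ltW.
  - by rewrite ler_pdivrMr // -natrX -natrM ler_nat.
  - by rewrite -!exprMn exprS ler_peMl // exprn_ge0 // divr_ge0 // ltW.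
apply: (le_trans (ler_sum _ (fun l _ => step l))).
rewrite sumr_const card_ord -[leLHS]mulr_natl.
have -> : 16 * r / dl = 2 * (8 * r / dl) by ring.
rewrite [leRHS]exprMn; apply: ler_wpM2r.
  by rewrite exprn_ge0 // divr_ge0 ?mulr_ge0 // ltW.
by rewrite -natrX ler_nat ltnW // ltn_expl.
Qed.

End Lagrange.

(** * Schwarz lemma at nodes, limits, orders of zeros *)

Section Consequences.
Context {R : realType}.
Local Notation C := (R[i]).
Implicit Types (f g u v : C -> C) (a b z w p h d : C) (r rho B : R).

Lemma holB a r f g : hol a r f -> hol a r g -> hol a r (fun z => f z - g z).
Proof. by move=> hf hg z za; have [d fd] := hf z za; have [d' gd] := hg z za; eexists; exact: cdiffB fd gd. Qed.

Lemma holD a r f g : hol a r f -> hol a r g -> hol a r (fun z => f z + g z).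
Proof. by move=> hf hg z za; have [d fd] := hf z za; have [d' gd] := hg z za; eexists; exact: cdiffD fd gd. Qed.

Lemma holM a r f g : hol a r f -> hol a r g -> hol a r (fun z => f z * g z).
Proof. by move=> hf hg z za; have [d fd] := hf z za; have [d' gd] := hg z za; eexists; exact: cdiffM fd gd. Qed.

Lemma hol_cst a r c : hol a r (fun=> c).
Proof. by move=> z _; eexists; exact: cdiff_cst. Qed.

Lemma hol_id a r : hol a r id.
Proof. by move=> z _; eexists; exact: cdiff_id. Qed.

Lemma hol_ext a r f g : hol a r f -> f =1 g -> hol a r g.
Proof. by move=> hf fg z za; have [d fd] := hf z za; exists d; apply: (cdiff_ext ltr01) fd => w _. Qed.

Lemma hol_sum (I : Type) (s : seq I) (P : pred I) (F : I -> C -> C) a r :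
  (forall i, P i -> hol a r (F i)) -> hol a r (fun z => \sum_(i <- s | P i) F i z).
Proof.
move=> hF; elim: s => [|i s IH]; first by apply: hol_ext (hol_cst 0) _ => z; rewrite big_nil.
case Pi: (P i); last by apply: hol_ext IH _ => z; rewrite big_cons Pi.
by apply: hol_ext (holD (hF i Pi) IH) _ => z; rewrite big_cons Pi.
Qed.

Lemma hol_prod (I : Type) (s : seq I) (P : pred I) (F : I -> C -> C) a r :
  (forall i, P i -> hol a r (F i)) -> hol a r (fun z => \prod_(i <- s | P i) F i z).
Proof.
move=> hF; elim: s => [|i s IH]; first by apply: hol_ext (hol_cst 1) _ => z; rewrite big_nil.
case Pi: (P i); last by apply: hol_ext IH _ => z; rewrite big_cons Pi.
by apply: hol_ext (holM (hF i Pi) IH) _ => z; rewrite big_cons Pi.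
Qed.

Lemma hol_poly (p : {poly C}) a r : hol a r (fun z => p.[z]).
Proof.
elim/poly_ind: p => [|p c IH]; first by apply: hol_ext (hol_cst 0) _ => z; rewrite horner0.
apply: (@hol_ext _ _ (fun z => p.[z] * z + c)); last by move=> z; rewrite !hornerE.
exact: holD (holM IH (@hol_id _ _)) (@hol_cst _ _ c).
Qed.

Lemma hol_shift a b r f : hol b r f -> hol (a + b) r (fun w => f (w - a)).
Proof.
move=> hf w wa; have [|d hd] := hf (w - a); first by rewrite -addrA -opprD.
exists (d * (1 - 0)); apply: (cdiff_comp (g := fun w => w - a) (f := f)) hd.
exact: cdiffB (cdiff_id _) (cdiff_cst _ _).
Qed.

Lemma hol_inv a r f : hol a r f -> (forall z, cn (z - a) < r -> f z != 0) ->
  hol a r (fun z => (f z)^-1).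
Proof.
move=> hf f0 z za; have [d fd] := hf z za.
by eexists; apply: (cdiff_comp fd); exact/cdiff_inv/f0.
Qed.

Lemma prod_seq_le (s : seq C) (F : C -> R) (M : R) : (forall c, c \in s -> 0 <= F c /\ F c <= M) ->
  \prod_(c <- s) F c <= M ^+ size s.
Proof.
elim: s => [|c s IH] h; first by rewrite big_nil expr0.
have [c0 cM] := h c (mem_head _ _).
have h' d : d \in s -> 0 <= F d /\ F d <= M by move=> ds; apply: h; rewrite inE ds orbT.
rewrite big_cons /= exprS; apply: ler_pM => //; last exact: IH.
by rewrite big_seq; apply: prodr_ge0 => d /h' [].
Qed.

Lemma prod_seq_ge (s : seq C) (F : C -> R) (M : R) : 0 <= M -> (forall c, c \in s -> M <= F c) ->
  M ^+ size s <= \prod_(c <- s) F c.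
Proof.
move=> M0; elim: s => [|c s IH] h; first by rewrite big_nil expr0.
rewrite big_cons /= exprS; apply: ler_pM => //; first exact: exprn_ge0.
  by apply: h; exact: mem_head.
by apply: IH => d ds; apply: h; rewrite inE ds orbT.
Qed.

Lemma bounded_ge0 a rho f B : 0 < rho -> bounded_by a rho f B -> 0 <= B.
Proof. by move=> r0 fB; apply: le_trans (cn_ge0 _) (fB a _); rewrite subrr cn0. Qed.

Lemma mean_value_bound z rho r f M : 0 < r -> r < rho -> hol z rho f ->
  (forall w, cn (w - z) = r -> cn (f w) <= M) -> cn (f z) <= M.
Proof.
move=> r0 r1 fh hM; have := circle_mean_hol r0 r1 fh => /circle_mean_bound; apply=> t.
by apply: hM; exact: cn_circle.
Qed.

Lemma nodes_factor a rho u (s : seq C) : hol a rho u -> uniq s ->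
  (forall c, c \in s -> cn (c - a) < rho /\ u c = 0) ->
  exists2 v, hol a rho v & forall z, u z = \prod_(c <- s) (z - c) * v z.
Proof.
elim: s u => [|c s IH] u hu us hs; first by exists u => // z; rewrite big_nil mul1r.
have [ca uc] := hs c (mem_head _ _).
move: us => /= /andP[cs us].
have [|d ds|v hv vE] := IH (divdiff u c) _ us.
- exact: divdiff_hol.
- have [da ud] := hs d (mem_behead (s := c :: s) ds); split => //.
  rewrite /divdiff; case: eqP => [dc|_]; first by rewrite -dc ds in cs.
  by rewrite ud uc subrr mul0r.
exists v => // z; rewrite big_cons -mulrA -vE.
by rewrite {1}(divdiffE u c z) uc add0r.
Qed.

(** The nodes are divided out. On the circle of radius [rho / 2] about [z] each factor is at least
    [3 * rho / 8], which bounds the quotient at [z]; at [z] itself each factor is at most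
    [2 * dl]. *)
Lemma schwarz_nodes a rho dl u B (s : seq C) z : 0 < dl -> dl <= rho / 16 ->
  hol a rho u -> bounded_by a rho u B -> uniq s ->
  (forall c, c \in s -> cn (c - a) <= dl /\ u c = 0) ->
  cn (z - a) <= dl -> cn (u z) <= (6 * dl / rho) ^+ size s * B.
Proof.
move=> d0 dr hu uB us hs za.
have rho0 : 0 < rho by lra.
have B0 := bounded_ge0 rho0 uB.
have [c cs|v hv vE] := nodes_factor hu us.
  by have [h1 h2] := hs c cs; split => //; lra.
have r0 : 0 < 3 * rho / 8 by lra.
have hvz : hol z (15 * rho / 16) v by apply: hol_sub hv _; lra.
have vb : cn (v z) <= B / (3 * rho / 8) ^+ size s.
  apply: (@mean_value_bound z _ (rho / 2)) hvz _; [lra|lra|move=> w wz].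
  have wa : cn (w - a) < rho by have := cn_distD z w a; lra.
  rewrite ler_pdivlMr ?exprn_gt0 //; apply: le_trans (uB w wa).
  rewrite vE cnM cn_prod mulrC; apply: ler_wpM2r; first exact: cn_ge0.
  apply: prod_seq_ge; first exact: ltW.
  move=> c /hs[ca _]; have := cn_distD c w z; have := cn_distD a c z.
  by rewrite [cn (a - z)]cnB; lra.
rewrite vE cnM cn_prod.
apply: le_trans (_ : (2 * dl) ^+ size s * (B / (3 * rho / 8) ^+ size s) <= _).
  apply: ler_pM => //; rewrite ?cn_ge0 //.
    by apply: prodr_ge0 => c _; exact: cn_ge0.
  apply: prod_seq_le => c /hs[ca _]; rewrite cn_ge0; split => //.
  by have := cn_distD a z c; rewrite [cn (a - c)]cnB; lra.
have -> : (2 * dl) ^+ size s * (B / (3 * rho / 8) ^+ size s) = (2 * dl / (3 * rho / 8)) ^+ size s * B.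
  by rewrite [in RHS]expr_div_n; ring.
apply: ler_wpM2r => //; apply: lerXn2r; rewrite ?nnegrE ?divr_ge0 //; try lra.
by rewrite ler_pdivrMr // mulrAC ler_pdivlMr //; nra.
Qed.

(* Lagrange interpolation at T equally spaced nodes; the Schwarz lemma makes the
   interpolation error decay exponentially in T. *)
Lemma small_at_nodes a rho dl u B (k : R) T z : 0 < dl -> dl <= rho / 16 -> 0 <= k ->
  hol a rho u -> bounded_by a rho u B ->
  (forall l : 'I_T, cn (u (a + (lnode dl T l)%:C)) <= k) ->
  cn (z - a) <= dl -> cn (u z) <= (6 * dl / rho) ^+ T * B + k * (2 * 192 ^+ T).
Proof.
move=> d0 dr k0 hu uB hk za.
have rho0 : 0 < rho by lra.
have dn0 : dl != 0 by rewrite gt_eqF.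
pose L w := \sum_(l < T) u (a + (lnode dl T l)%:C) * (node_poly dl l).[w - a].
have nodein (l : 'I_T) : 0 <= lnode dl T l <= dl.
  by have [h1 h2] := lnode_ge0 l d0; rewrite h1 ltW.
have hL : hol a rho L.
  apply: hol_sum => l _; apply: holM; first exact: hol_cst.
  by have := @hol_shift a 0 rho _ (@hol_poly (node_poly dl l) 0 rho); rewrite addr0.
have Lb (r : R) w : 2 * dl <= r -> cn (w - a) + dl <= r -> cn (L w) <= k * (16 * r / dl) ^+ T.
  move=> dr2 wr; apply: (le_trans (cn_sum _ _ _)).
  apply: le_trans (_ : k * \sum_(l < T) cn (node_poly dl l).[w - a] <= _).
    rewrite mulr_sumr; apply: ler_sum => l _; rewrite cnM; apply: ler_wpM2r => //.
    exact: cn_ge0.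
  apply: ler_wpM2l => //; apply: node_poly_bound => //; first lra.
  move=> l; apply: (le_trans (cnD _ _)); rewrite cnN cn_real.
  by have /andP[h1 h2] := nodein l; rewrite ger0_norm //; lra.
have L1 : cn (L z) <= k * 32 ^+ T.
  have := Lb (2 * dl) z (lexx _); have -> : 16 * (2 * dl) / dl = 32 by field; rewrite gt_eqF.
  by apply; lra.
have uL : bounded_by a rho (fun w => u w - L w) (B + k * (32 * rho / dl) ^+ T).
  move=> w wa; apply: (le_trans (cnD _ _)); rewrite cnN; apply: lerD; first exact: uB.
  have := Lb (2 * rho) w; have -> : 16 * (2 * rho) / dl = 32 * rho / dl by field; rewrite gt_eqF.
  by apply; lra.
pose s := [seq a + (lnode dl T l)%:C | l : 'I_T].
have ss : size s = T by rewrite size_map size_enum_ord.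
have us : uniq s.
  by rewrite map_inj_uniq ?enum_uniq // => l m /addrI /complexI /(lnode_inj dn0).
have := @schwarz_nodes a rho dl _ _ s z d0 dr (holB hu hL) uL us.
rewrite ss => H.
have {}H : cn (u z - L z) <= (6 * dl / rho) ^+ T * (B + k * (32 * rho / dl) ^+ T).
  apply: H => // _ /mapP[l _ ->]; split.
    rewrite addrAC subrr add0r cn_real; have /andP[h1 h2] := nodein l.
    by rewrite ger0_norm.
  rewrite /L (bigD1 l) //= addrAC subrr add0r node_poly_node // eqxx mulr1.
  rewrite big1 ?addr0 ?subrr // => m ml.
  by rewrite node_poly_node // eq_sym (negbTE ml) mulr0.
rewrite -(subrK (L z) (u z)); apply: (le_trans (cnD _ _)).
apply: (le_trans (lerD H L1)).
rewrite mulrDr -addrA lerD2l mulrCA -exprMn.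
(* The growth of the interpolant on the large disc is offset by the Schwarz factor; the base 192
   depends neither on [dl] nor on [rho]. *)
have -> : 6 * dl / rho * (32 * rho / dl) = 192 by field; rewrite !gt_eqF.
rewrite -mulrDr; apply: ler_wpM2l => //.
rewrite [leRHS]mulr_natl mulr2n lerD2l; apply: lerXn2r; rewrite ?nnegrE //; lra.
Qed.

Lemma hol_taylor_center a rho f B h : 0 < rho -> hol a rho f -> bounded_by a rho f B ->
  cn h < rho / 16 -> cn (f (a + h) - f a - cderiv f a * h) <= 64 * B / rho ^+ 2 * cn h ^+ 2.
Proof. by move=> r0 fh fB hh; apply: (hol_taylor1 (a := a)); rewrite // subrr cn0 divr_gt0. Qed.

Definition ccvg (u : nat -> C) l := forall e : R, 0 < e -> exists N : nat, forall k, (N <= k)%N -> cn (u k - l) <= e.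

Lemma real_cauchy (u : nat -> R) :
  (forall e : R, 0 < e -> exists N : nat, forall k m, (N <= k)%N -> (N <= m)%N -> `|u k - u m| <= e) ->
  exists l, forall e : R, 0 < e -> exists N : nat, forall k, (N <= k)%N -> `|u k - l| <= e.
Proof.
move=> hu.
have : cvg (u @ \oo).
  apply: (@cauchy_cvg R^o); apply: (@cauchy_exP R R^o) => e e0.
  have e2 : 0 < e / 2 by lra.
  have [N hN] := hu _ e2; exists (u N).
  exists N => // k /= Nk; rewrite /ball /=.
  by apply: le_lt_trans (hN N k _ _) _ => //; lra.
move=> /cvg_ex[l /(@cvgrPdist_le _ R^o) hl]; exists l => e e0.
have [N _ hN] := hl e e0; exists N => k /hN /=; by rewrite distrC.
Qed.

Lemma complex_cauchy (u : nat -> C) :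
  (forall e : R, 0 < e -> exists N : nat, forall k m, (N <= k)%N -> (N <= m)%N -> cn (u k - u m) <= e) ->
  exists l, ccvg u l.
Proof.
move=> hu.
have H (p : C -> R) : (forall z w, p (z - w) = p z - p w) -> (forall z, `|p z| <= cn z) ->
    exists l, forall e : R, 0 < e -> exists N : nat, forall k, (N <= k)%N -> `|p (u k) - l| <= e.
  move=> pB pc; apply: real_cauchy => e /hu[N hN]; exists N => k m Nk Nm.
  by rewrite -pB; apply: le_trans (pc _) _; exact: hN.
have [l1 h1] := H (@complex.Re R) (ltac:(by move=> [? ?] [? ?])) (@cn_Re R).
have [l2 h2] := H (@complex.Im R) (ltac:(by move=> [? ?] [? ?])) (@cn_Im R).
exists (Complex l1 l2) => e e0; have e2 : 0 < e / 2 by lra.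
have [N1 k1] := h1 _ e2; have [N2 k2] := h2 _ e2.
exists (maxn N1 N2) => k; rewrite geq_max => /andP[/k1 a1 /k2 a2].
apply: (le_trans (cn_le _)); move: a1 a2; case: (u k) => x y /=; lra.
Qed.

Lemma ccvg_le (u : nat -> C) l M : ccvg u l -> (forall k, cn (u k) <= M) -> cn l <= M.
Proof.
move=> hu hM; apply/ler_addgt0Pr => e e0; have [N hN] := hu e e0.
have := hN N (leqnn _); have := hM N; have := cn_dist l (u N); rewrite [cn (l - u _)]cnB; lra.
Qed.

Lemma ccvg_uniq (u : nat -> C) l m : ccvg u l -> ccvg u m -> l = m.
Proof.
move=> h1 h2; apply/eqP; rewrite -subr_eq0; apply/eqP/cn_small => e e0.
have e2 : 0 < e / 2 by lra.
have [N1 k1] := h1 _ e2; have [N2 k2] := h2 _ e2.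
have := k1 _ (leq_maxl N1 N2); have := k2 _ (leq_maxr N1 N2).
have := cn_distD (u (maxn N1 N2)) l m; rewrite [cn (l - u _)]cnB; lra.
Qed.

(** All [F k] share one bound for their Taylor remainders. With a common small step [s] their
    derivatives are difference quotients up to [e], and so inherit the Cauchy property from the
    values. *)
Lemma deriv_ccvg a rho (F : nat -> C -> C) f B : 0 < rho -> (forall k, hol a rho (F k)) ->
  (forall k, bounded_by a rho (F k) B) -> (forall z, cn (z - a) < rho -> ccvg (fun k => F k z) (f z)) ->
  exists2 d, ccvg (fun k => cderiv (F k) a) d &
    forall h, cn h < rho / 16 -> cn (f (a + h) - f a - d * h) <= 64 * B / rho ^+ 2 * cn h ^+ 2.
Proof.
move=> rho0 Fh FB Ff; pose K := 64 * B / rho ^+ 2.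
have B0 := bounded_ge0 rho0 (FB 0%N).
have K0 : 0 <= K by rewrite divr_ge0 ?sqr_ge0 ?mulr_ge0.
have [|d hd] := @complex_cauchy (fun k => cderiv (F k) a).
  move=> e e0; pose s := Num.min (rho / 32) (e / (4 * (K + 1))).
  have s0 : 0 < s by rewrite lt_min !divr_gt0 // mulr_gt0 //; lra.
  have sr : s < rho / 16 by apply: (@le_lt_trans _ _ (rho / 32)); [rewrite /s ge_min lexx|lra].
  have sK : 4 * K * s <= e.
    apply: le_trans (_ : 4 * (K + 1) * s <= _); first by rewrite ler_pM2r //; lra.
    by rewrite mulrC -ler_pdivlMr ?mulr_gt0 //; [rewrite /s ge_min lexx orbT|lra].
  have hs : cn (s%:C : C) = s by rewrite cn_real gtr0_norm.
  have es : 0 < e * s / 8 by rewrite divr_gt0 ?mulr_gt0.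
  have [|N1 h1] := Ff (a + s%:C) _ _ es; first by rewrite addrAC subrr add0r hs; lra.
  have [|N2 h2] := Ff a _ _ es; first by rewrite subrr cn0.
  exists (maxn N1 N2) => k m; rewrite !geq_max => /andP[k1 k2] /andP[m1 m2].
  have ks : cn (s%:C : C) < rho / 16 by rewrite hs.
  have := hol_taylor_center rho0 (Fh k) (FB k) ks.
  have := hol_taylor_center rho0 (Fh m) (FB m) ks.
  rewrite hs -/K => T1 T2.
  rewrite -(ler_pM2r s0) -{1}hs -cnM.
  have -> : (cderiv (F k) a - cderiv (F m) a) * s%:C =
    (F m (a + s%:C) - F m a - cderiv (F m) a * s%:C) - (F k (a + s%:C) - F k a - cderiv (F k) a * s%:C)
    + ((F k (a + s%:C) - f (a + s%:C)) - (F m (a + s%:C) - f (a + s%:C)))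
    - ((F k a - f a) - (F m a - f a)) by ring.
  have := h1 _ k1; have := h1 _ m1; have := h2 _ k2; have := h2 _ m2.
  set x1 := F k a - _; set x2 := F m a - f a; set x3 := F k _ - f _; set x4 := F m _ - f _.
  move: T1 T2; set x5 := F m _ - _ - _; set x6 := F k _ - _ - _ => T1 T2 e1 e2 e3 e4.
  have i1 := cnD (x5 - x6 + (x3 - x4)) (- (x2 - x1)).
  have i1' := cnD (x5 - x6 + (x3 - x4)) (- (x1 - x2)).
  have i2 := cnD (x5 - x6) (x3 - x4).
  have i3 := cnD x5 (- x6); have i4 := cnD x3 (- x4); have i5 := cnD x1 (- x2).
  rewrite !cnN in i1' i3 i4 i5.
  have : 4 * K * s * s <= e * s by rewrite ler_pM2r.
  by rewrite !expr2 in T1 T2; nra.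
exists d => // h hh; apply/ler_addgt0Pr => e e0.
have [||N1 h1] := Ff (a + h) _ (e / 4); [by rewrite addrAC subrr add0r; lra|lra|].
have [||N2 h2] := Ff a _ (e / 4); [by rewrite subrr cn0|lra|].
have M0 : 0 < 4 * (cn h + 1) by have := cn_ge0 h; lra.
have [N3 h3] := hd _ (divr_gt0 e0 M0).
pose k := maxn N1 (maxn N2 N3).
have := h1 k (leq_maxl _ _); have := h2 k (leq_trans (leq_maxl _ _) (leq_maxr _ _)).
have := h3 k (leq_trans (leq_maxr _ _) (leq_maxr _ _)).
have := hol_taylor_center rho0 (Fh k) (FB k) hh; rewrite -/K => T.
rewrite ler_pdivlMr // => e3 e2 e1.
have -> : f (a + h) - f a - d * h = (F k (a + h) - F k a - cderiv (F k) a * h)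
  + (F k a - f a) - (F k (a + h) - f (a + h)) + (cderiv (F k) a - d) * h by ring.
have i1 := cnD (F k (a + h) - F k a - cderiv (F k) a * h + (F k a - f a) - (F k (a + h) - f (a + h))) ((cderiv (F k) a - d) * h).
have i2 := cnD (F k (a + h) - F k a - cderiv (F k) a * h + (F k a - f a)) (- (F k (a + h) - f (a + h))).
have i3 := cnD (F k (a + h) - F k a - cderiv (F k) a * h) (F k a - f a).
rewrite cnM in i1; rewrite cnN in i2.
have : cn (cderiv (F k) a - d) * cn h <= cn (cderiv (F k) a - d) * (cn h + 1).
  by apply: ler_wpM2l; rewrite ?cn_ge0 // lerDl.
lra.
Qed.

Lemma hol_limit a rho (F : nat -> C -> C) f B : (forall k, hol a rho (F k)) ->
  (forall k, bounded_by a rho (F k) B) -> (forall z, cn (z - a) < rho -> ccvg (fun k => F k z) (f z)) ->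
  hol a rho f.
Proof.
move=> Fh FB Ff z za; have r0 : 0 < rho - cn (z - a) by rewrite subr_gt0.
have le : cn (z - a) + (rho - cn (z - a)) <= rho by lra.
have [|k|k|w wz|d _ hd] := @deriv_ccvg z (rho - cn (z - a)) F f B => //.
- exact: hol_sub (Fh k) le.
- exact: bounded_by_sub (FB k) le.
- by apply: Ff; have := cn_distD z w a; lra.
exists d => e e0; pose K := 64 * B / (rho - cn (z - a)) ^+ 2.
have B0 : 0 <= B by apply: bounded_ge0 (bounded_by_sub (FB 0%N) le).
have K0 : 0 <= K by rewrite divr_ge0 ?sqr_ge0 ?mulr_ge0.
have K1 : 0 < K + 1 by lra.
exists (Num.min ((rho - cn (z - a)) / 16) (e / (K + 1))).
  by rewrite lt_min !divr_gt0.
move=> h; rewrite lt_min => /andP[/hd h1]; rewrite ltr_pdivlMr // => h2.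
apply: (le_trans h1); rewrite -/K expr2 mulrA; apply: ler_wpM2r; first exact: cn_ge0.
by have := cn_ge0 h; nra.
Qed.

(** [divdiffs f a k a] is the [k]-th Taylor coefficient of [f] at [a], and [divdiffs f a k] is the
    Taylor remainder divided by the [k]-th power of [z - a]. *)
Definition divdiffs f a k := iter k (fun u => divdiff u a) f.

Lemma divdiffs_hol a rho f k : 0 < rho -> hol a rho f -> hol a rho (divdiffs f a k).
Proof.
by move=> r0 hf; elim: k => //= k IH; apply: divdiff_hol => //; rewrite subrr cn0.
Qed.

Lemma divdiffs_taylor f a k z :
  f z = \sum_(j < k) divdiffs f a j a * (z - a) ^+ j + (z - a) ^+ k * divdiffs f a k z.
Proof.
elim: k => [|k IH]; first by rewrite big_ord0 add0r expr0 mul1r.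
rewrite IH big_ord_recr /= {1}(divdiffE (divdiffs f a k) a z) exprSr; ring.
Qed.

(** If all Taylor coefficients vanish, every power of [z - a] divides [f]. Bounding the quotients by
    their values on a circle about [z] shows that [f] decays geometrically in the power, hence is 0
    near [a]. *)
Lemma zero_order a rho f : 0 < rho -> hol a rho f ->
  (exists2 r : R, 0 < r & forall z, cn (z - a) < r -> f z = 0) \/
  (exists2 m, divdiffs f a m a != 0 & forall k, (k < m)%N -> divdiffs f a k a = 0).
Proof.
move=> rho0 fh.
have aa : cn (a - a) < rho by rewrite subrr cn0.
pose g := divdiffs f a.
have gh k : hol a rho (g k) by exact: divdiffs_hol.
have [[m gm]|ng] := pselect (exists m, g m a != 0).
  right; have exP : exists m, g m a != 0 by exists m.
  case: (ex_minnP exP) => k gk kmin; exists k => // j jk.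
  by case: (eqVneq (g j a) 0) => // /kmin; rewrite leqNgt jk.
left.
have g0 k : g k a = 0 by case: (eqVneq (g k a) 0) => // h; exfalso; apply: ng; exists k.
have fE k z : f z = (z - a) ^+ k * g k z.
  elim: k => [|k IH]; first by rewrite expr0 mul1r.
  by rewrite IH {1}(divdiffE (g k) a z) g0 add0r exprSr mulrA.
have [r [B [r0 rr fB]]] := hol_locally_bounded rho0 fh.
have B0 := bounded_ge0 r0 fB.
exists (r / 8); first by lra.
move=> z za; apply: cn_small => e e0.
have gb k : cn (g k z) <= B / (3 * r / 8) ^+ k.
  have hk : hol z (7 * r / 8) (g k) by apply: hol_sub (gh k) _; lra.
  apply: (@mean_value_bound z _ (r / 2)) hk _; [lra|lra|move=> w wz].
  have wa : cn (w - a) < r by have := cn_distD z w a; lra.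
  have wa2 : 3 * r / 8 <= cn (w - a) by have := cn_distD a w z; rewrite [cn (a - z)]cnB; lra.
  rewrite ler_pdivlMr ?exprn_gt0 //; last lra.
  apply: le_trans (fB w wa); rewrite (fE k w) cnM cnX mulrC.
  by apply: ler_wpM2r; [exact: cn_ge0|apply: lerXn2r; rewrite ?nnegrE ?cn_ge0 //; lra].
have [k hk] : exists k, B / 2 ^+ k <= e.
  have := archi_boundP (divr_ge0 B0 (ltW e0)); set k := Num.bound _ => h; exists k.
  rewrite ler_pdivrMr ?exprn_gt0 //; move: h; rewrite ltr_pdivrMr // mulrC => h.
  apply: (le_trans (ltW h)); rewrite ler_pM2l // -natrX ler_nat ltnW // ltn_expl //.
apply: le_trans hk; rewrite (fE k z) cnM cnX.
apply: le_trans (_ : (r / 8) ^+ k * (B / (3 * r / 8) ^+ k) <= _).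
  apply: ler_pM => //; rewrite ?exprn_ge0 ?cn_ge0 //.
  by apply: lerXn2r; rewrite ?nnegrE ?cn_ge0 //; lra.
have -> : (r / 8) ^+ k * (B / (3 * r / 8) ^+ k) = B * (r / 8 / (3 * r / 8)) ^+ k.
  by rewrite [in RHS]expr_div_n; ring.
rewrite -exprVn; apply: ler_wpM2l => //; apply: lerXn2r; rewrite ?nnegrE ?divr_ge0 //; try lra.
by rewrite ler_pdivrMr //; lra.
Qed.

End Consequences.

(** * Several variables and Weierstrass preparation *)

Section Norm.
Context {R : realType}.
Local Notation C := (R[i]).

(** On row vectors this is the maximum norm, so its balls are polydiscs. The real part moves the
    norm from [R[i]] to [R], where linear arithmetic applies. *)
Definition nn (W : normedModType C) (w : W) : R := Re `|w|.

Section Gen.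
Variable W : normedModType C.
Implicit Types v w : W.

Lemma nnE w : `|w| = (nn w)%:C.
Proof. by rewrite /nn RRe_real ?normr_real. Qed.

Lemma nn_ge0 w : 0 <= nn w.
Proof. by rewrite -ler0c -nnE. Qed.

Lemma nnD v w : nn (v + w) <= nn v + nn w.
Proof. by have := ler_normD v w; rewrite !nnE -rmorphD lecR. Qed.

Lemma nnN w : nn (- w) = nn w.
Proof. by rewrite /nn normrN. Qed.

Lemma nnB v w : nn (v - w) = nn (w - v).
Proof. by rewrite -opprB nnN. Qed.

Lemma nn0 : nn (0 : W) = 0.
Proof. by rewrite /nn normr0. Qed.

Lemma nn_inj w : nn w = 0 -> w = 0.
Proof. by move=> h; apply/eqP; rewrite -normr_eq0 nnE h. Qed.

Lemma nnZ (a : C) w : nn (a *: w) = cn a * nn w.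
Proof. by apply: complexI; rewrite -nnE normrZ nnE cnE rmorphM. Qed.

Lemma nn_distD (u v w : W) : nn (v - w) <= nn (v - u) + nn (u - w).
Proof. by have := nnD (v - u) (u - w); rewrite addrA subrK. Qed.

Lemma nn_dist v w : nn v <= nn w + nn (v - w).
Proof. by rewrite -{1}(subrK w v) addrC; apply: le_trans (nnD _ _) _. Qed.

Lemma nn_small w : (forall e : R, 0 < e -> nn w <= e) -> w = 0.
Proof.
move=> h; apply: nn_inj; apply/eqP; rewrite eq_le nn_ge0 andbT.
by apply/ler_addgt0Pr => e e0; rewrite add0r h.
Qed.

Lemma nbhs_nnP (x : W) (A : set W) : nbhs x A <-> exists2 r : R, 0 < r & forall y, nn (y - x) < r -> A y.
Proof.
split=> [/nbhs_ballP[e /= e0 he]|[r r0 hr]].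
  exists (Re e); first by move: e0; rewrite ltcE => /andP[_].
  move=> y yx; apply: he; rewrite -ball_normE /= nnE nnB.
  by move: e0; rewrite !ltcE /= => /andP[/eqP -> _]; rewrite eqxx.
apply/nbhs_ballP; exists r%:C => /=; first by rewrite ltcR.
by move=> y; rewrite -ball_normE /= nnE nnB ltcR; exact: hr.
Qed.

Lemma open_nnP (A : set W) : open A <-> forall x, A x -> exists2 r : R, 0 < r & forall y, nn (y - x) < r -> A y.
Proof.
rewrite openE; split=> h x /h; first by move/nbhs_nnP.
by move=> k; apply/nbhs_nnP.
Qed.

End Gen.

Lemma nn_cn (z : C) : nn z = cn z.
Proof. by []. Qed.

Section RowNorm.
Variable n : nat.
Implicit Types v w : 'rV[C]_n.

Lemma nn_coord v i : cn (v 0 i) <= nn v.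
Proof.
rewrite -lecR -cnE -nnE; have -> : `|v| = mx_norm v by [].
rewrite mx_normE -[leLHS]nngE num_le; exact: (le_bigmax _ _ (0, i)).
Qed.

Lemma nn_le v (r : R) : 0 <= r -> (forall i, cn (v 0 i) <= r) -> nn v <= r.
Proof.
move=> r0 h; have [v0|v0] := eqVneq (mx_norm v) 0; first by rewrite (mx_norm_eq0 v0) nn0.
have [[i j] /= hij] := mx_norm_neq0 v0.
by rewrite -lecR -nnE [X in X <= _]hij cnE lecR ord1.
Qed.

Lemma nn_gtP v (r : R) : 0 <= r -> r < nn v -> exists i, r < cn (v 0 i).
Proof.
move=> r0 rv; apply: contrapT => /forallNP h; move: rv; rewrite ltNge; apply/negP/negPn.
by apply: nn_le => // i; rewrite leNgt; apply/negP/h.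
Qed.

End RowNorm.

(** This and [eps_diff] are the bridge between [differentiable] and explicit estimates. *)
Lemma diff_eps (V W : normedModType C) (f : V -> W) x : differentiable f x ->
  forall e : R, 0 < e -> exists2 r : R, 0 < r &
    forall h, nn h < r -> nn (f (x + h) - f x - 'd f x h) <= e * nn h.
Proof.
move=> /diff_locallyP[_ /eqaddoP hf] e e0.
have e0' : 0 < e%:C by rewrite ltcR.
have /nbhs_nnP[r r0 hr] := hf _ e0'; exists r => // h hh.
have := hr h; rewrite subr0 => /(_ hh).
rewrite -[X in `|X|]/(f (h + x) - (f x + 'd f x h)).
by rewrite !nnE -rmorphM lecR [h + x]addrC opprD addrA.
Qed.

Lemma eps_diff (V W : normedModType C) (f : V -> W) x (L : {linear V -> W}) : continuous L ->
  (forall e : R, 0 < e -> exists2 r : R, 0 < r &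
    forall h, nn h < r -> nn (f (x + h) - f x - L h) <= e * nn h) ->
  differentiable f x /\ 'd f x = L :> (V -> W).
Proof.
move=> Lc hf.
have E : f \o shift x = cst (f x) + L +o_ (0 : V) id.
  apply/eqaddoP => e e0; have e0R : 0 < Re e by move: e0; rewrite ltcE => /andP[].
  have eE : e = (Re e)%:C by move: e0; rewrite ltcE => /andP[/eqP h _]; rewrite [LHS]complexE h mulr0 addr0.
  have [r r0 hr] := hf _ e0R; apply/nbhs_nnP; exists r => // h; rewrite subr0 => /hr.
  rewrite -[X in _ -> `|X| <= _]/(f (h + x) - (f x + L h)).
  by rewrite [in X in _ -> X]eE !nnE -rmorphM lecR [h + x]addrC opprD addrA.
have dE := diff_unique Lc E.
split => //; apply/diff_locallyP; rewrite dE; split => //.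
Qed.

Lemma linear_row_bound (m : nat) (W : normedModType C) (L : {linear 'rV[C]_m -> W}) v :
  nn (L v) <= (\sum_(i < m) nn (L (delta_mx 0 i))) * nn v.
Proof.
rewrite {1}[v]row_sum_delta linear_sum mulr_suml.
elim/big_rec2: _ => [|i y1 y2 _ IH]; first by rewrite nn0.
apply: (le_trans (nnD _ _)); apply: lerD => //.
by rewrite linearZ nnZ mulrC; apply: ler_wpM2l; [exact: nn_ge0|exact: nn_coord].
Qed.

Lemma linear_row_continuous (m : nat) (W : normedModType C) (L : {linear 'rV[C]_m -> W}) : continuous L.
Proof.
move=> x A /nbhs_nnP [r r0 hr]; apply/nbhs_nnP.
pose M := \sum_(i < m) nn (L (delta_mx 0 i)).
have M0 : 0 < M + 1 by rewrite ltr_wpDl // sumr_ge0 // => i _; exact: nn_ge0.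
exists (r / (M + 1)) => [|y]; first exact: divr_gt0.
rewrite ltr_pdivlMr // => hy; apply: hr; rewrite -linearB.
apply: le_lt_trans hy; apply: (le_trans (linear_row_bound _ _)); rewrite -/M mulrC.
by apply: ler_wpM2l; rewrite ?nn_ge0 // lerDl.
Qed.

Lemma cdiff_slice (m : nat) (f : 'rV[C]_m -> C) (x v : 'rV[C]_m) (z : C) :
  differentiable f (x + z *: v) -> cdiff (fun w => f (x + w *: v)) z ('d f (x + z *: v) v).
Proof.
move=> /diff_eps hf e e0.
have M0 : 0 < nn v + 1 by rewrite ltr_wpDl // nn_ge0.
have [r r0 hr] := hf _ (divr_gt0 e0 M0).
exists (r / (nn v + 1)); first exact: divr_gt0.
move=> h; rewrite ltr_pdivlMr // => hh.
have hv : nn (h *: v) < r.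
  rewrite nnZ; apply: le_lt_trans hh; apply: ler_wpM2l; first exact: cn_ge0.
  by rewrite lerDl.
have := hr _ hv; rewrite nn_cn.
have -> : 'd f (x + z *: v) (h *: v) = 'd f (x + z *: v) v * h by rewrite linearZ mulrC.
rewrite scalerDl addrA nnZ => /le_trans; apply.
have -> : e / (nn v + 1) * (cn h * nn v) = e * cn h * (nn v / (nn v + 1)) by ring.
by rewrite ler_piMr ?mulr_ge0 ?cn_ge0 ?ltW // ltr_pdivrMr // mul1r ltrDl.
Qed.

End Norm.

(** * Functions holomorphic in each variable *)

Section SeparatelyHolomorphic.
Context {R : realType}.
Local Notation C := (R[i]).
Variable d : nat.
Implicit Types (t : 'rV[C]_d) (w z : C) (s f g : 'rV[C]_d -> C -> C) (r q : 'rV[C]_d -> C).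

(** Holomorphy in the parameters is recorded only along coordinate lines: in this form it passes to
    products, inverses and bounded limits by the one-variable lemmas, and together with a bound it
    still gives a Lipschitz estimate. *)
Definition sephol (rho : R) r := forall t (k : 'I_d), nn t < rho ->
  exists c, cdiff (fun z => r (t + z *: delta_mx 0 k)) 0 c.

Definition good (rho eta : R) s :=
  (forall t, nn t < rho -> hol 0 eta (s t)) /\
  (forall w, cn w < eta -> sephol rho (fun t => s t w)).

Definition bnd (rho eta B : R) s := forall t w, nn t < rho -> cn w < eta -> cn (s t w) <= B.

Lemma nn_delta (k : 'I_d) (z : C) : nn (z *: (delta_mx 0 k : 'rV[C]_d)) = cn z.
Proof.
rewrite nnZ; suff -> : nn (delta_mx 0 k : 'rV[C]_d) = 1 by rewrite mulr1.
apply/le_anti/andP; split.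
  by apply: nn_le => // i; rewrite mxE eqxx /=; case: eqP => _; rewrite ?cn1 ?cn0.
by have := nn_coord (delta_mx 0 k : 'rV[C]_d) k; rewrite mxE !eqxx cn1.
Qed.

Lemma sephol_cdiff rho r t k z : sephol rho r -> nn (t + z *: delta_mx 0 k) < rho ->
  exists c, cdiff (fun z => r (t + z *: delta_mx 0 k)) z c.
Proof.
move=> hr tz; have [c hc] := hr _ k tz; exists c => e e0.
have [s s0 hs] := hc e e0; exists s => // h /hs.
by rewrite add0r scale0r addr0 scalerDl addrA.
Qed.

Lemma sephol_hol rho r t k (eps : R) : sephol rho r -> nn t + eps <= rho ->
  hol 0 eps (fun z => r (t + z *: delta_mx 0 k)).
Proof.
move=> hr te z; rewrite subr0 => ze; apply: sephol_cdiff hr _.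
by apply: (le_lt_trans (nnD _ _)); rewrite nn_delta; lra.
Qed.

Lemma sephol_ext rho r q : sephol rho r -> (forall t, nn t < rho -> r t = q t) -> sephol rho q.
Proof.
move=> hr rq t k tr; have [c hc] := hr t k tr; exists c.
apply: (@cdiff_ext _ _ _ _ _ (rho - nn t)) hc; first by rewrite subr_gt0.
move=> z; rewrite subr0 => zr; apply: rq.
by apply: (le_lt_trans (nnD _ _)); rewrite nn_delta; lra.
Qed.

Lemma sephol_sub rho rho' r : rho' <= rho -> sephol rho r -> sephol rho' r.
Proof. by move=> h hr t k tr; apply: hr; exact: lt_le_trans h. Qed.

Lemma sephol_cst rho c : sephol rho (fun=> c).
Proof. by move=> t k _; eexists; exact: cdiff_cst. Qed.

Lemma sepholD rho r q : sephol rho r -> sephol rho q -> sephol rho (fun t => r t + q t).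
Proof.
by move=> hr hq t k tr; have [c hc] := hr t k tr; have [c' hc'] := hq t k tr; eexists; exact: cdiffD hc hc'.
Qed.

Lemma sepholB rho r q : sephol rho r -> sephol rho q -> sephol rho (fun t => r t - q t).
Proof.
by move=> hr hq t k tr; have [c hc] := hr t k tr; have [c' hc'] := hq t k tr; eexists; exact: cdiffB hc hc'.
Qed.

Lemma sepholM rho r q : sephol rho r -> sephol rho q -> sephol rho (fun t => r t * q t).
Proof.
by move=> hr hq t k tr; have [c hc] := hr t k tr; have [c' hc'] := hq t k tr; eexists; exact: cdiffM hc hc'.
Qed.

Lemma sephol_inv rho r : (forall t, nn t < rho -> r t != 0) -> sephol rho r -> sephol rho (fun t => (r t)^-1).
Proof.
move=> r0 hr t k tr; have [c hc] := hr t k tr; eexists; apply: (cdiff_comp hc).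
by apply: cdiff_inv; rewrite scale0r addr0; exact: r0.
Qed.

Lemma sephol_sum rho (I : Type) (l : seq I) (P : pred I) (F : I -> 'rV[C]_d -> C) :
  (forall i, P i -> sephol rho (F i)) -> sephol rho (fun t => \sum_(i <- l | P i) F i t).
Proof.
move=> hF; elim: l => [|i l IH].
  by apply: sephol_ext (sephol_cst 0) _ => t _; rewrite big_nil.
case Pi: (P i); last by apply: sephol_ext IH _ => t _; rewrite big_cons Pi.
by apply: sephol_ext (sepholD (hF i Pi) IH) _ => t _; rewrite big_cons Pi.
Qed.

Lemma sephol_limit rho (F : nat -> 'rV[C]_d -> C) r B : (forall j, sephol rho (F j)) ->
  (forall j t, nn t < rho -> cn (F j t) <= B) ->
  (forall t, nn t < rho -> ccvg (fun j => F j t) (r t)) -> sephol rho r.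
Proof.
move=> FH FB Fr t k tr.
have e0 : 0 < rho - nn t by rewrite subr_gt0.
have le : nn t + (rho - nn t) <= rho by lra.
have [] := @hol_limit R 0 (rho - nn t) (fun j z => F j (t + z *: delta_mx 0 k))
  (fun z => r (t + z *: delta_mx 0 k)) B _ _ _ 0.
- by move=> j; exact: sephol_hol (FH j) le.
- move=> j z; rewrite subr0 => ze; apply: FB.
  by apply: (le_lt_trans (nnD _ _)); rewrite nn_delta; lra.
- move=> z; rewrite subr0 => ze; apply: Fr.
  by apply: (le_lt_trans (nnD _ _)); rewrite nn_delta; lra.
- by rewrite subr0 cn0.
by move=> c hc; exists c.
Qed.

(** The coordinates of [t] are switched on one after the other, each at the cost of a one-variable
    Lipschitz bound. *)
Lemma sephol_lip0 rho r B t : 0 < rho -> sephol rho r -> (forall t, nn t < rho -> cn (r t) <= B) ->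
  nn t < rho / 4 -> cn (r t - r 0) <= (16 * B / rho * nn t) *+ d.
Proof.
move=> rho0 hr rB tr.
have B0 : 0 <= B by apply: le_trans (cn_ge0 _) (rB 0 _); rewrite nn0.
pose p k : 'rV[C]_d := \row_j (if (j < k)%N then t 0 j else 0).
have pn k : nn (p k) <= nn t.
  apply: nn_le; first exact: nn_ge0.
  by move=> i; rewrite mxE; case: ifP => _; rewrite ?cn0 ?nn_ge0 ?nn_coord.
have p0 : p 0%N = 0 by apply/rowP => i; rewrite !mxE.
have pd : p d = t by apply/rowP => i; rewrite !mxE ltn_ord.
have step (k : 'I_d) : cn (r (p k.+1) - r (p k)) <= 16 * B / rho * nn t.
  have pS : p k.+1 = p k + t 0 k *: delta_mx 0 k.
    apply/rowP => i; rewrite !mxE ltnS; case: (ltngtP i k) => [ik|ik|/ord_inj ->].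
    - by rewrite (ltn_eqF ik : (i == k) = false) mulr0 addr0.
    - by rewrite (gtn_eqF ik : (i == k) = false) mulr0 addr0.
    - by rewrite !eqxx mulr1 add0r.
  have e0 : 0 < rho / 2 by lra.
  have le : nn (p k) + rho / 2 <= rho by have := pn k; lra.
  have le4 : nn t < rho / 2 / 2 by lra.
  have := @hol_lip R 0 (rho / 2) (fun z => r (p k + z *: delta_mx 0 k)) B (t 0 k) 0 e0
    (@sephol_hol rho r (p k) k (rho / 2) hr le).
  rewrite scale0r addr0 -pS !subr0 cn0 => H; apply: le_trans (H _ _ _) _.
  - move=> z; rewrite subr0 => ze; apply: rB.
    by apply: (le_lt_trans (nnD _ _)); rewrite nn_delta; have := pn k; lra.
  - by apply: le_lt_trans le4; exact: nn_coord.
  - by lra.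
  have -> : 8 * B / (rho / 2) = 16 * B / rho by field; rewrite gt_eqF.
  by apply: ler_wpM2l; [rewrite divr_ge0 ?mulr_ge0 // ltW|exact: nn_coord].
rewrite -pd -p0 -(telescope_sumr (fun k => r (p k))) //.
rewrite big_mkord; apply: (le_trans (cn_sum _ _ _)).
apply: le_trans (ler_sum _ (fun k _ => step k)) _.
by rewrite sumr_const card_ord pd.
Qed.

Lemma good_ext rho eta s f : good rho eta s ->
  (forall t w, nn t < rho -> s t w = f t w) -> good rho eta f.
Proof.
move=> [h1 h2] sf; split=> [t tr|w we]; first by apply: hol_ext (h1 t tr) _ => w; exact: sf.
by apply: sephol_ext (h2 w we) _ => t; exact: sf.
Qed.

Lemma good_sub rho eta rho' eta' s : rho' <= rho -> eta' <= eta -> good rho eta s -> good rho' eta' s.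
Proof.
move=> hr he [h1 h2]; split=> [t tr|w we].
  by apply: hol_sub (h1 t (lt_le_trans tr hr)) _; rewrite subrr cn0 add0r.
by apply: sephol_sub hr _; apply: h2; exact: lt_le_trans he.
Qed.

Lemma bnd_sub rho eta rho' eta' B s : rho' <= rho -> eta' <= eta -> bnd rho eta B s -> bnd rho' eta' B s.
Proof. by move=> hr he h t w tr we; apply: h; [exact: lt_le_trans hr|exact: lt_le_trans he]. Qed.

Lemma goodM rho eta s f : good rho eta s -> good rho eta f -> good rho eta (fun t w => s t w * f t w).
Proof.
move=> [h1 h2] [k1 k2]; split=> [t tr|w we]; first by apply: holM; [exact: h1|exact: k1].
by apply: sepholM; [exact: h2|exact: k2].
Qed.

Lemma goodB rho eta s f : good rho eta s -> good rho eta f -> good rho eta (fun t w => s t w - f t w).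
Proof.
move=> [h1 h2] [k1 k2]; split=> [t tr|w we]; first by apply: holB; [exact: h1|exact: k1].
by apply: sepholB; [exact: h2|exact: k2].
Qed.

Lemma good_cst rho eta c : good rho eta (fun _ _ => c).
Proof. by split=> *; [exact: hol_cst|exact: sephol_cst]. Qed.

Lemma good_t rho eta r : sephol rho r -> good rho eta (fun t _ => r t).
Proof. by move=> h; split=> *; [exact: hol_cst|]. Qed.

Lemma good_w rho eta : good rho eta (fun _ w => w).
Proof. by split=> *; [exact: hol_id|exact: sephol_cst]. Qed.

Lemma good_wX rho eta j : good rho eta (fun _ w => w ^+ j).
Proof.
elim: j => [|j IH]; first exact: good_cst.
by apply: good_ext (goodM (good_w rho eta) IH) _ => t w _; rewrite exprS.
Qed.

Lemma good_sum rho eta (I : Type) (l : seq I) (P : pred I) (F : I -> 'rV[C]_d -> C -> C) :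
  (forall i, P i -> good rho eta (F i)) -> good rho eta (fun t w => \sum_(i <- l | P i) F i t w).
Proof.
move=> hF; split=> [t tr|w we].
  by apply: hol_sum => i /hF[h _]; exact: h.
by apply: (@sephol_sum rho I l P (fun i t => F i t w)) => i /hF[_ h]; exact: h.
Qed.

(** The backward shift on power series in [w]: the constant term is dropped and the rest divided by
    [w]. *)
Definition tau (s : 'rV[C]_d -> C -> C) : 'rV[C]_d -> C -> C := fun t => divdiff (s t) 0.

Lemma tauE s t w : s t w = s t 0 + w * tau s t w.
Proof. by rewrite {1}(divdiffE (s t) 0 w) subr0. Qed.

Lemma tau_bnd rho eta B s : 0 < eta -> good rho eta s -> bnd rho eta B s -> bnd rho eta (8 * B / eta) (tau s).
Proof.
move=> e0 [h1 _] hB t w tr we; have hs := h1 t tr.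
have sB : bounded_by 0 eta (s t) B by move=> z; rewrite subr0; exact: hB.
have B0 := bounded_ge0 e0 sB.
rewrite /tau /divdiff; case: eqP => [_|/eqP w0].
  apply: (le_trans (cauchy_estimate e0 hs sB)); rewrite ler_pM2r ?invr_gt0 //; lra.
have w0' : 0 < cn w by rewrite cn_gt0.
rewrite subr0 cnM cnV ler_pdivrMr //.
have [we2|we2] := ltP (cn w) (eta / 2).
  have := hol_lip e0 hs sB (z := w) (w := 0); rewrite !subr0 cn0; apply => //; lra.
apply: (le_trans (cnD _ _)); rewrite cnN.
have := hB t w tr we; have := hB t 0 tr; rewrite cn0 => /(_ e0).
have : B + B <= 8 * B / eta * (eta / 2).
  have -> : 8 * B / eta * (eta / 2) = 4 * B by field; rewrite gt_eqF.
  lra.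
have : 8 * B / eta * (eta / 2) <= 8 * B / eta * cn w.
  by apply: ler_wpM2l => //; rewrite divr_ge0 ?mulr_ge0 // ltW.
lra.
Qed.

(** Only [w = 0] is delicate: there the dependence on [t] is holomorphic as a bounded limit of the
    quotients at the points [x k], which tend to 0. *)
Lemma tau_good rho eta B s : 0 < eta -> good rho eta s -> bnd rho eta B s -> good rho eta (tau s).
Proof.
move=> e0 hs hB; have [h1 h2] := hs; split=> [t tr|w we].
  by apply: divdiff_hol (h1 t tr) _; rewrite subrr cn0.
have off z : cn z < eta -> z != 0 -> sephol rho (fun t => tau s t z).
  move=> ze z0; have h0 : cn (0 : C) < eta by rewrite cn0.
  apply: sephol_ext (sepholM (sepholB (h2 z ze) (h2 0 h0)) (sephol_cst z^-1)) _ => t _.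
  by rewrite /tau /divdiff (negbTE z0) subr0.
have [->|w0] := eqVneq w 0; last exact: off.
pose x k : C := (eta / (2 * k.+1%:R))%:C.
have xn k : cn (x k) = eta / (2 * k.+1%:R) by rewrite cn_real ger0_norm // divr_ge0 ?mulr_ge0 // ltW.
have xe k : cn (x k) < eta.
  rewrite xn ltr_pdivrMr ?mulr_gt0 // ltr_pMr //.
  by rewrite -natrM ltr1n mulnS.
have x0 k : x k != 0 by rewrite -cn_gt0 xn divr_gt0 // mulr_gt0.
apply: (@sephol_limit rho (fun k t => tau s t (x k)) _ (8 * B / eta)).
- by move=> k; exact: off.
- by move=> k t tr; exact: (tau_bnd e0 hs hB).
move=> t tr e he.
have [||c hc] := @divdiff_hol R 0 eta (s t) 0 (h1 t tr) _ 0; rewrite ?subrr ?cn0 //.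
have [r r0 hr] := cdiff_cont hc he.
have [N hN] : exists N : nat, eta / r < N%:R.
  by exists (Num.bound (eta / r)); apply: archi_boundP; rewrite divr_ge0 // ltW.
exists N => k Nk; apply: hr; rewrite subr0 xn ltr_pdivrMr ?mulr_gt0 //.
move: hN; rewrite ltr_pdivrMr // mulrC => h; apply: (lt_le_trans h).
rewrite ler_pM2l // -natrM ler_nat; apply: (leq_trans Nk).
by rewrite mul2n -addnn; apply: (leq_trans (leqnSn k)); rewrite leq_addr.
Qed.

Definition taus k s := iter k tau s.

Lemma taus_good rho eta B s k : 0 < eta -> good rho eta s -> bnd rho eta B s ->
  good rho eta (taus k s) /\ bnd rho eta ((8 / eta) ^+ k * B) (taus k s).
Proof.
move=> e0 hs hB; elim: k => [|k [IH1 IH2]]; first by split => //; rewrite expr0 mul1r.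
split; first exact: tau_good IH1 IH2.
by have := tau_bnd e0 IH1 IH2; congr bnd; rewrite exprS; ring.
Qed.

Lemma taus_taylor s t w k : s t w = \sum_(j < k) taus j s t 0 * w ^+ j + w ^+ k * taus k s t w.
Proof.
elim: k => [|k IH]; first by rewrite big_ord0 add0r expr0 mul1r.
by rewrite IH big_ord_recr /= {1}(tauE (taus k s)) exprSr; ring.
Qed.

End SeparatelyHolomorphic.

(** * Weierstrass division and preparation *)

Section Division.
Context {R : realType}.
Local Notation C := (R[i]).

Lemma ccvgD (u v : nat -> C) l m : ccvg u l -> ccvg v m -> ccvg (fun k => u k + v k) (l + m).
Proof.
move=> hu hv e e0; have e2 : 0 < e / 2 by lra.
have [N1 h1] := hu _ e2; have [N2 h2] := hv _ e2.
exists (maxn N1 N2) => k; rewrite geq_max => /andP[/h1 k1 /h2 k2].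
have -> : u k + v k - (l + m) = (u k - l) + (v k - m) by ring.
by apply: (le_trans (cnD _ _)); lra.
Qed.

Lemma ccvgZ (u : nat -> C) l c : ccvg u l -> ccvg (fun k => u k * c) (l * c).
Proof.
move=> hu e e0; have M0 : 0 < cn c + 1 by rewrite ltr_wpDl // cn_ge0.
have [N h] := hu _ (divr_gt0 e0 M0); exists N => k /h.
rewrite -mulrBl cnM ler_pdivlMr // => hk; apply: le_trans hk.
by apply: ler_wpM2l; rewrite ?cn_ge0 // lerDl.
Qed.

Lemma ccvg_sum (I : Type) (s : seq I) (u : I -> nat -> C) (l : I -> C) :
  (forall i, ccvg (u i) (l i)) -> ccvg (fun k => \sum_(i <- s) u i k) (\sum_(i <- s) l i).
Proof.
move=> h; elim: s => [|i s IH].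
  by move=> e e0; exists 0%N => k _; rewrite !big_nil subrr cn0 ltW.
move=> e e0; have [N hN] := ccvgD (h i) IH e0; exists N => k Nk.
by rewrite !big_cons; exact: hN.
Qed.

Definition clim (u : nat -> C) : C := xget 0 [set l | ccvg u l].

Lemma climP (u : nat -> C) l : ccvg u l -> ccvg u (clim u).
Proof. by move=> h; apply: (@xgetPex _ 0 [set l | ccvg u l]); exists l. Qed.

Lemma geo_tail (u : nat -> C) (M : R) : (forall k, cn (u k) <= M / 2 ^+ k) ->
  forall k j, cn (\sum_(i < k + j) u i - \sum_(i < k) u i) <= 2 * M / 2 ^+ k - 2 * M / 2 ^+ (k + j).
Proof.
move=> hu k; elim=> [|j IH]; first by rewrite addn0 !subrr cn0.
rewrite addnS big_ord_recr /= addrAC; apply: (le_trans (cnD _ _)).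
have := hu (k + j)%N; move: IH.
have -> : 2 * M / 2 ^+ (k + j) = 2 * (M / 2 ^+ (k + j)) by ring.
have -> : 2 * M / 2 ^+ (k + j).+1 = M / 2 ^+ (k + j).
  by rewrite exprS; field; rewrite expf_neq0.
by lra.
Qed.

Lemma half_pow_small (M e : R) : 0 <= M -> 0 < e -> exists k, M / 2 ^+ k <= e.
Proof.
move=> M0 e0; have := archi_boundP (divr_ge0 M0 (ltW e0)); set k := Num.bound _ => h; exists k.
rewrite ler_pdivrMr ?exprn_gt0 //; move: h; rewrite ltr_pdivrMr // mulrC => h.
by apply: (le_trans (ltW h)); rewrite ler_pM2l // -natrX ler_nat ltnW // ltn_expl.
Qed.

Lemma half_pow_mono (M : R) k j : 0 <= M -> (k <= j)%N -> M / 2 ^+ j <= M / 2 ^+ k.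
Proof.
by move=> M0 kj; apply: ler_wpM2l => //; rewrite lef_pV2 ?posrE ?exprn_gt0 // ler_eXn2l // ltr1n.
Qed.

Lemma geo_series (u : nat -> C) (M : R) : (forall k, cn (u k) <= M / 2 ^+ k) ->
  ccvg (fun k => \sum_(i < k) u i) (clim (fun k => \sum_(i < k) u i)) /\
  forall k, cn (\sum_(i < k) u i) <= 2 * M.
Proof.
move=> hu; have M0 : 0 <= M by have := hu 0%N; rewrite expr0 divr1; apply: le_trans; exact: cn_ge0.
have M20 : 0 <= 2 * M by rewrite mulr_ge0.
have p k : 0 <= 2 * M / 2 ^+ k by rewrite divr_ge0 // exprn_ge0.
split; last first.
  move=> k; have := geo_tail hu 0 k; rewrite add0n big_ord0 subr0 expr0 divr1.
  by have := p k; lra.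
have [e e0|l hl] := @complex_cauchy R (fun k => \sum_(i < k) u i); last exact: climP hl.
have e2 : 0 < e / 2 by lra.
have [N hN] := half_pow_small M20 e2.
have H k : (N <= k)%N -> cn (\sum_(i < k) u i - \sum_(i < N) u i) <= e / 2.
  by move=> Nk; have := geo_tail hu N (k - N); rewrite subnKC //; have := p k; lra.
exists N => k m /H h1 /H h2.
have := cn_distD (\sum_(i < N) u i) (\sum_(i < k) u i) (\sum_(i < m) u i).
by rewrite [cn (\sum_(i < N) u i - _)]cnB; lra.
Qed.

Variable d : nat.
Implicit Types (t : 'rV[C]_d) (w : C) (s b : 'rV[C]_d -> C -> C).

(* The division by w^m - b(t, w) is a perturbation of the division by w^m: it is
   inverted by a Neumann series. *)
Lemma weierstrass_division (rho eta k B : R) m b s : 0 < rho -> 0 < eta ->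
  good rho eta b -> bnd rho eta k b -> k * (8 / eta) ^+ m <= 1 / 2 ->
  good rho eta s -> bnd rho eta B s ->
  exists (r : 'I_m -> 'rV[C]_d -> C) (Q : 'rV[C]_d -> C -> C),
  [/\ forall j, sephol rho (r j),
      forall j t, nn t < rho -> cn (r j t) <= 2 * ((8 / eta) ^+ j * B),
      bnd rho eta (2 * ((8 / eta) ^+ m * B)) Q &
      forall t w, nn t < rho -> cn w < eta ->
        s t w = \sum_j r j t * w ^+ j + (w ^+ m - b t w) * Q t w].
Proof.
move=> rho0 eta0 bg bk kb sg sB.
(* Divide [S i] by [w ^+ m] and write [w ^+ m] as [(w ^+ m - b) + b]: what remains to be divided is
   [b] times the quotient, which is [S i.+1]. *)
pose S := fix S i := if i is i'.+1 then (fun t w => b t w * taus m (S i') t w) else s.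
have k0 : 0 <= k by apply: le_trans (cn_ge0 _) (bk 0 0 _ _); rewrite ?nn0 ?cn0.
have B0 : 0 <= B by apply: le_trans (cn_ge0 _) (sB 0 0 _ _); rewrite ?nn0 ?cn0.
have e8 : 0 <= 8 / eta by rewrite divr_ge0 // ltW.
have SP i : good rho eta (S i) /\ bnd rho eta (B / 2 ^+ i) (S i).
  elim: i => [|i [IH1 IH2]]; first by split => //; rewrite expr0 divr1.
  have [h1 h2] := taus_good m eta0 IH1 IH2; split; first exact: goodM.
  move=> t w tr we; rewrite /= cnM.
  apply: le_trans (ler_pM (cn_ge0 _) (cn_ge0 _) (bk t w tr we) (h2 t w tr we)) _.
  rewrite mulrA; apply: le_trans (ler_wpM2r _ kb) _; first by rewrite divr_ge0 // exprn_ge0.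
  rewrite exprS le_eqVlt; apply/orP; left; apply/eqP; field; rewrite expf_neq0 //.
have term j i : bnd rho eta ((8 / eta) ^+ j * B / 2 ^+ i) (taus j (S i)).
  have [h1 h2] := SP i; have [_] := taus_good j eta0 h1 h2; congr bnd; ring.
have h0 : cn (0 : C) < eta by rewrite cn0.
pose r (j : 'I_m) t := clim (fun K => \sum_(i < K) taus j (S i) t 0).
pose Q t w := clim (fun K => \sum_(i < K) taus m (S i) t w).
have rP (j : 'I_m) t : nn t < rho -> _ := fun tr => geo_series (fun i => term j i t 0 tr h0).
have QP t w : nn t < rho -> cn w < eta -> _ := fun tr we => geo_series (fun i => term m i t w tr we).
exists r, Q; split.
- move=> j; apply: (@sephol_limit R d rho (fun K t => \sum_(i < K) taus j (S i) t 0) _ (2 * ((8 / eta) ^+ j * B))).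
  + move=> K; apply: sephol_sum => i _; have [h1 h2] := SP i.
    by have [[_ h3] _] := taus_good j eta0 h1 h2; exact: h3.
  + by move=> K t tr; have [_ h] := rP j t tr; exact: h.
  + by move=> t tr; have [h _] := rP j t tr.
- by move=> j t tr; have [h1 h2] := rP j t tr; exact: ccvg_le h1 h2.
- by move=> t w tr we; have [h1 h2] := QP t w tr we; exact: ccvg_le h1 h2.
move=> t w tr we.
have part K : s t w = \sum_(j < m) (\sum_(i < K) taus j (S i) t 0) * w ^+ j +
     (\sum_(i < K) taus m (S i) t w) * (w ^+ m - b t w) + S K t w.
  elim: K => [|K IH].
    by rewrite !big_ord0 mul0r addr0 big1 ?add0r // => j _; rewrite big_ord0 mul0r.
  rewrite IH [S K t w](taus_taylor (S K) t w m) [in RHS]big_ord_recr /=.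
  under [in RHS]eq_bigr do rewrite big_ord_recr /= mulrDl.
  by rewrite big_split /=; ring.
have L : ccvg (fun K => \sum_(j < m) (\sum_(i < K) taus j (S i) t 0) * w ^+ j +
     (\sum_(i < K) taus m (S i) t w) * (w ^+ m - b t w)) (\sum_j r j t * w ^+ j + Q t w * (w ^+ m - b t w)).
  apply: ccvgD; last by apply: ccvgZ; have [h _] := QP t w tr we.
  by apply: ccvg_sum => j; apply: ccvgZ; have [h _] := rP j t tr.
rewrite [_ * Q t w]mulrC; apply: ccvg_uniq L => e e0.
have [K hK] := half_pow_small B0 e0; exists K => i Ki.
rewrite (part i) opprD addrA subrr add0r cnN.
have [_ h] := SP i; apply: (le_trans (h t w tr we)); apply: le_trans hK.
exact: half_pow_mono.
Qed.

Lemma good_inv (rho eta : R) s : good rho eta s ->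
  (forall t w, nn t < rho -> cn w < eta -> s t w != 0) -> good rho eta (fun t w => (s t w)^-1).
Proof.
move=> [h1 h2] s0; split=> [t tr|w we].
  by apply: hol_inv (h1 t tr) _ => w; rewrite subr0; exact: s0.
by apply: sephol_inv (h2 w we) => t tr; exact: s0.
Qed.

(** [f] is its head (the first [m] Taylor terms in [w]) plus [w ^+ m] times a unit; [b] is minus the
    head divided by the unit. It need not be a polynomial in [w], but it is as small as desired for
    small [t]. The smallness needed by [weierstrass_division] depends on [m] and [eta1], which are
    therefore fixed before [k]. *)
Lemma weierstrass_preparation (rho eta B : R) f : 0 < rho -> 0 < eta ->
  good rho eta f -> bnd rho eta B f ->
  ~ (exists2 e : R, 0 < e & forall w, cn w < e -> f 0 w = 0) ->
  exists m (eta1 : R), [/\ 0 < eta1, eta1 <= eta & forall k : R, 0 < k ->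
    exists rho1 b, [/\ 0 < rho1, rho1 <= rho, good rho1 eta1 b, bnd rho1 eta1 k b &
      forall t w, nn t < rho1 -> cn w < eta1 -> (f t w == 0) = (w ^+ m == b t w)]].
Proof.
move=> rho0 eta0 fg fB fnz; have [f1 f2] := fg.
have n0 : nn (0 : 'rV[C]_d) < rho by rewrite nn0.
have [[e e0 he]|[m um ul]] := zero_order eta0 (f1 0 n0).
  by exfalso; apply: fnz; exists e => // w we; apply: he; rewrite subr0.
pose u := taus m f.
have tE k s t : taus k s t = divdiffs (s t) 0 k by elim: k => //= k; rewrite /tau => ->.
have [[u1 u2] uB] := taus_good m eta0 fg fB; rewrite -/u in u1 u2 uB.
have u00 : u 0 0 != 0 by rewrite /u tE.
pose c := cn (u 0 0); have c0 : 0 < c by rewrite cn_gt0.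
have [|z hz] := u1 0 n0 0; first by rewrite subrr cn0.
have c4 : 0 < c / 4 by lra.
have [e1 e10 he1] := cdiff_cont hz c4.
pose eta1 := Num.min e1 eta.
have eta10 : 0 < eta1 by rewrite lt_min e10.
have eta1e : eta1 <= eta by rewrite ge_min lexx orbT.
exists m, eta1; split => // k k0.
have B0 : 0 <= B by apply: le_trans (cn_ge0 _) (fB 0 0 _ _); rewrite ?nn0 ?cn0.
pose L j := (16 * ((8 / eta) ^+ j * B) / rho) *+ d.
have e8 : 0 <= 8 / eta by rewrite divr_ge0 // ltW.
have L0 j : 0 <= L j.
  by rewrite mulrn_wge0 // divr_ge0 ?(ltW rho0) // mulr_ge0 // mulr_ge0 // exprn_ge0.
have lip j t w : nn t < rho / 4 -> cn w < eta -> cn (taus j f t w - taus j f 0 w) <= L j * nn t.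
  move=> tr we; have [[_ h1] h2] := taus_good j eta0 fg fB.
  rewrite /L mulrnAl; apply: (sephol_lip0 rho0 (h1 w we) _ tr) => t' tr'; exact: h2.
have h0 : cn (0 : C) < eta by rewrite cn0.
have head0 j : (j < m)%N -> taus j f 0 0 = 0 by move=> jm; rewrite tE ul.
pose Lh := \sum_(j < m) L j * eta ^+ j.
have Lh0 : 0 <= Lh by apply: sumr_ge0 => j _; rewrite mulr_ge0 // exprn_ge0 // ltW.
(* The second entry keeps the unit above [c / 2], the third keeps the head below [k * (c / 2)]. *)
pose rho1 := Num.min (rho / 4) (Num.min (c / 4 / (L m + 1)) (k * (c / 2) / (Lh + 1))).
have Lm1 : 0 < L m + 1 by rewrite ltr_wpDl.
have Lh1 : 0 < Lh + 1 by rewrite ltr_wpDl.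
have c2 : 0 < c / 2 by lra.
have rho10 : 0 < rho1.
  by rewrite !lt_min !divr_gt0 // mulr_gt0.
have r4 : rho1 <= rho / 4 by rewrite ge_min lexx.
have rc : rho1 <= c / 4 / (L m + 1) by rewrite !ge_min lexx orbT.
have rk : rho1 <= k * (c / 2) / (Lh + 1) by rewrite !ge_min lexx !orbT.
have uge t w : nn t < rho1 -> cn w < eta1 -> c / 2 <= cn (u t w).
  move=> tr we; have we1 : cn (w - 0) < e1 by rewrite subr0; apply: lt_le_trans we _; rewrite ge_min lexx.
  have wee := lt_le_trans we eta1e.
  have := lip m t w (lt_le_trans tr r4) wee; rewrite -/u => h.
  have : (L m + 1) * nn t <= c / 4.
    by rewrite mulrC -ler_pdivlMr //; apply: ltW; apply: lt_le_trans rc.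
  rewrite mulrDl mul1r => h2.
  have := he1 w we1; have := cn_dist (u 0 0) (u t w); rewrite -/c -/(u 0 w).
  have := cn_distD (u 0 w) (u 0 0) (u t w); rewrite [cn (u 0 0 - u 0 w)]cnB [cn (u 0 w - u t w)]cnB.
  by have := nn_ge0 t; clear -h2 h; lra.
have une t w : nn t < rho1 -> cn w < eta1 -> u t w != 0.
  by move=> tr we; rewrite -cn_gt0; apply: lt_le_trans (uge t w tr we).
have rr : rho1 <= rho by (clear -r4 rho10; lra).
pose b (t : 'rV[C]_d) (w : C) : C := - (\sum_(j < m) taus j f t 0 * w ^+ j) * (u t w)^-1.
exists rho1, b; split => //.
- apply: goodM; last first.
    by apply: good_inv une; apply: good_sub rr eta1e _; split.
  apply: (@good_ext R d rho1 eta1 (fun t w => 0 - \sum_(j < m) taus j f t 0 * w ^+ j)) => [|t w _]; last by rewrite sub0r.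
  apply: (@goodB R d rho1 eta1 (fun _ _ => 0) (fun t w => \sum_(j < m) taus j f t 0 * w ^+ j)); first exact: good_cst.
  apply: good_sum => j _.
  apply: (@goodM R d rho1 eta1 (fun t _ => taus j f t 0) (fun _ w => w ^+ j)); last exact: good_wX.
  apply: good_t.
  have [[_ h1] h2] := taus_good j eta0 fg fB.
  by apply: sephol_sub rr _; exact: h1.
- move=> t w tr we; rewrite /b cnM cnN cnV ler_pdivrMr ?cn_gt0 ?une //.
  have wee := lt_le_trans we eta1e.
  apply: le_trans (ler_wpM2l (ltW k0) (uge t w tr we)).
  apply: (le_trans (cn_sum _ _ _)); apply: (@le_trans _ _ (Lh * nn t)).
    rewrite mulr_suml; apply: ler_sum => j _; rewrite cnM cnX mulrAC.
    apply: ler_pM; rewrite ?cn_ge0 ?exprn_ge0 ?cn_ge0 //.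
      by have := lip j t 0 (lt_le_trans tr r4) h0; rewrite (head0 j) // subr0.
    by apply: lerXn2r; rewrite ?nnegrE ?cn_ge0 // ltW.
  have : (Lh + 1) * nn t <= k * (c / 2).
    by rewrite mulrC -ler_pdivlMr //; apply: ltW; apply: lt_le_trans rk.
  by rewrite mulrDl mul1r; have := nn_ge0 t; lra.
move=> t w tr we; rewrite (taus_taylor f t w m) -/(u t w) -[RHS]subr_eq0 /b.
have -> : w ^+ m - - (\sum_(j < m) taus j f t 0 * w ^+ j) / u t w =
  (\sum_(j < m) taus j f t 0 * w ^+ j + w ^+ m * u t w) / u t w.
  by field; exact: une.
by rewrite mulf_eq0 invr_eq0 (negbTE (une t w tr we)) orbF.
Qed.

End Division.

(** * Analytic sets *)

Section AnalyticSets.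
Context {R : realType}.
Local Notation C := (R[i]).

Lemma fin_radius (I : finType) (P : I -> R -> Prop) :
  (forall i, exists2 r : R, 0 < r & P i r) -> (forall i r r', r' <= r -> P i r -> P i r') ->
  exists2 r : R, 0 < r & forall i, P i r.
Proof.
move=> h mono.
suff H (s : seq I) : exists2 r : R, 0 < r & forall i, i \in s -> P i r.
  by have [r r0 hr] := H (enum I); exists r => // i; apply: hr; rewrite mem_enum.
elim: s => [|i s [r r0 hr]]; first by exists 1.
have [r' r'0 hi] := h i; exists (Num.min r r'); first by rewrite lt_min r0.
move=> j; rewrite inE => /orP[/eqP ->|js].
  by apply: mono hi; rewrite ge_min lexx orbT.
by apply: mono (hr j js); rewrite ge_min lexx.
Qed.

Lemma zero_isolated (a : C) (rho : R) f : 0 < rho -> hol a rho f ->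
  (exists2 r : R, 0 < r & forall z, cn (z - a) < r -> f z = 0) \/
  (exists2 r : R, 0 < r & forall z, z != a -> cn (z - a) < r -> f z != 0).
Proof.
move=> rho0 fh; have [|[m um ul]] := zero_order rho0 fh; first by left.
right; have [|c hc] := @divdiffs_hol R a rho f m rho0 fh a; first by rewrite subrr cn0.
have u0 : 0 < cn (divdiffs f a m a) / 2 by rewrite divr_gt0 ?cn_gt0.
have [r r0 hr] := cdiff_cont hc u0; exists r => // z za zr.
rewrite (divdiffs_taylor f a m z) big1 ?add0r => [|[j jm] _]; last by rewrite /= ul // mul0r.
rewrite mulf_neq0 ?expf_neq0 ?subr_eq0 // -cn_gt0.
by have := hr z zr; have := cn_dist (divdiffs f a m a) (divdiffs f a m z); rewrite cnB; lra.
Qed.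

(** To contain a neighbourhood of a point propagates along the segment by Cousin's lemma: near each
    point, either all local equations vanish identically, or some equation has no zero other than
    the point itself. *)
Lemma analytic_segment (Y : set C) (q0 z : C) (r0 : R) :
  (forall t : R, 0 <= t -> t <= 1 -> exists (r : R) (k : nat) (f : 'I_k -> C -> C),
    [/\ 0 < r, forall i, hol (q0 + t%:C * (z - q0)) r (f i) &
      forall w, cn (w - (q0 + t%:C * (z - q0))) < r -> (Y w <-> forall i, f i w = 0)]) ->
  0 < r0 -> (forall w, cn (w - q0) < r0 -> Y w) -> Y z.
Proof.
move=> hY r00 hq.
pose p (t : R) := q0 + t%:C * (z - q0).
pose Int (t : R) := exists2 r : R, 0 < r & forall w, cn (w - p t) < r -> Y w.
suff: Int 0 -> Int 1.
  case; first by exists r0 => // w; rewrite /p mul0r addr0; exact: hq.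
  by move=> r rr h; apply: h; rewrite /p mul1r [q0 + _]addrC subrK subrr cn0.
have M0 : 0 < cn (z - q0) + 1 by rewrite ltr_wpDl // cn_ge0.
have pd (s t : R) : cn (p s - p t) = `|s - t| * cn (z - q0).
  by rewrite -cn_real -cnM; congr cn; rewrite /p rmorphB /=; ring.
apply: (@cousin R (fun x y => Int x -> Int y)) => [//||x x0 x1]; first by move=> *; auto.
have [r [k [f [r1 fh Yf]]]] := hY x x0 x1; rewrite -/(p x) in fh Yf.
have close (r' : R) : 0 < r' -> exists2 d : R, 0 < d & forall y, `|y - x| < d -> cn (p y - p x) < r'.
  move=> r'0; exists (r' / (cn (z - q0) + 1)); first exact: divr_gt0.
  move=> y; rewrite ltr_pdivlMr // pd; apply: le_lt_trans.
  by apply: ler_wpM2l => //; rewrite lerDl.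
have [allz|/existsNP[i ni]] := pselect (forall i, exists2 r' : R, 0 < r' & forall w, cn (w - p x) < r' -> f i w = 0).
  have [|r' r'0 hr'] := fin_radius allz.
    by move=> i s s' ss h w ws; apply: h; exact: lt_le_trans ss.
  pose s := Num.min r r' / 2.
  have s0 : 0 < s by rewrite divr_gt0 // lt_min r1.
  have [d d0 hd] := close s s0; exists d => // y y' _ yx xy' _ yd y'd _.
  exists s => // w ws; have [sr sr'] : s + s <= r /\ s + s <= r'.
    have -> : s + s = Num.min r r' by rewrite /s; lra.
    by rewrite !ge_min !lexx orbT.
  have y'x : cn (p y' - p x) < s by apply: hd; rewrite ltr_norml; lra.
  have wx : cn (w - p x) < s + s.
    by apply: (le_lt_trans (cn_distD (p y') _ _)); exact: ltrD.
  by apply/Yf => [|i]; [exact: lt_le_trans sr|apply: hr'; exact: lt_le_trans sr'].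
have [//|[r' r'0 hr']] := zero_isolated r1 (fh i).
have s0 : 0 < Num.min r r' by rewrite lt_min r1.
have [d d0 hd] := close _ s0; exists d => // y y' _ yx xy' _ yd y'd [ry ry0 hy]; exfalso.
have yxs : cn (p y - p x) < Num.min r r' by apply: hd; rewrite ltr_norml; lra.
have bad w : Y w -> w != p x -> cn (w - p x) < Num.min r r' -> False.
  rewrite lt_min => Yw wx /andP[w1 w2]; have /eqP := hr' w wx w2; apply.
  by move: Yw => /(Yf w w1).
have [e|ne] := eqVneq (p y) (p x); last by apply: (bad (p y)) => //; apply: hy; rewrite subrr cn0.
pose h : C := (Num.min ry (Num.min r r') / 2)%:C.
have m0 : 0 < Num.min ry (Num.min r r') by rewrite lt_min ry0.
have hn : cn h = Num.min ry (Num.min r r') / 2 by rewrite cn_real ger0_norm // divr_ge0 // ltW.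
have h0 : 0 < cn h by rewrite hn divr_gt0.
have hl : cn h < Num.min ry (Num.min r r') by rewrite hn; lra.
move: hl; rewrite lt_min => /andP[l1 l2].
apply: (bad (p x + h)).
- by apply: hy; rewrite e addrC addKr.
- by rewrite -subr_eq0 addrC addKr -cn_gt0.
- by rewrite addrC addKr.
Qed.

Lemma analytic_line (Y : set C) :
  (forall q : C, exists (r : R) (k : nat) (f : 'I_k -> C -> C),
    [/\ 0 < r, forall i, hol q r (f i) & forall w, cn (w - q) < r -> (Y w <-> forall i, f i w = 0)]) ->
  forall (q0 : C) (r0 : R), 0 < r0 -> (forall w, cn (w - q0) < r0 -> Y w) -> forall z, Y z.
Proof. by move=> hY q0 r0 r00 hq z; apply: analytic_segment r00 hq => t _ _; exact: hY. Qed.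

Lemma slice_hol (n : nat) (f : 'rV[C]_n -> C) (q v : 'rV[C]_n) (w0 : C) (r s : R) :
  (forall x, nn (x - q) < r -> differentiable f x) -> cn w0 * nn v + s * nn v <= r -> 0 < r ->
  hol w0 s (fun w => f (q + w *: v)).
Proof.
move=> fd sr r0 w ws; eexists; apply: cdiff_slice; apply: fd.
rewrite addrC addKr nnZ; have [v0|v0] := eqVneq (nn v) 0; first by rewrite v0 mulr0.
have vp : 0 < nn v by rewrite lt_def v0 nn_ge0.
by apply: lt_le_trans sr; rewrite -mulrDl ltr_pM2r //; have := cn_dist w w0; lra.
Qed.

Lemma analytic_slice (n : nat) (X : set 'rV[C]_n) : analytic_subvariety X ->
  forall a v (q : C), exists (r : R) (k : nat) (f : 'I_k -> C -> C),
    [/\ 0 < r, forall i, hol q r (f i) &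
      forall w, cn (w - q) < r -> (X (a + w *: v) <-> forall i, f i w = 0)].
Proof.
move=> hX a v q; have [U [k [f [Uo Uq fh XU]]]] := hX (a + q *: v).
have [r r0 hr] := (open_nnP U).1 Uo _ Uq.
have v1 : 0 < nn v + 1 by rewrite ltr_wpDl // nn_ge0.
have inU w : cn (w - q) < r / (nn v + 1) -> U (a + w *: v).
  rewrite ltr_pdivlMr // => wq; apply: hr.
  have -> : a + w *: v - (a + q *: v) = (w - q) *: v by rewrite opprD addrACA subrr add0r scalerBl.
  by rewrite nnZ; apply: le_lt_trans wq; apply: ler_wpM2l; rewrite ?cn_ge0 // lerDl.
exists (r / (nn v + 1)), k, (fun i w => f i (a + w *: v)); split; first exact: divr_gt0.
  by move=> i w /inU Uw; eexists; apply: cdiff_slice; exact: fh.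
move=> w /inU Uw; have /seteqP[h1 h2] := XU; split.
  by move=> Xw i; have [_] := h1 _ (conj Xw Uw); exact.
by move=> h; have [] := h2 (a + w *: v) (conj Uw h).
Qed.

(** A set containing a ball contains every line through its centre, by the one-variable identity
    theorem [analytic_line]. *)
Lemma analytic_nowhere_dense (n : nat) (X : set 'rV[C]_n) : analytic_subvariety X -> X <> setT ->
  forall q (r : R), 0 < r -> exists2 z, nn (z - q) < r & ~ X z.
Proof.
move=> hX Xp q r r0; apply: contrapT => h; apply: Xp; apply/seteqP; split=> // z _.
have inX y : nn (y - q) < r -> X y.
  by move=> yr; apply: contrapT => nX; apply: h; exists y.
have v1 : 0 < nn (z - q) + 1 by rewrite ltr_wpDl // nn_ge0.
have := @analytic_line [set w | X (q + w *: (z - q))] (analytic_slice hX q (z - q)) 0 (r / (nn (z - q) + 1)).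
move=> /(_ (divr_gt0 r0 v1)) H; have := H _ 1; rewrite /= scale1r [q + _]addrC subrK; apply.
move=> w; rewrite subr0 ltr_pdivlMr // => wr; apply: inX.
by rewrite addrC addKr nnZ; apply: le_lt_trans wr; apply: ler_wpM2l; rewrite ?cn_ge0 // lerDl.
Qed.

(** Some local equation is nonzero at a point [z] outside [X] near [q]; by the identity theorem it
    does not vanish identically near [q] on the line through [q] and [z]. This line becomes the
    distinguished variable of the preparation theorem. *)
Lemma analytic_regular_slice (n : nat) (X : set 'rV[C]_n) q : analytic_subvariety X -> X <> setT -> X q ->
  exists (r B : R) (f : 'rV[C]_n -> C) v,
  [/\ 0 < r, forall x, nn (x - q) < r -> differentiable f x /\ cn (f x) <= B,
      forall x, nn (x - q) < r -> X x -> f x = 0 &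
      ~ exists2 e : R, 0 < e & forall w, cn w < e -> f (q + w *: v) = 0].
Proof.
move=> hX Xp Xq; have [U [k [f [Uo Uq fh XU]]]] := hX q; have /seteqP[h1 h2] := XU.
have [r r0 hr] := (open_nnP U).1 Uo _ Uq.
have [z zr nXz] := analytic_nowhere_dense hX Xp q r0.
have [i fi] : exists i, f i z <> 0.
  by apply: contrapT => h; apply: nXz; have [] := h2 z; rewrite //=; split;
    [exact: hr|move=> i; apply: contrapT => fi; apply: h; exists i].
have [r1 r10 hr1] := diff_eps (fh i q Uq) ltr01.
pose L := \sum_(j < n) nn ('d (f i) q (delta_mx 0 j)).
pose r' := Num.min r r1.
have r'0 : 0 < r' by rewrite lt_min r0.
exists r', (cn (f i q) + (L + 1) * r'), (f i), (z - q); split => //.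
- move=> x; rewrite lt_min => /andP[xr xr1]; split; first by apply: fh; exact: hr.
  have := hr1 (x - q) xr1; rewrite [q + _]addrC subrK !nn_cn mul1r => h3.
  have := linear_row_bound ('d (f i) q) (x - q); rewrite -/L nn_cn => h4.
  have L0 : 0 <= L by apply: sumr_ge0 => j _; exact: nn_ge0.
  have xr' : nn (x - q) <= r' by rewrite le_min (ltW xr) (ltW xr1).
  have : (L + 1) * nn (x - q) <= (L + 1) * r' by apply: ler_wpM2l => //; clear -L0; lra.
  rewrite mulrDl mul1r => h5.
  have := cn_dist (f i x) (f i q); have := cn_dist (f i x - f i q) ('d (f i) q (x - q)); clear -h5 h4 h3; lra.
- by move=> x; rewrite lt_min => /andP[/hr Ux _] Xx; have [] := h1 x (conj Xx Ux).
move=> [e e0 he]; apply: fi.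
have zq : nn (z - q) != 0.
  by apply/eqP => /nn_inj zq; apply: nXz; move/subr0_eq: zq => ->.
have zp : 0 < nn (z - q) by rewrite lt_def zq nn_ge0.
pose s := r / nn (z - q).
have s1 : 1 < s by rewrite ltr_pdivlMr // mul1r.
have hs : hol 0 s (fun w => f i (q + w *: (z - q))).
  apply: (@slice_hol n (f i) q (z - q) 0 r s) => //; first by move=> x /hr; exact: fh.
  by rewrite cn0 mul0r add0r /s divfK.
have := @analytic_segment [set w | f i (q + w *: (z - q)) = 0] 0 1 e.
rewrite /= scale1r [q + _]addrC subrK; apply => //; last by move=> w; rewrite subr0; exact: he.
move=> t t0 t1; exists (s - 1), 1%N, (fun _ w => f i (q + w *: (z - q))); split.
- by rewrite subr_gt0.
- move=> _; apply: hol_sub hs _; rewrite subr0 add0r subr0 mulr1 cn_real ger0_norm //; lra.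
- by move=> w _; split => [h j //|]; apply; exact: ord0.
Qed.

Definition emb (d : nat) (k0 : 'I_d.+1) (t : 'rV[C]_d) : 'rV[C]_d.+1 :=
  \row_i (if unlift k0 i is Some j then t 0 j else 0).

Lemma emb_add d (k0 : 'I_d.+1) t t' : emb k0 (t + t') = emb k0 t + emb k0 t'.
Proof. by apply/rowP => i; rewrite !mxE; case: unliftP => [j|] _; rewrite ?mxE ?addr0. Qed.

Lemma emb_scale d (k0 : 'I_d.+1) (a : C) t : emb k0 (a *: t) = a *: emb k0 t.
Proof. by apply/rowP => i; rewrite !mxE; case: unliftP => [j|] _; rewrite ?mxE ?mulr0. Qed.

Lemma nn_emb d (k0 : 'I_d.+1) t : nn (emb k0 t) <= nn t.
Proof.
apply: nn_le; first exact: nn_ge0.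
by move=> i; rewrite mxE; case: unliftP => [j|] _; rewrite ?cn0 ?nn_ge0 ?nn_coord.
Qed.

Lemma good_chart d (k0 : 'I_d.+1) (F : 'rV[C]_d.+1 -> C) q v (r rho eta : R) :
  (forall x, nn (x - q) < r -> differentiable F x) -> rho + eta * nn v <= r -> 0 < eta ->
  good rho eta (fun t w => F (q + emb k0 t + w *: v)).
Proof.
move=> Fd le eta0; have inr t w : nn t < rho -> cn w < eta -> nn (q + emb k0 t + w *: v - q) < r.
  move=> tr we; rewrite -[q + _ + _]addrA [q + _]addrC addrK; apply: (le_lt_trans (nnD _ _)).
  rewrite nnZ; have := nn_emb k0 t; have : cn w * nn v <= eta * nn v.
    by apply: ler_wpM2r; rewrite ?nn_ge0 // ltW.
  lra.
split=> [t tr w|w we t k tr].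
  by rewrite subr0 => we; eexists; apply: cdiff_slice; apply: Fd; exact: inr.
exists ('d F (q + emb k0 t + w *: v + 0 *: emb k0 (delta_mx 0 k)) (emb k0 (delta_mx 0 k))).
have -> : (fun z => F (q + emb k0 (t + z *: delta_mx 0 k) + w *: v)) =
  (fun z => F (q + emb k0 t + w *: v + z *: emb k0 (delta_mx 0 k))).
  apply/funext => z; congr F; rewrite emb_add emb_scale addrA -!addrA; congr (_ + (_ + _)).
  exact: addrC.
by apply: cdiff_slice; rewrite scale0r addr0; apply: Fd; exact: inr.
Qed.

(* Near q every entire function restricted to X is a polynomial of degree < m
   in W, with coefficients holomorphic in d parameters. *)
Lemma analytic_chart (d : nat) (X : set 'rV[C]_d.+1) q (K : R) : analytic_subvariety X -> X <> setT -> 1 <= K ->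
  exists (m : nat) (rho r A : R) (T : 'rV[C]_d.+1 -> 'rV[C]_d) (W : 'rV[C]_d.+1 -> C),
  [/\ 0 < rho, 0 < r, 0 <= A,
      forall z, nn (z - q) < r -> nn (T z) < rho / K /\ cn (W z) <= 1 &
      forall (F : 'rV[C]_d.+1 -> C) B, (forall x, nn (x - q) < 2 -> differentiable F x) ->
        (forall x, nn (x - q) < 2 -> cn (F x) <= B) ->
        exists c : 'I_m -> 'rV[C]_d -> C,
        [/\ forall j, sephol rho (c j), forall j t, nn t < rho -> cn (c j t) <= A * B &
          forall z, nn (z - q) < r -> X z -> F z = \sum_j c j (T z) * W z ^+ j]].
Proof.
move=> hX Xp K1; have K0 : 0 < K by lra.
have [Xq|nXq] := pselect (X q); last first.
  have [U [k [f [Uo Uq fh XU]]]] := hX q; have /seteqP[h1 h2] := XU.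
  have [i fi] : exists i, f i q <> 0.
    by apply: contrapT => h; apply: nXq; have [] := h2 q; rewrite //=; split => //;
      move=> i; apply: contrapT => fi; apply: h; exists i.
  have [r r0 hr] := (open_nnP U).1 Uo _ Uq.
  have q0 : 0 < cn (f i q) / 2 by rewrite divr_gt0 // cn_gt0; apply/eqP.
  have [r1 r10 hr1] := diff_eps (fh i q Uq) ltr01.
  pose L := \sum_(j < d.+1) nn ('d (f i) q (delta_mx 0 j)).
  have L0 : 0 < L + 1 by rewrite ltr_wpDl // sumr_ge0 // => j _; exact: nn_ge0.
  (* Outside [X] the chart has [m = 0]: the ball is chosen so small that it does not meet [X], and
     the representation holds vacuously. *)
  exists 0%N, 1, (Num.min r (Num.min r1 (cn (f i q) / 2 / (L + 1)))), 0, (fun=> 0), (fun=> 0).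
  split => //; first by rewrite !lt_min r0 r10 divr_gt0.
    by move=> z _; rewrite nn0 cn0; split => //; exact: divr_gt0.
  move=> F B _ _; exists (fun _ _ => 0); split; [by case|by case|].
  move=> z; rewrite !lt_min => /and3P[z1 z2 z3] Xz; exfalso.
  have [_ /(_ i) fz] := h1 z (conj Xz (hr z z1)).
  have := hr1 (z - q) z2; rewrite [q + _]addrC subrK !nn_cn mul1r fz sub0r -opprD cnN => h3.
  have := linear_row_bound ('d (f i) q) (z - q); rewrite -/L nn_cn => h4.
  move: z3; rewrite ltr_pdivlMr // mulrDr mulr1 mulrC => z3.
  have := cn_dist (f i q) (f i q + 'd (f i) q (z - q)); rewrite opprD addrA subrr add0r cnN.
  have := cn_ge0 (f i q); clear -h4 h3 z3; lra.
have [r0 [B0 [f [v [r00 fd fX fnz]]]]] := analytic_regular_slice hX Xp Xq.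
have [k0 vk0] : exists k0, v 0 k0 != 0.
  apply: contrapT => h; apply: fnz; exists 1 => // w _.
  have -> : v = 0 by apply/rowP => i; rewrite mxE; apply: contrapT => vi; apply: h; exists i; apply/eqP.
  by rewrite scaler0 addr0; apply: fX Xq; rewrite subrr nn0.
have v0 : 0 < nn v by apply: lt_le_trans (nn_coord v k0); rewrite cn_gt0.
pose rr := Num.min r0 1.
have rr0 : 0 < rr by rewrite lt_min r00 /=.
pose eta := rr / (2 * (nn v + 1)).
have v1 : 0 < nn v + 1 by lra.
have eta0 : 0 < eta by rewrite divr_gt0 // mulr_gt0.
have etav : eta * (nn v + 1) = rr / 2 by rewrite /eta; field; rewrite gt_eqF.
have etaE : rr / 2 + eta * nn v <= rr by move: etav; rewrite mulrDr mulr1; lra.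
have rr2 : 0 < rr / 2 by rewrite divr_gt0.
have rrr : rr <= r0 by rewrite ge_min lexx.
have rr1 : rr <= 1 by rewrite ge_min lexx orbT.
have fg : good (rr / 2) eta (fun t w => f (q + emb k0 t + w *: v)).
  by apply: (@good_chart d k0 f q v rr) => // x xr; have [] := fd x (lt_le_trans xr rrr).
have inr t w : nn t < rr / 2 -> cn w < eta -> nn (q + emb k0 t + w *: v - q) < rr.
  move=> tr we; rewrite -[q + _ + _]addrA [q + _]addrC addrK; apply: (le_lt_trans (nnD _ _)).
  rewrite nnZ; have := nn_emb k0 t; have : cn w * nn v <= eta * nn v.
    by apply: ler_wpM2r; rewrite ?nn_ge0 // ltW.
  lra.
have fB : bnd (rr / 2) eta B0 (fun t w => f (q + emb k0 t + w *: v)).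
  by move=> t w tr we; have [] := fd (q + emb k0 t + w *: v) (lt_le_trans (inr t w tr we) rrr).
have emb0 : emb k0 0 = 0 by apply/rowP => i; rewrite !mxE; case: unliftP => // j; rewrite mxE.
have [|m [eta1 [eta10 eta1e prep]]] := weierstrass_preparation rr2 eta0 fg fB.
  move=> [e e0 he]; apply: fnz; exists e => // w /he; by rewrite emb0 addr0.
have e8 : 0 < (8 / eta1) ^+ m by rewrite exprn_gt0 // divr_gt0.
pose k := 1 / 2 / (8 / eta1) ^+ m.
have k_gt0 : 0 < k by rewrite divr_gt0.
have kE : k * (8 / eta1) ^+ m <= 1 / 2 by rewrite divfK // gt_eqF.
have [rho [b [rho0 rhor bg bk hb]]] := prep k k_gt0.
(* Linear coordinates adapted to [v]: [W] is the coordinate along [v], and [T] the projection along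
   [v] onto the remaining coordinates. *)
pose W (z : 'rV[C]_d.+1) : C := (z - q) 0 k0 / v 0 k0.
pose T (z : 'rV[C]_d.+1) : 'rV[C]_d := \row_j (z - q - W z *: v) 0 (lift k0 j).
have recon z : q + emb k0 (T z) + W z *: v = z.
  apply/rowP => i; rewrite !mxE; case: unliftP => [j ->|->]; rewrite ?mxE; last first.
    by rewrite addr0 /W !mxE; field.
  by ring.
pose M := 1 + nn v / cn (v 0 k0).
have M0 : 0 < M by rewrite ltr_wpDr // divr_ge0 ?nn_ge0 ?cn_ge0.
have Wb z : cn (W z) * cn (v 0 k0) <= nn (z - q).
  by rewrite -cnM /W divfK //; exact: nn_coord.
have Tb z : nn (T z) <= M * nn (z - q).
  have vp : 0 < cn (v 0 k0) by rewrite cn_gt0.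
  apply: (@le_trans _ _ (nn (z - q - W z *: v))).
    by apply: nn_le => [|j]; [exact: nn_ge0|rewrite mxE; exact: nn_coord].
  apply: (le_trans (nnD _ _)); rewrite nnN nnZ mulrDl mul1r lerD2l.
  rewrite mulrAC [nn v * _]mulrC ler_pdivlMr // mulrAC; apply: ler_wpM2r; [exact: nn_ge0|exact: Wb].
pose r := Num.min (rho / K / M) (Num.min eta1 1 * cn (v 0 k0)).
have e1 : 0 < Num.min eta1 1 by rewrite lt_min eta10 /=.
have vp : 0 < cn (v 0 k0) by rewrite cn_gt0.
have inW z : nn (z - q) < r -> nn (T z) < rho / K /\ cn (W z) < Num.min eta1 1.
  rewrite lt_min => /andP[h1 h2]; split.
    by apply: le_lt_trans (Tb z) _; rewrite mulrC -ltr_pdivlMr.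
  by rewrite -(ltr_pM2r vp); apply: le_lt_trans h2; exact: Wb.
pose A := 2 * (1 + 8 / eta1) ^+ m.
have e80 : 0 <= 8 / eta1 by rewrite divr_ge0 // ltW.
exists m, rho, r, A, T, W; split => //.
- by rewrite lt_min !divr_gt0 ?mulr_gt0 //.
- by rewrite mulr_ge0 // exprn_ge0 // addr_ge0.
- move=> z /inW[h1]; rewrite lt_min => /andP[_ h2]; split => //; exact: ltW.
move=> F B Fd FB.
have in2 t w : nn t < rho -> cn w < eta1 -> nn (q + emb k0 t + w *: v - q) < 2.
  move=> tr we; apply: (@lt_trans _ _ 1); last by lra.
  by apply: lt_le_trans rr1; apply: inr; [exact: lt_le_trans rhor|exact: lt_le_trans eta1e].
have B1 : 0 <= B by apply: le_trans (cn_ge0 _) (FB q _); rewrite subrr nn0.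
have Fg : good rho eta1 (fun t w => F (q + emb k0 t + w *: v)).
  have le2 : rho + eta1 * nn v <= 2.
    have : eta1 * nn v <= eta * nn v by apply: ler_wpM2r; rewrite ?nn_ge0.
    lra.
  exact: (@good_chart d k0 F q v 2).
have FBb : bnd rho eta1 B (fun t w => F (q + emb k0 t + w *: v)).
  by move=> t w tr we; apply: FB; exact: in2.
have [c [Q [c1 c2 c3 c4]]] := weierstrass_division rho0 eta10 bg bk kE Fg FBb.
exists c; split => //.
  move=> j t tr; apply: (le_trans (c2 j t tr)); rewrite /A -mulrA ler_pM2l //.
  apply: ler_wpM2r => //; apply: (@le_trans _ _ ((1 + 8 / eta1) ^+ j)).
    by apply: lerXn2r; rewrite ?nnegrE ?addr_ge0 // lerDr.
  by apply: ler_weXn2l; [rewrite lerDl|exact: ltnW (ltn_ord j)].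
move=> z zr Xz; have [z1] := inW z zr; rewrite lt_min => /andP[z2 z3].
have z1' : nn (T z) < rho by apply: lt_le_trans z1 _; rewrite ler_pdivrMr // ler_peMr // ltW.
rewrite -{1}(recon z) (c4 _ _ z1' z2); suff -> : W z ^+ m - b (T z) (W z) = 0 by rewrite mul0r addr0.
apply/eqP; rewrite subr_eq0 -(hb _ _ z1' z2) recon; apply/eqP; apply: fX Xz.
rewrite -{1}(recon z); apply: lt_le_trans rrr; apply: inr => //.
  exact: lt_le_trans rhor.
exact: lt_le_trans eta1e.
Qed.

End AnalyticSets.

(** * Compactness of polydiscs and induction over compact sets *)

Section Compactness.
Context {R : realType}.
Local Notation C := (R[i]).

Lemma closed_ballC (W : normedModType C) (a : W) (r : R) : closed [set z : W | nn (z - a) <= r].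
Proof.
rewrite -openC; apply/open_nnP => x /= /negP; rewrite -ltNge => rx.
exists (nn (x - a) - r); first by rewrite subr_gt0.
move=> y yx /=; apply/negP; rewrite -ltNge.
have := nn_distD y x a; rewrite [nn (x - y)]nnB; lra.
Qed.

Lemma compact_disc (a : C) (r : R) : compact [set z : C | cn (z - a) <= r].
Proof.
pose f (p : R * R) : C := a + (Complex p.1 p.2).
apply: (@subclosed_compact _ _ (f @` (`[-r, r]%classic `*` `[-r, r]%classic))).
- by have := @closed_ballC C a r.
- apply: continuous_compact; last by apply: compact_setX; exact: segment_compact.
  apply: continuous_subspaceT => -[x y] A /nbhs_nnP[e e0 he].
  have e2 : 0 < e / 2 by lra.
  exists (ball x (e / 2), ball y (e / 2)) => /=; first by split; exact: nbhsx_ballx.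
  move=> [x' y'] [/= hx hy]; apply: he; rewrite nn_cn /f /=.
  rewrite opprD addrACA subrr add0r; apply: le_lt_trans (cn_le _) _ => /=.
  move: hx hy; rewrite /ball /= [ `|x - _|]distrC [ `|y - _|]distrC; lra.
move=> z /= zr; exists (Re (z - a), Im (z - a)) => /=.
  have := cn_Re (z - a); have := cn_Im (z - a); rewrite /= !in_itv /= !ler_norml; lra.
rewrite /f /=; have -> : Complex (Re (z - a)) (Im (z - a)) = z - a by case: (z - a).
by rewrite [a + _]addrC subrK.
Qed.

Lemma compact_polydisc (n : nat) (a : 'rV[C]_n) (r : R) : 0 <= r -> compact [set z : 'rV[C]_n | nn (z - a) <= r].
Proof.
move=> r0; have := @rV_compact C n (fun i => [set z : C | cn (z - a 0 i) <= r]) (fun i => @compact_disc (a 0 i) r).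
congr compact; apply/seteqP; split=> z /= h.
  by apply: nn_le => // i; have := h i; rewrite !mxE.
by move=> i; have := nn_coord (z - a) i; rewrite !mxE => /le_trans; apply.
Qed.

Lemma compact_bounded_closed (n : nat) (A : set 'rV[C]_n) (M : R) : closed A ->
  (forall z, A z -> nn z <= M) -> compact A.
Proof.
move=> Ac AM; apply: (@subclosed_compact _ _ [set z : 'rV[C]_n | nn (z - 0) <= Num.max M 0]) => //.
  by apply: compact_polydisc; rewrite le_max lexx orbT.
by move=> z /AM h /=; rewrite subr0 le_max h.
Qed.

(** If [P K] failed, the sets [A] such that [P] holds for the part of [K] outside [A] would form a
    proper filter containing [K], and [P] would fail in every neighbourhood of its cluster point. *)
Lemma compact_ind (W : normedModType C) (K : set W) (P : set W -> Prop) : compact K ->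
  P set0 -> (forall A B, P A -> P B -> P (A `|` B)) -> (forall A B, A `<=` B -> P B -> P A) ->
  (forall q, K q -> exists2 r : R, 0 < r & P [set z | nn (z - q) < r]) -> P K.
Proof.
move=> Kc P0 PU Ps Pl; apply: contrapT => nPK.
pose F : set_system W := [set A | P (K `\` A)].
have FF : ProperFilter F.
  split; first by rewrite /F /= setD0.
  split=> [|A B FA FB|A B AB]; rewrite /F /=.
  - by rewrite setDT.
  - by rewrite setDIr; exact: PU.
  - by apply: Ps => z [Kz nB]; split=> // /AB.
have FK : F K by rewrite /F /= setDv.
have [q [Kq cq]] := Kc F FF FK.
have [r r0 Pr] := Pl q Kq.
have FA : F (~` [set z | nn (z - q) < r]) by apply: Ps Pr => z [_ /contrapT].
have nq : nbhs q [set z | nn (z - q) < r] by apply/nbhs_nnP; exists r.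
by have [z [h1 h2]] := cq _ _ FA nq; exact: h1.
Qed.

Lemma compact_nn_bounded (W : normedModType C) (K : set W) : compact K -> exists M : R, forall z, K z -> nn z <= M.
Proof.
move=> Kc; apply: (@compact_ind W K (fun A => exists M : R, forall z, A z -> nn z <= M)) => //.
- by exists 0.
- move=> A B [M hM] [N hN]; exists (Num.max M N) => z [/hM|/hN] h; rewrite le_max h ?orbT //.
- by move=> A B AB [M hM]; exists M => z /AB; exact: hM.
- move=> q _; exists 1 => //; exists (nn q + 1) => z /= zq.
  by have := nn_dist z q; lra.
Qed.

Lemma compact_finite_isolated (W : normedModType C) (K : set W) : compact K ->
  (forall q, exists2 r : R, 0 < r & forall z, K z -> nn (z - q) < r -> z = q) -> finite_set K.
Proof.
move=> Kc h; suff : finite_set (K `&` K) by rewrite setIid.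
apply: (@compact_ind W K (fun A => finite_set (K `&` A))) => //.
- by rewrite setI0.
- by move=> A B hA hB; rewrite setIUr finite_setU.
- by move=> A B AB; apply: sub_finite_set; exact: setIS.
move=> q Kq; have [r r0 hr] := h q; exists r => //.
by apply: (@sub_finite_set _ _ [set q]) => // z [Kz zr]; rewrite /= (hr z).
Qed.

End Compactness.

(** * Elimination of a variable by companion matrices *)

Section Projection.
Context {R : realType}.
Local Notation C := (R[i]).

Section Sb.
Variable d : nat.
Implicit Types (r q : 'rV[C]_d -> C) (rho : R).

Definition sb rho r := sephol rho r /\ exists B : R, forall t, nn t < rho -> cn (r t) <= B.

Lemma sb_cst rho c : sb rho (fun=> c).
Proof. by split; [exact: sephol_cst|exists (cn c)]. Qed.

Lemma sbD rho r q : sb rho r -> sb rho q -> sb rho (fun t => r t + q t).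
Proof.
move=> [h1 [B hB]] [h2 [B' hB']]; split; first exact: sepholD.
by exists (B + B') => t tr; apply: (le_trans (cnD _ _)); apply: lerD; [exact: hB|exact: hB'].
Qed.

Lemma sbM rho r q : sb rho r -> sb rho q -> sb rho (fun t => r t * q t).
Proof.
move=> [h1 [B hB]] [h2 [B' hB']]; split; first exact: sepholM.
by exists (B * B') => t tr; rewrite cnM; apply: ler_pM; rewrite ?cn_ge0 //; [exact: hB|exact: hB'].
Qed.

Lemma sb_ext rho r q : sb rho r -> r =1 q -> sb rho q.
Proof. by move=> h /funext <-. Qed.

Lemma sb_sum rho (I : Type) (l : seq I) (P : pred I) (F : I -> 'rV[C]_d -> C) :
  (forall i, P i -> sb rho (F i)) -> sb rho (fun t => \sum_(i <- l | P i) F i t).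
Proof.
move=> hF; elim: l => [|i l IH].
  by apply: sb_ext (sb_cst rho 0) _ => t; rewrite big_nil.
case Pi: (P i); last by apply: sb_ext IH _ => t; rewrite big_cons Pi.
by apply: sb_ext (sbD (hF i Pi) IH) _ => t; rewrite big_cons Pi.
Qed.

Lemma sb_prod rho (I : Type) (l : seq I) (P : pred I) (F : I -> 'rV[C]_d -> C) :
  (forall i, P i -> sb rho (F i)) -> sb rho (fun t => \prod_(i <- l | P i) F i t).
Proof.
move=> hF; elim: l => [|i l IH].
  by apply: sb_ext (sb_cst rho 1) _ => t; rewrite big_nil.
case Pi: (P i); last by apply: sb_ext IH _ => t; rewrite big_cons Pi.
by apply: sb_ext (sbM (hF i Pi) IH) _ => t; rewrite big_cons Pi.
Qed.

Lemma sb_sub rho rho' r : rho' <= rho -> sb rho r -> sb rho' r.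
Proof.
move=> h [h1 [B hB]]; split; first exact: sephol_sub h h1.
by exists B => t tr; apply: hB; exact: lt_le_trans h.
Qed.

Lemma sb_det rho m (M : 'rV[C]_d -> 'M[C]_m) : (forall i j, sb rho (fun t => M t i j)) ->
  sb rho (fun t => \det (M t)).
Proof.
move=> h; apply: sb_sum => s _; apply: sbM; first exact: sb_cst.
by apply: sb_prod => i _; exact: h.
Qed.

Lemma sb_mulmx rho m n p (M : 'rV[C]_d -> 'M[C]_(m, n)) (N : 'rV[C]_d -> 'M[C]_(n, p)) :
  (forall i j, sb rho (fun t => M t i j)) -> (forall i j, sb rho (fun t => N t i j)) ->
  forall i j, sb rho (fun t => (M t *m N t) i j).
Proof.
move=> h1 h2 i j; apply: (@sb_ext _ (fun t => \sum_k M t i k * N t k j)) => [|t]; last by rewrite mxE.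
by apply: sb_sum => k _; exact: sbM.
Qed.

End Sb.

Section Companion.
Variable m : nat.
Implicit Types a : 'I_m.+1 -> C.

Definition companion_pol a : {poly C} := 'X^(m.+1) - \sum_j a j *: 'X^j.

Definition companion_matrix a : 'M[C]_m.+1 :=
  \matrix_(i, j) (if (i < m)%N then (j == i.+1 :> nat)%:R else a j).

Lemma companion_polE a w : (companion_pol a).[w] = w ^+ m.+1 - \sum_j a j * w ^+ j.
Proof.
rewrite /companion_pol hornerD hornerN hornerXn horner_sum; congr (_ - _).
by apply: eq_bigr => j _; rewrite hornerZ hornerXn.
Qed.

Lemma companion_pol_size a : size (companion_pol a) = m.+2.
Proof.
rewrite /companion_pol size_polyDl size_polyXn // size_polyN ltnS.
apply: (leq_trans (size_sum _ _ _)); apply/bigmax_leqP => j _.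
by apply: (leq_trans (size_scale_leq _ _)); rewrite size_polyXn.
Qed.

Lemma comp_eigen a w : (companion_pol a).[w] = 0 ->
  companion_matrix a *m (\col_i w ^+ i) = w *: (\col_i w ^+ i).
Proof.
rewrite companion_polE => /subr0_eq wm; apply/colP => i; rewrite !mxE.
case: (ltnP i m) => im.
  have i1 : (i.+1 < m.+1)%N by [].
  rewrite (bigD1 (Ordinal i1)) //= !mxE im eqxx mul1r big1 ?addr0 ?exprS // => j jn.
  rewrite !mxE im; case: eqP => [e|]; last by rewrite mul0r.
  by case/eqP: jn; exact: val_inj.
have -> : i = m :> nat by apply/eqP; rewrite eqn_leq im -ltnS ltn_ord.
rewrite -exprS wm; apply: eq_bigr => j _; rewrite !mxE.
by rewrite ltnNge im.
Qed.

(** The Cayley-Hamilton theorem for this matrix. Its powers carry the first basis vector to all the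
    others and commute with the left-hand side, so it suffices to evaluate on the first one. *)
Lemma comp_CH a : horner_mx (companion_matrix a) (companion_pol a) = 0.
Proof.
have e0X i (im : (i < m.+1)%N) : delta_mx 0 ord0 *m companion_matrix a ^+ i = delta_mx 0 (Ordinal im) :> 'rV_m.+1.
  elim: i im => [|i IH] im.
    by rewrite expr0 mulmx1; congr delta_mx; exact: val_inj.
  rewrite exprSr -mulmxE mulmxA IH //; first exact: ltnW.
  move=> im'; rewrite -rowE; apply/rowP => j; rewrite !mxE /= -ltnS im; congr (_ %:R).
have h0 : delta_mx 0 ord0 *m horner_mx (companion_matrix a) (companion_pol a) = 0 :> 'rV_m.+1.
  rewrite /companion_pol rmorphB /= rmorphXn /= horner_mx_X mulmxBr exprSr -mulmxE mulmxA.
  rewrite (e0X m (ltnSn m)) -rowE rmorph_sum mulmx_sumr; apply/eqP; rewrite subr_eq0; apply/eqP.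
  apply/rowP => j; rewrite !mxE /= ltnn summxE (bigD1 j) //= big1 ?addr0 => [|k kj].
    rewrite linearZ /= rmorphXn /= horner_mx_X -scalemxAr mxE (e0X j (ltn_ord j)) mxE eqxx /=.
    by rewrite (_ : j == _) ?mulr1 //; apply/eqP; exact: val_inj.
  rewrite linearZ /= rmorphXn /= horner_mx_X -scalemxAr mxE (e0X k (ltn_ord k)) mxE eqxx /=.
  by case: eqP => [e|]; rewrite ?mulr0 //; case/eqP: kj; rewrite e; exact: val_inj.
apply/row_matrixP => i; rewrite rowE row0.
have -> : i = Ordinal (ltn_ord i) by exact: val_inj.
rewrite -(e0X i (ltn_ord i)) -mulmxA.
have -> : companion_matrix a ^+ i *m horner_mx (companion_matrix a) (companion_pol a) =
  horner_mx (companion_matrix a) (companion_pol a) *m companion_matrix a ^+ i.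
  rewrite -[companion_matrix a ^+ i](_ : horner_mx (companion_matrix a) 'X^i = _); last by rewrite rmorphXn /= horner_mx_X.
  by rewrite !mulmxE -!rmorphM /= mulrC.
by rewrite mulmxA h0 mul0mx.
Qed.

(** The determinant plays the role of a resultant, and its entries are polynomial in the
    coefficients. Coprime polynomials give an invertible matrix by Bezout; a common root gives an
    eigenvector in its kernel. *)
Lemma comp_root a (q : {poly C}) :
  (\det (horner_mx (companion_matrix a) q) == 0) <-> exists2 w, (companion_pol a).[w] = 0 & q.[w] = 0.
Proof.
have p0 : companion_pol a != 0 by rewrite -size_poly_eq0 companion_pol_size.
split=> [/eqP d0|[w pw qw]].
  have [g1|g1] := eqVneq (size (gcdp (companion_pol a) q)) 1%N.
    have /Bezout_eq1_coprimepP[[u v] /= uv] : coprimep (companion_pol a) q by rewrite /coprimep g1.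
    have := congr1 (horner_mx (companion_matrix a)) uv; rewrite rmorphD !rmorphM /= comp_CH mulr0 add0r rmorph1.
    move=> /(congr1 determinant); rewrite det_mulmx d0 mulr0 det1 => /eqP.
    by rewrite eq_sym oner_eq0.
  have /closed_rootP[w] := g1; rewrite root_gcd => /andP[/rootP h1 /rootP h2].
  by exists w.
pose v : 'cV[C]_m.+1 := \col_i w ^+ i.
have v0 : v != 0.
  by apply/eqP => /colP/(_ ord0); rewrite !mxE expr0 => /eqP; rewrite oner_eq0.
have hv (p : {poly C}) : horner_mx (companion_matrix a) p *m v = p.[w] *: v.
  elim/poly_ind: p => [|p c IH]; first by rewrite rmorph0 mul0mx horner0 scale0r.
  rewrite rmorphD rmorphM /= horner_mx_X horner_mx_C hornerD hornerM hornerX hornerC.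
  rewrite mulmxDl -mulmxE -mulmxA comp_eigen // -scalemxAr IH mul_scalar_mx scalerDl scalerA.
  by rewrite [w * _]mulrC.
apply: contraT => dn; have : horner_mx (companion_matrix a) q \in unitmx by rewrite unitmxE unitfE.
move=> /mulKmx /(_ v); rewrite hv qw scale0r mulmx0 => v00.
by rewrite -v00 eqxx in v0.
Qed.

(* The roots of the companion polynomial being finitely many, one integer
   combination of the r i detects all of them simultaneously. *)
Lemma common_root (k : nat) a (r : 'I_k -> {poly C}) :
  (exists2 w, (companion_pol a).[w] = 0 & forall i, (r i).[w] = 0) <->
  (forall s : 'I_(m.+1 * k).+1, exists2 w, (companion_pol a).[w] = 0 &
     (\sum_(i < k) (s%:R ^+ i) *: r i).[w] = 0).
Proof.
split=> [[w pw h] s|h].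
  by exists w => //; rewrite horner_sum big1 // => i _; rewrite hornerZ h mulr0.
apply: contrapT => nh.
have [rs prs] := closed_field_poly_normal (companion_pol a).
have srs : size rs = m.+1.
  have := companion_pol_size a; rewrite prs size_scale; first by rewrite size_prod_XsubC => -[].
  by rewrite lead_coef_eq0 -size_poly_eq0 companion_pol_size.
pose Q w : {poly C} := \sum_i (r i).[w] *: 'X^i.
have Qs w : (size (Q w) <= k)%N.
  apply: (leq_trans (size_sum _ _ _)); apply/bigmax_leqP => j _.
  by apply: (leq_trans (size_scale_leq _ _)); rewrite size_polyXn.
have QE w (s : nat) : (Q w).[s%:R] = (\sum_(i < k) (s%:R ^+ i) *: r i).[w].
  rewrite /Q !horner_sum; apply: eq_bigr => i _; by rewrite !hornerZ hornerXn mulrC.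
have Qn0 w : w \in rs -> Q w != 0.
  move=> wr; apply/eqP => Q0; apply: nh; exists w.
    apply/rootP; rewrite prs rootZ ?root_prod_XsubC //.
    by rewrite lead_coef_eq0 -size_poly_eq0 companion_pol_size.
  move=> i; have := congr1 (fun p : {poly C} => p`_i) Q0; rewrite coef0 /Q coef_sum.
  rewrite (bigD1 i) //= big1 ?addr0; last first.
    by move=> j ji; rewrite coefZ coefXn; case: eqP => [e|]; rewrite ?mulr0 //; case/eqP: ji; exact: val_inj.
  by rewrite coefZ coefXn eqxx mulr1.
have Pn0 : \prod_(w <- rs) Q w != 0.
  by rewrite prodf_seq_neq0; apply/allP => w wr; rewrite Qn0.
have Ps (l : seq C) : (size (\prod_(w <- l) Q w)%R <= (size l * k).+1)%N.
  elim: l => [|w l IH]; first by rewrite big_nil size_poly1.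
  rewrite big_cons; apply: (leq_trans (size_polyMleq _ _)).
  by have := Qs w; move: IH => /=; rewrite mulSn; lia.
pose l : seq C := [seq (nat_of_ord s)%:R | s <- enum 'I_(m.+1 * k).+1].
have ul : uniq l.
  rewrite map_inj_uniq ?enum_uniq // => s s' /eqP; rewrite eqr_nat => /eqP; exact: val_inj.
have rl : all (root (\prod_(w <- rs) Q w)) l.
  apply/allP => _ /mapP[s _ ->]; have [w pw hw] := h s.
  have wr : w \in rs.
    move/rootP: pw; rewrite prs rootZ ?root_prod_XsubC //.
    by rewrite lead_coef_eq0 -size_poly_eq0 companion_pol_size.
  by rewrite /root (big_rem w) //= hornerM QE hw mul0r.
(* Every [s] is a root of the product of the [Q w], whose degree is at most [m.+1 * k], one less
   than the number of values of [s]. *)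
have := max_poly_roots Pn0 rl ul; rewrite size_map -cardE card_ord ltnNge.
by have := Ps rs; rewrite srs => ->.
Qed.

End Companion.

End Projection.

(** * Bounded analytic sets are finite *)

Section Finiteness.
Context {R : realType}.
Local Notation C := (R[i]).

(** Bounded separately holomorphic equations: the form in which [local_projection] produces
    equations of a projection, so that an induction on the dimension is possible. *)
Definition weakly_analytic d (X : set 'rV[C]_d) := forall p, exists (r : R) (I : finType) (f : I -> 'rV[C]_d -> C),
  [/\ 0 < r, forall i, sb r (f i) & forall t, nn t < r -> (X (p + t) <-> forall i, f i t = 0)].

Definition pt d (t : 'rV[C]_d) (w : C) : 'rV[C]_d.+1 := emb ord0 t + w *: delta_mx 0 ord0.

Lemma ptD d (t t' : 'rV[C]_d) w w' : pt t w + pt t' w' = pt (t + t') (w + w').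
Proof. by rewrite /pt addrACA -emb_add scalerDl. Qed.

Lemma nn_pt d (t : 'rV[C]_d) w : nn (pt t w) <= nn t + cn w.
Proof. by apply: (le_trans (nnD _ _)); rewrite nn_delta lerD2r; exact: nn_emb. Qed.

Lemma emb_delta d (k0 : 'I_d.+1) j : emb k0 (delta_mx 0 j : 'rV[C]_d) = delta_mx 0 (lift k0 j).
Proof.
apply/rowP => i; rewrite !mxE eqxx /=; case: unliftP => [k ->|->].
  by rewrite mxE eqxx /= (inj_eq (@lift_inj _ _)).
by rewrite (negbTE (neq_lift _ _)).
Qed.

Lemma pt_surj d (z : 'rV[C]_d.+1) : z = pt (\row_j z 0 (lift ord0 j)) (z 0 ord0).
Proof.
apply/rowP => i; rewrite !mxE eqxx /=; case: unliftP => [k ->|->].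
  by rewrite mxE eq_sym (negbTE (neq_lift _ _)) mulr0 addr0.
by rewrite eqxx mulr1 add0r.
Qed.

Lemma pt_fst d (t : 'rV[C]_d) w : \row_j (pt t w) 0 (lift ord0 j) = t.
Proof.
apply/rowP => j; by rewrite !mxE liftK eqxx /= mulr0 addr0.
Qed.

Lemma good_pt d (f : 'rV[C]_d.+1 -> C) (r : R) : sephol r f ->
  good (r / 2) (r / 2) (fun t w => f (pt t w)).
Proof.
move=> fs; have inr t w : nn t < r / 2 -> cn w < r / 2 -> nn (pt t w : 'rV[C]_d.+1) < r.
  by have := nn_pt t w; lra.
split=> [t tr w|w we t k tr].
  by rewrite subr0 => we; apply: (sephol_cdiff fs); exact: inr.
have [c hc] := fs (pt t w) (lift ord0 k) (inr t w tr we); exists c.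
apply: (@cdiff_ext _ _ _ _ _ 1) hc => // z _; congr f.
by rewrite /pt emb_add emb_scale emb_delta addrAC.
Qed.

Lemma lt_half_mul (m : nat) (y : R) : 0 < y -> ~ y <= m.+1%:R / (2 * m.+2%:R) * y.
Proof.
move=> y0; have m0 : 0 < 2 * m.+2%:R :> R by rewrite mulr_gt0 // ltr0n.
rewrite ler_pMl // ler_pdivlMr // mul1r -natrM ler_nat; lia.
Qed.

(** A local case of the proper mapping theorem. One equation is prepared in [w], the others are
    replaced by their remainders, and the existence of a common root is expressed by determinants
    depending holomorphically on [t]. *)
Lemma local_projection d (X : set 'rV[C]_d.+1) t0 w0 : weakly_analytic X ->
  ~ (exists2 e : R, 0 < e & forall w, cn w < e -> X (pt t0 (w0 + w))) ->
  exists (eta rho : R) (I : finType) (h : I -> 'rV[C]_d -> C),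
  [/\ 0 < eta, 0 < rho, forall i, sb rho (h i) &
    forall t, nn t < rho -> ((exists2 w, cn w < eta & X (pt (t0 + t) (w0 + w))) <-> forall i, h i t = 0)].
Proof.
move=> hX nX; have [r [I [f [r0 fsb Xf]]]] := hX (pt t0 w0).
have XE t w : nn t < r / 2 -> cn w < r / 2 -> (X (pt (t0 + t) (w0 + w)) <-> forall i, f i (pt t w) = 0).
  by move=> tr wr; rewrite -ptD; apply: Xf; have := nn_pt t w; lra.
have r20 : 0 < r / 2 by lra.
have n0 : nn (0 : 'rV[C]_d) < r / 2 by rewrite nn0.
have fg i : good (r / 2) (r / 2) (fun t w => f i (pt t w)) by apply: good_pt; have [] := fsb i.
have [i0 fi0] : exists i0, ~ exists2 e : R, 0 < e & forall w, cn w < e -> f i0 (pt 0 w) = 0.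
  apply: contrapT => /forallNP h.
  have [i|i s s' ss hs w ws|e e0 he] := @fin_radius R I (fun i e => forall w, cn w < e -> f i (pt 0 w) = 0).
  - by have /contrapT := h i.
  - by apply: hs; exact: lt_le_trans ss.
  apply: nX; exists (Num.min e (r / 2)); first by rewrite lt_min e0.
  move=> w; rewrite lt_min => /andP[we wr].
  by rewrite -[t0]addr0; apply/XE => // i; exact: he.
have fB i : exists B, bnd (r / 2) (r / 2) B (fun t w => f i (pt t w)).
  have [_ [B hB]] := fsb i; exists B => t w tr wr; apply: hB.
  by have := nn_pt t w; lra.
have [B0 fB0] := fB i0.
have [m [eta [eta0 etar prep]]] := weierstrass_preparation r20 r20 (fg i0) fB0 fi0.
have m1 : 0 < (m.+1)%:R :> R by rewrite ltr0n.
(* So small that all roots of the polynomial obtained below lie in the disc of radius [eta], and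
   that [Qb] stays below 1 in modulus. *)
pose k := eta ^+ m / (4 * m.+1%:R * 8 ^+ m).
have k0 : 0 < k by rewrite divr_gt0 ?exprn_gt0 // !mulr_gt0 // exprn_gt0.
have kE : k * (8 / eta) ^+ m = 1 / (4 * m.+1%:R).
  by rewrite /k expr_div_n; field; rewrite !expf_neq0 ?gt_eqF //.
have kE4 : k * (8 / eta) ^+ m <= 1 / 4.
  rewrite kE !div1r lef_pV2 ?posrE ?mulr_gt0 // ler_peMr // ler1n //.
have [rho [b [rho0 rhor bg bk hb]]] := prep k k0.
(* For [m = 0] a point over [t] would force [b = 1], against its bound; the projection is empty and
   has the equation 1 = 0. *)
case: m m1 k k0 kE kE4 bk hb {prep} => [|m] m1 k k0 kE kE4 bk hb.
  exists eta, rho, unit, (fun _ _ => 1); split=> // [i|t tr]; first exact: sb_cst.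
  split=> [[w we]|/(_ tt) /eqP]; last by rewrite oner_eq0.
  move=> /XE => /(_ (lt_le_trans tr rhor) (lt_le_trans we etar)) /(_ i0) /eqP.
  rewrite (hb t w tr we) expr0 => /eqP b1; exfalso.
  by have := bk t w tr we; rewrite -b1 cn1; move: kE4; rewrite expr0 mulr1; lra.
have kE2 : k * (8 / eta) ^+ m.+1 <= 1 / 2 by lra.
(* Dividing [b] itself by [w ^+ m.+1 - b] yields a true polynomial: [w ^+ m.+1] minus the remainder
   is the unit [1 + Qb] times [w ^+ m.+1 - b]. *)
have [a [Qb [a1 a2 a3 a4]]] := weierstrass_division rho0 eta0 bg bk kE2 bg bk.
pose f' (j : 'I_#|I|) t w := f (enum_val j) (pt t w).
have divf (j : 'I_#|I|) : exists c : 'I_m.+1 -> 'rV[C]_d -> C, (forall l, sb rho (c l)) /\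
    exists Q, forall t w, nn t < rho -> cn w < eta ->
      f' j t w = \sum_l c l t * w ^+ l + (w ^+ m.+1 - b t w) * Q t w.
  have [B hB] := fB (enum_val j).
  have [c [Q [c1 c2 _ c4]]] := weierstrass_division rho0 eta0 bg bk kE2
    (good_sub rhor etar (fg (enum_val j))) (bnd_sub rhor etar hB).
  exists c; split; last by exists Q.
  by move=> l; split => //; exists (2 * ((8 / eta) ^+ l * B)); exact: c2.
have [c hc] := choice divf.
pose rp t (j : 'I_#|I|) : {poly C} := \sum_(l < m.+1) c j l t *: 'X^l.
have rpE t j w : (rp t j).[w] = \sum_l c j l t * w ^+ l.
  by rewrite /rp horner_sum; apply: eq_bigr => l _; rewrite hornerZ hornerXn.
pose q t (s : 'I_(m.+1 * #|I|).+1) : {poly C} := \sum_(i < #|I|) (s%:R ^+ i) *: rp t i.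
pose cm t := companion_matrix (fun j => a j t).
have sba j : sb rho (a j) by split => //; exists (2 * ((8 / eta) ^+ j * k)); exact: a2.
have sbc i j : sb rho (fun t => cm t i j).
  rewrite /cm; case im: (i < m)%N.
    apply: (@sb_ext _ _ rho (fun=> ((j == i.+1 :> nat)%:R : C))); first exact: sb_cst.
    by move=> t; rewrite mxE im.
  by apply: (@sb_ext _ _ rho (a j)) => // t; rewrite mxE im.
have sbX l : forall i j, sb rho (fun t => (cm t ^+ l) i j).
  elim: l => [|l IH] i j.
    apply: (@sb_ext _ _ rho (fun=> (1 : 'M[C]_m.+1) i j)); first exact: sb_cst.
    by move=> t; rewrite expr0.
  apply: (@sb_ext _ _ rho (fun t => (cm t *m cm t ^+ l) i j)); first exact: sb_mulmx.
  by move=> t; rewrite exprS mulmxE.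
have sbq s i j : sb rho (fun t => horner_mx (cm t) (q t s) i j).
  apply: (@sb_ext _ _ _ (fun t => \sum_(u < #|I|) s%:R ^+ u * \sum_(l < m.+1) c u l t * (cm t ^+ l) i j)).
    apply: sb_sum => u _; apply: sbM; first exact: sb_cst.
    apply: sb_sum => l _; apply: sbM; last exact: sbX.
    by have [h _] := hc u; exact: h.
  move=> t; rewrite /q rmorph_sum summxE; apply: eq_bigr => u _.
  rewrite /= horner_mxZ mxE; congr (_ * _); rewrite /rp rmorph_sum summxE; apply: eq_bigr => l _.
  by rewrite /= horner_mxZ mxE rmorphXn /= horner_mx_X.
exists eta, rho, 'I_(m.+1 * #|I|).+1, (fun s t => \det (horner_mx (cm t) (q t s))); split => //.
  by move=> s; apply: sb_det; exact: sbq.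
move=> t tr.
have fact w : cn w < eta -> w ^+ m.+1 - \sum_j a j t * w ^+ j = (w ^+ m.+1 - b t w) * (1 + Qb t w).
  by move=> we; have := a4 t w tr we; set u := \sum_j _; set v := b t w; set v' := Qb t w;
    move=> e; rewrite mulrDr mulr1 {1}e; ring.
have div0 w : cn w < eta -> w ^+ m.+1 = b t w -> forall j, f' j t w = (rp t j).[w].
  move=> we wb j; have [_ [Q hQ]] := hc j.
  by rewrite (hQ t w tr we) wb subrr mul0r addr0 rpE.
have trr := lt_le_trans tr rhor.
transitivity (exists2 w, (companion_pol (fun j => a j t)).[w] = 0 & forall i, (rp t i).[w] = 0).
  split=> [[w we]|[w wp wr]].
    have wr := lt_le_trans we etar.
    move=> /XE => /(_ trr wr) fz.
    have wb : w ^+ m.+1 = b t w by apply/eqP; rewrite -(hb t w tr we) fz.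
    exists w; first by rewrite companion_polE fact // wb subrr mul0r.
    by move=> i; rewrite -div0 // /f' fz.
  (* At a root of modulus at least [eta], the leading term would exceed the sum of the other
     terms. *)
  have we : cn w < eta.
    rewrite ltNge; apply/negP => ew; pose x := cn w / eta.
    have x1 : 1 <= x by rewrite ler_pdivlMr // mul1r.
    have wx : cn w = x * eta by rewrite /x divfK // gt_eqF.
    clearbody x.
    move: wp; rewrite companion_polE => /subr0_eq /(congr1 (@cn R)); rewrite cnX => wm.
    have := cn_sum (index_enum 'I_m.+1) xpredT (fun j => a j t * w ^+ j); rewrite -wm wx.
    have le (j : 'I_m.+1) : cn (a j t * w ^+ j) <= 2 * 8 ^+ m.+1 * k * x ^+ m.+1.
      rewrite cnM cnX wx.
      apply: (@le_trans _ _ (2 * ((8 / eta) ^+ j * k) * (x * eta) ^+ j)).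
        by apply: ler_wpM2r; [rewrite exprn_ge0 // mulr_ge0 ?ltW // (lt_le_trans _ x1)|exact: a2].
      have -> : 2 * ((8 / eta) ^+ j * k) * (x * eta) ^+ j = 2 * k * (8 ^+ j * x ^+ j).
        by rewrite [(x * eta) ^+ _]exprMn expr_div_n; field; rewrite expf_neq0 // gt_eqF.
      have -> : 2 * 8 ^+ m.+1 * k * x ^+ m.+1 = 2 * k * (8 ^+ m.+1 * x ^+ m.+1) by ring.
      apply: ler_wpM2l; first by rewrite mulr_ge0 // ltW.
      have x0 : 0 <= x by lra.
      by apply: ler_pM; rewrite ?exprn_ge0 // ler_weXn2l ?ler1n // ltnW.
    move=> h; have := le_trans h (ler_sum _ (fun j _ => le j)).
    rewrite sumr_const card_ord -[X in _ <= X]mulr_natl.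
    have -> : m.+1%:R * (2 * 8 ^+ m.+1 * k * x ^+ m.+1) = (m.+1%:R / (2 * m.+2%:R)) * (x * eta) ^+ m.+1.
      rewrite exprMn; have -> : k = 1 / (4 * m.+2%:R) / (8 / eta) ^+ m.+1.
        by rewrite -kE mulfK // gt_eqF // exprn_gt0 // divr_gt0.
      by rewrite expr_div_n; field; rewrite !expf_neq0 ?gt_eqF //.
    have p0 : 0 < (x * eta) ^+ m.+1 by rewrite exprn_gt0 // mulr_gt0 //; lra.
    exact: lt_half_mul p0.
  have wb : w ^+ m.+1 = b t w.
    move: wp; rewrite companion_polE fact // => /eqP; rewrite mulf_eq0 => /orP[|].
      by rewrite subr_eq0 => /eqP.
    move=> /eqP e; have := a3 t w tr we; have -> : Qb t w = - 1.
      by apply/eqP; rewrite -subr_eq0 opprK addrC e.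
    rewrite cnN cn1; have -> : 2 * ((8 / eta) ^+ m.+1 * k) = 2 * (k * (8 / eta) ^+ m.+1) by ring.
    by move=> h; exfalso; lra.
  exists w => //; apply/XE => //; first exact: lt_le_trans etar.
  move=> i; have := div0 w we wb (enum_rank i); rewrite /f' enum_rankK => ->; exact: wr.
split.
  by move/common_root => h s; apply/eqP/comp_root; exact: h.
by move=> h; apply/common_root => s; apply/comp_root; rewrite h.
Qed.

(** A fibre containing a disc would be a whole line, against boundedness. So some equation does not
    vanish identically on the fibre near [w0], and its zeros are isolated. *)
Lemma fiber_isolated d (X : set 'rV[C]_d.+1) (M : R) t0 w0 : weakly_analytic X -> (forall z, X z -> nn z <= M) ->
  exists2 r : R, 0 < r & forall w, X (pt t0 w) -> cn (w - w0) < r -> w = w0.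
Proof.
move=> hX XM.
have nX q : ~ exists2 e : R, 0 < e & forall w, cn (w - q) < e -> X (pt t0 w).
  move=> [e e0 he]; have H hh := @analytic_line R [set w | X (pt t0 w)] hh q e e0 he (`|M| + 1)%:C; rewrite /= in H.
  have /H /XM : forall q' : C, exists (r : R) (k : nat) (f : 'I_k -> C -> C),
    [/\ 0 < r, forall i, hol q' r (f i) & forall w, cn (w - q') < r -> (X (pt t0 w) <-> forall i, f i w = 0)].
    move=> {he H}; clear q; move=> q; have [r [I [f [r0 fsb Xf]]]] := hX (pt t0 q).
    exists r, #|I|, (fun j w => f (enum_val j) (0 + (w - q) *: delta_mx 0 ord0)); split => //.
      move=> j; have [fs _] := fsb (enum_val j).
      rewrite -{1}[q]addr0; apply: (@hol_shift R q 0 r (fun z => f (enum_val j) (0 + z *: delta_mx 0 ord0))).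
      by apply: (@sephol_hol _ _ r (f (enum_val j)) 0 ord0 r fs); rewrite nn0 add0r.
    move=> w wr; have -> : pt t0 w = pt t0 q + (0 + (w - q) *: delta_mx 0 ord0).
      rewrite add0r /pt -addrA -scalerDl; congr (_ + _ *: _); by rewrite [q + _]addrC subrK.
    rewrite Xf; last by rewrite add0r nn_delta.
    split=> h i //; have := h (enum_rank i); by rewrite enum_rankK.
  have := nn_coord (pt t0 (`|M| + 1)%:C) ord0; rewrite !mxE unlift_none add0r !eqxx mulr1 cn_real.
  by rewrite ger0_norm ?addr_ge0 // ; have := ler_norm M; lra.
have [r [I [f [r0 fsb Xf]]]] := hX (pt t0 w0).
pose g i w := f i (0 + (w - w0) *: delta_mx 0 ord0).
have gh i : hol w0 r (g i).
  have [fs _] := fsb i.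
  rewrite -[w0]addr0; apply: (@hol_shift R w0 0 r (fun z => f i (0 + z *: delta_mx 0 ord0))).
  by apply: (@sephol_hol _ _ r (f i) 0 ord0 r fs); rewrite nn0 add0r.
have XE w : cn (w - w0) < r -> (X (pt t0 w) <-> forall i, g i w = 0).
  move=> wr; have -> : pt t0 w = pt t0 w0 + (0 + (w - w0) *: delta_mx 0 ord0).
    rewrite add0r /pt -addrA -scalerDl; congr (_ + _ *: _); by rewrite [w0 + _]addrC subrK.
  by apply: Xf; rewrite add0r nn_delta.
have [i gi] : exists i, ~ exists2 e : R, 0 < e & forall w, cn (w - w0) < e -> g i w = 0.
  apply: contrapT => /forallNP h.
  have [i|i s s' ss hs w ws|e e0 he] := @fin_radius R I (fun i e => forall w, cn (w - w0) < e -> g i w = 0).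
  - by have /contrapT := h i.
  - by apply: hs; exact: lt_le_trans ss.
  apply: (nX w0); exists (Num.min e r); first by rewrite lt_min e0.
  by move=> w; rewrite lt_min => /andP[we wr]; apply/XE => // i; exact: he.
have [[e e0 he]|[e e0 he]] := zero_isolated r0 (gh i); first by exfalso; apply: gi; exists e.
exists (Num.min e r); first by rewrite lt_min e0.
move=> w Xw; rewrite lt_min => /andP[we wr]; apply/eqP; apply: contraT => ww.
by have := he w ww we; have -> := (XE w wr).1 Xw i; rewrite eqxx.
Qed.

(** Induction on the dimension: the projection forgetting the first coordinate is again bounded and
    analytic, hence finite, and so are its fibres. The local projections are patched over the
    compact disc of values of [w]; products of equations describe the union. *)
Lemma weakly_analytic_finite d (X : set 'rV[C]_d) (M : R) : weakly_analytic X ->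
  (forall z, X z -> nn z <= M) -> finite_set X.
Proof.
elim: d X => [|d IH] X hX XM.
  apply: (@sub_finite_set _ _ [set 0]) => // z _ /=; apply/rowP; by case.
pose Y : set 'rV[C]_d := [set t | exists w, X (pt t w)].
have Xw t w : X (pt t w) -> cn w <= M.
  move=> /XM; apply: le_trans; have := nn_coord (pt t w) ord0.
  by rewrite !mxE unlift_none add0r !eqxx mulr1.
have Xt t w : X (pt t w) -> nn t <= M.
  move=> /XM h; apply: nn_le => [|j]; first by apply: le_trans (nn_ge0 _) h.
  apply: le_trans h; have := nn_coord (pt t w) (lift ord0 j); have := pt_fst t w.
  by move=> /rowP/(_ j); rewrite mxE => ->.
have Yfin : finite_set Y.
  apply: IH => [t0|t [w]]; last exact: Xt.
  (* The larger set [A'] makes [P] stable under passing to subsets. It does no harm, since the disc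
     of radius [M] contains the whole fibre. *)
  pose P (A : set C) := exists A' (rho : R) (I : finType) (h : I -> 'rV[C]_d -> C),
    [/\ A `<=` A', 0 < rho, forall i, sb rho (h i) &
      forall t, nn t < rho -> ((exists2 w, A' w & X (pt (t0 + t) w)) <-> forall i, h i t = 0)].
  have [A' [rho [I [h [AA rho0 hsb hE]]]]] : P [set z : C | cn (z - 0) <= M].
    apply: (@compact_ind R C).
    - exact: compact_disc.
    - exists set0, 1, unit, (fun _ _ => 1); split=> // [i|t _]; first exact: sb_cst.
      by split=> [[]//|/(_ tt) /eqP]; rewrite oner_eq0.
    - move=> A B [A' [rho [I [h [AA rho0 hsb hE]]]]] [B' [sig [J [g [BB sig0 gsb gE]]]]].
      exists (A' `|` B'), (Num.min rho sig), (I * J)%type, (fun ij t => h ij.1 t * g ij.2 t); split.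
      + exact: setUSS.
      + by rewrite lt_min rho0.
      + move=> [i j] /=; apply: sbM.
          by apply: sb_sub (hsb i); rewrite ge_min lexx.
        by apply: sb_sub (gsb j); rewrite ge_min lexx orbT.
      move=> t; rewrite lt_min => /andP[t1 t2]; split.
        move=> [w [wA|wB] Xtw] [i j] /=.
          by rewrite ((hE t t1).1 _ i) ?mul0r //; exists w.
        by rewrite ((gE t t2).1 _ j) ?mulr0 //; exists w.
      move=> hg; have [h0|/existsNP[i /eqP hi]] := pselect (forall i, h i t = 0).
        by have [w wA Xtw] := (hE t t1).2 h0; exists w => //; left.
      have [j|w wB Xtw] := (gE t t2).2; last by exists w => //; right.
      by have /eqP := hg (i, j); rewrite /= mulf_eq0 (negbTE hi) /= => /eqP.
    - move=> A B AB [A' [rho [I [h [AA rho0 hsb hE]]]]].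
      by exists A', rho, I, h; split => // z /AB /AA.
    move=> w0 _.
    have nX : ~ exists2 e : R, 0 < e & forall w, cn w < e -> X (pt t0 (w0 + w)).
      move=> [e e0 he]; have [r r0 hr] := @fiber_isolated d X M t0 w0 hX XM.
      pose s := Num.min e r / 2; have m0 : 0 < Num.min e r by rewrite lt_min e0.
      have s0 : 0 < s by rewrite divr_gt0.
      have sn : cn (s%:C) = s by rewrite cn_real gtr0_norm.
      have : cn (s%:C) < Num.min e r by rewrite sn /s; lra.
      rewrite lt_min => /andP[se sr].
      have := hr (w0 + s%:C) (he _ se); rewrite addrAC subrr add0r => /(_ sr) /eqP.
      by rewrite -subr_eq0 addrAC subrr add0r -cn_eq0 sn gt_eqF.
    have [eta [rho [I [h [eta0 rho0 hsb hE]]]]] := local_projection hX nX.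
    exists eta => //; exists [set z : C | nn (z - w0) < eta], rho, I, h; split => // t tr.
    rewrite -(hE t tr); split=> -[w wA Xtw].
      by exists (w - w0) => //; rewrite [w0 + _]addrC subrK.
    by exists (w0 + w) => //=; rewrite [w0 + _]addrC addrK.
  exists rho, I, h; split => // t tr; rewrite -(hE t tr); split=> [[w Xtw]|[w _ Xtw]]; last by exists w.
  by exists w => //; apply: AA; rewrite /= subr0; exact: Xw Xtw.
have -> : X = \bigcup_(t in Y) [set z | X z /\ \row_j z 0 (lift ord0 j) = t].
  apply/seteqP; split=> [z Xz|z [t _ [//]]].
  exists (\row_j z 0 (lift ord0 j)); last by split.
  by exists (z 0 ord0); rewrite -pt_surj.
apply: bigcup_finite => // t _.
have : finite_set [set w | X (pt t w)].
  have : compact [set w : C | cn (w - 0) <= M] by exact: compact_disc.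
  move=> Kc.
  suff : finite_set ([set w | X (pt t w)] `&` [set w : C | cn (w - 0) <= M]).
    by apply: sub_finite_set => w Xtw; split => //=; rewrite subr0; exact: Xw Xtw.
  apply: (@compact_ind R C _ (fun A => finite_set ([set w | X (pt t w)] `&` A)) Kc).
  - by rewrite setI0.
  - by move=> A B hA hB; rewrite setIUr finite_setU.
  - by move=> A B AB; apply: sub_finite_set; exact: setIS.
  move=> q _; have [r r0 hr] := @fiber_isolated d X M t q hX XM; exists r => //.
  by apply: (@sub_finite_set _ _ [set q]) => // z [Xz zr] /=; exact: hr.
move=> /(finite_image (pt t)); apply: sub_finite_set => z [Xz zt].
exists (z 0 ord0); last by rewrite -zt -pt_surj.
by rewrite /= -zt -pt_surj.
Qed.

Lemma analytic_weakly n (X : set 'rV[C]_n) : analytic_subvariety X -> weakly_analytic X.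
Proof.
move=> hX p; have [U [k [f [Uo Up fh XU]]]] := hX p; have /seteqP[h1 h2] := XU.
have [r r0 hr] := (open_nnP U).1 Uo _ Up.
have inU t : nn t < r -> U (p + t).
  by move=> tr; apply: hr; rewrite [p + _]addrC addrK.
have sf i : sephol r (fun t => f i (p + t)).
  move=> t j tr; exists ('d (f i) (p + t + 0 *: delta_mx 0 j) (delta_mx 0 j)).
  have -> : (fun z => f i (p + (t + z *: delta_mx 0 j))) = (fun z => f i (p + t + z *: delta_mx 0 j)).
    by apply/funext => z; rewrite addrA.
  by apply: cdiff_slice; rewrite scale0r addr0; apply: fh; exact: inU.
have [i|i s s' ss hs|e e0 he] := @fin_radius R 'I_k (fun i e => sb (Num.min e r) (fun t => f i (p + t))).
- have [r1 r10 hr1] := diff_eps (fh i p Up) ltr01.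
  pose L := \sum_(j < n) nn ('d (f i) p (delta_mx 0 j)).
  have L0 : 0 <= L by apply: sumr_ge0 => j _; exact: nn_ge0.
  exists r1 => //; split; first by apply: sephol_sub (sf i); rewrite ge_min lexx orbT.
  exists (cn (f i p) + (L + 1) * r1) => t; rewrite lt_min => /andP[tr _]; have := hr1 t tr; rewrite !nn_cn mul1r => h3.
  have := linear_row_bound ('d (f i) p) t; rewrite -/L nn_cn => h4.
  have : (L + 1) * nn t <= (L + 1) * r1 by apply: ler_wpM2l; [lra|exact: ltW].
  rewrite mulrDl mul1r => h5.
  have := cn_dist (f i (p + t)) (f i p); have := cn_dist (f i (p + t) - f i p) ('d (f i) p t); lra.
- apply: sb_sub hs; rewrite le_min; apply/andP; split; last by rewrite ge_min lexx orbT.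
  by rewrite ge_min ss.
exists (Num.min e r), 'I_k, (fun i t => f i (p + t)); split => //.
  by rewrite lt_min e0.
move=> t; rewrite lt_min => /andP[_ /inU Upt]; split=> [Xpt i|fz].
  by have [_] := h1 _ (conj Xpt Upt); exact.
by have [] := h2 (p + t) (conj Upt fz).
Qed.

(** This turns the hypothesis that [X] is infinite into a supply of points of [X] arbitrarily far
    out, as each step of the construction needs one. *)
Lemma analytic_infinite_unbounded n (X : set 'rV[C]_n) : analytic_subvariety X -> ~ finite_set X ->
  forall M : R, exists2 z, X z & M < nn z.
Proof.
move=> hX Xi M; apply: contrapT => h; apply: Xi.
apply: (@weakly_analytic_finite n X M) (analytic_weakly hX) _ => z Xz.
by rewrite leNgt; apply/negP => Mz; apply: h; exists z.
Qed.

End Finiteness.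

(** * Polynomials controlled by an analytic set *)

Section Siegel.
Context {R : realType}.
Local Notation C := (R[i]).

Section Diff.
Variables (V : normedModType C) (x : V).
Implicit Types f g : V -> C.

Lemma dfD f g : differentiable f x -> differentiable g x -> differentiable (fun z => f z + g z) x.
Proof. by move=> hf hg; exact: differentiableD. Qed.

Lemma dfM f g : differentiable f x -> differentiable g x -> differentiable (fun z => f z * g z) x.
Proof. by move=> hf hg; exact: differentiableM. Qed.

Lemma df_cst (c : C) : differentiable (fun _ : V => c) x.
Proof. exact: differentiable_cst. Qed.

Lemma df_sum (I : Type) (s : seq I) (P : pred I) (F : I -> V -> C) :
  (forall i, P i -> differentiable (F i) x) -> differentiable (fun z => \sum_(i <- s | P i) F i z) x.
Proof.
move=> h; elim: s => [|i s IH].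
  by rewrite (_ : (fun z => _) = (fun=> 0)); [exact: df_cst|apply/funext => z; rewrite big_nil].
case Pi: (P i); last by rewrite (_ : (fun z => _) = (fun z => \sum_(i <- s | P i) F i z)) //; apply/funext => z; rewrite big_cons Pi.
rewrite (_ : (fun z => _) = (fun z => F i z + \sum_(i <- s | P i) F i z)); first exact: dfD (h i Pi) IH.
by apply/funext => z; rewrite big_cons Pi.
Qed.

Lemma df_prod (I : Type) (s : seq I) (P : pred I) (F : I -> V -> C) :
  (forall i, P i -> differentiable (F i) x) -> differentiable (fun z => \prod_(i <- s | P i) F i z) x.
Proof.
move=> h; elim: s => [|i s IH].
  by rewrite (_ : (fun z => _) = (fun=> 1)); [exact: df_cst|apply/funext => z; rewrite big_nil].
case Pi: (P i); last by rewrite (_ : (fun z => _) = (fun z => \prod_(i <- s | P i) F i z)) //; apply/funext => z; rewrite big_cons Pi.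
rewrite (_ : (fun z => _) = (fun z => F i z * \prod_(i <- s | P i) F i z)); first exact: dfM (h i Pi) IH.
by apply/funext => z; rewrite big_cons Pi.
Qed.

Lemma df_poly (p : {poly C}) f : differentiable f x -> differentiable (fun z => p.[f z]) x.
Proof.
move=> hf; elim/poly_ind: p => [|p c IH].
  by rewrite (_ : (fun z => _) = (fun=> 0)); [exact: df_cst|apply/funext => z; rewrite horner0].
rewrite (_ : (fun z => _) = (fun z => p.[f z] * f z + c)); first exact: dfD (dfM IH hf) (df_cst c).
by apply/funext => z; rewrite !hornerE.
Qed.

End Diff.

Lemma df_coord n (x : 'rV[C]_n) i : differentiable (fun z : 'rV[C]_n => z 0 i) x.
Proof. exact: differentiable_coord. Qed.

(** A nonzero solution of a linear system with more unknowns than equations, divided by its largest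
    entry. *)
Lemma solve_conditions (I : finType) (k : nat) (L : I -> 'I_k -> C) : (k < #|I|)%N ->
  exists v : I -> C, [/\ forall s, \sum_i v i * L i s = 0, exists i, v i = 1 & forall i, cn (v i) <= 1].
Proof.
move=> kI; pose A : 'M[C]_(#|I|, k) := \matrix_(i, s) L (enum_val i) s.
have k0 : kermx A != 0.
  by rewrite -mxrank_eq0 mxrank_ker subn_eq0 -ltnNge (leq_ltn_trans (rank_leq_col A)).
pose u := nz_row (kermx A); have u0 : u != 0 by rewrite nz_row_eq0.
have uA : u *m A = 0 by apply/sub_kermxP; exact: nz_row_sub.
have [j0 _ jmax] : exists2 j0, true & forall j, cn (u 0 j) <= cn (u 0 j0).
  have i0 : 'I_#|I| by exact: (Ordinal (leq_ltn_trans (leq0n k) kI)).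
  have [j _ hj] := @Order.TotalTheory.arg_maxP _ R _ i0 xpredT (fun j => cn (u 0 j)) isT.
  by exists j => // l; exact: hj.
have m0 : u 0 j0 != 0.
  apply: contra u0 => /eqP j00; apply/eqP/rowP => j; rewrite mxE; apply: cn_inj.
  by apply/le_anti; rewrite cn_ge0 andbT; have := jmax j; rewrite j00 cn0.
exists (fun i => u 0 (enum_rank i) / u 0 j0); split.
- move=> s; have := congr1 (fun B : 'rV[C]_k => B 0 s) uA; rewrite !mxE => h.
  rewrite (reindex (@enum_val I I)) /=; last by exists (@enum_rank I) => x _; rewrite ?enum_valK ?enum_rankK.
  under eq_bigr do rewrite enum_valK mulrAC.
  rewrite -mulr_suml [X in X / _](_ : _ = 0) ?mul0r //; rewrite -[RHS]h.
  by apply: eq_bigr => i _; rewrite mxE.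
- by exists (enum_val j0); rewrite enum_valK divff.
- by move=> i; rewrite cnM cnV ler_pdivrMr ?cn_gt0 // mul1r.
Qed.

(** The coordinates are freed from the grid one at a time by [small_at_nodes]. Each costs a factor
    [2 * 192 ^+ T], at most [K ^+ T] since 384 = 2 * 192; the grid has side [rho / (32 * K ^+ d)],
    so small that [(3 / 8) ^+ T] survives all [d] steps. *)
Lemma grid_small d (rho B K : R) (r : 'rV[C]_d -> C) T : 384 <= K -> 0 < rho -> (0 < T)%N -> sephol rho r ->
  (forall t, nn t < rho -> cn (r t) <= B) ->
  (forall g : {ffun 'I_d -> 'I_T}, r (\row_k (lnode (rho / (32 * K ^+ d)) T (g k))%:C) = 0) ->
  forall t, nn t <= rho / (32 * K ^+ d) -> cn (r t) <= d%:R * (3 / 8) ^+ T * B.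
Proof.
move=> K384 rho0 T0 rs rB rz; set dl := rho / _ in rz *.
have K1' : 1 <= K by lra.
have K1 : 1 <= K ^+ d :> R by exact: exprn_ege1.
have K0' : 0 < K by lra.
have K0 : 0 < 32 * K ^+ d :> R by rewrite mulr_gt0 // exprn_gt0.
have dl0 : 0 < dl by rewrite divr_gt0.
have dlr : dl <= rho / 32.
  apply: ler_wpM2l; first exact: ltW.
  by rewrite lef_pV2 ?posrE // ler_peMr.
have th : 12 * dl / rho * K ^+ d = 3 / 8.
  by rewrite /dl; field; rewrite !gt_eqF // exprn_gt0.
clearbody dl.
have B0 : 0 <= B by apply: le_trans (cn_ge0 _) (rB 0 _); rewrite nn0.
have P2 : 2 * 192 ^+ T <= K ^+ T :> R.
  apply: (@le_trans _ _ ((2 * 192) ^+ T)).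
    rewrite exprMn; apply: ler_wpM2r; first by rewrite exprn_ge0.
    by case: T T0 {rz} => // T _; rewrite exprS ler_peMr // exprn_ege1 // ler1n.
  by apply: lerXn2r; rewrite ?nnegrE; clear -K384; lra.
pose e k : R := k%:R * (12 * dl / rho) ^+ T * B * (K ^+ T) ^+ k.
have th0 : 0 <= (12 * dl / rho) ^+ T * B.
  by rewrite mulr_ge0 // exprn_ge0 // divr_ge0 ?mulr_ge0 // ltW.
have Kd0 k : 0 <= (K ^+ T) ^+ k by apply: exprn_ge0; apply: exprn_ge0; exact: ltW.
have e0 k : 0 <= e k by rewrite /e -[_ * _ * B]mulrA; apply: mulr_ge0 => //; exact: mulr_ge0.
have claim k : (k <= d)%N -> forall t : 'rV[C]_d, (forall j : 'I_d, (j < k)%N -> cn (t 0 j) <= dl) ->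
    (forall j : 'I_d, (k <= j)%N -> exists l : 'I_T, t 0 j = (lnode dl T l)%:C) -> cn (r t) <= e k.
  elim: k => [|k IH] kd t tf tn.
    have [g hg] : {g : 'I_d -> 'I_T & forall j, t 0 j = (lnode dl T (g j))%:C}.
      by apply: (@choice 'I_d 'I_T (fun j l => t 0 j = (lnode dl T l)%:C)) => j; exact: tn.
    rewrite /e !mul0r; have := rz [ffun j => g j]; rewrite (_ : (\row_k _) = t) => [->|].
      by rewrite cn0.
    by apply/rowP => j; rewrite !mxE ffunE hg.
  pose k' : 'I_d := Ordinal kd.
  pose t' : 'rV[C]_d := \row_j (if j == k' then 0 else t 0 j).
  have tE : t = t' + t 0 k' *: delta_mx 0 k'.
    apply/rowP => j; rewrite !mxE eqxx /=; case: eqP => [->|_]; first by rewrite mulr1 add0r.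
    by rewrite mulr0 addr0.
  have tl j : cn (t 0 j) <= dl.
    case: (ltnP j k.+1) => [|/tn[l ->]]; first exact: tf.
    have [h1 h2] := lnode_ge0 l dl0; rewrite cn_real ger0_norm //; exact: ltW.
  have t'n : nn t' <= dl.
    apply: nn_le; first exact: ltW.
    by move=> j; rewrite mxE; case: eqP => _; rewrite ?cn0 ?(ltW dl0).
  have r2 : nn t' + rho / 2 <= rho by lra.
  have := @small_at_nodes R 0 (rho / 2) dl (fun z => r (t' + z *: delta_mx 0 k')) B (e k) T (t 0 k') dl0 _ (e0 k)
     (@sephol_hol _ _ rho r t' k' (rho / 2) rs r2).
  rewrite -tE subr0 => H; have dl16 : dl <= rho / 2 / 16 by (clear -dlr; lra).
  have {H} := H dl16 _ _ (tl k').
  have Hb : bounded_by 0 (rho / 2) (fun z => r (t' + z *: delta_mx 0 k')) B.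
    move=> z; rewrite subr0 => zr; apply: rB; apply: (le_lt_trans (nnD _ _)).
    by rewrite nn_delta; lra.
  have Hn (l : 'I_T) : cn (r (t' + (0 + (lnode dl T l)%:C) *: delta_mx 0 k')) <= e k.
    rewrite add0r; apply: IH => [|j jk|j kj]; first exact: ltnW.
      rewrite !mxE eqxx /= (_ : j == k' = false) ?mulr0 ?addr0 //.
      by apply/eqP => jk'; rewrite jk' /= ltnn in jk.
    have [jk|jk] := eqVneq j k'.
      by exists l; rewrite jk !mxE !eqxx mulr1 add0r.
    rewrite !mxE eqxx (negbTE jk) mulr0 addr0; apply: tn; rewrite ltn_neqAle kj andbT.
    by apply: contra jk => /eqP kj'; apply/eqP; exact: val_inj.
  move=> H; apply: (le_trans (H Hb Hn)).
  have -> : 6 * dl / (rho / 2) = 12 * dl / rho by field; rewrite gt_eqF.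
  have le1 : e k * (2 * 192 ^+ T) <= e k * K ^+ T by apply: ler_wpM2l.
  have le2 : (12 * dl / rho) ^+ T * B <= (12 * dl / rho) ^+ T * B * (K ^+ T) ^+ k.+1.
    rewrite ler_peMr //; apply: exprn_ege1; exact: exprn_ege1.
  rewrite {2}/e; apply: (le_trans (lerD le2 le1)); rewrite /e -natr1 [(K ^+ T) ^+ k.+1]exprSr.
  by rewrite le_eqVlt; apply/orP; left; apply/eqP; ring.
move=> t tdl; have := claim d (leqnn d) t; rewrite /e => H.
apply: (le_trans (H _ _)).
- by move=> j _; apply: le_trans tdl; exact: nn_coord.
- by move=> j; rewrite leqNgt ltn_ord.
rewrite -th [(_ * K ^+ d) ^+ T]exprMn -exprM mulnC exprM.
by rewrite le_eqVlt; apply/orP; left; apply/eqP; ring.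
Qed.

(** The rate [a] is arbitrary, and [M] may depend on it but not on [T]. The exponent [d] instead of
    [d.+1] expresses that [X] has positive codimension. *)
Definition few_conditions d (X : set 'rV[C]_d.+1) (R1 a : R) (A : set 'rV[C]_d.+1) := exists M : nat,
  forall T, (0 < T)%N -> forall (I : finType) (F : I -> 'rV[C]_d.+1 -> C) (B : R),
  (forall i x, differentiable (F i) x) -> (forall i x, nn x <= R1 -> cn (F i x) <= B) ->
  exists k (L : I -> 'I_k -> C), (k <= M * T ^ d)%N /\
  forall v : I -> C, (forall s, \sum_i v i * L i s = 0) -> (forall i, cn (v i) <= 1) ->
  forall z, A z -> X z -> cn (\sum_i v i * F i z) <= #|I|%:R * B / a ^+ T.

(** In a chart, the combination is small on [X] as soon as its [m] coefficient functions are. These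
    are made to vanish on a grid with [tau.+1 * T] nodes in each of the [d] directions, where [tau]
    is such that [(3 / 8) ^+ tau] beats [a] and the constants of the chart. *)
Lemma few_conditions_local d (X : set 'rV[C]_d.+1) q (R1 a : R) : analytic_subvariety X -> X <> setT ->
  1 <= a -> nn q + 2 <= R1 -> exists2 r : R, 0 < r & few_conditions X R1 a [set z | nn (z - q) < r].
Proof.
move=> hX Xp a1 qR.
have [K K384] : exists K : R, 384 <= K by exists 384.
have K1 : 1 <= 32 * K ^+ d by apply: mulr_ege1; [lra|apply: exprn_ege1; lra].
have [m [rho [r [A [Tm [W [rho0 r0 A0 hW hF]]]]]]] := analytic_chart q hX Xp K1.
exists r => //.
pose c0 : R := (m%:R * d%:R * A + 1) * a.
have mdA : 0 <= m%:R * d%:R * A by rewrite !mulr_ge0.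
have a0 : 0 < a by lra.
have c00 : 0 <= c0 by rewrite mulr_ge0 ?addr_ge0 // ltW.
have [tau htau] := half_pow_small c00 ltr01.
have htau3 : c0 * (3 / 8) ^+ tau <= 1.
  apply: le_trans htau; apply: ler_wpM2l => //; rewrite -exprVn; apply: lerXn2r; rewrite ?nnegrE; clear; lra.
have htauT T : (0 < T)%N -> m%:R * d%:R * A * (3 / 8) ^+ (tau.+1 * T) <= 1 / a ^+ T.
  move=> T0; rewrite ler_pdivlMr ?exprn_gt0 //.
  apply: (@le_trans _ _ ((c0 * (3 / 8) ^+ tau) ^+ T)); last first.
    by apply: exprn_ile1 => //; rewrite mulr_ge0 // exprn_ge0 // divr_ge0.
  rewrite [(c0 * _) ^+ T]exprMn [c0 ^+ T]exprMn -exprM.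
  rewrite [X in _ <= X]mulrAC; apply: ler_wpM2r; first by rewrite exprn_ge0 // ltW.
  apply: ler_pM => //.
  - apply: (@le_trans _ _ (m%:R * d%:R * A + 1)); first by rewrite lerDl.
    by case: T T0 => // T _; rewrite exprS ler_peMr ?addr_ge0 // exprn_ege1 // lerDr.
  - by apply: ler_wiXn2l; rewrite ?divr_ge0 // ?leq_mul2r ?leqnSn ?orbT //; lra.
exists (m * tau.+1 ^ d)%N => T T0 I F B Fd FB.
have T'0 : (0 < tau.+1 * T)%N by rewrite muln_gt0.
have hi i : exists c : 'I_m -> 'rV[C]_d -> C,
   [/\ forall j, sephol rho (c j), forall j t, nn t < rho -> cn (c j t) <= A * B &
          forall z, nn (z - q) < r -> X z -> F i z = \sum_j c j (Tm z) * W z ^+ j].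
  apply: hF => x xq; first exact: Fd.
  by apply: FB; have := nn_dist x q; lra.
have [c hc] := choice hi.
pose node (g : {ffun 'I_d -> 'I_(tau.+1 * T)}) : 'rV[C]_d :=
  \row_k (lnode (rho / (32 * K ^+ d)) (tau.+1 * T) (g k))%:C.
pose S : finType := ('I_m * {ffun 'I_d -> 'I_(tau.+1 * T)})%type.
exists #|S|, (fun i s => c i (enum_val s).1 (node (enum_val s).2)); split.
  by rewrite card_prod card_ffun !card_ord expnMn mulnA.
move=> v hv v1 z zr Xz.
have B0 (i : I) : 0 <= B by apply: le_trans (cn_ge0 _) (FB i q _); clear -qR; lra.
pose Rj j t := \sum_i v i * c i j t.
have RjE : \sum_i v i * F i z = \sum_j Rj j (Tm z) * W z ^+ j.
  under eq_bigr => i _ do (have [_ _ ->] := hc i; rewrite // mulr_sumr).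
  rewrite exchange_big; apply: eq_bigr => j _; rewrite /Rj mulr_suml.
  by apply: eq_bigr => i _; rewrite mulrA.
have Rjb j t : nn t < rho -> cn (Rj j t) <= #|I|%:R * (A * B).
  move=> tr; apply: (le_trans (cn_sum _ _ _)).
  apply: (@le_trans _ _ (\sum_(i : I) A * B)); last by rewrite sumr_const mulr_natl.
  apply: ler_sum => i _; rewrite cnM -[A * B]mul1r; have [_ h _] := hc i.
  by apply: ler_pM; rewrite ?cn_ge0 // h.
have [TW W1] := hW z zr.
have Rjs j : cn (Rj j (Tm z)) <= d%:R * (3 / 8) ^+ (tau.+1 * T) * (#|I|%:R * (A * B)).
  apply: (@grid_small d rho _ K (Rj j) (tau.+1 * T)) => //; last exact: ltW.
  - by apply: sephol_sum => i _; apply: sepholM; [exact: sephol_cst|have [h _ _] := hc i; exact: h].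
  - by move=> t; exact: Rjb.
  - move=> g; have := hv (enum_rank ((j, g) : S)); rewrite enum_rankK /=; exact.
rewrite RjE; apply: (le_trans (cn_sum _ _ _)).
apply: (@le_trans _ _ (\sum_(j < m) d%:R * (3 / 8) ^+ (tau.+1 * T) * (#|I|%:R * (A * B)))).
  apply: ler_sum => j _; rewrite cnM cnX -[X in _ <= X]mulr1.
  by apply: ler_pM; rewrite ?cn_ge0 ?exprn_ge0 ?cn_ge0 //; apply: exprn_ile1; rewrite ?cn_ge0.
rewrite sumr_const card_ord -[X in X <= _]mulr_natl.
have [i0|I0] := pickP (fun _ : I => true); last first.
  by rewrite (eq_card0 I0) !mul0r !mulr0.
have -> : m%:R * (d%:R * (3 / 8) ^+ (tau.+1 * T) * (#|I|%:R * (A * B))) =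
   #|I|%:R * B * (m%:R * d%:R * A * (3 / 8) ^+ (tau.+1 * T)) by ring.
move=> _; rewrite -[(a ^+ T)^-1]div1r; apply: ler_wpM2l; last exact: htauT.
by rewrite mulr_ge0 // B0.
Qed.

Lemma few_conditions_polydisc d (X : set 'rV[C]_d.+1) (L a : R) : analytic_subvariety X -> X <> setT ->
  0 <= L -> 1 <= a -> few_conditions X (L + 2) a [set z | nn z <= L].
Proof.
move=> hX Xp L0 a1.
have := @compact_polydisc R d.+1 0 L L0.
have -> : [set z : 'rV[C]_d.+1 | nn (z - 0) <= L] = [set z | nn z <= L].
  by apply/seteqP; split=> z /=; rewrite subr0.
move=> Kc; apply: (compact_ind Kc).
- by exists 0%N => T T0 I F B _ _; exists 0%N, (fun _ _ => 0); split.
- move=> A A' [M hM] [M' hM']; exists (M + M')%N => T T0 I F B Fd FB.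
  have [k [U [hk hU]]] := hM T T0 I F B Fd FB; have [k' [U' [hk' hU']]] := hM' T T0 I F B Fd FB.
  exists (k + k')%N, (fun i (s : 'I_(k + k')) => match fintype.split s with inl s => U i s | inr s => U' i s end); split.
    by rewrite mulnDl leq_add.
  move=> v hv v1 z [Az|Az] Xz.
    by apply: hU => // s; have := hv (unsplit (inl s)); rewrite unsplitK.
  by apply: hU' => // s; have := hv (unsplit (inr s)); rewrite unsplitK.
- move=> A A' AA [M hM]; exists M => T T0 I F B Fd FB.
  have [k [U [hk hU]]] := hM T T0 I F B Fd FB; exists k, U; split => // v hv v1 z /AA; exact: hU.
by move=> q /= qL; apply: few_conditions_local => //; lra.
Qed.

Section GridPoly.
Variables (n : nat) (v0 : 'rV[C]_n) (dl : R) (T : nat).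
Hypothesis dl0 : 0 < dl.

(** Tensor products of Lagrange polynomials rather than monomials: a coefficient is then the value
    at a grid node, so a coefficient 1 gives a point where the polynomial equals 1. *)
Definition grid_basis (b : {ffun 'I_n -> 'I_T}) (z : 'rV[C]_n) : C :=
  \prod_i (node_poly dl (b i)).[z 0 i - v0 0 i].

Lemma grid_basis_sum (r : R) z : dl <= r -> nn (z - v0) + dl <= r ->
  \sum_b cn (grid_basis b z) <= (16 * r / dl) ^+ (T * n).
Proof.
move=> dr zr; under eq_bigr do rewrite cn_prod.
rewrite -(bigA_distr_bigA (fun i l => cn (node_poly dl l).[z 0 i - v0 0 i])).
apply: (@le_trans _ _ (\prod_(i < n) (16 * r / dl) ^+ T)); last first.
  by rewrite prodr_const card_ord exprM.
apply: ler_prod => i _; rewrite sumr_ge0 => [/=|l _]; last exact: cn_ge0.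
apply: node_poly_bound => // k; have [h1 h2] := lnode_ge0 k dl0.
apply: (le_trans (cnD _ _)); rewrite cnN cn_real ger0_norm //.
by have := nn_coord (z - v0) i; rewrite !mxE; lra.
Qed.

Lemma grid_basis_node (b g : {ffun 'I_n -> 'I_T}) :
  grid_basis b (v0 + \row_i (lnode dl T (g i))%:C) = (g == b)%:R.
Proof.
have d0 : dl != 0 by rewrite gt_eqF.
rewrite /grid_basis; have [->|gb] := eqVneq g b.
  by apply: big1 => i _; rewrite !mxE addrAC subrr add0r node_poly_node // eqxx.
have [i gi] : exists i, g i != b i.
  apply: contrapT => h; case/eqP: gb; apply/ffunP => i; apply/eqP; apply: contrapT => /negP gi.
  by apply: h; exists i.
rewrite (bigD1 i) //= !mxE addrAC subrr add0r node_poly_node //.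
by rewrite (negbTE gi) mul0r.
Qed.

Lemma grid_basis_diff b x : differentiable (grid_basis b) x.
Proof.
apply: df_prod => i _; apply: df_poly; apply: dfD; first exact: df_coord.
exact: df_cst.
Qed.

End GridPoly.

(* The number of conditions grows like T^d, the number of coefficients like
   T^(d+1). *)
Lemma siegel_polynomial d (X : set 'rV[C]_d.+1) (v0 : 'rV[C]_d.+1) (dl L a : R) :
  analytic_subvariety X -> X <> setT -> 0 <= L -> 1 <= a -> 0 < dl ->
  exists T (v : {ffun 'I_d.+1 -> 'I_T} -> C),
  [/\ (0 < T)%N, forall b, cn (v b) <= 1,
      exists b, v b = 1 &
      forall z, nn z <= L -> X z ->
      cn (\sum_b v b * grid_basis v0 dl b z) <=
        (2 * (16 * (L + 2 + nn v0 + dl) / dl)) ^+ (T * d.+1) / a ^+ T].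
Proof.
move=> hX Xp L0 a1 dl0; have [M hM] := few_conditions_polydisc hX Xp L0 a1.
(* With [T > M] the number [M * T ^ d] of conditions is below the number [T ^ d.+1] of
   coefficients. *)
pose T := M.+1; pose r := L + 2 + nn v0 + dl.
have T0 : (0 < T)%N by [].
have rb (b : {ffun 'I_d.+1 -> 'I_T}) z : nn z <= L + 2 -> cn (grid_basis v0 dl b z) <= (16 * r / dl) ^+ (T * d.+1).
  move=> zL; apply: le_trans (@grid_basis_sum d.+1 v0 dl T dl0 r z _ _).
  - by rewrite (bigD1 b) //= lerDl sumr_ge0 // => i _; exact: cn_ge0.
  - by rewrite /r; have := nn_ge0 v0; lra.
  - by rewrite /r; have := nnD z (- v0); rewrite nnN; lra.
have [k [U [hk hU]]] := hM T T0 {ffun 'I_d.+1 -> 'I_T} (grid_basis v0 dl (T := T)) _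
   (fun b x => grid_basis_diff v0 dl b x) rb.
have kI : (k < #|{ffun 'I_d.+1 -> 'I_T}|)%N.
  rewrite card_ffun !card_ord; apply: (leq_ltn_trans hk).
  by rewrite expnS ltn_mul2r expn_gt0 /= ltnSn.
have [v [v1 v2 v3]] := solve_conditions U kI.
exists T, v; split => // z zL Xz; apply: (le_trans (hU v v1 v3 z zL Xz)).
apply: ler_wpM2r; first by rewrite invr_ge0 exprn_ge0 //; lra.
rewrite -/r [X in _ <= X]exprMn; apply: ler_wpM2r.
  by rewrite exprn_ge0 // divr_ge0 ?(ltW dl0) // mulr_ge0 // /r; have := nn_ge0 v0; lra.
rewrite card_ffun !card_ord -natrX ler_nat expnM leq_exp2r //.
by rewrite ltnW // ltn_expl.
Qed.

End Siegel.

(** * Lower bounds for polynomials along a tilted segment *)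

Section SegmentLemma.
Context {R : realType}.
Local Notation C := (R[i]).

(* A root of p contributes at least the sine of its angle to the tilted
   direction, and Lagrange interpolation in the tilt bounds the product of these
   sines from below for some tilt. *)
Lemma tilted_segment (p : {poly C}) T (W : C) (eta : R) : (size p <= T)%N -> (0 < T)%N -> p.[0] = 1 ->
  0 < eta -> eta <= 1 ->
  exists2 s : R, 0 <= s < eta & forall t : R, (eta / 128) ^+ T <= cn p.[t%:C * (Complex 1 s * W)].
Proof.
move=> sp T0 p0 e0 e1; have eb : 0 <= eta / 128 by rewrite divr_ge0 // ltW.
have [->|W0] := eqVneq W 0.
  exists 0 => [|t]; first by rewrite lexx.
  by rewrite !mulr0 p0 cn1; apply: exprn_ile1 => //; clear -e1; lra.
have pn0 : p != 0 by apply: contra_eq_neq p0 => ->; rewrite horner0 eq_sym oner_neq0.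
have [rs prs] := closed_field_poly_normal p.
have l0 : lead_coef p != 0 by rewrite lead_coef_eq0.
have srs : (size rs < T)%N.
  by move: sp; rewrite prs size_scale // size_prod_XsubC.
have rs0 z : z \in rs -> z != 0.
  move=> zr; apply/eqP => z0; have : root p 0 by rewrite prs rootZ // root_prod_XsubC -z0.
  by rewrite /root p0 oner_eq0.
have pE x : p.[x] = \prod_(z <- rs) (1 - x / z).
  have h y : p.[y] = lead_coef p * \prod_(z <- rs) (y - z).
    rewrite {1}prs hornerZ horner_prod; congr (_ * _); apply: eq_bigr => z _; by rewrite !hornerE.
  have : p.[x] = p.[x] / p.[0] by rewrite p0 divr1.
  rewrite (h x) (h 0) -mulf_div divff // mul1r => ->.
  rewrite -prodf_div !big_seq; apply: eq_bigr => z zr; field; rewrite ?rs0 ?oppr_eq0 //.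
pose al z := W / z.
have al0 z : z \in rs -> 0 < cn (al z) by move=> zr; rewrite cn_gt0 mulf_neq0 // invr_neq0 // rs0.
pose u z := Re (al z) / cn (al z); pose v z := Im (al z) / cn (al z).
(* At a real tilt [s], each factor is the sine of the angle between the tilted direction and a root,
   up to the modulus of [1 + i s]. At [i] every factor has modulus 1, so [Q] cannot be small at all
   the nodes. *)
pose Q : {poly C} := \prod_(z <- rs) (((v z)%:C)%:P + (u z)%:C *: 'X).
have QE x : Q.[x] = \prod_(z <- rs) ((v z)%:C + (u z)%:C * x).
  by rewrite /Q horner_prod; apply: eq_bigr => z _; rewrite !hornerE.
have sQ : (size Q <= T)%N.
  apply: leq_trans srs; rewrite /Q; elim: (rs) => [|z l IH]; first by rewrite big_nil size_poly1.
  rewrite big_cons; apply: (leq_trans (size_polyMleq _ _)).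
  have : (size (((v z)%:C)%:P + (u z)%:C *: 'X)%R <= 2)%N.
    apply: (leq_trans (size_polyD _ _)); rewrite geq_max (leq_trans (size_polyC_leq1 _)) //=.
    by apply: (leq_trans (size_scale_leq _ _)); rewrite size_polyX.
  move=> h1; move: (leq_add h1 IH); rewrite add2n /=; by case: (_ + _)%N.
have d0 : eta != 0 by rewrite gt_eqF.
have Qi : cn Q.[Complex 0 1] = 1.
  rewrite QE cn_prod big_seq big1 // => z zr.
  have z0 := al0 z zr; apply/eqP; rewrite -(@eqrXn2 _ 2) ?cn_ge0 // expr1n; apply/eqP.
  rewrite cn_sqr /= !mulr0 !mul0r ?mulr1 !subr0 !addr0 !add0r /u /v !expr_div_n -mulrDl addrC -cn_sqr.
  by rewrite divff // expf_neq0 // gt_eqF.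
have [k hk] : exists k : 'I_T, (eta / 64) ^+ T < cn Q.[(lnode eta T k)%:C].
  apply: contrapT => /forallNP h.
  have := node_interpolation (Complex 0 1) d0 sQ => /(congr1 (@cn R)); rewrite Qi => h1.
  have h2 : 1 <= \sum_(l < T) (eta / 64) ^+ T * cn (node_poly eta l).[Complex 0 1].
    rewrite [X in X <= _]h1; apply: (le_trans (cn_sum _ _ _)); apply: ler_sum => l _; rewrite cnM.
    by apply: ler_wpM2r; rewrite ?cn_ge0 // leNgt; apply/negP; exact: h.
  move: h2; rewrite -mulr_sumr => h2.
  have h3 : \sum_(l < T) cn (node_poly eta l).[Complex 0 1] <= (16 * 2 / eta) ^+ T.
    apply: node_poly_bound => //; first by lra.
    move=> l; apply: (le_trans (cnD _ _)); rewrite cn_i cnN cn_real.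
    by have [q1 q2] := lnode_ge0 l e0; rewrite ger0_norm //; lra.
  have p64 : 0 <= (eta / 64) ^+ T by rewrite exprn_ge0 // divr_ge0 // ltW.
  have := le_trans h2 (ler_wpM2l p64 h3); rewrite -exprMn.
  (* 64 is twice the base 32 in the growth of the interpolation at [i]. *)
  have -> : eta / 64 * (16 * 2 / eta) = 1 / 2 by field.
  have : (1 / 2 : R) ^+ T <= 1 / 2.
    case: (T) T0 => // T' _; rewrite exprS ler_piMr ?divr_ge0 //.
    by apply: exprn_ile1; clear; lra.
  lra.
have [n1 n2] := lnode_ge0 k e0; set s := lnode eta T k in hk n1 n2.
exists s => [|t]; first by rewrite n1 n2.
rewrite pE cn_prod.
have H : \prod_(z <- rs) (cn ((v z)%:C + (u z)%:C * s%:C) / 2) <= \prod_(z <- rs) cn (1 - t%:C * (Complex 1 s * W) / z).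
  rewrite !big_seq; apply: ler_prod => z zr; rewrite divr_ge0 ?cn_ge0 //=.
  have z0 := al0 z zr; pose be := Complex 1 s * al z.
  have -> : t%:C * (Complex 1 s * W) / z = t%:C * be by rewrite /be /al !mulrA.
  have b2 : cn be <= 2 * cn (al z).
    rewrite /be cnM; apply: ler_wpM2r; rewrite ?cn_ge0 //.
    by apply: (le_trans (cn_le _)) => /=; rewrite normr1 ger0_norm //; lra.
  have I1 : Im be = cn (al z) * (v z + u z * s).
    rewrite /be /u /v; move: z0; move: (cn (al z)) => c c0.
    by generalize (al z) => -[x y] /=; field; rewrite gt_eqF.
  (* The distance from 1 to the real line spanned by [be] is the sine of the angle of [be]. *)
  have I2 : `|Im be| <= cn (1 - t%:C * be) * cn be.
    have -> : Im be = - Im ((1 - t%:C * be) * be^*).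
      by case: be {b2 I1} => x y /=; ring.
    rewrite normrN; apply: (le_trans (cn_Im _)); rewrite cnM; apply: ler_wpM2l; first exact: cn_ge0.
    by rewrite le_eqVlt /cn normcJ eqxx.
  rewrite -rmorphM -rmorphD cn_real /=; move: I2; rewrite I1 normrM (ger0_norm (cn_ge0 _)).
  move=> I2; have := le_trans I2 (ler_wpM2l (cn_ge0 (1 - t%:C * be)) b2).
  have -> : cn (1 - t%:C * be) * (2 * cn (al z)) = cn (al z) * (2 * cn (1 - t%:C * be)) by ring.
  rewrite ler_pM2l //.
  by (clear; lra).
apply: le_trans H; rewrite big_split /= -cn_prod -QE.
have -> : \prod_(z <- rs) (2^-1 : R) = 2^-1 ^+ size rs by rewrite big_const_seq count_predT -Monoid.iteropE.
(* The further factor 2 for each root is the bound for the modulus of [1 + i s]. *)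
have -> : eta / 128 = (eta / 64) * 2^-1 by field.
rewrite exprMn; apply: ler_pM; rewrite ?exprn_ge0 ?divr_ge0 ?invr_ge0 ?(ltW e0) //; first exact: ltW.
by apply: ler_wiXn2l; [rewrite invr_ge0|rewrite invf_le1 // ler1n|exact: ltnW].
Qed.

End SegmentLemma.

(** * Moving a point by automorphisms *)

Section Shears.
Context {R : realType}.
Local Notation C := (R[i]).

Section Any.
Variable n : nat.
Implicit Types (f g : 'rV[C]_n -> 'rV[C]_n) (x y z a c e : 'rV[C]_n).

Definition aut_pair f g := [/\ forall x, differentiable f x, forall x, differentiable g x, cancel f g & cancel g f].

Lemma aut_pair_comp f g f' g' : aut_pair f g -> aut_pair f' g' -> aut_pair (f' \o f) (g \o g').
Proof.
move=> [h1 h2 h3 h4] [k1 k2 k3 k4]; split.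
- by move=> x; exact: differentiable_comp.
- by move=> x; exact: differentiable_comp.
- by move=> x; rewrite /= k3 h3.
- by move=> x; rewrite /= h4 k4.
Qed.

Lemma aut_pair_id : aut_pair id id.
Proof. by split => // x; exact: differentiable_id. Qed.

Lemma aut_pair_sym f g : aut_pair f g -> aut_pair g f.
Proof. by case=> *; split. Qed.

Definition aff (l : C * 'rV[C]_n) z : C := l.1 + \sum_j l.2 0 j * z 0 j.

Lemma aff_dir l z (t : C) a : aff l (z + t *: a) = aff l z + t * \sum_j l.2 0 j * a 0 j.
Proof.
rewrite /aff -addrA; congr (_ + _); rewrite mulr_sumr -big_split; apply: eq_bigr => j _.
by rewrite !mxE /=; ring.
Qed.

Lemma aff_diff l x : differentiable (aff l) x.
Proof.
apply: dfD; first exact: df_cst; apply: df_sum => j _; apply: dfM; first exact: df_cst.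
exact: df_coord.
Qed.

Definition shear (q : {poly C}) l a (t : C) z := z + (t * q.[aff l z]) *: a.

Lemma shear_aut q (l : C * 'rV[C]_n) a t : \sum_j l.2 0 j * a 0 j = 0 -> aut_pair (shear q l a t) (shear q l a (- t)).
Proof.
move=> la; have D u x : differentiable (shear q l a u) x.
  apply: differentiableD; first by [].
  apply: differentiableZl; apply: dfM; first exact: df_cst.
  by apply: df_poly; exact: aff_diff.
split => // x; rewrite /shear aff_dir la mulr0 addr0 -addrA -scalerDl.
  by rewrite mulNr subrr scale0r addr0.
by rewrite mulNr addNr scale0r addr0.
Qed.

Definition near c (r t : R) f g := forall z, nn (z - c) <= r -> nn (f z - z) <= t /\ nn (g z - z) <= t.

Definition reach c (r t : R) y e := exists f g, [/\ aut_pair f g, f y = e & near c r t f g].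

Lemma near_comp c (r t : R) f g f' g' : 0 <= t -> near c (r + t) t f g -> near c (r + t) t f' g' ->
  near c r (t + t) (f' \o f) (g \o g').
Proof.
move=> t0 h h' z zr.
have zt : nn (z - c) <= r + t by rewrite -[nn _]addr0; exact: lerD.
have [k1 k2] := h z zt; have [k1' k2'] := h' z zt.
have fz : nn (f z - c) <= r + t by rewrite [r + t]addrC; apply: le_trans (nn_distD z _ _) _; exact: lerD.
have gz : nn (g' z - c) <= r + t by rewrite [r + t]addrC; apply: le_trans (nn_distD z _ _) _; exact: lerD.
have [l1 l2] := h (g' z) gz; have [l1' l2'] := h' (f z) fz.
split => /=; [apply: le_trans (nn_distD (f z) _ _) _|apply: le_trans (nn_distD (g' z) _ _) _]; exact: lerD.
Qed.

Lemma reach_trans c (r t : R) y y' e : 0 <= t -> reach c (r + t) t y y' -> reach c (r + t) t y' e -> reach c r (t + t) y e.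
Proof.
move=> t0 [f [g [a1 a2 a3]]] [f' [g' [b1 b2 b3]]]; exists (f' \o f), (g \o g'); split.
- exact: aut_pair_comp.
- by rewrite /= a2.
- exact: near_comp.
Qed.

(* The shear along e - y with profile ((z_l - c_l)/(y_l - c_l))^s. *)
Lemma reach_pivot c (r t : R) y e l : 0 <= r -> 0 < t -> y 0 l = e 0 l -> r < cn (y 0 l - c 0 l) -> reach c r t y e.
Proof.
move=> r0 t0 ye ry; set m := y 0 l - c 0 l in ry.
have m0 : 0 < cn m by lra.
have mn : m != 0 by rewrite -cn_gt0.
pose lf : C * 'rV[C]_n := (- (c 0 l / m), m^-1 *: delta_mx 0 l).
have affE z : aff lf z = (z 0 l - c 0 l) / m.
  rewrite /aff /= (bigD1 l) //= big1 ?addr0 => [|j jl]; last by rewrite !mxE eqxx (negbTE jl) mulr0 mul0r.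
  by rewrite !mxE !eqxx mulr1; field.
pose a := e - y.
have q0 : 0 <= r / cn m by rewrite divr_ge0 // ltW.
have q1 : r / cn m < 1 by rewrite ltr_pdivrMr // mul1r.
have [s hs] : exists s, (r / cn m) ^+ s * nn a <= t.
  have A0 : 0 < nn a + 1 by rewrite ltr_wpDl // nn_ge0.
  have := @cvg_expr R (r / cn m); rewrite ger0_norm // => /(_ q1) /cvgrPdist_lt.
  move=> /(_ (t / (nn a + 1)) (divr_gt0 t0 A0)) [N _ /(_ N (leqnn _))].
  rewrite /= sub0r normrN ger0_norm ?exprn_ge0 // => h; exists N.
  apply: (@le_trans _ _ (t / (nn a + 1) * nn a)); first by apply: ler_wpM2r; rewrite ?nn_ge0 // ltW.
  rewrite -mulrA ger_pMr // mulrC ler_pdivrMr // mul1r lerDl //.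
have la : \sum_j lf.2 0 j * a 0 j = 0.
  rewrite (bigD1 l) //= big1 ?addr0 => [|j jl]; last by rewrite !mxE eqxx (negbTE jl) mulr0 mul0r.
  by rewrite !mxE ye subrr mulr0.
exists (shear 'X^s lf a 1), (shear 'X^s lf a (- 1)); split.
- exact: shear_aut.
- by rewrite /shear affE -/m divff // hornerXn expr1n mul1r scale1r /a addrC subrK.
move=> z zr; have H : nn ((aff lf z) ^+ s *: a) <= t.
  rewrite nnZ cnX affE cnM cnV; apply: le_trans hs; apply: ler_wpM2r; first exact: nn_ge0.
  apply: lerXn2r; rewrite ?nnegrE ?mulr_ge0 ?cn_ge0 ?invr_ge0 ?cn_ge0 //.
  apply: ler_wpM2r; first by rewrite invr_ge0 cn_ge0.
  by have := nn_coord (z - c) l; rewrite !mxE; lra.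
rewrite /shear !hornerXn mul1r mulN1r scaleNr; split.
  by rewrite addrAC subrr add0r.
by rewrite addrAC subrr add0r nnN.
Qed.

End Any.

(** A pivot shear keeps one coordinate, in which the point sticks out, and changes the others at
    will. If [y] and [e] stick out in different coordinates, two pivots suffice. If they stick out
    in the same coordinate [l], a second coordinate [b] is first made large, then [l] is changed
    while [b] is the pivot, then [b] is moved back; this takes at least two dimensions. *)
Lemma reach_outside d (c y e : 'rV[C]_d.+2) (r t : R) : 0 <= r -> 0 < t -> r < nn (y - c) -> r < nn (e - c) ->
  reach c r t y e.
Proof.
move=> r0 t0 ry re; have [l yl] := nn_gtP r0 ry; have [m em] := nn_gtP r0 re.
rewrite !mxE in yl em.
(* The tolerances used below add up to at most [4 * s], and both points still stick out when the
   polydisc is enlarged by [3 * s]. *)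
pose s := Num.min t (Num.min (cn (y 0 l - c 0 l) - r) (cn (e 0 m - c 0 m) - r)) / 5.
have s0 : 0 < s by rewrite divr_gt0 // !lt_min t0 !subr_gt0 yl em.
have s5 : s * 5 = Num.min t (Num.min (cn (y 0 l - c 0 l) - r) (cn (e 0 m - c 0 m) - r)) by rewrite /s; field.
have st : s * 5 <= t by rewrite s5 ge_min lexx.
have sl : r + s + s + s < cn (y 0 l - c 0 l).
  have : s * 5 <= cn (y 0 l - c 0 l) - r by rewrite s5 !ge_min lexx orbT.
  lra.
have sm : r + s + s + s < cn (e 0 m - c 0 m).
  have : s * 5 <= cn (e 0 m - c 0 m) - r by rewrite s5 !ge_min lexx !orbT.
  lra.
have weak (r1 t1 : R) (u v : 'rV[C]_d.+2) : r <= r1 -> t1 <= t -> reach c r1 t1 u v -> reach c r t u v.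
  move=> rr tt [f [g [h1 h2 h3]]]; exists f, g; split => // z zr.
  by have [k1 k2] := h3 z (le_trans zr rr); split; clear -k2 k1 tt; lra.
have [b bl] : exists b : 'I_d.+2, b != l.
  have [->|l0] := eqVneq l ord0; first by exists (lift ord0 ord0); rewrite eq_sym neq_lift.
  by exists ord0; rewrite eq_sym.
have [ml|ml] := eqVneq m l; last first.
  pose y' : 'rV[C]_d.+2 := \row_j (if j == l then y 0 l else e 0 j).
  apply: (weak r (s + s)); [by []|by (clear -st s0; lra)|apply: (@reach_trans _ c r s y y' e (ltW s0))].
    by apply: (@reach_pivot _ c (r + s) s y y' l) => //; [(clear -r0 s0; lra)|rewrite mxE eqxx|(clear -sl s0; lra)].
  by apply: (@reach_pivot _ c (r + s) s y' e m) => //; [(clear -r0 s0; lra)|rewrite mxE (negbTE ml)|rewrite mxE (negbTE ml); (clear -sm em; lra)].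
subst m; pose big : C := c 0 b + (r + s + s + s + s)%:C.
have bigE : cn (big - c 0 b) = r + s + s + s + s.
  by rewrite /big addrAC subrr add0r cn_real ger0_norm //; lra.
pose y1 : 'rV[C]_d.+2 := \row_j (if j == b then big else y 0 j).
pose y2 : 'rV[C]_d.+2 := \row_j (if j == b then big else e 0 j).
apply: (weak r (s + s + (s + s))); [by []|by lra|].
have ss0 : 0 <= s + s by lra.
apply: (@reach_trans _ c r (s + s) y y2 e ss0).
  apply: (@reach_trans _ c (r + (s + s)) s y y1 y2 (ltW s0)).
    apply: (@reach_pivot _ c (r + (s + s) + s) s y y1 l) => //; [(clear -ss0 r0; lra)|by rewrite mxE eq_sym (negbTE bl)|(clear -sl; lra)].
  apply: (@reach_pivot _ c (r + (s + s) + s) s y1 y2 b) => //; first by lra.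
    by rewrite !mxE eqxx.
  by rewrite !mxE eqxx bigE; lra.
apply: (@reach_pivot _ c (r + (s + s)) (s + s) y2 e l); [(clear -ss0 r0; lra)|(clear -s0; lra)| |].
  by rewrite mxE eq_sym (negbTE bl).
by rewrite mxE eq_sym (negbTE bl); lra.
Qed.

End Shears.

(** * A splitting scheme of shears for polynomial fields *)

Section Euler.
Context {R : realType}.
Local Notation C := (R[i]).
Variable n : nat.
Implicit Types (z w a p : 'rV[C]_n).

Definition loclip (W : normedModType C) (f : 'rV[C]_n -> W) := forall r : R, exists2 M : R, 0 <= M &
  forall z w, nn z <= r -> nn w <= r -> nn (f z) <= M /\ nn (f z - f w) <= M * nn (z - w).

Lemma loclip_cst (W : normedModType C) (c : W) : loclip (fun=> c).
Proof.
move=> r; exists (nn c) => [|z w _ _]; first exact: nn_ge0.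
by rewrite subrr nn0; split => //; rewrite mulr_ge0 // nn_ge0.
Qed.

Lemma loclipD (W : normedModType C) (f g : 'rV[C]_n -> W) : loclip f -> loclip g -> loclip (fun z => f z + g z).
Proof.
move=> hf hg r; have [M M0 hM] := hf r; have [N N0 hN] := hg r.
exists (M + N) => [|z w zr wr]; first exact: addr_ge0.
have [m1 m2] := hM z w zr wr; have [n1 n2] := hN z w zr wr; split.
  by apply: le_trans (nnD _ _) _; exact: lerD.
by rewrite opprD addrACA mulrDl; apply: le_trans (nnD _ _) _; exact: lerD.
Qed.

Lemma loclipZ (W : normedModType C) (f : 'rV[C]_n -> C) (g : 'rV[C]_n -> W) :
  loclip f -> loclip g -> loclip (fun z => f z *: g z).
Proof.
move=> hf hg r; have [M M0 hM] := hf r; have [N N0 hN] := hg r.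
have MN : 0 <= M * N by exact: mulr_ge0.
exists (M * N + M * N) => [|z w zr wr]; first exact: addr_ge0.
have [m1 m2] := hM z w zr wr; have [n1 n2] := hN z w zr wr.
have [m3 _] := hM w w wr wr.
rewrite !nn_cn in m1 m2 m3; split.
  by rewrite nnZ; apply: (@le_trans _ _ (M * N)); [apply: ler_pM; rewrite ?cn_ge0 ?nn_ge0|lra].
have -> : f z *: g z - f w *: g w = (f z - f w) *: g z + f w *: (g z - g w).
  by rewrite scalerBl scalerBr addrA subrK.
apply: (le_trans (nnD _ _)); rewrite !nnZ mulrDl; apply: lerD.
  rewrite mulrAC; apply: ler_pM; rewrite ?cn_ge0 ?nn_ge0 //.
by rewrite -mulrA; apply: ler_pM; rewrite ?cn_ge0 ?nn_ge0.
Qed.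

Lemma loclip_coord i : loclip (fun z => z 0 i : C).
Proof.
move=> r; exists (Num.max 1 r) => [|z w zr wr]; first by rewrite le_max ler01.
rewrite !nn_cn; split; first by apply: le_trans (nn_coord _ _) _; rewrite le_max zr orbT.
have := nn_coord (z - w) i; rewrite !mxE => h; apply: (le_trans h).
by rewrite ler_peMl ?nn_ge0 // le_max lexx.
Qed.

Lemma loclip_sum (W : normedModType C) (I : Type) (s : seq I) (F : I -> 'rV[C]_n -> W) :
  (forall i, loclip (F i)) -> loclip (fun z => \sum_(i <- s) F i z).
Proof.
move=> h; elim: s => [|i s IH].
  by rewrite (_ : (fun z => _) = (fun=> 0)); [exact: loclip_cst|apply/funext => z; rewrite big_nil].
rewrite (_ : (fun z => _) = (fun z => F i z + \sum_(i <- s) F i z)); first exact: loclipD.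
by apply/funext => z; rewrite big_cons.
Qed.

Lemma loclip_poly (q : {poly C}) (f : 'rV[C]_n -> C) : loclip f -> loclip (fun z => q.[f z]).
Proof.
move=> hf; elim/poly_ind: q => [|q c IH].
  by rewrite (_ : (fun z => _) = (fun=> 0)); [exact: loclip_cst|apply/funext => z; rewrite horner0].
rewrite (_ : (fun z => _) = (fun z => q.[f z] *: f z + c)); last by apply/funext => z; rewrite !hornerE.
by apply: loclipD; [exact: loclipZ|exact: loclip_cst].
Qed.

Lemma loclip_aff l : loclip (@aff R n l).
Proof.
apply: loclipD; first exact: loclip_cst.
apply: (@loclip_sum C) => j.
rewrite (_ : (fun z => _) = (fun z => l.2 0 j *: (z 0 j : C))); last by [].
by apply: loclipZ; [exact: loclip_cst|exact: loclip_coord].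
Qed.

Definition shear_data := ({poly C} * (C * 'rV[C]_n) * 'rV[C]_n)%type.

(** The linear form kills the direction, so the profile is constant along the orbits: the time-[t]
    flow of [shear_field] is the shear itself, with inverse at time [- t]. *)
Definition shear_ok (s : shear_data) := \sum_j s.1.2.2 0 j * s.2 0 j = 0.

Definition shear_field (s : shear_data) z : 'rV[C]_n := s.1.1.[aff s.1.2 z] *: s.2.

Definition field (s : seq shear_data) z : 'rV[C]_n := \sum_(x <- s) shear_field x z.

(** The composition of the time-[t] flows of the summands: one step of a splitting scheme for
    [field s], with complex time. *)
Fixpoint step (t : C) (s : seq shear_data) z :=
  if s is x :: s' then step t s' (shear x.1.1 x.1.2 x.2 t z) else z.

Lemma step_cat t s s' z : step t (s ++ s') z = step t s' (step t s z).
Proof. by elim: s z => //= x s IH z; rewrite IH. Qed.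

Lemma step_aut t s : (forall x, x \in s -> shear_ok x) -> aut_pair (step t s) (step (- t) (rev s)).
Proof.
elim: s => [_|x s IH h]; first exact: aut_pair_id.
have -> : step (- t) (rev (x :: s)) = (shear x.1.1 x.1.2 x.2 (- t)) \o step (- t) (rev s).
  by apply/funext => z; rewrite rev_cons -cats1 step_cat.
have -> : step t (x :: s) = step t s \o shear x.1.1 x.1.2 x.2 t by [].
apply: aut_pair_comp; last by apply: IH => y ys; apply: h; rewrite inE ys orbT.
by apply: shear_aut; apply: h; exact: mem_head.
Qed.

Lemma shear_field_loclip x : loclip (shear_field x).
Proof. by apply: loclipZ; [apply: loclip_poly; exact: loclip_aff|exact: loclip_cst]. Qed.

Lemma field_loclip s : loclip (field s).
Proof. by apply: loclip_sum => x; exact: shear_field_loclip. Qed.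

(** The local error of the scheme. Each shear is evaluated at a point displaced by a multiple of
    [t], which costs [t] times the Lipschitz constant, hence a quadratic error. *)
Lemma step_error s (r : R) : exists2 M : R, 0 <= M & forall t z, cn t <= 1 -> nn z <= r ->
  nn (step t s z - z - t *: field s z) <= M * cn t ^+ 2.
Proof.
elim: s r => [|x s IH] r.
  by exists 0 => // t z _ _; rewrite /field big_nil scaler0 /= subrr subr0 nn0 mul0r.
have [A A0 hA] := shear_field_loclip x r.
have [M M0 hM] := IH (r + A); have [L L0 hL] := field_loclip s (r + A).
exists (M + L * A) => [|t z t1 zr]; first by rewrite addr_ge0 // mulr_ge0.
have [a1 _] := hA z z zr zr.
pose z' := shear x.1.1 x.1.2 x.2 t z.
have zE : z' = z + t *: shear_field x z by rewrite /z' /shear /shear_field scalerA.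
have dz : nn (z' - z) <= cn t * A.
  by rewrite zE addrAC subrr add0r nnZ; apply: ler_wpM2l; rewrite ?cn_ge0.
have z'r : nn z' <= r + A.
  apply: (le_trans (nn_dist z' z)); apply: lerD => //; apply: (le_trans dz).
  by rewrite ler_piMl.
have zr' : nn z <= r + A by lra.
have [_ l2] := hL z' z z'r zr'.
have -> : step t (x :: s) z - z - t *: field (x :: s) z =
  (step t s z' - z' - t *: field s z') + t *: (field s z' - field s z).
  rewrite {1}/field big_cons -/(field s z) /= -/z' scalerDr scalerBr {3}zE.
  rewrite opprD !addrA; congr (_ - _).
  rewrite -[RHS]addrA addNr addr0 -!addrA; congr (_ + _); by rewrite opprD.
apply: (le_trans (nnD _ _)); rewrite mulrDl; apply: lerD; first exact: hM.
rewrite nnZ expr2 mulrA mulrC; apply: ler_wpM2r; first exact: cn_ge0.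
by apply: (le_trans l2); rewrite -mulrA [A * _]mulrC; apply: ler_wpM2l.
Qed.

Fixpoint run (s : seq shear_data) (cs : seq C) z :=
  if cs is c :: cs' then run s cs' (step c s z) else z.

Lemma run_cat s cs cs' z : run s (cs ++ cs') z = run s cs' (run s cs z).
Proof. by elim: cs z => //= c cs IH z; rewrite IH. Qed.

Lemma run_aut s cs : (forall x, x \in s -> shear_ok x) ->
  aut_pair (run s cs) (run (rev s) (rev (map -%R cs))).
Proof.
move=> h; elim: cs => [|c cs IH]; first exact: aut_pair_id.
have -> : run s (c :: cs) = run s cs \o step c s by [].
have -> : run (rev s) (rev (map -%R (c :: cs))) = step (- c) (rev s) \o run (rev s) (rev (map -%R cs)).
  by apply/funext => z; rewrite map_cons rev_cons -cats1 run_cat.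
by apply: aut_pair_comp; [exact: step_aut|exact: IH].
Qed.

(** As long as the orbit stays within [nu] of [z0], every step moves by at most
    [k * v + M * k ^+ 2]; the bound on the total keeps it there. *)
Lemma run_near s cs z0 z (r nu v k M : R) : 0 <= M -> 0 <= v -> 0 <= k -> k <= 1 ->
  (forall t z, cn t <= 1 -> nn z <= r -> nn (step t s z - z - t *: field s z) <= M * cn t ^+ 2) ->
  (forall z, nn (z - z0) <= nu -> nn z <= r /\ nn (field s z) <= v) ->
  (forall c, c \in cs -> cn c <= k) -> nn (z - z0) + (size cs)%:R * (k * v + M * k ^+ 2) <= nu ->
  nn (run s cs z - z0) <= nn (z - z0) + (size cs)%:R * (k * v + M * k ^+ 2).
Proof.
move=> M0 v0 k0 k1 hM hV; set e := k * v + _.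
have e0 : 0 <= e by rewrite addr_ge0 ?mulr_ge0 ?exprn_ge0.
elim: cs z => [|c cs IH] z hc le; first by rewrite /= mul0r addr0.
have ck : cn c <= k by apply: hc; exact: mem_head.
have se : 0 <= (size cs)%:R * e by exact: mulr_ge0.
move: le; rewrite /= -natr1 mulrDl mul1r => le.
have zn : nn (z - z0) <= nu by move: le se e0; set u := _ * e; lra.
have [v1 v2] := hV z zn.
have d1 : nn (step c s z - z) <= e.
  have := hM c z (le_trans ck k1) v1 => h.
  apply: (le_trans (nn_dist _ (c *: field s z))); rewrite nnZ; apply: lerD.
    by apply: ler_pM; rewrite ?cn_ge0 ?nn_ge0.
  apply: (le_trans h); apply: ler_wpM2l => //; apply: lerXn2r; rewrite ?nnegrE ?cn_ge0 //.
have d2 : nn (step c s z - z0) <= nn (z - z0) + e.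
  by rewrite [X in _ <= X]addrC; apply: le_trans (nn_distD z _ _) _; exact: lerD.
have H : nn (step c s z - z0) + (size cs)%:R * e <= nu.
  by move: d2 le; set u := _ * e; clear; lra.
have := IH (step c s z) _ H; move: d2; set u := _ * e => d2 {}IH.
apply: (le_trans (IH _)); last by (clear -d2; lra).
by move=> c' c's; apply: hc; rewrite inE c's orbT.
Qed.

(** A discrete Gronwall estimate against the Euler polygon [q]: the deviation grows by the factor
    [1 + k * L] in each step, plus the local error. *)
Lemma run_track s (c : nat -> C) (q : nat -> 'rV[C]_n) (r k M L : R) : 0 <= M -> 0 <= L -> 0 <= k -> k <= 1 ->
  (forall t z, cn t <= 1 -> nn z <= r -> nn (step t s z - z - t *: field s z) <= M * cn t ^+ 2) ->
  (forall z w, nn z <= r -> nn w <= r -> nn (field s z - field s w) <= L * nn (z - w)) ->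
  (forall j, cn (c j) <= k) -> (forall j, q j.+1 = q j + c j *: field s (q j)) ->
  (forall j, nn (q j) <= r - 1) ->
  forall m j z, (nn (z - q j) + m%:R * (M * k ^+ 2)) * (1 + k * L) ^+ m <= 1 ->
  nn (run s [seq c i | i <- iota j m] z - q (j + m)%N) <= (nn (z - q j) + m%:R * (M * k ^+ 2)) * (1 + k * L) ^+ m.
Proof.
move=> M0 L0 k0 k1 hM hL hc hq qr; set e := M * k ^+ 2; set g := 1 + k * L.
have e0 : 0 <= e by rewrite mulr_ge0 ?exprn_ge0.
have g1 : 1 <= g by rewrite lerDl mulr_ge0.
have g0 : 0 <= g by lra.
elim=> [|m IH] j z; first by rewrite /= addn0 mul0r addr0 mulr1.
set D := nn (z - q j) => le.
have D0 : 0 <= D by exact: nn_ge0.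
have sub : D <= (D + m.+1%:R * e) * g ^+ m.+1.
  have gm : 1 <= g ^+ m.+1 by exact: exprn_ege1.
  have : D + m.+1%:R * e <= (D + m.+1%:R * e) * g ^+ m.+1 by rewrite ler_peMr // addr_ge0 ?mulr_ge0.
  by apply: le_trans; rewrite lerDl mulr_ge0.
have D1 : D <= 1 := le_trans sub le.
have zr : nn z <= r.
  have := nn_dist z (q j); have := qr j; rewrite -/D; lra.
have qjr : nn (q j) <= r by have := qr j; lra.
have d1 : nn (step (c j) s z - q j.+1) <= e + D * g.
  rewrite hq; have -> : step (c j) s z - (q j + c j *: field s (q j)) =
    (step (c j) s z - z - c j *: field s z) + ((z - q j) + c j *: (field s z - field s (q j))).
    by apply/rowP => i; rewrite !mxE; ring.
  apply: (le_trans (nnD _ _)); apply: lerD.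
    apply: (le_trans (hM _ _ (le_trans (hc j) k1) zr)); apply: ler_wpM2l => //.
    by apply: lerXn2r; rewrite ?nnegrE ?cn_ge0.
  apply: (le_trans (nnD _ _)); rewrite -/D nnZ mulrDr mulr1 lerD2l.
  apply: (@le_trans _ _ (k * (L * D))); last by rewrite mulrA mulrC.
  by apply: ler_pM; rewrite ?cn_ge0 ?nn_ge0 // hL.
have key : (nn (step (c j) s z - q j.+1) + m%:R * e) * g ^+ m <= (D + m.+1%:R * e) * g ^+ m.+1.
  rewrite exprS mulrA; apply: ler_wpM2r; first exact: exprn_ge0.
  rewrite mulrDl; apply: (le_trans (lerD d1 (lexx _))).
  have -> : e + D * g + m%:R * e = D * g + m.+1%:R * e by rewrite -natr1; ring.
  by rewrite lerD2l ler_peMr // mulr_ge0.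
rewrite addnS -addSn /=; apply: (le_trans _ key); apply: IH.
exact: (le_trans key le).
Qed.

Lemma field_rev s z : field (rev s) z = field s z.
Proof. by rewrite /field; apply: perm_big; rewrite perm_rev. Qed.

(* An explicit Euler scheme with shears: along the segment the field points in
   the direction a, and the step lengths are chosen to move at unit speed. *)
Lemma shear_flow s p a w (g : R -> C) (K : set 'rV[C]_n) (r nu v tau eta : R) :
  (forall x, x \in s -> shear_ok x) -> 0 <= v -> 0 < tau -> tau <= nu -> 0 < eta ->
  (forall t : R, 0 <= t -> t <= 1 -> field s (p + t%:C *: w) = g t *: a /\ 1 <= cn (g t)) ->
  (forall t : R, 0 <= t -> t <= 1 -> nn (p + t%:C *: w) <= r - 1) ->
  forall u : C, w = u *: a -> cn u * v <= tau / 2 ->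
  (forall z0 z, K z0 -> nn (z - z0) <= nu -> nn z <= r /\ nn (field s z) <= v) ->
  exists f f', [/\ aut_pair f f', nn (f p - (p + w)) <= eta &
    forall z, K z -> nn (f z - z) <= tau /\ nn (f' z - z) <= tau].
Proof.
move=> ok v0 tau0 tn eta0 hg pr u wE uv hK.
have [M1 M10 hM1] := step_error s r; have [M2 M20 hM2] := step_error (rev s) r.
have [L L0 hL] := field_loclip s r.
pose M := M1 + M2; have M0 : 0 <= M by exact: addr_ge0.
pose A := cn u; have A0 : 0 <= A by exact: cn_ge0.
pose E := expR (A * L); have E0 : 0 < E by exact: expR_gt0.
pose m0 := Num.min eta 1; have m00 : 0 < m0 by rewrite lt_min eta0 /=.
have MA : 0 <= M * A ^+ 2 by rewrite mulr_ge0 ?exprn_ge0.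
(* The number [N] of steps exceeds [S]. The three summands ensure step lengths at most 1, a total
   local error at most [tau / 2], and a Gronwall bound at most [m0] at the end point. *)
pose S := A + 2 * (M * A ^+ 2) / tau + M * A ^+ 2 * E / m0.
have S1 : 0 <= 2 * (M * A ^+ 2) / tau by rewrite divr_ge0 ?(ltW tau0) // mulr_ge0.
have S2 : 0 <= M * A ^+ 2 * E / m0 by rewrite divr_ge0 ?(ltW m00) // mulr_ge0 // ltW.
have S0 : 0 <= S by rewrite !addr_ge0.
pose N := (Num.bound S).+1.
have SN : S <= N%:R.
  apply: (@le_trans _ _ (Num.bound S)%:R); first by apply: ltW; exact: archi_boundP.
  by rewrite ler_nat.
have N0 : 0 < N%:R :> R by rewrite ltr0n.
pose k := A / N%:R.
have k0 : 0 <= k by rewrite divr_ge0 // ltW.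
have kN : N%:R * k = A by rewrite /k mulrC divfK // gt_eqF.
have k1 : k <= 1 by rewrite ler_pdivrMr // mul1r; move: SN; rewrite /S; clear -S2 S1; lra.
have Mk : N%:R * (M * k ^+ 2) = M * A ^+ 2 / N%:R by rewrite -kN; field; rewrite gt_eqF.
have Mk1 : N%:R * (M * k ^+ 2) <= tau / 2.
  rewrite Mk ler_pdivrMr // [tau / 2 * _]mulrC -ler_pdivrMr ?divr_gt0 //.
  have -> : M * A ^+ 2 / (tau / 2) = 2 * (M * A ^+ 2) / tau by field; rewrite gt_eqF.
  by move: SN; rewrite /S; clear -S2 A0; lra.
have Mk2 : N%:R * (M * k ^+ 2) * E <= m0.
  rewrite Mk mulrAC ler_pdivrMr // [m0 * _]mulrC -ler_pdivrMr //.
  by move: SN; rewrite /S; clear -S1 A0; lra.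
(* Capped at [N], so that the polygon [q] is defined for all [j] and rests after step [N]. *)
pose t j : R := (Num.min j%:R N%:R) / N%:R.
have t0 j : 0 <= t j by rewrite divr_ge0 ?(ltW N0) // le_min ler0n ltW.
have t1 j : t j <= 1 by rewrite ler_pdivrMr // mul1r ge_min lexx orbT.
(* Complex time: dividing by the value [g] of the field makes the Euler polygon run exactly along
   the segment. As [g] is at least 1 in modulus, the steps stay short. *)
pose c j : C := (t j.+1 - t j)%:C * u / g (t j).
pose q j := p + (t j)%:C *: w.
have tS j : 0 <= t j.+1 - t j /\ t j.+1 - t j <= 1 / N%:R.
  rewrite /t -mulrBl; have [jN|jN] := ltnP j N.
    rewrite !min_l ?ler_nat // ?(ltnW jN) // -natr1 addrAC subrr add0r; split => //.
  have jN1 : (N <= j.+1)%N by exact: leqW.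
  by rewrite !min_r ?ler_nat // subrr mul0r; split => //; rewrite divr_ge0 // ltW.
have ck j : cn (c j) <= k.
  have [_ g1] := hg (t j) (t0 j) (t1 j); have [s0 s1] := tS j.
  rewrite /c !cnM cnV cn_real (ger0_norm s0) ler_pdivrMr; last by (clear -g1; lra).
  apply: (@le_trans _ _ k); last by rewrite ler_peMr.
  by rewrite /k -/A mulrC; apply: ler_wpM2l => //; rewrite -div1r.
have qS j : q j.+1 = q j + c j *: field s (q j).
  have [-> g1] := hg (t j) (t0 j) (t1 j).
  have gn : g (t j) != 0 by rewrite -cn_gt0; clear -g1; lra.
  rewrite scalerA /c divfK // /q -addrA; congr (_ + _); rewrite wE !scalerA -scalerDl; congr (_ *: _).
  by rewrite rmorphB /=; ring.
have qr j : nn (q j) <= r - 1 by apply: pr.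
pose cs := [seq c i | i <- iota 0 N].
have szc : size cs = N by rewrite size_map size_iota.
exists (run s cs), (run (rev s) (rev (map -%R cs))); split.
- exact: run_aut.
- have q0 : q 0%N = p by rewrite /q /t min_l ?ler0n // mul0r scale0r addr0.
  have qN : q N = p + w by rewrite /q /t min_l // divff ?gt_eqF // scale1r.
  have kL : (1 + k * L) ^+ N <= E.
    apply: (@le_trans _ _ (expR (k * L) ^+ N)).
      apply: lerXn2r; rewrite ?nnegrE ?expR_ge0 ?expR_ge1Dx // addr_ge0 // mulr_ge0 //.
    by rewrite -expRM_natl /E mulrA kN.
  have Mk0 : 0 <= N%:R * (M * k ^+ 2) by rewrite mulr_ge0 // mulr_ge0 // exprn_ge0.
  have lem : (nn (p - q 0%N) + N%:R * (M * k ^+ 2)) * (1 + k * L) ^+ N <= m0.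
    rewrite q0 subrr nn0 add0r; apply: le_trans Mk2; exact: ler_wpM2l.
  have hM t' z' : cn t' <= 1 -> nn z' <= r -> nn (step t' s z' - z' - t' *: field s z') <= M * cn t' ^+ 2.
    move=> t1' zr; apply: (le_trans (hM1 _ _ t1' zr)); apply: ler_wpM2r; rewrite ?exprn_ge0 ?cn_ge0 //.
    by rewrite lerDl.
  have hL' z' w' : nn z' <= r -> nn w' <= r -> nn (field s z' - field s w') <= L * nn (z' - w').
    by move=> z1 w1; have [] := hL z' w' z1 w1.
  have := @run_track s c q r k M L M0 L0 k0 k1 hM hL' ck qS qr N 0%N p.
  rewrite add0n qN -/cs => H; apply: (le_trans (H _)); apply: (le_trans lem).
    by rewrite ge_min lexx orbT.
  by rewrite ge_min lexx.
move=> z Kz.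
have e1 : N%:R * (k * v + M * k ^+ 2) <= tau.
  by rewrite mulrDr mulrA kN; move: uv Mk1; rewrite -/A; clear; lra.
split.
  apply: le_trans e1; have := @run_near s cs z z r nu v k M M0 v0 k0 k1.
  rewrite subrr nn0 add0r szc; apply.
  - move=> t' z' t1' zr; apply: (le_trans (hM1 _ _ t1' zr)); apply: ler_wpM2r; rewrite ?exprn_ge0 ?cn_ge0 //.
    by rewrite lerDl.
  - by move=> z' z'n; exact: hK Kz z'n.
  - by move=> c' /mapP[j _ ->].
  - by apply: le_trans tn; rewrite mulrDr mulrA kN; move: uv Mk1; rewrite -/A; lra.
apply: le_trans e1; have := @run_near (rev s) (rev (map -%R cs)) z z r nu v k M M0 v0 k0 k1.
rewrite subrr nn0 add0r size_rev size_map szc; apply.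
- move=> t' z' t1' zr; apply: (le_trans (hM2 _ _ t1' zr)); apply: ler_wpM2r; rewrite ?exprn_ge0 ?cn_ge0 //.
  by rewrite lerDr.
- by move=> z' z'n; rewrite field_rev; exact: hK Kz z'n.
- by move=> c'; rewrite mem_rev => /mapP[y /mapP[j _ ->] ->]; rewrite cnN.
- by apply: le_trans tn; rewrite mulrDr mulrA kN; move: uv Mk1; rewrite -/A; lra.
Qed.

End Euler.

(** * Polynomials as sums of powers of affine forms *)

Section Spanned.
Context {R : realType}.
Local Notation C := (R[i]).
Variable n : nat.
Implicit Types (z w a p : 'rV[C]_n) (G H : 'rV[C]_n -> C).

Definition power_sum (s : seq (C * (C * 'rV[C]_n) * nat)) z : C := \sum_(x <- s) x.1.1 * aff x.1.2 z ^+ x.2.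

(** Hamiltonians of this form generate sums of shear fields. By the polarisation in [power_product]
    the class is closed under products, so it contains all polynomials in the coordinates. *)
Definition spanned G := exists s, G =1 power_sum s.

Lemma spanned_ext G H : spanned G -> G =1 H -> spanned H.
Proof. by move=> [s hs] GH; exists s => z; rewrite -GH. Qed.

Lemma spanned_aff l m : spanned (fun z => aff l z ^+ m).
Proof. by exists [:: (1, l, m)] => z; rewrite /power_sum big_seq1 mul1r. Qed.

Lemma spannedD G H : spanned G -> spanned H -> spanned (fun z => G z + H z).
Proof. by move=> [s hs] [u hu]; exists (s ++ u) => z; rewrite /power_sum big_cat hs hu. Qed.

Lemma spannedZ G (c : C) : spanned G -> spanned (fun z => c * G z).
Proof.
move=> [s hs]; exists [seq (c * x.1.1, x.1.2, x.2) | x <- s] => z.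
by rewrite /power_sum big_map hs mulr_sumr; apply: eq_bigr => x _; rewrite mulrA.
Qed.

Lemma spanned_sum (I : Type) (s : seq I) (F : I -> 'rV[C]_n -> C) :
  (forall i, spanned (F i)) -> spanned (fun z => \sum_(i <- s) F i z).
Proof.
move=> h; elim: s => [|i s IH]; first by exists [::] => z; rewrite /power_sum !big_nil.
by apply: spanned_ext (spannedD (h i) IH) _ => z; rewrite big_cons.
Qed.

Lemma spanned_cst (c : C) : spanned (fun=> c).
Proof. by exists [:: (c, (0, 0), 0%N)] => z; rewrite /power_sum big_seq1 expr0 mulr1. Qed.

Lemma spanned_coord i : spanned (fun z => z 0 i : C).
Proof.
apply: spanned_ext (spanned_aff (0, delta_mx 0 i) 1) _ => z.
rewrite expr1 /aff /= add0r (bigD1 i) //= big1 ?addr0 => [|j ji]; first by rewrite mxE !eqxx mul1r.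
by rewrite mxE (negbTE ji) andbF mul0r.
Qed.

Lemma coef_affine_exp (x y : C) k j : ((x%:P + y *: 'X) ^+ k)`_j = (x ^+ (k - j) * y ^+ j) *+ 'C(k, j).
Proof.
rewrite exprDn coef_sum; under eq_bigr => i _.
  rewrite exprZn -scalerAr -rmorphXn /= coefMn coefZ coefCM coefXn.
  over.
have [jk|kj] := ltnP j k.+1.
  rewrite (bigD1 (Ordinal jk)) //= eqxx mulr1 big1 ?addr0 1?mulrC // => i ij.
  case: eqP => [e|_]; last by rewrite !mulr0 mul0rn.
  by case/eqP: ij; apply: val_inj.
rewrite bin_small // mulr0n big1 // => i _; case: eqP => [e|_]; last by rewrite !mulr0 mul0rn.
by move: kj; rewrite e leqNgt ltn_ord.
Qed.

(* x^k y^m is a coefficient of (x + y X)^(k + m), hence by interpolation a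
   combination of the powers (x + t y)^(k + m) at the nodes t. *)
Lemma power_product (k m : nat) : exists u : 'I_(k + m).+1 -> C, forall x y : C,
  x ^+ k * y ^+ m = \sum_l u l * (x + (lnode 1 (k + m).+1 l)%:C * y) ^+ (k + m).
Proof.
pose T := (k + m).+1; have d0 : (1 : R) != 0 by exact: oner_neq0.
exists (fun l => ('C(k + m, m)%:R)^-1 * (node_poly (1 : R) l)`_m) => x y.
pose p : {poly C} := (x%:P + y *: 'X) ^+ (k + m).
have sp : (size p <= T)%N.
  apply: (leq_trans (size_poly_exp_leq _ _)); rewrite ltnS.
  have s2 : (size (x%:P + y *: 'X)%R <= 2)%N.
    apply: (leq_trans (size_polyD _ _)); rewrite geq_max (leq_trans (size_polyC_leq1 _)) //=.
    by apply: (leq_trans (size_scale_leq _ _)); rewrite size_polyX.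
  by rewrite -[X in (_ <= X)%N]mul1n leq_mul2r; case: (size _) s2 => [|[|[|]]] //; rewrite ?orbT.
pose q := \sum_(l < T) p.[(lnode 1 T l)%:C] *: node_poly (1 : R) l.
have pq : p = q.
  apply/eqP; rewrite -subr_eq0; apply/negPn/negP => /closed_nonrootP[t].
  rewrite /root hornerD hornerN {1}(node_interpolation t d0 sp) /q horner_sum.
  under [X in _ - X]eq_bigr do rewrite hornerZ.
  by rewrite subrr eqxx.
have b0 : ('C(k + m, m)%:R : C) != 0 by rewrite pnatr_eq0 -lt0n bin_gt0 leq_addl.
have : p`_m = q`_m by rewrite {1}pq.
rewrite /p coef_affine_exp addnK -mulr_natr /q coef_sum => h.
apply: (mulIf b0); rewrite h mulr_suml; apply: eq_bigr => l _.
rewrite coefZ /p horner_exp !hornerE [y * _]mulrC; field.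
exact: b0.
Qed.

Lemma spannedM G H : spanned G -> spanned H -> spanned (fun z => G z * H z).
Proof.
move=> [s hs] [u hu].
have pp l l' k m : spanned (fun z => aff l z ^+ k * aff l' z ^+ m).
  have [c hc] := power_product k m.
  apply: (@spanned_ext (fun z => \sum_(j < (k + m).+1) c j *
     aff (l.1 + (lnode 1 (k + m).+1 j)%:C * l'.1, l.2 + (lnode 1 (k + m).+1 j)%:C *: l'.2) z ^+ (k + m))).
    by apply: spanned_sum => j; apply: spannedZ; exact: spanned_aff.
  move=> z; rewrite hc; apply: eq_bigr => j _; congr (_ * _ ^+ _).
  rewrite /aff /= mulrDr addrACA; congr (_ + _); rewrite mulr_sumr -big_split; apply: eq_bigr => i _.
  by rewrite !mxE /=; ring.
apply: (@spanned_ext (fun z => \sum_(x <- s) \sum_(y <- u) (x.1.1 * y.1.1) * (aff x.1.2 z ^+ x.2 * aff y.1.2 z ^+ y.2))).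
  by apply: spanned_sum => x; apply: spanned_sum => y; apply: spannedZ; exact: pp.
move=> z; rewrite hs hu /power_sum mulr_suml; apply: eq_bigr => x _.
by rewrite mulr_sumr; apply: eq_bigr => y _; rewrite mulrACA.
Qed.

Lemma spannedX G k : spanned G -> spanned (fun z => G z ^+ k).
Proof.
move=> h; elim: k => [|k IH]; first exact: spanned_cst.
by apply: spanned_ext (spannedM h IH) _ => z; rewrite exprS.
Qed.

Lemma spanned_prod (I : Type) (s : seq I) (F : I -> 'rV[C]_n -> C) :
  (forall i, spanned (F i)) -> spanned (fun z => \prod_(i <- s) F i z).
Proof.
move=> h; elim: s => [|i s IH]; first by apply: spanned_ext (spanned_cst 1) _ => z; rewrite big_nil.
by apply: spanned_ext (spannedM (h i) IH) _ => z; rewrite big_cons.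
Qed.

Lemma spanned_poly (q : {poly C}) G : spanned G -> spanned (fun z => q.[G z]).
Proof.
move=> h; elim/poly_ind: q => [|q c IH].
  by apply: spanned_ext (spanned_cst 0) _ => z; rewrite horner0.
by apply: spanned_ext (spannedD (spannedM IH h) (spanned_cst c)) _ => z; rewrite !hornerE.
Qed.

Lemma spanned_diff G x : spanned G -> differentiable G x.
Proof.
move=> [s hs]; have -> : G = power_sum s by exact/funext.
apply: df_sum => y _; apply: dfM; first exact: df_cst.
have -> : (fun z => aff y.1.2 z ^+ y.2) = (fun z => ('X^(y.2)).[aff y.1.2 z]).
  by apply/funext => z; rewrite hornerXn.
by apply: df_poly; exact: aff_diff.
Qed.

Lemma spanned_loclip G : spanned G -> loclip G.
Proof.
move=> [s hs]; have -> : G = power_sum s by exact/funext.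
apply: loclip_sum => y.
have -> : (fun z => y.1.1 * aff y.1.2 z ^+ y.2) = (fun z => y.1.1 *: ('X^(y.2)).[aff y.1.2 z]).
  by apply/funext => z; rewrite hornerXn.
apply: loclipZ; first exact: loclip_cst.
by apply: loclip_poly; exact: loclip_aff.
Qed.

(** The Hamiltonian field, in the plane of the coordinates [i] and [b], of a multiple of a power of
    an affine form. Its direction is killed by the linear part of the form. *)
Definition ham_shear i b (x : C * (C * 'rV[C]_n) * nat) : shear_data n :=
  ((x.1.1 * x.2%:R) *: 'X^(x.2.-1), x.1.2, x.1.2.2 0 b *: delta_mx 0 i - x.1.2.2 0 i *: delta_mx 0 b).

Lemma ham_shear_ok i b x : shear_ok (ham_shear i b x).
Proof.
rewrite /shear_ok /=; set m := x.1.2.2.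
under eq_bigr do rewrite !mxE eqxx /= mulrBr.
rewrite sumrB (bigD1 i) //= big1 ?addr0 => [|j ji]; last by rewrite (negbTE ji) !mulr0.
rewrite (bigD1 b) //= big1 ?addr0 => [|j ji]; last by rewrite (negbTE ji) !mulr0.
by rewrite !eqxx !mulr1 mulrC subrr.
Qed.

Lemma cdiff_pow (u v : C) m : cdiff (fun t => (u + t * v) ^+ m) 0 (m%:R * u ^+ m.-1 * v).
Proof.
elim: m => [|m IH]; first by rewrite !mul0r; apply: cdiff_eq (cdiff_cst _ _) _.
have h1 : cdiff (fun t => u + t * v) 0 v.
  apply: cdiff_eq (cdiffD (cdiff_cst u 0) (cdiffM (cdiff_id 0) (cdiff_cst v 0))) _.
  by rewrite mul1r mulr0 addr0 add0r.
have := cdiffM h1 IH; rewrite mul0r addr0 => h2.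
have -> : (fun t => (u + t * v) ^+ m.+1) = (fun t => (u + t * v) * (u + t * v) ^+ m).
  by apply/funext => t; rewrite exprS.
apply: cdiff_eq h2 _; rewrite -natr1 /=.
by case: m {IH} => [|m]; rewrite ?mul0r ?mulr0 ?addr0 ?add0r ?expr0 ?exprS ?mulr1 ?mul1r //=; ring.
Qed.

Lemma cdiff_big_sum (I : Type) (s : seq I) (F : I -> C -> C) (D : I -> C) (x : C) :
  (forall i, cdiff (F i) x (D i)) -> cdiff (fun t => \sum_(i <- s) F i t) x (\sum_(i <- s) D i).
Proof.
move=> h; elim: s => [|i s IH].
  rewrite big_nil (_ : (fun t => _) = (fun=> 0)); first exact: cdiff_cst.
  by apply/funext => t; rewrite big_nil.
rewrite big_cons (_ : (fun t => _) = (fun t => F i t + \sum_(i <- s) F i t)); first exact: cdiffD.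
by apply/funext => t; rewrite big_cons.
Qed.

Lemma spanned_field G i b : spanned G -> exists s, (forall x, x \in s -> shear_ok x) /\
  forall z, exists db di : C, [/\ cdiff (fun t => G (z + t *: delta_mx 0 b)) 0 db,
    cdiff (fun t => G (z + t *: delta_mx 0 i)) 0 di &
    field s z = db *: delta_mx 0 i - di *: delta_mx 0 b].
Proof.
move=> [s hs]; exists (map (ham_shear i b) s); split.
  by move=> _ /mapP[x _ ->]; exact: ham_shear_ok.
move=> z; pose D j : C := \sum_(x <- s) x.1.1 * (x.2%:R * aff x.1.2 z ^+ x.2.-1 * x.1.2.2 0 j).
have hD j : cdiff (fun t => G (z + t *: delta_mx 0 j)) 0 (D j).
  rewrite (_ : (fun t => _) = (fun t => \sum_(x <- s) x.1.1 * (aff x.1.2 z + t * x.1.2.2 0 j) ^+ x.2)).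
    apply: cdiff_big_sum => x.
    apply: cdiff_eq (cdiffM (cdiff_cst _ _) (cdiff_pow _ _ _)) _; by rewrite mul0r add0r.
  apply/funext => t; rewrite hs /power_sum; apply: eq_bigr => x _; congr (_ * _ ^+ _).
  rewrite aff_dir; congr (_ + _ * _); rewrite (bigD1 j) //= big1 ?addr0 => [|k kj].
    by rewrite mxE !eqxx mulr1.
  by rewrite mxE (negbTE kj) andbF mulr0.
exists (D b), (D i); split => //.
rewrite /field big_map /D !scaler_suml -sumrB; apply: eq_bigr => x _.
rewrite /shear_field /= hornerZ hornerXn scalerBr !scalerA.
by congr (_ *: _ - _ *: _); ring.
Qed.

Lemma spanned_field_bound G i b s z (nu M : R) : spanned G -> 0 < nu ->
  (exists db di : C, [/\ cdiff (fun t => G (z + t *: delta_mx 0 b)) 0 db,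
    cdiff (fun t => G (z + t *: delta_mx 0 i)) 0 di &
    field s z = db *: delta_mx 0 i - di *: delta_mx 0 b]) ->
  (forall y, nn (y - z) <= nu -> cn (G y) <= M) -> nn (field s z) <= 8 * M / nu.
Proof.
move=> hG nu0 [db [di [hb hi ->]]] hM.
have H j (dj : C) : cdiff (fun t => G (z + t *: delta_mx 0 j)) 0 dj -> cn dj <= 4 * M / nu.
  move=> hj; rewrite (cdiff_uniq hj (cdiff_deriv hj)); apply: cauchy_estimate => //.
    by move=> t _; eexists; apply: cdiff_slice; exact: spanned_diff.
  move=> t; rewrite subr0 => tn; apply: hM; rewrite addrAC subrr add0r nn_delta; exact: ltW.
apply: (le_trans (nnD _ _)); rewrite nnN !nn_delta.
have := H _ _ hb; have := H _ _ hi; have -> : 8 * M / nu = 4 * M / nu + 4 * M / nu by ring.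
by move=> h1 h2; exact: lerD.
Qed.

End Spanned.

(** * Hamiltonians concentrated on a segment *)

Section Move.
Context {R : realType}.
Local Notation C := (R[i]).

Definition grid_poly n (v0 : 'rV[C]_n) (dl : R) T (v : {ffun 'I_n -> 'I_T} -> C) (z : 'rV[C]_n) : C :=
  \sum_b v b * grid_basis v0 dl b z.

Lemma grid_poly_line n (v0 : 'rV[C]_n) (dl : R) T (v : {ffun 'I_n -> 'I_T} -> C) (z : 'rV[C]_n) (i : 'I_n) : exists s : {poly C},
  (size s <= T)%N /\ forall x, s.[x] = grid_poly v0 dl v (z + x *: delta_mx 0 i).
Proof.
exists (\sum_b (v b * \prod_(j | j != i) (node_poly dl (b j)).[z 0 j - v0 0 j]) *:
   (node_poly dl (b i) \Po ('X + (z 0 i - v0 0 i)%:P))); split.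
  apply: (leq_trans (size_sum _ _ _)); apply/bigmax_leqP => b _.
  apply: (leq_trans (size_scale_leq _ _)); rewrite size_comp_poly2 ?size_XaddC //.
  exact: size_node_poly.
move=> x; rewrite horner_sum; apply: eq_bigr => b _; rewrite hornerZ horner_comp -mulrA; congr (_ * _).
rewrite /grid_basis [in RHS](bigD1 i) //= mulrC; congr (_ * _).
  have -> : (z + x *: delta_mx 0 i) 0 i - v0 0 i = x + (z 0 i - v0 0 i) by rewrite !mxE !eqxx mulr1; ring.
  by rewrite !hornerE.
by apply: eq_bigr => j ji; rewrite !mxE (negbTE ji) andbF mulr0 addr0.
Qed.

Lemma grid_poly_spanned n (v0 : 'rV[C]_n) (dl : R) T (v : {ffun 'I_n -> 'I_T} -> C) : spanned (grid_poly v0 dl v).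
Proof.
apply: spanned_sum => b; apply: spannedZ; apply: spanned_prod => i.
apply: (@spanned_poly _ _ _ (fun z => z 0 i - v0 0 i)).
by apply: spannedD; [exact: spanned_coord|exact: spanned_cst].
Qed.

Lemma geometric_small (q M e : R) : 0 <= q -> q < 1 -> 0 <= M -> 0 < e -> exists s : nat, M * q ^+ s <= e.
Proof.
move=> q0 q1 M0 e0; have M1 : 0 < M + 1 by lra.
have := @cvg_expr R q; rewrite ger0_norm // => /(_ q1) /cvgrPdist_lt.
move=> /(_ (e / (M + 1)) (divr_gt0 e0 M1)) [N _ /(_ N (leqnn _))].
rewrite /= sub0r normrN ger0_norm ?exprn_ge0 // ltr_pdivlMr // => h; exists N.
apply: le_trans (ltW h); rewrite mulrC; apply: ler_wpM2l; [exact: exprn_ge0|lra].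
Qed.

Lemma half_expr (T : nat) (x : R) : (0 < T)%N -> 0 <= x -> x <= 1 / 2 -> x ^+ T <= 1 / 2.
Proof.
case: T => // T _ x0 x1; rewrite exprS; apply: (le_trans _ x1); rewrite ler_piMr //.
by apply: exprn_ile1 => //; lra.
Qed.

(* The polynomial controlling the motion: of modulus at least 1 along a segment
   ending near e, and at most 1/2 on the polydisc and on X. *)
Lemma controlling_polynomial d (X : set 'rV[C]_d.+1) (c e : 'rV[C]_d.+1) (i : 'I_d.+1) (r L Lb eta : R) :
  analytic_subvariety X -> X <> setT -> 0 <= r -> 0 <= L -> 0 <= Lb -> 0 < eta -> r < cn (e 0 i - c 0 i) ->
  exists (p : 'rV[C]_d.+1) (u : C) (h : 'rV[C]_d.+1 -> C),
  [/\ Lb < nn p, nn (p + u *: delta_mx 0 i - e) <= eta, spanned h,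
      forall t : R, 0 <= t -> t <= 1 -> 1 <= cn (h (p + (t%:C * u) *: delta_mx 0 i)) &
      forall z, nn (z - c) <= r \/ (X z /\ nn z <= L) -> cn (h z) <= 1 / 2].
Proof.
move=> hX Xp r0 L0 Lb0 eta0; set ei := e 0 i - c 0 i; set rho := cn ei => re.
have rho0 : 0 < rho by lra.
pose mu := (rho - r) / 4; have mu0 : 0 < mu by rewrite divr_gt0 // subr_gt0.
pose m1 := Num.min (eta / 4) mu; have m10 : 0 < m1 by rewrite lt_min divr_gt0.
have m1e : m1 <= eta / 4 by rewrite ge_min lexx.
have m1m : m1 <= mu by rewrite ge_min lexx orbT.
pose dl := Num.min 1 m1; have dl0 : 0 < dl by rewrite lt_min ltr01.
have dl1 : dl <= 1 by rewrite ge_min lexx.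
have dlm : dl <= m1 by rewrite ge_min lexx orbT.
pose la := (Lb + nn e + 2) / rho.
have la0 : 0 < la by rewrite divr_gt0 // ; have := nn_ge0 e; lra.
(* Up to small corrections, the segment approaches [e] radially in the [i]-th coordinate: its
   distance from [c 0 i] shrinks from [(1 + la) * rho] to [rho], so it stays above [r + mu], and the
   starting point is as far away as required. *)
pose W : C := - (la%:C * ei).
have Wn : cn W = Lb + nn e + 2 by rewrite cnN cnM cn_real gtr0_norm // /la -/rho divfK // gt_eqF.
have W0 : 0 < cn W by rewrite Wn; have := nn_ge0 e; lra.
(* The tilt of the segment, found only later, then displaces its end by at most [m1]. *)
pose eta1 := Num.min 1 (m1 / cn W); have eta10 : 0 < eta1 by rewrite lt_min ltr01 divr_gt0.
have eta11 : eta1 <= 1 by rewrite ge_min lexx.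
have eta1W : eta1 * cn W <= m1 by rewrite -ler_pdivlMr // ge_min lexx orbT.
pose v0 := e - W *: delta_mx 0 i.
(* [c1 ^+ T] is the lower bound that [tilted_segment] gives for the polynomial on the segment. *)
pose c1 := eta1 / 128; have c10 : 0 < c1 by rewrite divr_gt0.
have c11 : c1 <= 1 by rewrite /c1; lra.
pose C0 := 16 * (r + nn (c - v0) + dl) / dl.
have C00 : 0 <= C0 by rewrite divr_ge0 ?(ltW dl0) // mulr_ge0 // ; have := nn_ge0 (c - v0); lra.
have rm0 : 0 < r + mu by lra.
pose th := r / (r + mu).
have th0 : 0 <= th by rewrite divr_ge0 // ltW.
have th1 : th < 1 by rewrite ltr_pdivrMr // mul1r; lra.
have c12 : 0 < c1 / 2 by lra.
have C0n : 0 <= C0 ^+ d.+1 by exact: exprn_ge0.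
(* On the polydisc the polynomial may be as large as [C0 ^+ d.+1] to the power [T]. The [sg * T]-th
   power of the normalised [i]-th coordinate, at least 1 in modulus on the segment, compensates for
   this and for the division by [c1 ^+ T]. *)
have [sg hsg] := geometric_small th0 th1 C0n c12.
pose Th := Num.max 1 ((L + nn c) / (r + mu)).
have Th1 : 1 <= Th by rewrite le_max lexx.
pose C1 := (2 * (16 * (L + 2 + nn v0 + dl) / dl)) ^+ d.+1.
have C11 : 1 <= C1.
  apply: exprn_ege1; rewrite -[1]mulr1; apply: ler_pM => //; first by (clear; lra).
  by rewrite ler_pdivlMr // mul1r; have := nn_ge0 v0; clear -L0 dl0; lra.
(* On [X] the decay must beat the bound [C1] of the polynomial, the growth [Th ^+ sg] of the
   coordinate factor and the division by [c1], with 1/2 to spare; all of them enter to the power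
   [T]. *)
pose a := 2 * C1 * Th ^+ sg / c1.
have Thsg : 1 <= Th ^+ sg by exact: exprn_ege1.
have a1 : 1 <= a.
  rewrite ler_pdivlMr // mul1r; apply: (le_trans c11).
  by rewrite -[1]mulr1; apply: ler_pM => //; rewrite -[1]mulr1; apply: ler_pM => //; clear; lra.
have a0 : 0 < a by (clear -a1; lra).
have [T [v [T0 v1 [g vg] hP]]] := siegel_polynomial v0 hX Xp L0 a1 dl0.
pose P := grid_poly v0 dl v.
pose nd := \row_j (lnode dl T (g j))%:C : 'rV[C]_d.+1.
have ndn j : cn (nd 0 j) <= dl.
  by rewrite mxE cn_real; have [q1 q2] := lnode_ge0 (g j) dl0; rewrite ger0_norm // ltW.
pose p := v0 + nd.
have Pp : P p = 1.
  rewrite /P /grid_poly /p (bigD1 g) //= big1 ?addr0 => [|b bg].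
    by rewrite grid_basis_node // eqxx mulr1.
  by rewrite grid_basis_node // eq_sym (negbTE bg) mulr0.
have [s [ss sE]] := @grid_poly_line _ v0 dl T v p i.
have s1 : s.[0] = 1 by rewrite sE scale0r addr0 -/P.
have [si /andP[si0 si1] hs] := tilted_segment W ss T0 s1 eta10 eta11.
pose u : C := Complex 1 si * W.
have uW : u = W + Complex 0 si * W.
  have cE : Complex 1 si = 1 + Complex 0 si by apply/eqP; rewrite eq_complex /= addr0 add0r !eqxx.
  by rewrite /u cE mulrDl mul1r.
have uWn : cn (Complex 0 si * W) <= m1.
  rewrite cnM; have -> : cn (Complex 0 si) = si.
    have -> : Complex 0 si = Complex 0 1 * si%:C by apply/eqP; rewrite eq_complex /= !mul0r !mulr0 mul1r subrr add0r !eqxx.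
    by rewrite cnM cn_i mul1r cn_real ger0_norm.
  by apply: le_trans eta1W; apply: ler_wpM2r; [exact: ltW|exact: ltW].
have c1T : 0 < c1 ^+ T by exact: exprn_gt0.
pose h z := ((c1 ^+ T)^-1)%:C * (P z * (((r + mu)^-1)%:C * (z 0 i - c 0 i)) ^+ (sg * T)).
have hn z : cn (h z) = (c1 ^+ T)^-1 * (cn (P z) * (cn (z 0 i - c 0 i) / (r + mu)) ^+ (sg * T)).
  rewrite /h !cnM cnX cnM !cn_real !ger0_norm ?invr_ge0 ?(ltW c1T) ?(ltW rm0) //.
  by rewrite [(_)^-1 * cn _]mulrC.
exists p, u, h; split.
- have h1 : cn (p 0 i) <= nn p by exact: nn_coord.
  apply: lt_le_trans h1; have -> : p 0 i = (- W) + (e 0 i + nd 0 i).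
    by rewrite /p /v0 !mxE !eqxx mulr1; ring.
  have := cn_dist (- W) (- W + (e 0 i + nd 0 i)).
  have -> : - W - (- W + (e 0 i + nd 0 i)) = - (e 0 i + nd 0 i) by ring.
  rewrite (cnN W) (cnN (e 0 i + nd 0 i)) Wn.
  have := cnD (e 0 i) (nd 0 i); have := ndn i; have := nn_coord e i; lra.
- apply: nn_le => [|j]; first exact: ltW.
  rewrite !mxE eqxx /=; have [->|ji] := eqVneq j i.
    rewrite !mulr1; have -> : e 0 i - W + (lnode dl T (g i))%:C + u - e 0 i = nd 0 i + (u - W) by rewrite mxE; ring.
    apply: (le_trans (cnD _ _)); have := ndn i; rewrite uW [W + _]addrC addrK; lra.
  rewrite !mulr0 subr0 addr0 addrAC subrr add0r; have := ndn j; rewrite mxE; lra.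
- apply: spannedZ; apply: spannedM; first exact: grid_poly_spanned.
  apply: spannedX; apply: spannedZ; apply: spannedD; [exact: spanned_coord|exact: spanned_cst].
- move=> t t0 t1; rewrite hn.
  have h1 : c1 ^+ T <= cn (P (p + (t%:C * u) *: delta_mx 0 i)) by rewrite /P -sE; exact: hs.
  have h2 : 1 <= cn ((p + (t%:C * u) *: delta_mx 0 i) 0 i - c 0 i) / (r + mu).
    rewrite ler_pdivlMr // mul1r.
    have laE : (1 + la * (1 - t))%:C = 1 + la%:C * (1 - t%:C).
      by rewrite !(rmorphD, rmorphM, rmorphN, rmorph1).
    have -> : (p + (t%:C * u) *: delta_mx 0 i) 0 i - c 0 i =
       (1 + la * (1 - t))%:C * ei + (nd 0 i + t%:C * (Complex 0 si * W)).
      rewrite laE uW !mxE !eqxx !mulr1 /W /ei.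
      by set si' := Complex 0 si; ring.
    set A := (1 + _)%:C * ei; set B := nd 0 i + _.
    have A1 : rho <= cn A.
      have l1 : 0 <= la * (1 - t) by apply: mulr_ge0; [exact: ltW|rewrite subr_ge0].
      have l2 : 0 <= 1 + la * (1 - t) by exact: addr_ge0.
      rewrite /A cnM cn_real (ger0_norm l2) -/rho; apply: ler_peMl; first exact: ltW.
      by rewrite lerDl.
    have B1 : cn B <= m1 + m1.
      apply: (le_trans (cnD _ _)); apply: lerD; first by apply: le_trans (ndn i) _.
      rewrite cnM cn_real ger0_norm //; apply: le_trans uWn; rewrite ler_piMl ?cn_ge0 //.
    have := cn_dist A (A + B); have -> : A - (A + B) = - B by ring.
    rewrite (cnN B).
    by rewrite /mu in m1m mu0 *; lra.
  rewrite mulrC ler_pdivlMr // mul1r; apply: (le_trans h1); rewrite ler_peMr ?cn_ge0 //.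
  exact: exprn_ege1.
move=> z hz; rewrite hn.
suff [x [x0 x1 hx]] : exists x : R, [/\ 0 <= x, x <= 1 / 2 &
   (c1 ^+ T)^-1 * (cn (P z) * (cn (z 0 i - c 0 i) / (r + mu)) ^+ (sg * T)) <= x ^+ T].
  by apply: (le_trans hx); exact: half_expr.
have zc0 : 0 <= cn (z 0 i - c 0 i) / (r + mu) by rewrite divr_ge0 ?cn_ge0 // ltW.
have zcn : cn (z 0 i - c 0 i) <= nn (z - c) by have := nn_coord (z - c) i; rewrite !mxE.
case: hz => [zF|[Xz zL]].
  exists (c1^-1 * (C0 ^+ d.+1 * th ^+ sg)); split.
  - by rewrite !mulr_ge0 ?invr_ge0 ?exprn_ge0 // ltW.
  - by rewrite mulrC ler_pdivrMr //; lra.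
  rewrite [X in _ <= X]exprMn [c1^-1 ^+ T]exprVn [(_ * th ^+ sg) ^+ T]exprMn.
  apply: ler_wpM2l; first by rewrite invr_ge0 ltW.
  apply: ler_pM; rewrite ?cn_ge0 ?exprn_ge0 //.
    rewrite -exprM mulnC; apply: (le_trans (cn_sum _ _ _)).
    apply: (@le_trans _ _ (\sum_b cn (grid_basis v0 dl b z))).
      apply: ler_sum => b _; rewrite cnM ler_piMl ?cn_ge0 // v1.
    apply: grid_basis_sum => //; first by have := nn_ge0 (c - v0); lra.
    by have := nn_distD c z v0; lra.
  rewrite -exprM; apply: lerXn2r; rewrite ?nnegrE //.
  by apply: ler_wpM2r; [rewrite invr_ge0 ltW|exact: le_trans zF].
exists (c1^-1 * (C1 / a * Th ^+ sg)); split.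
- apply: mulr_ge0; first by rewrite invr_ge0 ltW.
  apply: mulr_ge0; last by apply: le_trans Thsg; exact: ler01.
  by apply: divr_ge0; [apply: le_trans C11; exact: ler01|exact: ltW].
- rewrite /a le_eqVlt; apply/orP; left; apply/eqP; field.
  by rewrite !gt_eqF //; lra.
rewrite [X in _ <= X]exprMn [c1^-1 ^+ T]exprVn [(C1 / a * _) ^+ T]exprMn.
apply: ler_wpM2l; first by rewrite invr_ge0 ltW.
apply: ler_pM; rewrite ?cn_ge0 ?exprn_ge0 //.
  by have := hP z zL Xz; rewrite mulnC exprM -/C1 [(C1 / a) ^+ T]expr_div_n.
rewrite -exprM; apply: lerXn2r; rewrite ?nnegrE //; first by lra.
rewrite le_max; apply/orP; right; apply: ler_wpM2r; first by rewrite invr_ge0 ltW.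
by apply: (le_trans zcn); have := nnD z (- c); rewrite nnN; lra.
Qed.

(** The Hamiltonian is [h ^+ N] times [z 0 b - p 0 b] for a coordinate [b] other than [i]. On the
    line, where the second factor vanishes, its field is [h ^+ N] in the direction [i]; near the
    polydisc and [X] it is of order [(3 / 4) ^+ N] by Cauchy's estimate. The estimate extends to a
    [nu]-neighbourhood, since [move_point] composes with another map. *)
Lemma move_to_target d (X : set 'rV[C]_d.+2) (c e : 'rV[C]_d.+2) (r L Lb tau eta : R) :
  analytic_subvariety X -> X <> setT -> 0 <= r -> 0 <= L -> 0 <= Lb -> 0 < tau -> 0 < eta -> r < nn (e - c) ->
  exists (p : 'rV[C]_d.+2) (nu : R) (f f' : 'rV[C]_d.+2 -> 'rV[C]_d.+2),
  [/\ Lb < nn p, 0 < nu, aut_pair f f', nn (f p - e) <= eta &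
      forall z0 z, nn (z0 - c) <= r \/ (X z0 /\ nn z0 <= L) -> nn (z - z0) <= nu ->
        nn (f z - z) <= tau /\ nn (f' z - z) <= tau].
Proof.
move=> hX Xp r0 L0 Lb0 tau0 eta0 re; have [i ei] := nn_gtP r0 re; rewrite !mxE in ei.
have eta2 : 0 < eta / 2 by lra.
have [p [u [h [pL pe hs h1 h2]]]] := controlling_polynomial hX Xp r0 L0 Lb0 eta2 ei.
have [b bi] : exists b : 'I_d.+2, b != i.
  have [->|i0] := eqVneq i ord0; first by exists (lift ord0 ord0); rewrite eq_sym neq_lift.
  by exists ord0; rewrite eq_sym.
pose K z0 := nn (z0 - c) <= r \/ (X z0 /\ nn z0 <= L).
pose rr := r + nn c + L + nn p + cn u + 4.
have nc := nn_ge0 c; have np := nn_ge0 p; have nu' := cn_ge0 u.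
have [M M0 hM] := spanned_loclip hs rr.
(* [h] stays below 3/4 within [3 * nu]: one [nu] for the neighbourhood, one for the motion along the
   flow, one for the discs of Cauchy's estimate. *)
pose nu := Num.min (1 / 4) (1 / (12 * (M + 1))).
have M1 : 0 < 12 * (M + 1) by lra.
have nu0 : 0 < nu by rewrite lt_min !divr_gt0.
have nu4 : nu <= 1 / 4 by rewrite ge_min lexx.
have nuM : M * (3 * nu) <= 1 / 4.
  have : nu * (12 * (M + 1)) <= 1 by rewrite -ler_pdivlMr // ge_min lexx orbT.
  have : 0 <= M * nu by rewrite mulr_ge0 // ltW.
  clear -nu0; lra.
have Kr z0 : K z0 -> nn z0 <= rr - 4.
  by rewrite /rr; case=> [zc|[_ zL]]; [have := nn_dist z0 c; (clear -zc nu' np L0; lra)|(clear -zL nu' np nc r0; lra)].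
have near3 z0 z : K z0 -> nn (z - z0) <= 3 * nu -> nn z <= rr /\ cn (h z) <= 3 / 4.
  move=> Kz zn; have z0r := Kr _ Kz; have zr : nn z <= rr by have := nn_dist z z0; clear -z0r zn nu4; lra.
  have z0r' : nn z0 <= rr by (clear -z0r; lra).
  split => //; have [_ l] := hM z z0 zr z0r'; have := h2 z0 Kz.
  have := cn_dist (h z) (h z0); rewrite nn_cn in l.
  have := le_trans l (ler_wpM2l M0 zn); clear -nuM; lra.
pose B1 := rr + nn p.
have rr0 : 0 <= rr by rewrite /rr; clear -nu' np nc L0 r0; lra.
have B10 : 0 <= B1 by rewrite /B1; clear -rr0 np; lra.
pose tau' := Num.min tau nu; have tau'0 : 0 < tau' by rewrite lt_min tau0.
have q0 : 0 <= (3 / 4 : R) by (clear; lra).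
have q1 : (3 / 4 : R) < 1 by (clear; lra).
have cM : 0 <= cn u * (8 * B1 / nu) by rewrite mulr_ge0 // divr_ge0 ?mulr_ge0 // ltW.
have t2 : 0 < tau' / 2 by (clear -tau'0; lra).
have [N hN] := geometric_small q0 q1 cM t2.
pose G z := h z ^+ N * (z 0 b - p 0 b).
have Gs : spanned G.
  apply: spannedM; first exact: spannedX.
  by apply: spannedD; [exact: spanned_coord|exact: spanned_cst].
have [s [sok sf]] := spanned_field i b Gs.
pose v := 8 * ((3 / 4) ^+ N * B1) / nu.
have v0 : 0 <= v by rewrite divr_ge0 ?(ltW nu0) // mulr_ge0 // mulr_ge0 // exprn_ge0.
pose K' : set 'rV[C]_d.+2 := [set z1 | exists2 z0, K z0 & nn (z1 - z0) <= nu].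
have hK' z1 z : K' z1 -> nn (z - z1) <= nu -> nn z <= rr /\ nn (field s z) <= v.
  move=> [z0 Kz z1n] zn; split.
    by have [] := near3 z0 z Kz _ => //; have := nn_distD z1 z z0; clear -zn z1n nu0; lra.
  apply: (spanned_field_bound Gs nu0 (sf z)) => y yn.
  have y0 : nn (y - z0) <= 3 * nu.
    by have := nn_distD z y z0; have := nn_distD z1 z z0; clear -yn zn z1n; lra.
  have [yr hy] := near3 z0 y Kz y0.
  rewrite /G cnM cnX; apply: ler_pM; rewrite ?exprn_ge0 ?cn_ge0 //.
    by apply: lerXn2r; rewrite ?nnegrE ?cn_ge0.
  by apply: (le_trans (cnD _ _)); rewrite cnN; apply: lerD; [apply: le_trans (nn_coord _ _) yr|exact: nn_coord].
have uv : cn u * v <= tau' / 2.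
  apply: le_trans hN; rewrite le_eqVlt; apply/orP; left; apply/eqP; rewrite /v; ring.
pose w := u *: (delta_mx 0 i : 'rV[C]_d.+2).
have line (t : R) : p + t%:C *: w = p + (t%:C * u) *: delta_mx 0 i by rewrite /w scalerA.
have hg (t : R) : 0 <= t -> t <= 1 ->
    field s (p + t%:C *: w) = h (p + t%:C *: w) ^+ N *: delta_mx 0 i /\ 1 <= cn (h (p + t%:C *: w) ^+ N).
  move=> t0 t1; split; last by rewrite cnX exprn_ege1 // line; exact: h1.
  set z := p + _; have zb : z 0 b = p 0 b.
    by rewrite /z line !mxE (negbTE bi) andbF mulr0 addr0.
  clearbody z.
  have [db [di [hb hi ->]]] := sf z.
  have -> : di = 0.
    apply: (cdiff_uniq hi); rewrite (_ : (fun t => _) = (fun=> 0)); first exact: cdiff_cst.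
    by apply/funext => x; rewrite /G !mxE (negbTE bi) andbF mulr0 addr0 zb subrr mulr0.
  rewrite scale0r subr0; congr (_ *: _); apply: (cdiff_uniq hb).
  have := @cdiff_slice R _ (fun z => h z ^+ N) z (delta_mx 0 b) 0 (spanned_diff _ (spannedX N hs)).
  move=> k; have := cdiffM k (cdiff_id 0); rewrite mulr0 add0r mulr1 scale0r addr0.
  rewrite (_ : (fun x => G _) = (fun x => h (z + x *: delta_mx 0 b) ^+ N * x)) //.
  by apply/funext => x; rewrite /G !mxE !eqxx mulr1 zb addrAC subrr add0r.
have pr (t : R) : 0 <= t -> t <= 1 -> nn (p + t%:C *: w) <= rr - 1.
  move=> t0 t1; rewrite line; apply: (le_trans (nnD _ _)); rewrite nn_delta cnM cn_real ger0_norm //.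
  have : t * cn u <= cn u by rewrite ler_piMl ?cn_ge0.
  by rewrite /rr; clear -nc L0 r0; lra.
have tn : tau' <= nu by rewrite ge_min lexx orbT.
have [f [f' [ff fp fK]]] := shear_flow sok v0 tau'0 tn eta2 hg pr (erefl w) uv hK'.
exists p, nu, f, f'; split => //.
  have := nn_distD (p + w) (f p) e; clear -fp pe; lra.
move=> z0 z Kz zn; have [k1 k2] := fK z (ex_intro2 _ _ z0 Kz zn).
have : tau' <= tau by rewrite ge_min lexx.
by split; clear -H k2 k1; lra.
Qed.

End Move.

(** * Moving a given point; limits of holomorphic maps *)

Section VectorLimit.
Context {R : realType}.
Local Notation C := (R[i]).

(** [move_to_target] chooses its starting point [p] itself. Since [y] and [p] lie outside the large
    polydisc of radius [r1], which contains all the points to be kept, [reach_outside] first carries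
    [y] to [p]. *)
Lemma move_point d (X : set 'rV[C]_d.+2) (c e y : 'rV[C]_d.+2) (r L tau eta : R) :
  analytic_subvariety X -> X <> setT -> 0 <= r -> 0 <= L -> 0 < tau -> 0 < eta -> r < nn (e - c) ->
  nn c + r + L + 1 < nn y ->
  exists f f' : 'rV[C]_d.+2 -> 'rV[C]_d.+2, [/\ aut_pair f f', nn (f y - e) <= eta &
    forall z, nn (z - c) <= r \/ (X z /\ nn z <= L) -> nn (f z - z) <= tau /\ nn (f' z - z) <= tau].
Proof.
move=> hX Xp r0 L0 tau0 eta0 re yr; set r1 := nn c + r + L + 1 in yr.
have nc := nn_ge0 c; have r10 : 0 <= r1 by rewrite /r1; lra.
pose t := Num.min (tau / 2) (1 / 2); have t0 : 0 < t by rewrite lt_min divr_gt0 //=.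
have tt : t <= tau / 2 by rewrite ge_min lexx.
have t2 : t <= 1 / 2 by rewrite ge_min lexx orbT.
have [p [nu [f [f' [pr nu0 ff fp fK]]]]] := move_to_target hX Xp r0 L0 r10 t0 eta0 re.
pose t1 := Num.min nu t; have t10 : 0 < t1 by rewrite lt_min nu0.
have t1n : t1 <= nu by rewrite ge_min lexx.
have t1t : t1 <= t by rewrite ge_min lexx orbT.
have [||f1 [g1 [a1 a2 a3]]] := @reach_outside R d 0 y p r1 t1 r10 t10; rewrite ?subr0 //.
exists (f \o f1), (g1 \o f'); split; first exact: aut_pair_comp.
  by rewrite /= a2.
move=> z Kz; have zr : nn z <= r1 - 1.
  by rewrite /r1; case: Kz => [zc|[_ zL]]; [have := nn_dist z c|]; clear t1t t1n fp t2 tt r10 t10 nu0 pr t0 yr re eta0 tau0 a2; lra.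
have zr' : nn (z - 0) <= r1 by rewrite subr0; clear -zr; lra.
have [b1 b2] := a3 z zr'; split.
  have [k1 _] := fK z (f1 z) Kz (le_trans b1 t1n).
  by have := nn_distD (f1 z) (f (f1 z)) z; rewrite /=; clear -k1 b1 t1t tt; lra.
have z0 : nn (z - z) <= nu by rewrite subrr nn0 ltW.
have [_ k2] := fK z z Kz z0.
have k3 : nn (f' z - 0) <= r1 by rewrite subr0; have := nn_dist (f' z) z; clear -k2 zr t2; lra.
have [_ k4] := a3 (f' z) k3.
by have := nn_distD (f' z) (g1 (f' z)) z; rewrite /=; clear -k4 k2 t1t tt; lra.
Qed.

Lemma hol_vector_taylor n m (F : 'rV[C]_n -> 'rV[C]_m) z (rho B : R) : 0 < rho ->
  (forall x, nn (x - z) < rho -> differentiable F x) -> (forall x, nn (x - z) < rho -> nn (F x) <= B) ->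
  forall h, nn h < rho / 16 -> nn (F (z + h) - F z - 'd F z h) <= 64 * B / rho ^+ 2 * nn h ^+ 2.
Proof.
move=> rho0 Fd FB h hr.
have B0 : 0 <= B by apply: le_trans (nn_ge0 _) (FB z _); rewrite subrr nn0.
have bd0 : 0 <= 64 * B / rho ^+ 2 * nn h ^+ 2 by rewrite mulr_ge0 ?sqr_ge0 // divr_ge0 ?sqr_ge0 // mulr_ge0.
have [h0|h0] := eqVneq h 0.
  by move: bd0; rewrite h0 addr0 subrr linear0 subrr !nn0.
have nh : 0 < nn h by rewrite lt_def nn_ge0 andbT; apply: contra h0 => /eqP/nn_inj ->.
apply: nn_le => // i.
pose f (w : C) := (F (z + w *: h)) 0 i.
have inb (w : C) : cn w < rho / nn h -> nn (z + w *: h - z) < rho.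
  by move=> wr; rewrite addrAC subrr add0r nnZ -ltr_pdivlMr.
have Fi x : nn (x - z) < rho -> differentiable (fun y => (F y) 0 i : C) x.
  by move=> xr; exact: (@differentiable_comp _ _ _ _ F (fun w : 'rV[C]_m => w 0 i) x (Fd x xr) (df_coord _ _)).
have fh : hol 0 (rho / nn h) f.
  move=> w; rewrite subr0 => wr; eexists.
  by apply: (@cdiff_slice R n (fun y => (F y) 0 i)); apply: Fi; exact: inb.
have fB : bounded_by 0 (rho / nn h) f B.
  move=> w; rewrite subr0 => wr; apply: le_trans (nn_coord _ i) _; apply: FB; exact: inb.
have rh0 : 0 < rho / nn h by exact: divr_gt0.
have c1 : cn (1 : C) < rho / nn h / 16.
  by rewrite cn1 ltr_pdivlMr // mul1r ltr_pdivlMr // -ltr_pdivlMl // mulrC.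
have := hol_taylor_center rh0 fh fB c1; rewrite add0r /f scale1r scale0r addr0 mulr1 cn1 expr1n mulr1.
have -> : cderiv (fun w : C => (F (z + w *: h)) 0 i) 0 = ('d F z h) 0 i.
  have z0 : nn (z - z) < rho by rewrite subrr nn0.
  have D : cdiff (fun w : C => (F (z + w *: h)) 0 i) 0 (('d F z h) 0 i).
    move=> e e0; have [s s0 hs] := diff_eps (Fd z z0) (divr_gt0 e0 nh).
    exists (s / nn h) => [|k]; first exact: divr_gt0.
    rewrite ltr_pdivlMr // => ks; have khs : nn (k *: h) < s by rewrite nnZ.
    have := hs _ khs; rewrite linearZ nnZ mulrA [_ * cn k]mulrC mulrA => H.
    rewrite add0r scale0r addr0; have := nn_coord (F (z + k *: h) - F z - k *: 'd F z h) i.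
    rewrite !mxE [k * _]mulrC => H2; apply: (le_trans H2); apply: (le_trans H).
    by rewrite divfK ?gt_eqF // mulrC.
  exact: (cdiff_uniq (cdiff_deriv D) D).
rewrite !mxE => H; apply: (le_trans H).
by rewrite le_eqVlt; apply/orP; left; apply/eqP; field; rewrite !gt_eqF.
Qed.

Definition vcvg n (u : nat -> 'rV[C]_n) (l : 'rV[C]_n) := forall i, ccvg (fun k => u k 0 i) (l 0 i).

Lemma vcvg_le n (u : nat -> 'rV[C]_n) l M : vcvg u l -> (forall k, nn (u k) <= M) -> nn l <= M.
Proof.
move=> ul uM; apply: nn_le => [|i]; first by apply: le_trans (nn_ge0 _) (uM 0%N).
apply: (ccvg_le (ul i)) => k; exact: le_trans (nn_coord _ _) (uM k).
Qed.

Lemma vcvg_near n (u : nat -> 'rV[C]_n) (l v : 'rV[C]_n) M k0 : vcvg u l -> (forall k, (k0 <= k)%N -> nn (u k - v) <= M) -> nn (l - v) <= M.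
Proof.
move=> ul uM; apply: nn_le => [|i]; first by apply: le_trans (nn_ge0 _) (uM k0 _).
rewrite !mxE; apply/ler_addgt0Pr => e e0; have [N hN] := ul i e e0.
have := hN (maxn N k0) (leq_maxl _ _); have := uM (maxn N k0) (leq_maxr _ _).
have := nn_coord (u (maxn N k0) - v) i; rewrite !mxE => h1 h2 h3.
have := cn_distD (u (maxn N k0) 0 i) (l 0 i) (v 0 i); rewrite [cn (l 0 i - u _ _ _)]cnB; lra.
Qed.

Lemma scaled_close (t M : R) (x1 x2 b : C) : 0 < t -> cn (t%:C * x1 - b) <= M -> cn (t%:C * x2 - b) <= M ->
  t * cn (x1 - x2) <= 2 * M.
Proof.
move=> t0 h1 h2; rewrite -{1}(gtr0_norm t0) -cn_real -cnM.
have -> : t%:C * (x1 - x2) = (t%:C * x1 - b) - (t%:C * x2 - b) by ring.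
by apply: (le_trans (cnD _ _)); rewrite cnN; lra.
Qed.

(** The Taylor remainders of the [F k] at [z] have a common quadratic bound, which forces their
    differentials to converge; the limit matrix [M] satisfies the same estimate for [J]. *)
Lemma vector_limit_diff n m (F : nat -> 'rV[C]_n -> 'rV[C]_m) (J : 'rV[C]_n -> 'rV[C]_m) z (rho B : R) : 0 < rho ->
  (forall k x, nn (x - z) < rho -> differentiable (F k) x) -> (forall k x, nn (x - z) < rho -> nn (F k x) <= B) ->
  (forall x, nn (x - z) < rho -> vcvg (fun k => F k x) (J x)) -> differentiable J z.
Proof.
move=> rho0 Fd FB FJ.
have B0 : 0 <= B by apply: le_trans (nn_ge0 _) (FB 0%N z _); rewrite subrr nn0.
pose A := 64 * B / rho ^+ 2; have A0 : 0 <= A by rewrite divr_ge0 ?sqr_ge0 // mulr_ge0.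
have T k := hol_vector_taylor rho0 (Fd k) (FB k).
have z0 : nn (z - z) < rho by rewrite subrr nn0.
have Dc (h : 'rV[C]_n) i : nn h < rho / 16 -> exists l, ccvg (fun k => ('d (F k) z h) 0 i) l.
  move=> hr; apply: complex_cauchy => e e0.
  pose t := Num.min 1 (e / (4 * (A * nn h ^+ 2 + 1))).
  have d1 : 0 < 4 * (A * nn h ^+ 2 + 1) by rewrite mulr_gt0 // ltr_wpDl // mulr_ge0 ?sqr_ge0.
  have t0 : 0 < t by rewrite lt_min ltr01 divr_gt0.
  have t1 : t <= 1 by rewrite ge_min lexx.
  have te : t * (4 * (A * nn h ^+ 2 + 1)) <= e by rewrite -ler_pdivlMr // ge_min lexx orbT.
  have th : nn (t%:C *: h) < rho / 16.
    by rewrite nnZ cn_real gtr0_norm //; apply: le_lt_trans hr; rewrite ler_piMl ?nn_ge0.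
  have zt : nn (z + t%:C *: h - z) < rho by rewrite addrAC subrr add0r; lra.
  have te4 : 0 < t * e / 8 by rewrite divr_gt0 // mulr_gt0.
  have [N1 h1] := FJ _ zt i _ te4; have [N2 h2] := FJ _ z0 i _ te4.
  exists (maxn N1 N2) => k k'; rewrite !geq_max => /andP[k1 k2] /andP[k1' k2'].
  have E kk : (N1 <= kk)%N -> (N2 <= kk)%N ->
      cn (t%:C * ('d (F kk) z h) 0 i - ((J (z + t%:C *: h)) 0 i - (J z) 0 i)) <= t * e / 4 + A * (t * nn h) ^+ 2.
    have lz : 'd (F kk) z (t%:C *: h) = t%:C *: 'd (F kk) z h by exact: linearZ.
    move=> q1 q2; have := T kk _ th; rewrite nnZ cn_real gtr0_norm // lz => q3.
    have := nn_coord (F kk (z + t%:C *: h) - F kk z - t%:C *: 'd (F kk) z h) i.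
    rewrite !mxE => q4.
    have := h1 kk q1; have := h2 kk q2; move: q4.
    move: (F kk z 0 i) (F kk (z + t%:C *: h) 0 i) (J z 0 i) (J (z + t%:C *: h) 0 i) (t%:C * 'd (F kk) z h 0 i).
    move=> a1 a2 b1 b2 dd q4.
    move=> q5 q6.
    have -> : dd - (b2 - b1) = - (a2 - a1 - dd) + ((a2 - b2) - (a1 - b1)) by ring.
    apply: (le_trans (cnD _ _)); rewrite cnN; have := cnD (a2 - b2) (- (a1 - b1)); rewrite cnN.
    by move: q4 q3 q5 q6; rewrite -/A; clear; lra.
  have e3 := scaled_close t0 (E k k1 k2) (E k' k1' k2').
  rewrite -(ler_pM2l t0); apply: (le_trans e3).
  have : A * (t * nn h) ^+ 2 <= t * (e / 4).
    have -> : A * (t * nn h) ^+ 2 = t * (t * (A * nn h ^+ 2)) by ring.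
    rewrite ler_pM2l // ler_pdivlMr // mulrC mulrCA; apply: le_trans te.
    by rewrite ler_pM2l // ler_pM2l //; clear; lra.
  clear; lra.
pose sc := rho / 32; have sc0 : 0 < sc by rewrite divr_gt0.
have bs j : nn (sc%:C *: delta_mx 0 j : 'rV[C]_n) < rho / 16.
  by rewrite nn_delta cn_real gtr0_norm // /sc; lra.
have /choice[Mf hMf] : forall ji : 'I_n * 'I_m, exists l, ccvg (fun k => ('d (F k) z (delta_mx 0 ji.1)) 0 ji.2) l.
  move=> [j i] /=; have [l hl] := Dc _ i (bs j); exists (l * (sc%:C)^-1).
  have := ccvgZ (sc%:C)^-1 hl.
  have -> : (fun k => 'd (F k) z (sc%:C *: delta_mx 0 j) 0 i * (sc%:C)^-1) = (fun k => ('d (F k) z (delta_mx 0 j)) 0 i) => //.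
  apply/funext => k; have lz : 'd (F k) z (sc%:C *: delta_mx 0 j) = sc%:C *: 'd (F k) z (delta_mx 0 j) by exact: linearZ.
  by rewrite lz mxE mulrC mulrA mulVf ?mul1r // -cn_gt0 cn_real gtr0_norm.
pose M : 'M[C]_(n, m) := \matrix_(j, i) Mf (j, i).
have dE k h : 'd (F k) z h = \sum_j h 0 j *: 'd (F k) z (delta_mx 0 j).
  rewrite {1}[h]row_sum_delta linear_sum; apply: eq_bigr => j _; by rewrite linearZ.
have Lc h : vcvg (fun k => 'd (F k) z h) (mulmxr M h).
  move=> i; rewrite /= mxE.
  have -> : (fun k => ('d (F k) z h) 0 i) = (fun k => \sum_j ('d (F k) z (delta_mx 0 j)) 0 i * h 0 j).
    by apply/funext => k; rewrite dE summxE; apply: eq_bigr => j _; rewrite mxE mulrC.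
  have -> : \sum_j h 0 j * M j i = \sum_j Mf (j, i) * h 0 j.
    by apply: eq_bigr => j _; rewrite mxE mulrC.
  apply: ccvg_sum => j; apply: ccvgZ; exact: (hMf (j, i)).
have key h : nn h < rho / 16 -> nn (J (z + h) - J z - mulmxr M h) <= A * nn h ^+ 2.
  move=> hr; apply: (@vcvg_le _ (fun k => F k (z + h) - F k z - 'd (F k) z h)); last by move=> k; exact: T.
  move=> i; have zh : nn (z + h - z) < rho by rewrite addrAC subrr add0r; lra.
  have c1 := FJ _ zh i; have c2 := ccvgZ (-1) (FJ _ z0 i); have c3 := ccvgZ (-1) (Lc h i).
  have := ccvgD (ccvgD c1 c2) c3; rewrite !mulrN1 !mxE; congr ccvg.
    by apply/funext => k; rewrite !mxE !mulrN1.
apply: (proj1 (@eps_diff R _ _ J z (mulmxr M) (@linear_row_continuous R n _ (mulmxr M)) _)).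
move=> e e0; exists (Num.min (rho / 16) (e / (A + 1))).
  by rewrite lt_min !divr_gt0 //; clear -A0; lra.
move=> h; rewrite lt_min => /andP[h1 h2]; apply: (le_trans (key h h1)).
rewrite expr2 mulrA; apply: ler_wpM2r; first exact: nn_ge0.
have A1 : 0 < A + 1 by (clear -A0; lra).
move: h2; rewrite ltr_pdivlMr // => h2; apply: le_trans (ltW h2).
by rewrite mulrC; apply: ler_wpM2l; [exact: nn_ge0|(clear; lra)].
Qed.

End VectorLimit.

(** * Embeddings as limits of automorphisms *)

Section Sequence.
Context {R : realType}.
Local Notation C := (R[i]).

Lemma differentiable_bounded n m (f : 'rV[C]_n -> 'rV[C]_m) (M : R) : (forall x, differentiable f x) ->
  exists M' : R, forall u, nn u <= M -> nn (f u) <= M'.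
Proof.
move=> fd; have K := @compact_polydisc R n 0 (Num.max M 0); rewrite le_max lexx orbT in K.
have fc : {within [set z : 'rV[C]_n | nn (z - 0) <= Num.max M 0], continuous f}.
  by apply: continuous_subspaceT => x; apply: differentiable_continuous.
have [M' hM'] := compact_nn_bounded (continuous_compact fc (K isT)).
exists M' => u uM; apply: hM'; exists u => //=.
by rewrite subr0 le_max uM.
Qed.

Lemma analytic_preimage n (X : set 'rV[C]_n) (f : 'rV[C]_n -> 'rV[C]_n) : (forall x, differentiable f x) ->
  analytic_subvariety X -> analytic_subvariety (f @^-1` X).
Proof.
move=> fd hX p; have [U [k [g [Uo Up gh XU]]]] := hX (f p); have /seteqP[h1 h2] := XU.
exists (f @^-1` U), k, (fun i => g i \o f); split => //.
- by apply: open_comp => // x _; apply: differentiable_continuous.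
- by move=> i x Ux; apply: differentiable_comp => //; exact: gh.
apply/seteqP; split=> q /=.
  move=> [Xq Uq]; split => // i; have [_] := h1 (f q) (conj Xq Uq); exact.
by move=> [Uq hq]; have [] := h2 (f q) (conj Uq hq).
Qed.

Section Iteration.
Variables (d : nat) (X : set 'rV[C]_d.+2).
Variables (c e : nat -> 'rV[C]_d.+2) (r dl : nat -> R) (H : nat -> R -> R).
Hypothesis X_analytic : analytic_subvariety X.
Hypothesis X_proper : X <> setT.
Hypothesis X_unbounded : forall M : R, exists2 z, X z & M < nn z.
Hypothesis dl_gt0 : forall s, 0 < dl s.
Hypothesis r_ge0 : forall s, 0 <= r s.
Hypothesis target_outside : forall s, r s < nn (e s - c s).
Hypothesis nested : forall s, nn (c s.+1 - c s) + r s <= r s.+1.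
Hypothesis target_inside : forall s, nn (e s - c s.+1) + 2 * dl s <= r s.+1.
Hypothesis exhausting : forall M : R, exists s, M <= r s - nn (c s).

(** Each tolerance is at most half the preceding one, so all the errors from step [k] on add up to
    at most [2 * tol k]. The bound 1/100 keeps this well below the unit margins used later. *)
Fixpoint tol (s : nat) : R :=
  if s is s'.+1 then Num.min (tol s' / 2) (dl s / 2) else Num.min (dl 0%N / 2) (1 / 100).

Lemma tol_gt0 s : 0 < tol s.
Proof. by elim: s => [|s IH] /=; rewrite lt_min !divr_gt0. Qed.

Lemma tol_half s : 2 * tol s.+1 <= tol s.
Proof. by have h : tol s.+1 <= tol s / 2; [rewrite /= ge_min lexx|lra]. Qed.

Lemma tol_dl s : 2 * tol s <= dl s.
Proof.
suff : tol s <= dl s / 2 by lra.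
by case: s => [|s] /=; rewrite ge_min lexx ?orbT.
Qed.

Lemma tol_le s : tol s <= 1 / 100 / 2 ^+ s.
Proof.
elim: s => [|s IH]; first by rewrite expr0 divr1 /= ge_min lexx orbT.
have := tol_half s; rewrite exprS invfM.
have -> : 1 / 100 * (2^-1 / 2 ^+ s) = (1 / 100 / 2 ^+ s) / 2 :> R by ring.
lra.
Qed.

Lemma tol_100 s : tol s <= 1 / 100.
Proof.
apply: (le_trans (tol_le s)); rewrite ler_pdivrMr ?exprn_gt0 // ler_peMr ?divr_ge0 //.
by apply: exprn_ege1; lra.
Qed.

Definition autom := {f : ('rV[C]_d.+2 -> 'rV[C]_d.+2) * ('rV[C]_d.+2 -> 'rV[C]_d.+2) | aut_pair f.1 f.2}.

(** [M] bounds the points of [X] already lying in the polydisc, and [x] is chosen beyond [H s M].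
    The tolerance holds as soon as either map puts the point into the polydisc: this lets points be
    followed forwards in [inside_stays] and backwards in [limit_pullback]. *)
Definition one_step (s : nat) (S S' : autom) (x : 'rV[C]_d.+2) :=
  [/\ X x, nn ((sval S').1 x - e s) <= dl s,
   exists2 M : R, H s M < nn x & forall u, X u -> nn ((sval S).1 u - c s) <= r s -> nn u <= M,
   forall u, nn ((sval S).1 u - c s) <= r s \/ nn ((sval S').1 u - c s) <= r s ->
     nn ((sval S').1 u - (sval S).1 u) <= tol s &
   forall u, X u -> nn u <= s%:R -> nn ((sval S').1 u - (sval S).1 u) <= tol s].

(** [move_point] is applied to the image of [X] under the automorphism [f] built so far, which is
    analytic as a preimage under [f']. The estimate for the inverse map gives the second alternative
    of the tolerance condition. *)
Lemma one_step_exists s (S : autom) : exists Sx : autom * 'rV[C]_d.+2, one_step s S Sx.1 Sx.2.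
Proof.
case: S => -[f f'] /= ff; have [fd fd' fK fK'] := ff.
have [L0 hL0] := differentiable_bounded s%:R fd.
pose L := Num.max L0 0; have L_ge0 : 0 <= L by rewrite le_max lexx orbT.
have hL u : nn u <= s%:R -> nn (f u) <= L by move=> /hL0 h; rewrite le_max h.
have [M1 hM1] := differentiable_bounded (nn (c s) + r s) fd'.
have [M2 hM2] := differentiable_bounded (nn (c s) + r s + L + 1) fd'.
have [x Xx xM] := X_unbounded (Num.max M2 (H s M1)).
move: xM; rewrite gt_max => /andP[x2 x1].
have yL : nn (c s) + r s + L + 1 < nn (f x).
  by rewrite ltNge; apply/negP => /hM2; rewrite fK leNgt x2.
have XfP : f' @^-1` X <> setT.
  move=> XT; apply: X_proper; apply/seteqP; split => // u _; rewrite -(fK u).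
  by have : (f' @^-1` X) (f u) by rewrite XT.
have [g [g' [gg gx gn]]] := move_point (analytic_preimage fd' X_analytic) XfP (r_ge0 s) L_ge0 (tol_gt0 s)
  (dl_gt0 s) (target_outside s) yL.
exists (exist _ (g \o f, f' \o g') (aut_pair_comp ff gg), x); split => //=.
- exists M1 => // u Xu; move=> uc; rewrite -(fK u); apply: hM1.
  by have := nn_dist (f u) (c s); lra.
- move=> u [uc|uc]; first by have [] := gn (f u) (or_introl uc).
  have [_ h] := gn (g (f u)) (or_introl uc); have [_ _ gK _] := gg.
  by rewrite gK nnB in h.
- move=> u Xu us; have [|//] := gn (f u) _.
  by right; split; [rewrite /= fK|exact: hL].
Qed.

Definition limit_data (Th Ps : nat -> 'rV[C]_d.+2 -> 'rV[C]_d.+2) (x : nat -> 'rV[C]_d.+2) :=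
  [/\ forall s, aut_pair (Th s) (Ps s),
   forall s, [/\ X (x s), nn (Th s.+1 (x s) - e s) <= dl s &
     exists2 M : R, H s M < nn (x s) & forall u, X u -> nn (Th s u - c s) <= r s -> nn u <= M],
   forall s u, nn (Th s u - c s) <= r s \/ nn (Th s.+1 u - c s) <= r s -> nn (Th s.+1 u - Th s u) <= tol s &
   forall s u, X u -> nn u <= s%:R -> nn (Th s.+1 u - Th s u) <= tol s].

Lemma limit_data_exists : exists Th Ps x, limit_data Th Ps x.
Proof.
have [next hnext] : {next : nat * autom -> autom * 'rV[C]_d.+2 & forall sS, one_step sS.1 sS.2 (next sS).1 (next sS).2}.
  apply: (@choice (nat * autom) (autom * 'rV[C]_d.+2) (fun sS Sx => one_step sS.1 sS.2 Sx.1 Sx.2)) => -[s S].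
  exact: one_step_exists.
pose st := fix st s : autom := if s is s'.+1 then (next (s', st s')).1 else exist _ (id, id) (@aut_pair_id R d.+2).
have hst s : one_step s (st s) (st s.+1) (next (s, st s)).2 by exact: (hnext (s, st s)).
exists (fun s => (sval (st s)).1), (fun s => (sval (st s)).2), (fun s => (next (s, st s)).2); split.
- by move=> s; exact: svalP (st s).
- by move=> s; have [] := hst s.
- by move=> s; have [] := hst s.
- by move=> s; have [] := hst s.
Qed.

Section Limit.
Variables (Th Ps : nat -> 'rV[C]_d.+2 -> 'rV[C]_d.+2) (x : nat -> 'rV[C]_d.+2).
Hypothesis dataP : limit_data Th Ps x.

Let ThA s : aut_pair (Th s) (Ps s). Proof. by have [] := dataP. Qed.

Lemma polydiscs_nested k s z : (k <= s)%N -> nn (z - c k) <= r k -> nn (z - c s) <= r s.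
Proof.
move=> ks zk; elim: s ks => [|s IH]; first by rewrite leqn0 => /eqP k0; rewrite k0 in zk.
rewrite leq_eqVlt => /orP[/eqP ks|]; first by rewrite ks in zk.
rewrite ltnS => /IH zs.
have := nn_distD (c s) z (c s.+1); have := nested s; rewrite [nn (c s - _)]nnB; clear zk; lra.
Qed.

Lemma telescoping k s u : (k <= s)%N -> (forall l, (k <= l < s)%N -> nn (Th l.+1 u - Th l u) <= tol l) ->
  nn (Th s u - Th k u) <= 2 * tol k - 2 * tol s.
Proof.
move=> ks; elim: s ks => [|s IH].
  by rewrite leqn0 => /eqP k0 _; rewrite k0 !subrr nn0.
rewrite leq_eqVlt => /orP[/eqP kE _|]; first by rewrite kE !subrr nn0.
rewrite ltnS => ks h; have {}IH : nn (Th s u - Th k u) <= 2 * tol k - 2 * tol s.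
  by apply: IH => // l /andP[kl ls]; apply: h; rewrite kl ltnW.
have hs : nn (Th s.+1 u - Th s u) <= tol s by apply: h; rewrite ks ltnSn.
by have := nn_distD (Th s u) (Th s.+1 u) (Th k u); have := tol_half s; lra.
Qed.

(** The margin is all that the later steps can move the point, so it remains in all later
    polydiscs. *)
Definition inside k u := nn (Th k u - c k) + 2 * tol k <= r k.

Lemma inside_stays k s u : inside k u -> (k <= s)%N ->
  nn (Th s u - c s) <= r s /\ nn (Th s u - Th k u) <= 2 * tol k - 2 * tol s.
Proof.
move=> ik ks; have [_ _ hA _] := dataP.
suff H1 l : (k <= l)%N -> nn (Th l u - Th k u) <= 2 * tol k - 2 * tol l /\ nn (Th l u - c l) <= r l.
  by have [] := H1 s ks.
have fin l' : (k <= l')%N -> nn (Th l' u - Th k u) <= 2 * tol k - 2 * tol l' -> nn (Th l' u - c l') <= r l'.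
  move=> kl' h; apply: (@polydiscs_nested k) => //.
  by move: ik; rewrite /inside; have := nn_distD (Th k u) (Th l' u) (c k); have := tol_gt0 l'; lra.
have base : nn (Th k u - Th k u) <= 2 * tol k - 2 * tol k by rewrite !subrr nn0.
elim: l => [|l IH] kl.
  by move: kl; rewrite leqn0 => /eqP k0; move: base fin; rewrite k0 => bb ff; split => //; exact: ff.
move: kl; rewrite leq_eqVlt => /orP[/eqP kE|].
  by move: base fin; rewrite kE => bb ff; split => //; exact: ff.
rewrite ltnS => kl; have [h1 h2] := IH kl.
have h3 : nn (Th l.+1 u - Th k u) <= 2 * tol k - 2 * tol l.+1.
  have := hA l u (or_introl h2); have := nn_distD (Th l u) (Th l.+1 u) (Th k u).
  by have := tol_half l; clear h2 base; lra.
by split => //; apply: fin => //; exact: leqW.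
Qed.

Definition limit_map u : 'rV[C]_d.+2 := \row_i clim (fun s => Th s u 0 i).

Lemma telescoping_cvg k u : (forall l, (k <= l)%N -> nn (Th l.+1 u - Th l u) <= tol l) ->
  vcvg (fun s => Th s u) (limit_map u).
Proof.
move=> hk i; rewrite mxE.
have [ep ep0|l hl] := @complex_cauchy R (fun s => Th s u 0 i); last exact: climP hl.
have [N hN] := half_pow_small (ler01 : 0 <= 1 :> R) ep0; set m := maxn N k.
have hm a : (m <= a)%N -> cn (Th a u 0 i - Th m u 0 i) <= ep / 4.
  move=> ma; have : nn (Th a u - Th m u) <= 2 * tol m - 2 * tol a.
    by apply: telescoping => // l /andP[ml _]; apply: hk; apply: leq_trans ml; exact: leq_maxr.
  have := nn_coord (Th a u - Th m u) i; rewrite !mxE; have := tol_le m; have := tol_gt0 a.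
  have : 1 / 100 / 2 ^+ m <= 1 / 100 * ep.
    have -> : 1 / 100 / 2 ^+ m = 1 / 100 * (1 / 2 ^+ m) :> R by rewrite !mul1r.
    apply: ler_wpM2l; first by lra.
    apply: le_trans hN; rewrite !mul1r lef_pV2 ?posrE ?exprn_gt0 //.
    by apply: ler_weXn2l; [lra|exact: leq_maxl].
  lra.
exists m => a b ma mb; have := hm a ma; have := hm b mb; rewrite [cn (Th b u 0 i - _)]cnB.
have := cn_distD (Th m u 0 i) (Th a u 0 i) (Th b u 0 i); lra.
Qed.

Lemma inside_cvg k u : inside k u -> vcvg (fun s => Th s u) (limit_map u).
Proof.
move=> ik; apply: (@telescoping_cvg k) => l kl; have [_ _ hA _] := dataP; apply: hA; left.
by have [] := inside_stays ik kl.
Qed.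

Lemma inside_limit k u : inside k u -> nn (limit_map u - Th k u) <= 2 * tol k.
Proof.
move=> ik; apply: (vcvg_near (inside_cvg ik) (k0 := k)) => s ks.
by have [_] := inside_stays ik ks; have := tol_gt0 s; lra.
Qed.

(** The margin 3 leaves room for the tolerances, for a neighbourhood whose image moves by less than
    1, and for Cauchy estimates on discs of size 1. *)
Definition deep k u := nn (Th k u - c k) + 3 <= r k.

Lemma deep_inside k u : deep k u -> inside k u.
Proof. by rewrite /deep /inside; have := tol_100 k; lra. Qed.

Lemma exhausting_mono k s : (k <= s)%N -> r k - nn (c k) <= r s - nn (c s).
Proof.
elim: s => [|s IH]; first by rewrite leqn0 => /eqP ->.
rewrite leq_eqVlt => /orP[/eqP -> //|]; rewrite ltnS => /IH h.
by have := nested s; have := nn_dist (c s.+1) (c s); lra.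
Qed.

(** From step [N], at least the norm of [u], the maps move [u] only by the tolerances, while the
    polydiscs exhaust the space. *)
Lemma subvariety_deep u : X u -> exists k0, forall k, (k0 <= k)%N -> deep k u.
Proof.
move=> Xu; have [_ _ _ hC] := dataP; pose N := Num.bound (nn u).
have uN : nn u <= N%:R by apply: ltW; apply: archi_boundP; exact: nn_ge0.
have [K hK] := exhausting (nn (Th N u) + 5); exists (maxn N K) => k; rewrite geq_max => /andP[Nk Kk].
have h : nn (Th k u - Th N u) <= 2 * tol N - 2 * tol k.
  apply: telescoping => // l /andP[Nl _]; apply: hC => //; apply: (le_trans uN).
  by rewrite ler_nat.
rewrite /deep; have := exhausting_mono Kk; have := nn_dist (Th k u) (Th N u).
have := nnD (Th k u) (- c k); rewrite nnN; have := tol_100 N; have := tol_gt0 k; clear uN; lra.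
Qed.

Lemma subvariety_cvg u : X u -> vcvg (fun s => Th s u) (limit_map u).
Proof. by move=> /subvariety_deep[k hk]; apply: (@inside_cvg k); apply: deep_inside; exact: hk. Qed.

Lemma deep_nearby k u : exists2 rho : R, 0 < rho & forall y, nn (y - u) < rho -> nn (Th k y - Th k u) < 1.
Proof.
have [Td _ _ _] := ThA k; have /differentiable_continuous Tc := Td u.
have /Tc/nbhs_nnP[rho rho0 h] : nbhs (Th k u) [set z | nn (z - Th k u) < 1].
  by apply/nbhs_nnP; exists 1.
by exists rho.
Qed.

Lemma limit_differentiable k u : nn (Th k u - c k) + 2 <= r k -> differentiable limit_map u.
Proof.
move=> uk; have [rho rho0 h] := deep_nearby k u.
have ins y : nn (y - u) < rho -> inside k y.
  move=> /h; rewrite /inside; have := nn_distD (Th k u) (Th k y) (c k); have := tol_100 k; clear rho0; lra.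
apply: (@vector_limit_diff R _ _ (fun s => Th (k + s)%N) limit_map u rho (nn (Th k u) + 3) rho0).
- by move=> s y _; have [] := ThA (k + s).
- move=> s y yu; have [_] := inside_stays (ins _ yu) (leq_addr s k); have := h _ yu.
  have := nn_dist (Th (k + s)%N y) (Th k y); have := nn_dist (Th k y) (Th k u).
  have := tol_100 k; have := tol_gt0 (k + s); lra.
move=> y yu i ep ep0; have [N hN] := inside_cvg (ins _ yu) i ep0; exists N => s Ns.
by apply: hN; apply: leq_trans Ns _; exact: leq_addl.
Qed.

(** At a late step [s] the image is close to the limit, hence in the [k]-th polydisc with a margin;
    from there it is followed backwards to step [k]. This gives properness and excludes that points
    of [X] enter a polydisc later on. *)
Lemma limit_pullback k u : X u -> nn (limit_map u - c k) + 2 * tol k < r k -> nn (Th k u - c k) <= r k.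
Proof.
move=> Xu uk; have [_ _ hA _] := dataP.
pose g := r k - 2 * tol k - nn (limit_map u - c k); have g0 : 0 < g by rewrite /g; lra.
have [N hN] : exists N, forall s, (N <= s)%N -> nn (Th s u - limit_map u) <= g.
  have hi i : exists N, forall s, (N <= s)%N -> cn (Th s u 0 i - limit_map u 0 i) <= g.
    by have [N hN] := subvariety_cvg Xu i g0; exists N.
  have [f hf] := choice hi; exists (\max_(i < d.+2) f i)%N => s Ns.
  apply: nn_le => [|i]; first exact: ltW.
  have rB (v w : 'rV[C]_d.+2) : (v - w) 0 i = v 0 i - w 0 i by rewrite !mxE.
  by rewrite rB; apply: hf; apply: leq_trans Ns; exact: leq_bigmax.
set s := maxn N k; have ks : (k <= s)%N by exact: leq_maxr.
have sk : nn (Th s u - c k) + 2 * tol k <= r k.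
  have := hN s (leq_maxl _ _); have := nn_distD (limit_map u) (Th s u) (c k); rewrite /g; clear g0 uk; lra.
suff H1 m : (m <= s - k)%N -> nn (Th (s - m)%N u - Th s u) <= 2 * tol (s - m)%N - 2 * tol s.
  have := H1 (s - k)%N (leqnn _); rewrite subKn // => h.
  by have := nn_distD (Th s u) (Th k u) (c k); have := tol_gt0 s; clear g0 uk; lra.
elim: m => [|m IH] ms; first by rewrite subn0 !subrr nn0.
have {}IH := IH (ltnW ms); set l := (s - m.+1)%N in IH *.
have lE : (s - m)%N = l.+1 by rewrite /l subnSK //; apply: leq_trans ms _; exact: leq_subr.
have kl : (k <= l)%N by rewrite /l leq_subRL ?(leq_trans ms) ?leq_subr // addnC -leq_subRL.
have tk : tol l.+1 <= tol k.
  have : 0 <= 2 * tol k - 2 * tol l.+1; last by lra.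
  have tm p : 2 * tol (k + p)%N <= 2 * tol k.
    elim: p => [|p hp]; first by rewrite addn0.
    by rewrite addnS; have := tol_half (k + p); have := tol_gt0 (k + p).+1; lra.
  by have := tm (l.+1 - k)%N; rewrite subnKC ?(leqW kl) //; lra.
rewrite lE in IH; have h1 : nn (Th l.+1 u - c k) <= r k.
  by have := nn_distD (Th s u) (Th l.+1 u) (c k); have := tol_gt0 s; clear g0 uk lE; lra.
have := hA l u (or_intror (polydiscs_nested kl h1)); rewrite nnB.
by have := nn_distD (Th l.+1 u) (Th l u) (Th s u); have := tol_half l; clear h1 tk sk g0 uk lE; lra.
Qed.

End Limit.
End Iteration.
End Sequence.

(** * Lipschitz estimates for maps close to the identity *)

Section Lipschitz.
Context {R : realType}.
Local Notation C := (R[i]).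

Lemma vcvgB n (u v : nat -> 'rV[C]_n) l m : vcvg u l -> vcvg v m -> vcvg (fun k => u k - v k) (l - m).
Proof.
move=> ul vm i; have hm := ccvgD (ul i) (ccvgZ (-1) (vm i)).
rewrite !mxE -[X in _ - X]mulr1 -mulrN => e e0; have [N hN] := hm e e0; exists N => k Nk.
by rewrite !mxE -[X in _ - X - _]mulr1 -mulrN; exact: hN.
Qed.

(** Cauchy's estimate for [f - id] along the segment from [w] to [w'], on discs reaching at distance
    at most 1 from it; hence the unit margins. *)
Lemma near_identity_lip n (f : 'rV[C]_n -> 'rV[C]_n) (c w w' : 'rV[C]_n) (r t : R) :
  (forall z, differentiable f z) -> (forall z, nn (z - c) <= r -> nn (f z - z) <= t) ->
  nn (w - c) + 1 <= r -> nn (w' - c) + 1 <= r -> nn (f w' - f w - (w' - w)) <= 4 * t * nn (w' - w).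
Proof.
move=> fd ft wr wr'.
have t0 : 0 <= t by apply: le_trans (nn_ge0 _) (ft w _); lra.
have [v0|v0] := eqVneq (w' - w) 0.
  by move/eqP: v0; rewrite subr_eq0 => /eqP ->; rewrite !subrr nn0 mulr0.
have v1 : 0 < nn (w' - w).
  by rewrite lt_neqAle nn_ge0 andbT eq_sym; apply: contra_neq v0; exact: nn_inj.
apply: nn_le => [|i]; first by rewrite !mulr_ge0 ?nn_ge0.
set v := w' - w in v0 v1 *.
pose g (s : C) := f (w + s *: v) 0 i - (w + s *: v) 0 i.
have gd s : exists d, cdiff g s d.
  have D1 : differentiable ((fun z : 'rV[C]_n => z 0 i : C) \o f) (w + s *: v).
    by apply: differentiable_comp; [exact: fd|exact: df_coord].
  have D2 : differentiable (fun z : 'rV[C]_n => z 0 i : C) (w + s *: v) by exact: df_coord.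
  by have := cdiffB (cdiff_slice D1) (cdiff_slice D2); eexists; eassumption.
have gB (s : R) : 0 <= s -> s <= 1 -> cn (cderiv g s%:C) <= 4 * t * nn v.
  move=> s0 s1; have := @cauchy_estimate R s%:C (1 / nn v) g t.
  rewrite divr_gt0 // => /(_ isT) h.
  have -> : 4 * t * nn v = 4 * t / (1 / nn v) by field; rewrite gt_eqF.
  apply: h; first by move=> z _; exact: gd.
  move=> z; rewrite ltr_pdivlMr // => zs.
  have zc : nn (w + z *: v - c) <= r.
    have -> : w + z *: v - c = (1 - s)%:C *: (w - c) + (s%:C *: (w' - c) + (z - s%:C) *: v).
      by rewrite /v; apply/rowP => j; rewrite !mxE rmorphB rmorph1; ring.
    apply: (le_trans (nnD _ _)); rewrite nnZ cn_real.
    apply: (le_trans (lerD (lexx _) (nnD _ _))); rewrite !nnZ cn_real !ger0_norm ?subr_ge0 //.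
    have h1 : (1 - s) * nn (w - c) <= (1 - s) * (r - 1) by apply: ler_wpM2l; clear -s1 wr; lra.
    have h2 : s * nn (w' - c) <= s * (r - 1) by apply: ler_wpM2l; clear -s0 wr'; lra.
    by move: zs h1 h2; rewrite mulrBl mul1r; clear; lra.
  by have := ft _ zc; apply: le_trans; apply: (le_trans _ (nn_coord _ i)); rewrite /g !mxE.
have := @cdiff_mvi R g (cderiv g) 0 1 (4 * t * nn v).
have E : g 1 - g 0 = (f w' - f w - v) 0 i.
  by rewrite /g scale1r scale0r addr0 /v subrKC; rewrite !mxE; ring.
rewrite E subr0 cn1 mulr1; apply.
  by move=> s s0 s1; have [d hd] := gd (0 + s%:C * 1); exact: cdiff_deriv hd.
by move=> s s0 s1; rewrite add0r mulr1; exact: gB.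
Qed.

Lemma differentiable_lip_at n m (f : 'rV[C]_n -> 'rV[C]_m) x : differentiable f x ->
  exists M : R, exists2 rho : R, 0 < rho & forall y, nn (y - x) < rho -> nn (f y - f x) <= M * nn (y - x).
Proof.
move=> /diff_eps/(_ 1 ltr01)[rho rho0 h]; exists (\sum_(i < n) nn ('d f x (delta_mx 0 i)) + 1), rho => // y yx.
have := h _ yx; rewrite addrCA subrr addr0 mul1r => h1.
have := linear_row_bound ('d f x) (y - x); have := nn_dist (f y - f x) ('d f x (y - x)).
by rewrite mulrDl mul1r; clear -h1; lra.
Qed.

(** Along a nonzero vector in the kernel of the differential, [f] would move by less than any
    multiple of the distance. *)
Lemma expanding_diff_inj n m (f : 'rV[C]_n -> 'rV[C]_m) x v (M rho : R) : differentiable f x -> 0 < rho ->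
  (forall y, nn (y - x) < rho -> nn (y - x) <= M * nn (f y - f x)) -> 'd f x v = 0 -> v = 0.
Proof.
move=> fd rho0 fM dv; apply/eqP; apply: contraT => v0.
have v1 : 0 < nn v.
  by rewrite lt_neqAle nn_ge0 andbT eq_sym; apply: contra_neq v0; exact: nn_inj.
have M0 : 0 < 2 * (`|M| + 1) by rewrite mulr_gt0 // ltr_wpDl.
have [r r0 h] := diff_eps fd (divr_gt0 ltr01 M0).
pose t := Num.min r rho / (2 * nn v); have t0 : 0 < t by rewrite divr_gt0 ?mulr_gt0 // lt_min r0.
have tv : nn (t%:C *: v) < Num.min r rho.
  rewrite nnZ cn_real gtr0_norm // /t -mulrA.
  have -> : (2 * nn v)^-1 * nn v = 1 / 2 by field; rewrite gt_eqF.
  by have : 0 < Num.min r rho; [rewrite lt_min r0|lra].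
move: tv; rewrite lt_min => /andP[tr trho].
have lz : 'd f x (t%:C *: v) = t%:C *: 'd f x v by exact: linearZ.
have := h _ tr; rewrite lz dv scaler0 subr0.
have := fM (x + t%:C *: v); rewrite addrAC subrr add0r => /(_ trho).
have hp : 0 < nn (t%:C *: v) by rewrite nnZ cn_real gtr0_norm // mulr_gt0.
have key (p q : R) : 0 < p -> 0 <= q -> p <= M * q -> q <= 1 / (2 * (`|M| + 1)) * p -> false.
  move=> p0 q0 h1; rewrite mulrC mulrA mulr1 ler_pdivlMr // => h2; have := ler_wpM2r q0 (ler_norm M).
  by move: h1 h2 (normr_ge0 M); nra.
by move=> h1; exact: (key _ _ hp (nn_ge0 _) h1).
Qed.

End Lipschitz.

(** * The limit is an embedding of [X] *)

Section Limit.
Context {R : realType}.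
Local Notation C := (R[i]).
Variables (d : nat) (X : set 'rV[C]_d.+2).
Variables (c e : nat -> 'rV[C]_d.+2) (r dl : nat -> R) (H : nat -> R -> R).
Hypothesis X_analytic : analytic_subvariety X.
Hypothesis X_proper : X <> setT.
Hypothesis X_unbounded : forall M : R, exists2 z, X z & M < nn z.
Hypothesis dl_gt0 : forall s, 0 < dl s.
Hypothesis r_ge0 : forall s, 0 <= r s.
Hypothesis target_outside : forall s, r s < nn (e s - c s).
Hypothesis nested : forall s, nn (c s.+1 - c s) + r s <= r s.+1.
Hypothesis target_inside : forall s, nn (e s - c s.+1) + 2 * dl s <= r s.+1.
Hypothesis exhausting : forall M : R, exists s, M <= r s - nn (c s).

Variables (Th Ps : nat -> 'rV[C]_d.+2 -> 'rV[C]_d.+2) (x : nat -> 'rV[C]_d.+2).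
Hypothesis dataP : limit_data X c e r dl H Th Ps x.
Local Notation tol := (tol dl).
Local Notation deep := (deep c r Th).
Local Notation J := (limit_map Th).

Let ThA s : aut_pair (Th s) (Ps s). Proof. by have [] := dataP. Qed.

(** Seen from step [k], the later maps are [Th s \o Ps k], which are close to the identity on the
    polydisc; their difference from it has Lipschitz constant at most 1/2, and this survives in the
    limit. Injectivity and, with [expanding_diff_inj], immersivity follow. *)
Lemma limit_expanding k u u' : deep k u -> nn (Th k u' - c k) + 2 <= r k ->
  nn (Th k u' - Th k u) <= 2 * nn (J u' - J u).
Proof.
move=> du du'; set w := Th k u; set w' := Th k u'.
have [Td Pd TK PK] := ThA k.
have iu : inside c r dl Th k u by exact: deep_inside.
have iu' : inside c r dl Th k u' by rewrite /inside; have := tol_100 dl k; lra.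
have cv := vcvgB (inside_cvg dl_gt0 nested dataP iu') (inside_cvg dl_gt0 nested dataP iu).
have cl : nn (J u' - J u - (w' - w)) <= 1 / 2 * nn (w' - w).
  apply: (vcvg_near cv (k0 := k)) => s ks.
  have [Sd _ _ _] := ThA s.
  have fd z : differentiable (Th s \o Ps k) z by exact: differentiable_comp.
  have := @near_identity_lip R _ (Th s \o Ps k) (c k) w w' (r k - 2 * tol k) (2 * tol k) fd.
  rewrite /= /w /w' !TK => h; apply: (le_trans (h _ _ _)).
  - move=> z zc; have iz : inside c r dl Th k (Ps k z) by rewrite /inside PK; lra.
    by have [_] := inside_stays dl_gt0 nested dataP iz ks; rewrite PK; have := tol_gt0 dl_gt0 s; lra.
  - by move: du; rewrite /deep; have := tol_100 dl k; lra.
  - by have := tol_100 dl k; lra.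
  by apply: ler_wpM2r; [exact: nn_ge0|have := tol_100 dl k; lra].
have := nn_dist (w' - w) (J u' - J u); rewrite [nn (w' - w - _)]nnB; lra.
Qed.

Lemma limit_injective u u' : X u -> X u' -> J u = J u' -> u = u'.
Proof.
move=> Xu Xu' Juu.
have [k hk] := subvariety_deep dl_gt0 nested exhausting dataP Xu.
have [k' hk'] := subvariety_deep dl_gt0 nested exhausting dataP Xu'.
have d1 := hk _ (leq_maxl k k'); have d2 := hk' _ (leq_maxr k k').
have [_ _ TK _] := ThA (maxn k k').
have d3 : nn (Th (maxn k k') u' - c (maxn k k')) + 2 <= r (maxn k k') by move: d2; rewrite /deep; lra.
have := limit_expanding d1 d3; rewrite Juu subrr nn0 mulr0 => h.
apply: (can_inj TK); apply/eqP; rewrite eq_sym -subr_eq0; apply/eqP; apply: nn_inj.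
by apply/eqP; rewrite eq_le h nn_ge0.
Qed.

Lemma limit_immersive u v : X u -> 'd J u v = 0 -> v = 0.
Proof.
move=> /(subvariety_deep dl_gt0 nested exhausting dataP)[k /(_ _ (leqnn k)) du].
have [Td Pd TK _] := ThA k.
have [M [rho rho0 hM]] := differentiable_lip_at (Pd (Th k u)).
have ud : nn (Th k u - c k) + 2 <= r k by move: du; rewrite /deep; lra.
have Jd := limit_differentiable dl_gt0 nested dataP ud.
have [r1 r10 h1] := deep_nearby dataP k u.
have [r2 r20 h2] : exists2 r2 : R, 0 < r2 & forall y, nn (y - u) < r2 -> nn (Th k y - Th k u) < rho.
  have /differentiable_continuous Tc := Td u.
  have /Tc/nbhs_nnP[rr rr0 h] : nbhs (Th k u) [set z | nn (z - Th k u) < rho].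
    by apply/nbhs_nnP; exists rho.
  by exists rr.
apply: (@expanding_diff_inj _ _ _ _ _ _ (`|M| * 2) (Num.min r1 r2) Jd).
  by rewrite lt_min r10.
move=> y; rewrite lt_min => /andP[y1 y2].
have := hM _ (h2 _ y2); rewrite !TK => h; apply: (le_trans h).
apply: (@le_trans _ _ (`|M| * nn (Th k y - Th k u))).
  by apply: ler_wpM2r; [exact: nn_ge0|exact: ler_norm].
rewrite -mulrA; apply: ler_wpM2l => //; apply: limit_expanding => //.
have := h1 _ y1; have := nn_distD (Th k u) (Th k y) (c k); move: du; rewrite /deep; lra.
Qed.

(** This is properness. A single step [k] serves for all [u]: [limit_pullback] puts [Th k u] into a
    polydisc, whose preimage under [Th k] is bounded. *)
Lemma limit_bounded M : exists M' : R, forall u, X u -> nn (J u) <= M -> nn u <= M'.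
Proof.
have [k hk] := exhausting (M + 1); have [_ Pd TK _] := ThA k.
have [M' hM'] := differentiable_bounded (nn (c k) + r k) Pd.
exists M' => u Xu uM; rewrite -(TK u); apply: hM'.
have := nn_dist (Th k u) (c k); have := @limit_pullback _ _ _ _ _ _ _ _ dl_gt0 nested exhausting _ _ _ dataP k u Xu.
move=> h1; have h2 : nn (J u - c k) + 2 * tol k < r k.
  by have := nnD (J u) (- c k); rewrite nnN; have := tol_100 dl k; lra.
have := h1 h2; lra.
Qed.

(** Step [s] brings [x s] within [dl s] of its target; afterwards the point moves by at most
    [2 * tol s.+1], which is again at most [dl s]. *)
Lemma limit_targets s : [/\ X (x s), nn (J (x s) - e s) <= 2 * dl s &
  exists2 M : R, H s M < nn (x s) & forall u, X u -> nn (J u - c s) + dl s < r s -> nn u <= M].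
Proof.
have [_ hB _ _] := dataP; have [Xx xe [M HM hM]] := hB s; split => //.
  have t1 : 2 * tol s.+1 <= dl s by have := tol_half dl s; have := tol_dl dl s; have := tol_gt0 dl_gt0 s; lra.
  have ix : inside c r dl Th s.+1 (x s).
    by rewrite /inside; have := target_inside s; have := nn_distD (e s) (Th s.+1 (x s)) (c s.+1); lra.
  have := inside_limit dl_gt0 nested dataP ix.
  by have := nn_distD (Th s.+1 (x s)) (J (x s)) (e s); lra.
exists M => // u Xu uc; apply: hM => //; apply: (limit_pullback dl_gt0 nested exhausting dataP) => //.
by have := tol_dl dl s; lra.
Qed.

Lemma limit_near_differentiable u : X u -> exists2 rho : R, 0 < rho & forall y, nn (y - u) < rho -> differentiable J y.
Proof.
move=> /(subvariety_deep dl_gt0 nested exhausting dataP)[k /(_ _ (leqnn k)) du].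
have [rho rho0 h] := deep_nearby dataP k u; exists rho => // y /h yu.
apply: (limit_differentiable dl_gt0 nested dataP (k := k)).
by have := nn_distD (Th k u) (Th k y) (c k); move: du; rewrite /deep; lra.
Qed.

End Limit.

Section Existence.
Context {R : realType}.
Local Notation C := (R[i]).

(* H s M will bound the translates, by the s-th compact part of the group, of the
   points of X of norm at most M. *)
Lemma embedding_avoiding d (X : set 'rV[C]_d.+2) (c e : nat -> 'rV[C]_d.+2) (r dl : nat -> R) (H : nat -> R -> R) :
  analytic_subvariety X -> X <> setT -> ~ finite_set X ->
  (forall s, 0 < dl s) -> (forall s, 0 <= r s) -> (forall s, r s < nn (e s - c s)) ->
  (forall s, nn (c s.+1 - c s) + r s <= r s.+1) -> (forall s, nn (e s - c s.+1) + 2 * dl s <= r s.+1) ->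
  (forall M : R, exists s, M <= r s - nn (c s)) ->
  exists J : 'rV[C]_d.+2 -> 'rV[C]_d.+2, [/\
    forall u, X u -> exists2 rho : R, 0 < rho & forall y, nn (y - u) < rho -> differentiable J y,
    forall u u', X u -> X u' -> J u = J u' -> u = u',
    forall u v, X u -> 'd J u v = 0 -> v = 0,
    forall M, exists M' : R, forall u, X u -> nn (J u) <= M -> nn u <= M' &
    forall s, exists x, [/\ X x, nn (J x - e s) <= 2 * dl s &
      exists2 M : R, H s M < nn x & forall u, X u -> nn (J u - c s) + dl s < r s -> nn u <= M]].
Proof.
move=> Xa XT Xi dl0 r0 out nes ins exh; have Xu := analytic_infinite_unbounded Xa Xi.
have [Th [Ps [x D]]] := @limit_data_exists R d X c e r dl H Xa XT Xu dl0 r0 out.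
exists (limit_map Th); split.
- exact: (limit_near_differentiable dl0 nes exh D).
- exact: (limit_injective dl0 nes exh D).
- exact: (limit_immersive dl0 nes exh D).
- exact: (limit_bounded dl0 nes exh D).
by move=> s; exists (x s); exact: (limit_targets dl0 nes ins exh D).
Qed.

End Existence.

(** * Automorphisms omitting nets in thin shells *)

Section Propagation.
Context {R : realType}.
Local Notation C := (R[i]).

(** A quantitative identity theorem: smallness on a real segment spreads to a disc, and [q] depends
    only on the sizes and bounds, not on the function. *)
Lemma small_on_segment (rho dl B k : R) : 0 < dl -> dl <= rho / 16 -> 0 <= B -> 0 < k ->
  exists2 q : R, 0 < q & forall (D : C -> C) (x : R), hol x%:C rho D -> bounded_by x%:C rho D B ->
    (forall t, x <= t -> t <= x + dl -> cn (D t%:C) <= q) -> forall z, cn (z - x%:C) <= dl -> cn (D z) <= k.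
Proof.
move=> d0 dr B0 k0; have k20 : 0 < k / 2 by lra.
have [T hT] := half_pow_small B0 k20.
have p0 : 0 < 192 ^+ T :> R by rewrite exprn_gt0.
exists (k / (4 * 192 ^+ T)) => [|D x Dh DB Ds z zx]; first by rewrite divr_gt0 ?mulr_gt0.
have q0 : 0 <= k / (4 * 192 ^+ T) by rewrite divr_ge0 ?mulr_ge0 // ltW.
have := @small_at_nodes R x%:C rho dl D B (k / (4 * 192 ^+ T)) T z d0 dr q0 Dh DB.
have nd (l : 'I_T) : cn (D (x%:C + (lnode dl T l)%:C)) <= k / (4 * 192 ^+ T).
  have [h1 h2] := lnode_ge0 l d0; rewrite -rmorphD; apply: Ds; clear -h1 h2; lra.
move=> /(_ nd zx) h; apply: (le_trans h).
have -> : k / (4 * 192 ^+ T) * (2 * 192 ^+ T) = k / 2 by field; rewrite gt_eqF.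
have : (6 * dl / rho) ^+ T * B <= B / 2 ^+ T; last by (clear -hT; lra).
rewrite mulrC; apply: ler_wpM2l => //; rewrite -exprVn; apply: lerXn2r; rewrite ?nnegrE ?divr_ge0 //; try lra.
by rewrite ler_pdivrMr; lra.
Qed.

(* Otherwise D is small on a segment ending at t0 and, by repeated interpolation
   towards the left, at 0. *)
Lemma propagation (sg B Dl ep : R) : 0 < sg -> 0 <= B -> 0 < Dl -> 0 < ep ->
  exists2 q : R, 0 < q & forall D : C -> C,
    (forall t, 0 <= t -> t <= 1 -> hol t%:C sg D /\ bounded_by t%:C sg D B) -> Dl <= cn (D 0) ->
    forall t0, ep <= t0 -> t0 <= 1 -> exists t1, [/\ t0 - ep <= t1, t1 <= t0 & q < cn (D t1%:C)].
Proof.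
move=> s0 B0 D0 e0; pose dl := Num.min (sg / 16) ep.
have dl0 : 0 < dl by rewrite lt_min e0 divr_gt0.
have dls : dl <= sg / 16 by rewrite ge_min lexx.
have dle : dl <= ep by rewrite ge_min lexx orbT.
have chain N (k : R) : 0 < k -> exists2 q : R, 0 < q & forall D : C -> C,
    (forall t, 0 <= t -> t <= 1 -> hol t%:C sg D /\ bounded_by t%:C sg D B) ->
    forall x, 0 <= x -> x + dl <= 1 -> x <= N.+1%:R * dl ->
    (forall t, x <= t -> t <= x + dl -> cn (D t%:C) <= q) -> cn (D 0) <= k.
  elim: N k => [|N IH] k k0.
    have [q q0 hq] := small_on_segment dl0 dls B0 k0; exists q => // D hD x x0 x1 xN Ds.
    have [h1 h2] := hD x x0 ltac:(lra); apply: (hq D x h1 h2 Ds).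
    by rewrite sub0r cnN cn_real ger0_norm //; lra.
  have [q1 q10 hq1] := IH k k0.
  have [q2 q20 hq2] := small_on_segment dl0 dls B0 q10.
  have [q3 q30 hq3] := small_on_segment dl0 dls B0 k0.
  exists (Num.min q2 q3) => [|D hD x x0 x1 xN Ds]; first by rewrite lt_min q20.
  have [h1 h2] := hD x x0 ltac:(lra).
  have [xd|xd] := leP x dl.
    apply: (hq3 D x h1 h2) => [t t1 t2|].
      by have := Ds t t1 t2; rewrite le_min => /andP[].
    by rewrite sub0r cnN cn_real ger0_norm.
  apply: (hq1 D hD (x - dl)); rewrite ?subr_ge0 ?subrK //; first exact: ltW.
  - by lra.
  - by move: xN; rewrite -(natr1 N.+1) mulrDl mul1r; lra.
  move=> t t1 t2; apply: (hq2 D x h1 h2) => [t' t1' t2'|].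
    by have := Ds t' t1' t2'; rewrite le_min => /andP[].
  by rewrite -rmorphB cn_real ler_norml; lra.
have [q q0 hq] := chain (Num.bound (1 / dl)) (Dl / 2) ltac:(lra).
exists q => // D hD D1 t0 t0e t01; apply: contrapT => hn.
have : cn (D 0) <= Dl / 2; last by lra.
apply: (hq D hD (t0 - dl)); rewrite ?subrK //; try lra.
  have := archi_boundP (divr_ge0 ler01 (ltW dl0)); rewrite ltr_pdivrMr // -natr1 mulrDl mul1r; lra.
move=> t tl tr; rewrite leNgt; apply/negP => qt; apply: hn; exists t; split => //; lra.
Qed.

End Propagation.

(** * Jacobian matrices along complex lines *)

Section Jacobian.
Context {R : realType}.
Local Notation C := (R[i]).

Lemma cdiff_row n m (F : 'rV[C]_n -> 'rV[C]_m) z u i : differentiable F z ->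
  cdiff (fun s => F (z + s *: u) 0 i) 0 (('d F z u) 0 i).
Proof.
move=> Fd; have D1 : differentiable ((fun w : 'rV[C]_m => w 0 i : C) \o F) (z + 0 *: u).
  by rewrite scale0r addr0; apply: differentiable_comp => //; exact: df_coord.
move=> e e0; have M0 : 0 < nn u + 1 by rewrite ltr_wpDl // nn_ge0.
have [r r0 hr] := diff_eps Fd (divr_gt0 e0 M0).
exists (r / (nn u + 1)); first exact: divr_gt0.
move=> h; rewrite ltr_pdivlMr // => hh.
have hu : nn (h *: u) <= cn h * (nn u + 1).
  by rewrite nnZ; apply: ler_wpM2l; rewrite ?cn_ge0 ?lerDl.
have lz : 'd F z (h *: u) = h *: 'd F z u by exact: linearZ.
have := hr _ (le_lt_trans hu hh); rewrite lz => h1.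
have := nn_coord (F (z + h *: u) - F z - h *: 'd F z u) i; rewrite !mxE => h2.
rewrite add0r scale0r addr0 [_ * h]mulrC; apply: (le_trans h2); apply: (le_trans h1).
apply: (@le_trans _ _ (e / (nn u + 1) * (cn h * (nn u + 1)))).
  by apply: ler_wpM2l => //; rewrite divr_ge0 ?ltW.
by rewrite le_eqVlt; apply/orP; left; apply/eqP; field; rewrite gt_eqF.
Qed.

(** The derivative in the direction [u] is the limit of difference quotients with steps [sk k].
    These are holomorphic in [t] and uniformly bounded, so [hol_limit] applies. *)
Lemma partial_hol n (f : 'rV[C]_n -> C) (c v u : 'rV[C]_n) a rho (eta B : R) (g : C -> C) : 0 < eta ->
  (forall z, differentiable f z) -> (forall t, cdiff (fun s => f (c + t *: v + s *: u)) 0 (g t)) ->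
  (forall t s, cn (t - a) < rho -> cn s < eta -> cn (f (c + t *: v + s *: u)) <= B) ->
  hol a rho g /\ bounded_by a rho g (8 * B / eta).
Proof.
move=> eta0 fd fg fB.
pose sk k : R := eta / 4 / 2 ^+ k; have sk0 k : 0 < sk k by rewrite !divr_gt0 ?exprn_gt0.
have sk1 k : sk k < eta / 2.
  apply: (@le_lt_trans _ _ (eta / 4)); last by lra.
  by rewrite ler_pdivrMr ?exprn_gt0 // ler_peMr ?exprn_ege1 //; lra.
have fh t : hol 0 eta (fun s => f (c + t *: v + s *: u)).
  by move=> s _; eexists; apply: cdiff_slice; exact: fd.
have Fb : forall k, bounded_by a rho (fun t => (f (c + t *: v + (sk k)%:C *: u) - f (c + t *: v)) * ((sk k)^-1)%:C) (8 * B / eta).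
  move=> k t ta; rewrite cnM cn_real gtr0_norm ?invr_gt0 // ler_pdivrMr //.
  have := @hol_lip R 0 eta _ B (sk k)%:C 0 eta0 (fh t); rewrite !subr0 cn0 cn_real gtr0_norm // scale0r addr0.
  by apply=> //; [move=> s; rewrite subr0 => /(fB t s ta)|lra].
have cv t : ccvg (fun k => (f (c + t *: v + (sk k)%:C *: u) - f (c + t *: v)) * ((sk k)^-1)%:C) (g t).
  move=> e e0; have [r r0 hr] := fg t e e0.
  have [N hN] := half_pow_small (ltW (divr_gt0 eta0 (ltr0Sn R 3))) (divr_gt0 r0 (ltr0Sn R 1)).
  exists N => k Nk; have sr : sk k < r.
    have : sk k <= eta / 4 / 2 ^+ N; last by lra.
    apply: ler_wpM2l; first by lra.
    by rewrite lef_pV2 ?posrE ?exprn_gt0 //; apply: ler_weXn2l; [lra|].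
  have := hr (sk k)%:C; rewrite cn_real gtr0_norm // => /(_ sr); rewrite add0r scale0r addr0 => h.
  rewrite -(ler_pM2r (sk0 k)); apply: le_trans h.
  rewrite -[X in _ * X](gtr0_norm (sk0 k)) -cn_real -cnM mulrBl -mulrA -rmorphM mulVf ?gt_eqF //.
  by rewrite rmorph1 mulr1.
split.
  apply: (hol_limit (F := fun k t => (f (c + t *: v + (sk k)%:C *: u) - f (c + t *: v)) * ((sk k)^-1)%:C)) Fb _ => //.
  move=> k; apply: holM; last exact: hol_cst; apply: holB.
    move=> t _; have := @cdiff_slice R n f (c + (sk k)%:C *: u) v t (fd _) => h.
    have E : (fun w => f (c + (sk k)%:C *: u + w *: v)) = (fun t => f (c + t *: v + (sk k)%:C *: u)).
      by apply: funext => w; rewrite addrAC.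
    by rewrite E in h; eexists; exact: h.
  by move=> t _; eexists; apply: cdiff_slice; exact: fd.
by move=> t ta; apply: (ccvg_le (cv t)) => k; exact: Fb.
Qed.

Definition jac n (F : 'rV[C]_n -> 'rV[C]_n) z : 'M[C]_n := \matrix_(k, i) ('d F z (delta_mx 0 k)) 0 i.

Lemma jacE n (F : 'rV[C]_n -> 'rV[C]_n) z u : 'd F z u = u *m jac F z.
Proof.
rewrite {1}[u]row_sum_delta linear_sum; apply/rowP => i; rewrite summxE mxE; apply: eq_bigr => k _.
have -> : 'd F z (u 0 k *: delta_mx 0 k) = u 0 k *: 'd F z (delta_mx 0 k) by exact: linearZ.
by rewrite !mxE.
Qed.

Lemma det_bound n (A : 'M[C]_n) (L : R) : 0 <= L -> (forall i j, cn (A i j) <= L) -> cn (\det A) <= (n`!)%:R * L ^+ n.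
Proof.
move=> L0 AL; rewrite /determinant; apply: (le_trans (cn_sum _ _ _)).
apply: (@le_trans _ _ (\sum_(s : 'S_n) L ^+ n)); last by rewrite sumr_const card_Sn mulr_natl.
apply: ler_sum => s _; rewrite cnM.
have -> : cn ((-1) ^+ s : C) = 1 by case: (odd_perm s); rewrite ?expr1 ?expr0 ?cnN cn1.
rewrite mul1r -[X in _ ^+ X]card_ord -prodr_const.
elim/big_rec2: _ => [|i y1 y2 _ h]; first by rewrite cn1.
by rewrite cnM; apply: ler_pM => //; exact: cn_ge0.
Qed.

Lemma det_hol n (A : C -> 'M[C]_n) a rho : (forall i j, hol a rho (fun t => A t i j)) -> hol a rho (fun t => \det (A t)).
Proof.
move=> Ah; rewrite /determinant; apply: hol_sum => s _; apply: holM; first exact: hol_cst.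
by apply: hol_prod => i _; exact: Ah.
Qed.

(** The adjugate matrix recovers [\det A *: u] from [u *m A], and its entries are bounded minors. *)
Lemma det_lower_bound n (A : 'M[C]_n.+1) (L : R) (u : 'rV[C]_n.+1) : 0 <= L -> (forall i j, cn (A i j) <= L) ->
  cn (\det A) * nn u <= n.+1%:R * (n`!)%:R * L ^+ n * nn (u *m A).
Proof.
move=> L0 AL; have aL i j : cn ((\adj A) i j) <= (n`!)%:R * L ^+ n.
  rewrite mxE /cofactor cnM.
  have -> : cn ((-1) ^+ (j + i) : C) = 1 by rewrite -signr_odd; case: (odd _); rewrite ?expr1 ?expr0 ?cnN cn1.
  by rewrite mul1r; apply: det_bound => // k l; rewrite !mxE.
have E : \det A *: u = (u *m A) *m \adj A by rewrite -mulmxA mul_mx_adj mul_mx_scalar.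
rewrite -nnZ E; apply: nn_le => [|j]; first by rewrite !mulr_ge0 ?nn_ge0 ?exprn_ge0.
rewrite mxE; apply: (le_trans (cn_sum _ _ _)).
apply: (@le_trans _ _ (\sum_(i < n.+1) (nn (u *m A) * ((n`!)%:R * L ^+ n)))).
  apply: ler_sum => i _; rewrite cnM; apply: ler_pM; rewrite ?cn_ge0 //; exact: nn_coord.
by rewrite sumr_const card_ord -mulr_natl le_eqVlt; apply/orP; left; apply/eqP; ring.
Qed.

End Jacobian.

(** * Images crossing a shell cover balls of uniform size *)

Section Shell.
Context {R : realType}.
Local Notation C := (R[i]).

Lemma nn_dist_near m (p q w : 'rV[C]_m) (e : R) : nn (p - q) <= e -> `|nn (q - w) - nn (p - w)| <= e.
Proof.
move=> pq; rewrite ler_norml; have h1 := nn_distD q p w; have h2 := nn_distD p q w.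
rewrite (nnB q p) in h2; move: pq h1 h2.
move: (nn (p - q)) (nn (q - w)) (nn (p - w)) => x1 x2 x3; lra.
Qed.

Lemma path_ivt n m (F : 'rV[C]_n -> 'rV[C]_m) (c v : 'rV[C]_n) (w : 'rV[C]_m) (b : R) :
  (forall z, differentiable F z) -> nn (F c - w) <= b -> b <= nn (F (c + v) - w) ->
  exists t : R, [/\ 0 <= t, t <= 1 & nn (F (c + t%:C *: v) - w) = b].
Proof.
move=> Fd h0 h1; pose f (t : R) := nn (F (c + t%:C *: v) - w).
have fc : {within `[0, 1], continuous f}.
  apply: continuous_subspaceT => x; apply/cvgrPdist_le => e e0.
  have /differentiable_continuous Fc := Fd (c + x%:C *: v).
  have /Fc/nbhs_nnP[rho rho0 h] : nbhs (F (c + x%:C *: v)) [set z | nn (z - F (c + x%:C *: v)) < e].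
    by apply/nbhs_nnP; exists e.
  have v0 : 0 < nn v + 1 by rewrite ltr_wpDl // nn_ge0.
  have p0 : 0 < rho / (nn v + 1) by rewrite divr_gt0.
  near=> t; rewrite /f; have tx : `|x - t| < rho / (nn v + 1).
    by near: t; apply: cvgr_dist_lt.
  have tE : nn (c + t%:C *: v - (c + x%:C *: v)) < rho.
    have -> : c + t%:C *: v - (c + x%:C *: v) = (t - x)%:C *: v.
      by rewrite rmorphB scalerBl; apply/rowP => i; rewrite !mxE; ring.
    rewrite nnZ cn_real distrC; move: tx; rewrite ltr_pdivlMr //; apply: le_lt_trans.
    by apply: ler_wpM2l; rewrite ?lerDl.
  by apply: nn_dist_near; apply: ltW; exact: h tE.
have [|t t01 ft] := @IVT R f 0 1 b ler01 fc.
  rewrite ge_min le_max /f scale0r addr0 scale1r h0 h1 orbT //.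
by move: t01; rewrite in_itv /= => /andP[t0 t1]; exists t.
Unshelve. all: by end_near.
Qed.

Lemma path_lip n m (F : 'rV[C]_n -> 'rV[C]_m) (c v : 'rV[C]_n) (sg B : R) : 0 < sg -> 0 <= B ->
  (forall z, differentiable F z) -> (forall (t : R) s, 0 <= t -> t <= 1 -> cn (s - t%:C) < sg -> nn (F (c + s *: v)) <= B) ->
  forall t t' : R, 0 <= t -> t <= 1 -> 0 <= t' -> t' <= 1 ->
  nn (F (c + t%:C *: v) - F (c + t'%:C *: v)) <= 4 * B / sg * `|t - t'|.
Proof.
move=> s0 B0 Fd FB t t' t0 t1 t'0 t'1.
apply: nn_le => [|i]; first by rewrite mulr_ge0 // divr_ge0 ?mulr_ge0 // ltW.
pose g (s : C) := F (c + s *: v) 0 i.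
have gd s : exists d, cdiff g s d.
  have D1 : differentiable ((fun z : 'rV[C]_m => z 0 i : C) \o F) (c + s *: v).
    by apply: differentiable_comp; [exact: Fd|exact: df_coord].
  by have := cdiff_slice D1; eexists; eassumption.
have := @cdiff_mvi R g (cderiv g) t'%:C t%:C (4 * B / sg).
rewrite -rmorphB cn_real => h.
have -> : (F (c + t%:C *: v) - F (c + t'%:C *: v)) 0 i = g t%:C - g t'%:C by rewrite !mxE.
apply: h => s u0 u1; first by have [d hd] := gd (t'%:C + s%:C * (t - t')%:C); exact: cdiff_deriv hd.
rewrite -rmorphM -rmorphD; apply: (@cauchy_estimate R _ sg g B s0); first by move=> z _; exact: gd.
move=> z zs; apply: le_trans (nn_coord _ i) _; apply: (FB (t' + s * (t - t'))) => //; nra.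
Qed.

(** The inverse [G] is globally defined. If it sent [q] far from [z], its path over the segment from
    [F z] to [q] would cross the sphere of radius [k] about [z], where the linear part of [F] moves
    points farther than the segment reaches. *)
Lemma inverse_covers n (F G : 'rV[C]_n -> 'rV[C]_n) (z : 'rV[C]_n) (rho B m : R) : aut_pair F G -> 0 < rho -> 0 < m -> 0 <= B ->
  (forall x, nn (x - z) < rho -> nn (F x) <= B) -> (forall u, m * nn u <= nn ('d F z u)) ->
  forall k, 0 < k -> k <= rho / 32 -> k * (64 * B / rho ^+ 2) <= m / 2 ->
  forall q, nn (q - F z) < m * k / 2 -> nn (G q - z) < k.
Proof.
move=> [Fd Gd FK GK] rho0 m0 B0 FB hm k k0 kr km q qz; rewrite ltNge; apply/negP => hq.
have [|//|t [t0 t1 tk]] := @path_ivt n n G (F z) (q - F z) z k Gd _ _.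
- by rewrite FK subrr nn0 ltW.
- by rewrite [F z + _]addrC subrK.
set y := G _ in tk; have yE : F (z + (y - z)) = F z + t%:C *: (q - F z) by rewrite [z + _]addrC subrK GK.
have kr16 : nn (y - z) < rho / 16 by rewrite tk; lra.
have := hol_vector_taylor rho0 (fun x _ => Fd x) FB kr16; rewrite yE [F z + _]addrC addrK tk.
have := hm (y - z); rewrite tk => h1.
have := nn_dist ('d F z (y - z)) (t%:C *: (q - F z)); rewrite nnB nnZ cn_real ger0_norm //.
have tq : t * nn (q - F z) <= nn (q - F z) by rewrite ler_piMl // nn_ge0.
have : 64 * B / rho ^+ 2 * k ^+ 2 <= m / 2 * k.
  by rewrite expr2 mulrA ler_wpM2r ?(ltW k0) // mulrC.
move: (64 * B / rho ^+ 2 * k ^+ 2) h1 qz tq => A; lra.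
Qed.

Lemma jac_path n (F : 'rV[C]_n -> 'rV[C]_n) (c v : 'rV[C]_n) (a rho eta B : R) : 0 < eta ->
  (forall z, differentiable F z) ->
  (forall t s (u : 'rV[C]_n), cn (t - a%:C) < rho -> cn s < eta -> nn u <= 1 -> nn (F (c + t *: v + s *: u)) <= B) ->
  forall i j, hol a%:C rho (fun t => jac F (c + t *: v) i j) /\ bounded_by a%:C rho (fun t => jac F (c + t *: v) i j) (8 * B / eta).
Proof.
move=> e0 Fd FB i j.
apply: (@partial_hol R n ((fun z : 'rV[C]_n => z 0 j : C) \o F) c v (delta_mx 0 i) a%:C rho eta B) => //.
- by move=> z; apply: differentiable_comp; [exact: Fd|exact: df_coord].
- by move=> t; rewrite /jac mxE; exact: cdiff_row.
move=> t s ta se; apply: le_trans (nn_coord _ j) _; apply: FB => //.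
apply: nn_le => // k; rewrite mxE eqxx /=; case: eqP => _; first by rewrite cn1.
by rewrite cn0.
Qed.

(* The segment from c to z contains a point in the shell at which the Jacobian
   determinant is not small; F covers a ball of radius th around its image. *)
Lemma shell_ball d (A0 eta B r dlt Dl : R) : 0 < A0 -> 0 < eta -> 0 <= B -> 0 < dlt -> 0 < Dl ->
  exists2 th : R, 0 < th & forall (F G : 'rV[C]_d.+1 -> 'rV[C]_d.+1) (c c' z : 'rV[C]_d.+1) a, aut_pair F G -> a <= A0 ->
    (forall y, nn (y - c) <= a -> nn (F y) <= B) -> nn (F c - c') <= r -> Dl <= cn (\det (jac F c)) ->
    nn (z - c) <= a - 2 * eta -> r + dlt <= nn (F z - c') ->
    exists p, [/\ r + dlt / 4 <= nn (p - c'), nn (p - c') <= r + 3 * dlt / 4 &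
      forall q, nn (q - p) < th -> nn (G q - c) <= a - eta].
Proof.
(* Since [v] has norm at most [A0], complex parameters within [sg] of [0, 1] keep [c + s *: v] at
   distance at most [a - eta] from [c]. *)
move=> A00 e0 B0 dl0 Dl0; pose sg := eta / A0; have sg0 : 0 < sg by rewrite divr_gt0.
pose L := 8 * B / (eta / 2); have L0 : 0 <= L by rewrite !divr_ge0 ?mulr_ge0 // ltW.
pose LN := 4 * B / sg; have LN0 : 0 <= LN by apply: divr_ge0; [exact: mulr_ge0|exact: ltW].
(* Over a parameter interval of length [ep] the image moves by at most [dlt / 4]. The point found by
   [propagation] just before the crossing of the middle sphere thus still lies in the shell. *)
pose ep := dlt / (4 * (LN + 1)); have ep0 : 0 < ep by rewrite divr_gt0 // mulr_gt0 // ltr_wpDl.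
have LNep : LN * ep <= dlt / 4.
  rewrite /ep; have -> : dlt / (4 * (LN + 1)) = dlt / 4 / (LN + 1) by field; rewrite gt_eqF // ltr_wpDl.
  by rewrite mulrA ler_pdivrMr ?ltr_wpDl // mulrC; apply: ler_wpM2l; [rewrite divr_ge0 // ltW|lra].
have BD0 : 0 <= (d.+1`!)%:R * L ^+ d.+1 by rewrite mulr_ge0 ?exprn_ge0.
have [q q0 hq] := propagation sg0 BD0 Dl0 ep0.
pose K := d.+1%:R * (d`!)%:R * L ^+ d + 1.
have K0 : 0 < K by rewrite ltr_wpDl // !mulr_ge0 ?exprn_ge0.
(* By [det_lower_bound], a differential whose determinant exceeds [q] stretches every vector at
   least by the factor [m]. *)
pose m := q / K; have m0 : 0 < m by rewrite divr_gt0.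
pose AA := 64 * B / eta ^+ 2; have AA0 : 0 <= AA by rewrite divr_ge0 ?sqr_ge0 // mulr_ge0.
pose k := Num.min (eta / 32) (m / (2 * (AA + 1))).
have AA1 : 0 < 2 * (AA + 1) by rewrite mulr_gt0 // ltr_wpDl.
have k0 : 0 < k by rewrite lt_min !divr_gt0.
have ke : k <= eta / 32 by rewrite ge_min lexx.
have kA : k * AA <= m / 2.
  apply: (@le_trans _ _ (m / (2 * (AA + 1)) * AA)).
    by apply: ler_wpM2r => //; rewrite ge_min lexx orbT.
  by rewrite mulrAC ler_pdivrMr //; move: m0 AA0; clear; nra.
exists (m * k / 2) => [|F G c c' z a FG aA FB Fc Fj zc Fz]; first by apply: divr_gt0 => //; exact: mulr_gt0.
have [Fd Gd FK GK] := FG; set v := z - c in zc.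
have r1 : r <= r + dlt / 2 by clear -dl0; lra.
have r2 : r + dlt / 2 <= r + dlt by clear -dl0; lra.
have zE : z = c + v by rewrite addrC subrK.
have v0 : 0 <= nn v := nn_ge0 v.
have sgv : sg * nn v <= eta.
  by rewrite /sg mulrAC ler_pdivrMr //; apply: ler_wpM2l; [exact: ltW|(clear -zc aA e0; lra)].
have tv (t : R) s : 0 <= t -> t <= 1 -> cn (s - t%:C) < sg -> nn (s *: v) <= a - eta.
  move=> t0 t1 st; rewrite nnZ; have := cn_dist s t%:C; rewrite cn_real ger0_norm // => h.
  have : cn s * nn v <= (1 + sg) * nn v by apply: ler_wpM2r => //; clear -h t1 st; lra.
  by rewrite mulrDl mul1r; clear -sgv zc; lra.
have F1 (t : R) s : 0 <= t -> t <= 1 -> cn (s - t%:C) < sg -> nn (F (c + s *: v)) <= B.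
  by move=> t0 t1 st; apply: FB; rewrite addrAC subrr add0r; apply: (le_trans (tv t s t0 t1 st)); clear -e0; lra.
have lip := path_lip sg0 B0 Fd F1; have Fz' := Fz; rewrite {1}zE in Fz'.
have [t0 [t00 t01 Nt0]] := @path_ivt d.+1 d.+1 F c v c' (r + dlt / 2) Fd (le_trans Fc r1) (le_trans r2 Fz').
have ept : ep <= t0.
  rewrite leNgt; apply/negP => tep; have := lip t0 0 t00 t01 (lexx _) ler01; rewrite -/LN subr0 scale0r addr0 ger0_norm // => h1.
  have h2 : LN * t0 <= LN * ep by apply: ler_wpM2l => //; apply: ltW.
  have := nn_distD (F c) (F (c + t0%:C *: v)) c'; rewrite Nt0.
  move: (nn (F c - c')) (nn (F (c + t0%:C *: v) - F c)) Fc h1 => x1 x2 Fc h1; clear -Fc h1 h2 LNep dl0; lra.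
have jp (t : R) : 0 <= t -> t <= 1 -> forall i j, hol t%:C sg (fun s => jac F (c + s *: v) i j) /\
    bounded_by t%:C sg (fun s => jac F (c + s *: v) i j) L.
  move=> h0 h1; apply: jac_path => //; first by rewrite divr_gt0.
  move=> s s' u st s'e u1; apply: FB; rewrite -[c + s *: v + _]addrA [c + _]addrC addrK.
  apply: (le_trans (nnD _ _)); rewrite [nn (s' *: u)]nnZ; have := tv t s h0 h1 st.
  have : cn s' * nn u <= eta / 2 * 1 by apply: ler_pM; rewrite ?cn_ge0 ?nn_ge0 // ltW.
  move: (nn (s *: v)) (cn s' * nn u) => x1 x2; clear -e0; lra.
have [||t1 [t10 t11 qD]] := hq (fun s => \det (jac F (c + s *: v))) _ _ t0 ept t01.
- move=> t h0 h1; split; first by apply: det_hol => i j; have [] := jp t h0 h1 i j.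
  by move=> s st; apply: det_bound => // i j; have [_] := jp t h0 h1 i j; apply.
- by rewrite scale0r addr0.
have t1_0 : 0 <= t1 by apply: le_trans t10; rewrite subr_ge0.
have t1_1 : t1 <= 1 by exact: le_trans t11 t01.
have in1 : nn (t1%:C *: v) <= a - 2 * eta.
  rewrite nnZ cn_real ger0_norm //; apply: le_trans zc.
  by rewrite ler_piMl.
exists (F (c + t1%:C *: v)).
have h1 := lip t1 t0 t1_0 t1_1 t00 t01; rewrite -/LN in h1.
have h2 : LN * `|t1 - t0| <= dlt / 4.
  apply: le_trans LNep; apply: ler_wpM2l => //; rewrite ler_distl t10 /=.
  by apply: (le_trans t11); rewrite lerDl ltW.
have : `|r + dlt / 2 - nn (F (c + t1%:C *: v) - c')| <= dlt / 4 by rewrite -Nt0; have := nn_dist_near c' (le_trans h1 h2).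
rewrite ler_norml.
move: (nn (F (c + t1%:C *: v) - c')) => N N1.
split; [clear -N1 dl0; lra|clear -N1 dl0; lra|move=> y yp].
have := @inverse_covers d.+1 F G (c + t1%:C *: v) eta B m FG e0 m0 B0.
have FBz x : nn (x - (c + t1%:C *: v)) < eta -> nn (F x) <= B.
  move=> xz; apply: FB; apply: (le_trans (nn_distD (c + t1%:C *: v) x c)).
  rewrite [c + _ - c]addrAC subrr add0r; apply: (le_trans (lerD (ltW xz) in1)); clear -e0; lra.
have mz u : m * nn u <= nn ('d F (c + t1%:C *: v) u).
  rewrite /m mulrAC ler_pdivrMr // jacE [_ * K]mulrC.
  apply: (@le_trans _ _ (cn (\det (jac F (c + t1%:C *: v))) * nn u)).
    by apply: ler_wpM2r; [exact: nn_ge0|exact: ltW].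
  apply: (@le_trans _ _ (d.+1%:R * d`!%:R * L ^+ d * nn (u *m jac F (c + t1%:C *: v)))).
    apply: det_lower_bound => // i j; have [_] := jp t1 t1_0 t1_1 i j; apply.
    by rewrite subrr cn0.
  by apply: ler_wpM2r; [exact: nn_ge0|rewrite lerDl].
move=> /(_ FBz mz k k0 ke kA y yp) h5.
apply: (le_trans (nn_distD (c + t1%:C *: v) (G y) c)); rewrite [c + _ - c]addrAC subrr add0r.
apply: (le_trans (lerD (ltW h5) in1)); clear -ke e0; lra.
Qed.

End Shell.

(** * Maps of nearly isometric growth; nets in shells *)

Section Fixed.
Context {R : realType}.
Local Notation C := (R[i]).

(** Liouville's argument: on a ball of radius [rho / 2] the map is bounded by [2 * rho], so the
    second-order Taylor remainder at [u] is at most [512 * nn u ^+ 2 / rho], with [rho] arbitrarily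
    large. *)
Lemma affine_of_linear_growth n (F : 'rV[C]_n -> 'rV[C]_n) (c : 'rV[C]_n) :
  (forall z, differentiable F z) ->
  (forall M : R, exists2 rho : R, M <= rho & forall z, nn (z - c) <= rho - 1 -> nn (F z - c) <= rho + 1) ->
  forall u, F (c + u) = F c + 'd F c u.
Proof.
move=> Fd hF u; apply/eqP; rewrite -subr_eq0 opprD addrA; apply/eqP; apply: nn_small => e e0.
have [rho Mrho h] := hF (Num.max (512 * nn u ^+ 2 / e) (Num.max (32 * nn u + 4) (nn c + 4))).
move: Mrho; rewrite !ge_max => /and3P[m1 m2 m3].
have u0 := nn_ge0 u; have c0 := nn_ge0 c; have rho0 : 0 < rho by lra.
have r2 : 0 < rho / 2 by lra.
have FB x : nn (x - c) < rho / 2 -> nn (F x) <= 2 * rho.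
  by move=> xc; have := h x ltac:((clear -u0 m2 xc; lra)); have := nn_dist (F x) c; clear -m3; lra.
have uc : nn u < rho / 2 / 16 by lra.
apply: (le_trans (hol_vector_taylor r2 (fun x _ => Fd x) FB uc)).
have -> : 64 * (2 * rho) / (rho / 2) ^+ 2 * nn u ^+ 2 = 512 * nn u ^+ 2 / rho by field; rewrite gt_eqF.
by rewrite ler_pdivrMr // [e * _]mulrC -ler_pdivrMr.
Qed.

Lemma symmetric_bound n (p q : 'rV[C]_n) (t M : R) : 0 < t -> nn (p + t%:C *: q) <= M -> nn (p + - t%:C *: q) <= M ->
  t * nn q <= M.
Proof.
move=> t0 h1 h2; have := nnD (p + t%:C *: q) (- (p + - t%:C *: q)); rewrite nnN.
have -> : p + t%:C *: q - (p + - t%:C *: q) = (t + t)%:C *: q.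
  by rewrite rmorphD; apply/rowP => i; rewrite !mxE; ring.
rewrite nnZ cn_real gtr0_norm ?addr_gt0 //; move: h1 h2.
move: (nn (p + t%:C *: q)) (nn (p + - t%:C *: q)) (nn q) => x y z; clear; lra.
Qed.

(** Comparing the images of [c + t *: u] and [c - t *: u] eliminates the constant term. With
    [t * nn u = rho - 1] the stretching is at most [(rho + 1) / (rho - 1)], which tends to 1. *)
Lemma linear_growth_contracts n (F L : 'rV[C]_n -> 'rV[C]_n) (c : 'rV[C]_n) : (forall u, F (c + u) = F c + L u) ->
  (forall s u, L (s *: u) = s *: L u) ->
  (forall M : R, exists2 rho : R, M <= rho & forall z, nn (z - c) <= rho - 1 -> nn (F z - c) <= rho + 1) ->
  forall u, nn (L u) <= nn u.
Proof.
move=> Fa lz hF u; apply/ler_addgt0Pr => e e0.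
have [u0|u0] := eqVneq u 0.
  have -> : L u = 0 by have := lz 0 0; rewrite !scale0r u0.
  by rewrite u0 nn0 add0r ltW.
have up : 0 < nn u by rewrite lt_def nn_ge0 andbT; apply: contra u0 => /eqP/nn_inj ->.
have [rho Mrho h] := hF (2 * nn u / e + 2).
have rho1 : 0 < rho - 1 by have := divr_ge0 (nn_ge0 u) (ltW e0); lra.
pose t := (rho - 1) / nn u; have t0 : 0 < t by rewrite divr_gt0.
have tu : t * nn u = rho - 1 by rewrite /t divfK // gt_eqF.
have hs (s : C) : cn s = t -> nn (F c - c + s *: L u) <= rho + 1.
  move=> st; have -> : F c - c + s *: L u = F (c + s *: u) - c by rewrite Fa lz addrAC.
  by apply: h; rewrite addrAC subrr add0r nnZ st tu.
have h1 := hs t%:C; have h2 := hs (- t%:C).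
rewrite cnN cn_real gtr0_norm // in h1 h2; have {}h1 := h1 erefl; have {}h2 := h2 erefl.
have h3 := symmetric_bound t0 h1 h2.
have h4 : (rho - 1) * nn (L u) <= (rho + 1) * nn u by rewrite -tu mulrAC; apply: ler_wpM2r; [exact: ltW|].
have h5 : 2 * nn u <= (rho - 1) * e.
  rewrite -ler_pdivrMr //; move: Mrho; move: (2 * nn u / e) => x; clear; lra.
rewrite -(ler_pM2l rho1); move: h4 h5; move: (nn (L u)) (nn u) => x y; clear; lra.
Qed.

(** [L'] is a contraction and a right inverse of [L]. With [b = F c - c], the point [c + t *: L' b]
    goes to [c + (1 + t) *: b]: if [t * nn b = rho - e / 2], the growth condition leaves at most [e]
    for [nn b]. *)
Lemma affine_center_fixed n (F G L L' : 'rV[C]_n -> 'rV[C]_n) (c : 'rV[C]_n) : cancel G F ->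
  (forall u, F (c + u) = F c + L u) -> (forall u, G (c + u) = G c + L' u) ->
  (forall u v, L (u + v) = L u + L v) -> (forall s u, L (s *: u) = s *: L u) -> L' 0 = 0 -> (forall u, nn (L' u) <= nn u) ->
  (forall e M : R, 0 < e -> exists2 rho : R, M <= rho & forall z, nn (z - c) <= rho - e -> nn (F z - c) <= rho + e) ->
  F c = c.
Proof.
move=> GK Fa Ga LD LZ L0 Lc hh.
have E w : c + w = F c + L (G c - c) + L (L' w).
  have Gw : G (c + w) = c + ((G c - c) + L' w) by rewrite Ga addrA subrKC.
  by rewrite -[LHS]GK Gw Fa LD addrA.
have E0 : F c + L (G c - c) = c.
  have := E 0; rewrite L0 addr0; have -> : L 0 = 0 by have := LZ 0 0; rewrite !scale0r.
  by rewrite addr0.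
have LL w : L (L' w) = w by have := E w; rewrite E0 => /addrI.
apply/eqP; rewrite -subr_eq0; apply/eqP; apply: nn_small => e e0.
set b := F c - c; have [b0|b0] := eqVneq b 0; first by rewrite b0 nn0 ltW.
have bp : 0 < nn b by rewrite lt_def nn_ge0 andbT; apply: contra b0 => /eqP/nn_inj ->.
have e2 : 0 < e / 2 by lra.
have [rho Mr h] := hh (e / 2) (e + 1) e2.
pose t := (rho - e / 2) / nn b; have t0 : 0 < t by rewrite divr_gt0 //; lra.
have tb : t * nn b = rho - e / 2 by rewrite /t divfK // gt_eqF.
have := h (c + t%:C *: L' b).
have -> : F (c + t%:C *: L' b) - c = (1 + t%:C) *: b by rewrite Fa LZ LL scalerDl scale1r addrAC.
rewrite addrAC subrr add0r !nnZ -(rmorph1 (real_complex R)) -rmorphD !cn_real (gtr0_norm t0) ger0_norm ?mulrDl ?mul1r ?tb; last by lra.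
have : t * nn (L' b) <= rho - e / 2 by rewrite -tb; apply: ler_wpM2l; [exact: ltW|exact: Lc].
by move=> h1 /(_ h1); lra.
Qed.

Lemma center_fixed n (F G : 'rV[C]_n -> 'rV[C]_n) (c : 'rV[C]_n) : aut_pair F G ->
  (forall e M : R, 0 < e -> exists2 rho : R, M <= rho &
    forall z, nn (z - c) <= rho - e -> nn (F z - c) <= rho + e) ->
  (forall e M : R, 0 < e -> exists2 rho : R, M <= rho &
    forall z, nn (z - c) <= rho - e -> nn (G z - c) <= rho + e) ->
  F c = c.
Proof.
move=> [Fd Gd FK GK] hF hG.
have Fa := affine_of_linear_growth Fd (fun M => hF 1 M ltr01).
have Ga := affine_of_linear_growth Gd (fun M => hG 1 M ltr01).
have GZ (s : C) u : 'd G c (s *: u) = s *: 'd G c u by exact: linearZ.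
have Gc := linear_growth_contracts Ga GZ (fun M => hG 1 M ltr01).
have FD u v : 'd F c (u + v) = 'd F c u + 'd F c v by exact: linearD.
have FZ (s : C) u : 'd F c (s *: u) = s *: 'd F c u by exact: linearZ.
have G0 : 'd G c 0 = 0 by exact: linear0.
exact: (affine_center_fixed GK Fa Ga FD FZ G0 Gc hF).
Qed.

Lemma affine_fixing_frame n (F L : 'rV[C]_n -> 'rV[C]_n) : (forall u, F (0 + u) = F 0 + L u) ->
  (forall u v, L (u + v) = L u + L v) -> (forall s u, L (s *: u) = s *: L u) ->
  F 0 = 0 -> (forall i, F (delta_mx 0 i) = delta_mx 0 i) -> forall u, F u = u.
Proof.
move=> Fa LD LZ F0 Fe u; have FL v : F v = L v by have := Fa v; rewrite !add0r F0 add0r.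
have L0 : L 0 = 0 by have := LZ 0 0; rewrite !scale0r.
rewrite FL {1}[u]row_sum_delta [RHS]row_sum_delta.
elim: (index_enum _) => [|i s IH]; first by rewrite !big_nil.
by rewrite !big_cons LD LZ IH -FL Fe.
Qed.

Lemma sphere_net n (th : R) : 0 < th -> exists s : seq 'rV[C]_n,
  (forall u, u \in s -> nn u = 1) /\ forall p, nn p = 1 -> exists2 u, u \in s & nn (u - p) < th.
Proof.
move=> th0; pose P (A : set 'rV[C]_n) := exists s : seq 'rV[C]_n,
  (forall u, u \in s -> nn u = 1) /\ forall p, A p -> nn p = 1 -> exists2 u, u \in s & nn (u - p) < th.
have [] // : P [set z | nn (z - 0) <= 1].
  apply: compact_ind; first exact: compact_polydisc.
  - by exists [::].
  - move=> A B [s [s1 s2]] [s' [s1' s2']]; exists (s ++ s'); split => [u|p].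
      by rewrite mem_cat => /orP[/s1|/s1'].
    by move=> [Ap|Bp] p1; [have [u us up] := s2 p Ap p1|have [u us up] := s2' p Bp p1]; exists u => //; rewrite mem_cat us ?orbT.
  - move=> A B AB [s [s1 s2]]; exists s; split => // p /AB; exact: s2.
  move=> z _; have [[w [wz w1]]|hn] := pselect (exists w : 'rV[C]_n, nn (w - z) < th / 2 /\ nn w = 1).
    exists (th / 2); first by lra.
    exists [:: w]; split => [u|p pz p1]; first by rewrite inE => /eqP ->.
    by exists w; rewrite ?inE //; have := nn_distD z w p; rewrite [nn (z - p)]nnB; move: pz => /=; lra.
  exists (th / 2); first by (clear -th0; lra).
  by exists [::]; split => // p pz p1; case: hn; exists p.
move=> s [s1 s2]; exists s; split => // p p1; apply: s2 => //=.
by rewrite subr0 p1.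
Qed.

(** The distances of the net points from [c] increase strictly with [j]. This allows a polydisc
    which contains all the earlier targets but not the next one. *)
Lemma shell_net d (c : 'rV[C]_d.+1) (r dlt th : R) : 0 <= r -> 0 < dlt -> 0 < th ->
  exists (M : nat) (h : R) (e : nat -> 'rV[C]_d.+1), [/\ (0 < M)%N, 0 < h,
    forall j, nn (e j - c) = r + dlt / 4 + j%:R * h, M%:R * h = dlt / 2 &
    forall p, r + dlt / 4 <= nn (p - c) -> nn (p - c) <= r + 3 * dlt / 4 ->
      exists2 j, (j < M)%N & nn (e j - p) < th / 2].
Proof.
move=> r0 d0 th0; have th'0 : 0 < th / (4 * (r + dlt + 1)) by rewrite divr_gt0 //; lra.
have [s [s1 s2]] := @sphere_net d.+1 _ th'0; pose m := size s.
have dm : nn (delta_mx 0 0 : 'rV[C]_d.+1) = 1.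
  apply/eqP; rewrite eq_le; apply/andP; split.
    by apply: nn_le => // i; rewrite mxE /=; case: eqP => _; rewrite ?cn1 ?cn0.
  by have := nn_coord (delta_mx 0 0 : 'rV[C]_d.+1) 0; rewrite mxE !eqxx cn1.
have m0 : (0 < m)%N.
  by have [u us _] := s2 _ dm; rewrite /m; case: (s) us.
have := archi_boundP (divr_ge0 (mulr_ge0 (ler0n R 8) (ltW d0)) (ltW th0)); set N := Num.bound _ => hN.
have N0 : 0 < N%:R :> R by apply: le_lt_trans hN; rewrite divr_ge0 ?mulr_ge0 // ltW.
have mR : 0 < m%:R :> R by rewrite ltr0n.
pose w := dlt / (2 * N%:R); have w0 : 0 < w by rewrite divr_gt0 // mulr_gt0.
have wth : 16 * w < th.
  have E : 16 * w = 8 * dlt / N%:R by rewrite /w; field; rewrite gt_eqF.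
  by rewrite E ltr_pdivrMr // [th * _]mulrC -ltr_pdivrMr.
pose h := w / m%:R; have h0 : 0 < h by rewrite divr_gt0.
have mh : m%:R * h = w by rewrite /h mulrC divfK // gt_eqF.
have Nw : N%:R * w = dlt / 2 by rewrite /w; field; rewrite gt_eqF.
(* The directions run cyclically through the net of the unit sphere; in each cycle the radius grows
   by only [w], so every direction occurs at nearly every radius. *)
pose e j := c + (r + dlt / 4 + j%:R * h)%:C *: nth 0 s (j %% m).
have sn j : nn (nth 0 s (j %% m)) = 1 by apply: s1; apply: mem_nth; rewrite -/m ltn_mod.
have en j : 0 < r + dlt / 4 + j%:R * h by rewrite ltr_wpDr ?mulr_ge0 ?(ltW h0) //; clear -r0 d0; lra.
exists (N * m)%N, h, e; split => //.
- by rewrite muln_gt0 m0 andbT -(ltr0n R).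
- by move=> j; rewrite /e addrAC subrr add0r nnZ cn_real sn mulr1 gtr0_norm.
- by rewrite natrM -mulrA mh.
move=> p p1 p2; have pp : 0 < nn (p - c) by lra.
have [|u us up] := s2 ((nn (p - c))^-1%:C *: (p - c)).
  by rewrite nnZ cn_real gtr0_norm ?invr_gt0 // mulVf // gt_eqF.
have [b bN [b1 b2]] : exists2 b, (b < N)%N & r + dlt / 4 + b%:R * w <= nn (p - c) /\ nn (p - c) <= r + dlt / 4 + b%:R * w + w.
  have : exists b : nat, nn (p - c) <= r + dlt / 4 + b%:R * w + w.
    by exists N; rewrite Nw; lra.
  move=> /ex_minnP[b hb bmin]; have bN : (b < N)%N.
    have N1 : (0 < N)%N by rewrite -(ltr0n R).
    rewrite -(prednK N1) ltnS; apply: bmin; rewrite -addrA -{2}[w]mul1r -mulrDl natr1 prednK // Nw; lra.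
  exists b => //; split => //; case: b hb bmin {bN} => [|b] hb bmin; first by rewrite mul0r addr0.
  rewrite leNgt; apply/negP => hlt; have := bmin b; rewrite ltnn => bb.
  have // : false by apply: bb; rewrite -addrA -{2}[w]mul1r -mulrDl natr1; exact: ltW.
pose i := index u s; have im : (i < m)%N by rewrite /i index_mem.
exists (b * m + i)%N; first by apply: (@leq_trans (b.+1 * m)); [rewrite mulSn addnC ltn_add2r|rewrite leq_mul2r bN orbT].
have ji : ((b * m + i) %% m = i)%N by rewrite modnMDl modn_small.
rewrite /e ji nth_index //; set l := r + dlt / 4 + _; set q := nn (p - c) in pp p1 p2 b1 b2 up *.
have -> : c + l%:C *: u - p = (l - q)%:C *: u + q%:C *: (u - q^-1%:C *: (p - c)).
  rewrite scalerBr scalerA -rmorphM mulfV ?gt_eqF // rmorph1 scale1r rmorphB.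
  by apply/rowP => k; rewrite !mxE; ring.
apply: (le_lt_trans (nnD _ _)); rewrite !nnZ !cn_real (s1 _ us) mulr1 (gtr0_norm pp).
have lq : `|l - q| <= 2 * w.
  have ih : i%:R * h <= w by rewrite -mh; apply: ler_wpM2r; [exact: ltW|rewrite ler_nat ltnW].
  have lE : l = r + dlt / 4 + b%:R * w + i%:R * h by rewrite /l natrD natrM mulrDl -mulrA mh addrA.
  have i0 : 0 <= i%:R * h by rewrite mulr_ge0 // ltW.
  rewrite ler_norml lE; lra.
have : q * nn (u - q^-1%:C *: (p - c)) <= (r + dlt + 1) * (th / (4 * (r + dlt + 1))).
  by apply: ler_pM; rewrite ?nn_ge0 ?(ltW up) ?(ltW pp) //; lra.
have -> : (r + dlt + 1) * (th / (4 * (r + dlt + 1))) = th / 4 by field; rewrite gt_eqF //; lra.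
clear -lq b2 b1 wth; lra.
Qed.

End Fixed.

(** * The sequence of targets and its rigidity *)

Section Levels.
Context {R : realType}.
Local Notation C := (R[i]).

Lemma det_unit_neq0 n (A B : 'M[C]_n) : A *m B = 1%:M -> \det A != 0.
Proof.
move=> AB; have := congr1 (fun M : 'M[C]_n => \det M) AB; rewrite det_mulmx det1 => h.
by apply/eqP => d0; move/eqP: h; rewrite d0 mul0r eq_sym oner_eq0.
Qed.

Lemma det_jac_neq0 n (F G : 'rV[C]_n -> 'rV[C]_n) z : aut_pair F G -> \det (jac F z) != 0.
Proof.
move=> [Fd Gd FK GK]; have GF : G \o F = id by apply: funext => w; exact: FK.
have E u : 'd G (F z) ('d F z u) = u.
  have := diff_comp (Fd z) (Gd (F z)); rewrite GF => E.
  have E2 : 'd (id : 'rV[C]_n -> 'rV[C]_n) z = id :> ('rV[C]_n -> 'rV[C]_n) by exact: diff_val.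
  exact: (etrans (esym (congr1 (fun h : 'rV[C]_n -> 'rV[C]_n => h u) E)) (congr1 (fun h : 'rV[C]_n -> 'rV[C]_n => h u) E2)).
have J1 : jac F z *m jac G (F z) = 1%:M.
  by apply/row_matrixP => i; rewrite row_mul rowE -jacE -jacE E rowE mulmx1.
exact: det_unit_neq0 J1.
Qed.

Variable d : nat.
Implicit Types (F G : 'rV[C]_d.+2 -> 'rV[C]_d.+2) (k l : nat).

(** Consecutive radii differ by 4: a change of centre costs at most 2, and the thickness of the
    shell is at most 1. *)
Definition radius k : R := 4 * k%:R + 10.

(** This serves as the thickness of the [k]-th shell, as the loss of radius in [shell_ball], and as
    the lower bound for the Jacobian determinant. As it tends to 0, any given automorphism satisfies
    the last requirement from some level on. *)
Definition gap k : R := 1 / 2 ^+ k.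

(* With n = d + 2, the origin and the n unit vectors alternate cyclically. *)
Definition level_center k : 'rV[C]_d.+2 := if (k %% d.+3)%N is j.+1 then delta_mx 0 (inord j) else 0.

Lemma gap_gt0 k : 0 < gap k.
Proof. by rewrite /gap divr_gt0 // exprn_gt0. Qed.

Lemma gapS k : gap k.+1 = gap k / 2.
Proof. by rewrite /gap exprS; field; rewrite gt_eqF // exprn_gt0. Qed.

Lemma gap_mono k l : (k <= l)%N -> gap l <= gap k.
Proof. by move=> kl; rewrite /gap !mul1r lef_pV2 ?posrE ?exprn_gt0 //; apply: ler_weXn2l; [lra|]. Qed.

Lemma gap_le1 k : gap k <= 1.
Proof. by have := gap_mono (leq0n k); rewrite {2}/gap expr0 divr1. Qed.

Lemma radiusS k : radius k.+1 = radius k + 4.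
Proof. by rewrite /radius -natr1; ring. Qed.

Lemma radius_mono k l : (k <= l)%N -> radius k <= radius l.
Proof. by rewrite -(ler_nat R) /radius; lra. Qed.

Lemma radius_jump k l : (k < l)%N -> radius k + 4 <= radius l.
Proof. by rewrite -radiusS; exact: radius_mono. Qed.

Lemma radius_ge10 k : 10 <= radius k.
Proof. by rewrite /radius lerDr mulr_ge0. Qed.

Lemma radius_large (M : R) : exists N, forall k, (N <= k)%N -> M <= radius k.
Proof.
exists (Num.bound `|M|) => k Nk; have := archi_boundP (normr_ge0 M).
have : (Num.bound `|M|)%:R <= k%:R :> R by rewrite ler_nat.
by have := ler_norm M; have := ler0n R k; rewrite /radius; lra.
Qed.

Lemma gap_small (e : R) : 0 < e -> exists N, forall k, (N <= k)%N -> gap k <= e.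
Proof.
move=> e0; have [N hN] := half_pow_small (ler01 : 0 <= 1 :> R) e0; exists N => k /gap_mono.
by move=> h; apply: le_trans h hN.
Qed.

Lemma nn_center k : nn (level_center k) <= 1.
Proof. by rewrite /level_center; case: (_ %% _)%N => [|j]; [rewrite nn0|rewrite -[delta_mx _ _]scale1r nn_delta cn1]. Qed.

Lemma nn_center_dist k l : nn (level_center k - level_center l) <= 2.
Proof. by apply: (le_trans (nnD _ _)); rewrite nnN; have := nn_center k; have := nn_center l; lra. Qed.

(** The net of level [k] is fixed before [F], so [th] may depend only on the bound [radius k + 10]
    for [F] and on [gap k]. *)
Definition shell_constant k (th : R) :=
  forall F G (c c' z : 'rV[C]_d.+2) a, aut_pair F G -> a <= radius k ->
    (forall y, nn (y - c) <= a -> nn (F y) <= radius k + 10) -> nn (F c - c') <= radius k -> gap k <= cn (\det (jac F c)) ->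
    nn (z - c) <= a - 2 * gap k -> radius k + gap k <= nn (F z - c') ->
    exists p, [/\ radius k + gap k / 4 <= nn (p - c'), nn (p - c') <= radius k + 3 * gap k / 4 &
      forall q, nn (q - p) < th -> nn (G q - c) <= a - gap k].

Section Descent.
Variables (th : nat -> R) (F G : 'rV[C]_d.+2 -> 'rV[C]_d.+2) (k : nat).
Hypothesis thP : forall l, shell_constant l (th l).
Hypothesis FG : aut_pair F G.
Hypothesis F_center : forall l, (k <= l)%N -> nn (F (level_center k) - level_center l) <= radius l.
Hypothesis F_det : forall l, (k <= l)%N -> gap l <= cn (\det (jac F (level_center k))).
Hypothesis omitted : forall l p, (k <= l)%N -> radius l + gap l / 4 <= nn (p - level_center l) ->
  nn (p - level_center l) <= radius l + 3 * gap l / 4 -> exists2 q, nn (q - p) < th l & radius l <= nn (G q - level_center l) + gap l.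

(** Passing from [l.+1] to [l] costs [2 * gap l] in [shell_ball], exactly the difference between the
    margins [4 * gap l] and [4 * gap l.+1]. *)
Let small l := forall z, nn (z - level_center k) <= radius k - 4 * gap l -> nn (F z - level_center l) <= radius l + gap l.

(* The inclusion at level l + 1 provides the bound on F on which the constant th of
   level l depends. *)
Lemma descent_step l : (k <= l)%N -> small l.+1 -> small l.
Proof.
move=> kl sl z zk; rewrite leNgt; apply/negP => /ltW Fz.
have aR : radius k - 4 * gap l.+1 <= radius l.
  by have := radius_mono kl; have := gap_gt0 l.+1; lra.
have Fy y : nn (y - level_center k) <= radius k - 4 * gap l.+1 -> nn (F y) <= radius l + 10.
  move=> /sl; rewrite radiusS; have := nn_dist (F y) (level_center l.+1).
  have := nn_center l.+1; have := gap_le1 l.+1.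
  by move: (nn (F y)) (nn (F y - _)) (nn (level_center _)) => x1 x2 x3; lra.
have zk2 : nn (z - level_center k) <= radius k - 4 * gap l.+1 - 2 * gap l.
  by apply: (le_trans zk); rewrite gapS; lra.
have [p [p1 p2 pG]] := thP FG aR Fy (F_center kl) (F_det kl) zk2 Fz.
have [q qp qG] := omitted kl p1 p2.
have := pG q qp; rewrite gapS; have := gap_gt0 l.
move: kl; rewrite leq_eqVlt => /orP[/eqP kE|kl].
  by rewrite -kE in qG *; move: qG; move: (nn (G q - level_center k)) => x; clear -zk qp; lra.
have := nn_distD (level_center k) (G q) (level_center l); have := nn_center_dist k l; have := radius_jump kl.
move: qG; move: (nn (G q - level_center k)) (nn (G q - level_center l)) (nn (level_center k - level_center l)) => x1 x2 x3; clear -qp; lra.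
Qed.

(** The start is a level [k + N] whose radius exceeds the bound of [F] on a ball of radius
    [radius k + 1]. This level depends on [F], but the descent ends at [k] without trace of it. *)
Lemma descent z : nn (z - level_center k) <= radius k - 4 * gap k -> nn (F z - level_center k) <= radius k + gap k.
Proof.
have [Fd _ _ _] := FG; have [M hM] := differentiable_bounded (radius k + 1) Fd.
have [N hN] := radius_large (M + 1).
have top : small (k + N)%N.
  move=> w wk; have := hN (k + N)%N (leq_addl _ _); have := hM w; have := nn_dist w (level_center k).
  have := nnD (F w) (- level_center (k + N)%N); rewrite nnN; have := nn_center k; have := nn_center (k + N)%N.
  have := gap_gt0 (k + N)%N; move: wk.
  move: (nn (w - _)) (nn w) (nn (F w)) (nn (F w - _)) (nn (level_center _)) (nn (level_center _)) => x1 x2 x3 x4 x5 x6.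
  move=> w1 g0 h5 h6 h4 h2 h3 hR; have := h3 ltac:(lra); lra.
suff : small k by exact.
elim: N {hN} top => [|N IH]; first by rewrite addn0.
by rewrite addnS => h; apply: IH; apply: descent_step h; exact: leq_addr.
Qed.

End Descent.

Definition level k (th : R) (M : nat) (h : R) (e : nat -> 'rV[C]_d.+2) :=
  [/\ 0 < th, shell_constant k th, (0 < M)%N, 0 < h &
   [/\ forall j, nn (e j - level_center k) = radius k + gap k / 4 + j%:R * h, M%:R * h = gap k / 2 &
    forall p, radius k + gap k / 4 <= nn (p - level_center k) -> nn (p - level_center k) <= radius k + 3 * gap k / 4 ->
      exists2 j, (j < M)%N & nn (e j - p) < th / 2]].

Lemma level_exists k : exists x : R * nat * R * (nat -> 'rV[C]_d.+2), level k x.1.1.1 x.1.1.2 x.1.2 x.2.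
Proof.
have R0 := radius_ge10 k; have g0 := gap_gt0 k.
have R1 : 0 < radius k by lra.
have R2 : 0 <= radius k + 10 by lra.
have [th th0 hth] := @shell_ball R d.+1 (radius k) (gap k) (radius k + 10) (radius k) (gap k) (gap k) R1 g0 R2 g0 g0.
have [M [h [e [M0 h0 eN Mh net]]]] := @shell_net R d.+1 (level_center k) (radius k) (gap k) th (ltW R1) g0 th0.
by exists (th, M, h, e).
Qed.

Section Flatten.
Variable M : nat -> nat.
Hypothesis M_gt0 : forall k, (0 < M k)%N.

(** The lexicographic enumeration of the pairs of a level [k] and an index [j < M k]. *)
Fixpoint flat (s : nat) : nat * nat :=
  if s is s'.+1 then let: (k, j) := flat s' in if (j.+1 < M k)%N then (k, j.+1) else (k.+1, 0%N) else (0, 0)%N.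

Lemma flat_lt s : ((flat s).2 < M (flat s).1)%N.
Proof. by elim: s => [|s] //=; case: (flat s) => k j /= h; case: ifP. Qed.

Lemma flat_le s : ((flat s).1 <= s)%N.
Proof. by elim: s => [|s] //=; case: (flat s) => k j /= h; case: ifP => // _; exact: leqW. Qed.

Lemma flat_onto k j : (j < M k)%N -> exists s, flat s = (k, j).
Proof.
elim: k j => [|k IHk].
  elim=> [|j IH] jM; first by exists 0%N.
  by have [s hs] := IH (ltnW jM); exists s.+1; rewrite /= hs jM.
elim=> [|j IH] jM; last by have [s hs] := IH (ltnW jM); exists s.+1; rewrite /= hs jM.
have [s hs] := IHk (M k).-1 ltac:(by rewrite prednK).
by exists s.+1; rewrite /= hs prednK // ltnn.
Qed.

End Flatten.

(** The sequences are fixed before any automorphism. An [F] that respects them from some index [s0]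
    on satisfies the hypotheses of [descent] at all large levels, for every centre, and so does its
    inverse; [center_fixed] then applies to each of the centres. *)
Lemma rigid_sequence : exists (c e : nat -> 'rV[C]_d.+2) (r dl : nat -> R),
  [/\ (forall s, 0 < dl s) /\ (forall s, 0 <= r s), forall s, r s < nn (e s - c s),
   (forall s, nn (c s.+1 - c s) + r s <= r s.+1) /\ (forall s, nn (e s - c s.+1) + 2 * dl s <= r s.+1),
   forall B : R, exists s, B <= r s - nn (c s) &
   forall (s0 : nat) F G (y : nat -> 'rV[C]_d.+2), aut_pair F G -> (forall s, nn (y s - e s) <= 2 * dl s) ->
     (forall s, (s0 <= s)%N -> r s <= nn (F (y s) - c s) + dl s /\ r s <= nn (G (y s) - c s) + dl s) ->
     forall z, F z = z].
Proof.
have [X hX] := choice level_exists.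
pose th k := (X k).1.1.1; pose M k := (X k).1.1.2; pose h k := (X k).1.2; pose E k := (X k).2.
have LP k : level k (th k) (M k) (h k) (E k) by exact: hX.
clearbody th M h E; clear X hX.
have th0 k : 0 < th k by have [] := LP k.
have thP k : shell_constant k (th k) by have [] := LP k.
have M0 k : (0 < M k)%N by have [] := LP k.
have h0 k : 0 < h k by have [] := LP k.
have EN k j : nn (E k j - level_center k) = radius k + gap k / 4 + j%:R * h k by have [_ _ _ _ []] := LP k.
have Mh k : (M k)%:R * h k = gap k / 2 by have [_ _ _ _ []] := LP k.
have net k p : radius k + gap k / 4 <= nn (p - level_center k) -> nn (p - level_center k) <= radius k + 3 * gap k / 4 ->
      exists2 j, (j < M k)%N & nn (E k j - p) < th k / 2 by have [_ _ _ _ [_ _]] := LP k; exact.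
have {LP} hg k : h k <= gap k / 2.
  rewrite -Mh ler_peMl ?(ltW (h0 k)) //.
  by rewrite (ler_nat R 1).
have jh k j : (j < M k)%N -> j%:R * h k + h k <= gap k / 2.
  by move=> jM; rewrite -Mh -{2}[h k]mul1r -mulrDl natr1; apply: ler_wpM2r; [exact: ltW|rewrite ler_nat].
(* Half a step below the distance of the [j]-th target: the polydisc excludes this target and
   contains the earlier ones of its level. *)
pose rr k j := radius k + gap k / 4 + j%:R * h k - h k / 2.
(* The entry [h k / 4] keeps an approximate target within the next polydisc, [th k / 8] keeps it in
   the covered ball, and [gap k / 8] makes the loss negligible against the shell. *)
pose dd k := Num.min (h k / 4) (Num.min (th k / 8) (gap k / 8)).
have dd0 k : 0 < dd k by rewrite !lt_min !divr_gt0 ?gap_gt0.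
have ddh k : dd k <= h k / 4 by rewrite ge_min lexx.
have ddt k : dd k <= th k / 8 by rewrite /dd !ge_min lexx orbT.
have ddg k : dd k <= gap k / 8 by rewrite /dd !ge_min lexx !orbT.
have rR k j : radius k <= rr k j.
  have : 0 <= j%:R * h k by rewrite mulr_ge0 // ltW.
  by rewrite /rr; have := hg k; move: (j%:R * h k) => x; lra.
clearbody dd; pose f := flat M.
exists (fun s => level_center (f s).1), (fun s => E (f s).1 (f s).2), (fun s => rr (f s).1 (f s).2), (fun s => dd (f s).1).
have step s : f s.+1 = ((f s).1, (f s).2.+1) \/ f s.+1 = ((f s).1.+1, 0%N).
  by rewrite /f /=; case: (flat M s) => k j; case: ifP => _; [left|right].
have fM s : ((f s).2 < M (f s).1)%N by exact: flat_lt.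
split.
- by split => // s; apply: le_trans (rR _ _); have := radius_ge10 (f s).1; lra.
- by move=> s; rewrite EN /rr; have := h0 (f s).1; lra.
- split => s.
    have [->|->] /= := step s.
      by rewrite subrr nn0 add0r /rr -(@natr1 R (f s).2) mulrDl mul1r; have := h0 (f s).1; lra.
    apply: le_trans (rR _ _); rewrite radiusS; have := nn_center_dist (f s).1.+1 (f s).1.
    move: (nn (_ - _)) => x; rewrite /rr; have := jh _ _ (fM s); have := gap_le1 (f s).1; have := h0 (f s).1; lra.
  have [->|->] /= := step s.
    by rewrite EN /rr -(@natr1 R (f s).2) mulrDl mul1r; have := h0 (f s).1; have := ddh (f s).1; lra.
  apply: le_trans (rR _ _); rewrite radiusS; have := nn_center_dist (f s).1 (f s).1.+1.
  have := nn_distD (level_center (f s).1) (E (f s).1 (f s).2) (level_center (f s).1.+1); rewrite EN.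
  move: (nn (_ - _)) (nn (_ - _)) => x x'; have := jh _ _ (fM s); have := gap_le1 (f s).1; have := h0 (f s).1.
  by have := ddg (f s).1; lra.
- move=> B; have [k hk] := radius_large (B + 1); have [s hs] := flat_onto M0 (M0 k).
  exists s; rewrite -/f in hs; rewrite hs /=; have := hk k (leqnn k); have := rR k 0%N; have := nn_center k; lra.
move=> s0 F G y FG yE om.
have fix1 F' G' : aut_pair F' G' -> (forall s, (s0 <= s)%N -> rr (f s).1 (f s).2 <= nn (G' (y s) - level_center (f s).1) + dd (f s).1) ->
    forall i, (i < d.+3)%N -> forall e B : R, 0 < e -> exists2 rho : R, B <= rho &
      forall z, nn (z - level_center i) <= rho - e -> nn (F' z - level_center i) <= rho + e.
  move=> FG' om' i id3 e B e0.
  have det0 : 0 < cn (\det (jac F' (level_center i))).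
    by rewrite lt_def cn_ge0 andbT; apply: contra (det_jac_neq0 (level_center i) FG') => /eqP/cn_inj ->.
  have [N1 hN1] := gap_small det0.
  have [N2 hN2] := gap_small (divr_gt0 e0 (ltr0Sn R 3)).
  have [N3 hN3] := radius_large (Num.max B (nn (F' (level_center i)) + 1)).
  (* A level beyond all the thresholds and congruent to [i], hence with the same centre. *)
  pose N := maxn (maxn N1 N2) (maxn N3 s0); pose k := (i + N * d.+3)%N.
  have Nk : (N <= k)%N by apply: leq_trans (leq_addl _ _); rewrite leq_pmulr.
  have ck : level_center k = level_center i by rewrite /level_center /k addnC modnMDl.
  move: (Nk); rewrite !geq_max => /andP[/andP[N1k N2k] /andP[N3k s0k]].
  have := hN3 k N3k; rewrite ge_max => /andP[Bk Fk].
  exists (radius k) => // z zi.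
  have dk : nn (F' z - level_center k) <= radius k + gap k.
    apply: (@descent th F' G' k thP FG') => [l kl|l kl|l p kl p1 p2|].
    - apply: le_trans (radius_mono kl); apply: le_trans Fk; rewrite ck; apply: (le_trans (nnD _ _)).
      by rewrite nnN lerD2l; exact: nn_center.
    - by rewrite ck; apply: hN1; exact: leq_trans kl.
    - have [j jM ej] := net l p p1 p2; have [s hs] := flat_onto M0 jM; rewrite -/f in hs.
      have ls : (l <= s)%N by have := flat_le M s; rewrite -/f hs.
      have s0s : (s0 <= s)%N by apply: leq_trans s0k (leq_trans kl ls).
      have := yE s; have := om' s s0s; rewrite hs /= => o1 o2; exists (y s).
        apply: (le_lt_trans (nn_distD (E l j) _ _)); have := ddt l; have := th0 l.
        by move: o2 ej; move: (nn (y s - E l j)) (nn (E l j - p)) => x x'; lra.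
      by have := rR l j; have := ddg l; have := gap_gt0 l; move: o1; move: (nn _) => x; lra.
    rewrite ck; apply: (le_trans zi); have := hN2 k N2k; clear -d e0; lra.
  rewrite ck in dk; apply: (le_trans dk); have := hN2 k N2k; have := gap_gt0 k; lra.
have GF := aut_pair_sym FG.
have fixc i : (i < d.+3)%N -> F (level_center i) = level_center i.
  move=> id3; apply: (center_fixed FG).
    exact: (fix1 F G FG (fun s h => (om s h).2) i id3).
  exact: (fix1 G F GF (fun s h => (om s h).1) i id3).
have c0 : level_center 0 = 0 by rewrite /level_center mod0n.
have F0 : F 0 = 0 by have := fixc 0%N isT; rewrite c0.
have cS (i : 'I_d.+2) : level_center i.+1 = delta_mx 0 i.
  have im : (i.+1 %% d.+3)%N = i.+1 by rewrite modn_small // ltnS.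
  by rewrite /level_center im inord_val.
have [Fd _ _ _] := FG.
have Fa : forall u, F (0 + u) = F 0 + 'd F 0 u.
  apply: affine_of_linear_growth => // B.
  have := @fix1 F G FG (fun s h => (om s h).2) 0%N isT 1 B ltr01; rewrite c0.
  by case=> rho Br hr; exists rho.
have FD u v : 'd F 0 (u + v) = 'd F 0 u + 'd F 0 v by exact: linearD.
have FZ (t : C) u : 'd F 0 (t *: u) = t *: 'd F 0 u by exact: linearZ.
apply: (affine_fixing_frame Fa FD FZ F0) => i; rewrite -cS; apply: fixc.
by rewrite ltnS.
Qed.

End Levels.

(** * Lie group actions *)

Section SigmaCompact.
Context {R : realType}.
Local Notation C := (R[i]).

Lemma real_box_compact d (u : 'rV[R]_d) (e : R) : compact [set z : 'rV[R]_d | forall i, `[u 0 i - e, u 0 i + e]%classic (z 0 i)].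
Proof. by apply: (@rV_compact R d (fun i => `[u 0 i - e, u 0 i + e]%classic)) => i; exact: segment_compact. Qed.

Lemma lie_locally_compact d (G : lieGroupType R d) (g : G) : exists2 K : set G, compact K & nbhs g K.
Proof.
have [a _ ag] := @lie_atlas_cover R d G g; have dom_open := @chart_dom_open R d G a; have cod_open := @chart_cod_open R d G a.
pose u := chart_map a g; have cu : chart_cod a u by exact: chart_map_cod.
have /nbhs_ballP[e /= e0 he] : nbhs u (chart_cod a) by exact: open_nbhs_nbhs.
pose B := [set z : 'rV[R]_d | forall i, `[u 0 i - e / 2, u 0 i + e / 2]%classic (z 0 i)].
have Bc : B `<=` chart_cod a.
  move=> z Bz; apply: he; split => // i j; rewrite /ball /= ord1; have := Bz j; rewrite /= in_itv /= => /andP[z1 z2].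
  by rewrite ltr_norml; lra.
exists (chart_inv a @` B).
  apply: continuous_compact; last exact: real_box_compact.
  exact: continuous_subspaceW Bc (@chart_inv_continuous R d G a).
have := @chart_map_continuous R d G a; rewrite continuous_open_subspace // => mc.
have /mc : g \in chart_dom a by exact: mem_set.
have : nbhs u (ball u (e / 2)) by apply: nbhsx_ballx; rewrite divr_gt0.
move=> ub /(_ _ ub) /= h; have gd : nbhs g (chart_dom a) by exact: open_nbhs_nbhs.
apply: filterS (filterI gd h) => x [xd xb]; exists (chart_map a x); last exact: chart_mapK.
move=> i; rewrite /= in_itv /=; have := xb.2 0 i; rewrite /ball /= ltr_norml => /andP[b1 b2].
by apply/andP; split; lra.
Qed.

(** For each code of a basic open set contained in some compact set, such a compact set is chosen;
    finite unions make the sequence increasing, and local compactness makes it exhaust the group. *)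
Lemma lie_sigma_compact d (G : lieGroupType R d) : exists K : nat -> set G,
  (forall s, compact (K s)) /\ forall g, exists s0, forall s, (s0 <= s)%N -> K s g.
Proof.
have [B /countable_injP[code codeP] [Bo Bb]] := @lie_second_countable R d G.
have hK n : exists K : set G, compact K /\ forall U, B U -> code U = n -> (exists2 K', compact K' & U `<=` K') -> U `<=` K.
  have [[U [BU Un [K' K'c UK']]]|hn] := pselect (exists U, [/\ B U, code U = n & exists2 K', compact K' & U `<=` K']).
    exists K'; split => // V BV Vn _; have -> // : V = U.
    by apply: codeP; rewrite ?inE // Un Vn.
  by exists set0; split; [exact: compact0|move=> U BU Un UK; case: hn; exists U].
have [K hK'] := choice hK.
pose KK := fix KK s := if s is s'.+1 then KK s' `|` K s else K 0%N.
exists KK; split.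
  elim=> [|s IH] /=; first by have [] := hK' 0%N.
  by apply: compactU => //; have [] := hK' s.+1.
move=> g; have [K' K'c gK'] := lie_locally_compact g.
have [U [BU Ug] UK'] := Bb g _ gK'; exists (code U) => s.
have base : K (code U) g by have [_ h] := hK' (code U); apply: (h U) => //; exists K'.
elim: s => [|s IH]; first by rewrite leqn0 => /eqP E; rewrite E in base.
rewrite leq_eqVlt => /orP[/eqP E|]; first by right; rewrite E in base.
by rewrite ltnS => /IH h; left.
Qed.

Section Subspace.
Variables (n : nat) (X : set 'rV[C]_n).

Lemma subspace_compact (A : set 'rV[C]_n) : compact A -> A `<=` X -> compact ((set_val : X -> 'rV[C]_n) @^-1` A).
Proof.
move=> Ac AX F PF FA; have [p [Ap pF]] := Ac (fmap (set_val : X -> 'rV[C]_n) F) _ FA.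
have Xp : p \in X by apply: mem_set; exact: AX.
exists (SigSub Xp : X); split => // S V FS; rewrite nbhsE => -[W [[W' W'o <-] /= W'p] WV].
have := pF (set_val @` S) W'; case => [||_ [[s Ss <-] W's]].
- by change (F (set_val @^-1` [set set_val x | x in S])); apply: filterS FS => s Ss; exists s.
- exact: open_nbhs_nbhs.
by exists s; split => //; apply: WV.
Qed.

Lemma set_val_continuous : continuous (set_val : X -> 'rV[C]_n).
Proof. exact: initial_continuous. Qed.

Lemma subvariety_closed : analytic_subvariety X -> closed X.
Proof.
move=> Xa; rewrite -openC; apply/open_nnP => p nXp; have [U [k [f [Uo Up fh XU]]]] := Xa p.
have [i fi] : exists i, f i p != 0.
  apply: contrapT => hn; apply: nXp.
  suff : (X `&` U) p by case.
  by rewrite XU; split => // i; apply/eqP; apply: contrapT => fi; apply: hn; exists i; exact/negP.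
have := fh i p Up => /differentiable_continuous fc.
have fip : 0 < cn (f i p) by rewrite lt_def cn_ge0 andbT; apply: contra fi => /eqP/cn_inj ->.
have /fc fn : nbhs (f i p) [set z | nn (z - f i p) < cn (f i p)] by apply/nbhs_nnP; exists (cn (f i p)).
have Un : nbhs p U by exact: open_nbhs_nbhs.
have {}fn : nbhs p (f i @^-1` [set z | nn (z - f i p) < cn (f i p)]) := fn.
have fU : nbhs p (U `&` f i @^-1` [set z | nn (z - f i p) < cn (f i p)]) by exact: filterI Un fn.
have /nbhs_nnP[r r0 hr] := fU; exists r => // y /hr[Uy /= fy] Xy.
have : (X `&` U) y by [].
by rewrite XU => -[_ /(_ i) fy0]; move: fy; rewrite fy0 nn_cn sub0r cnN ltxx.
Qed.

(** The action maps the product of [K] and a compact part of [X] to a compact set. This is the bound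
    inserted for [H] in [embedding_avoiding]. *)
Lemma action_bounded d (G : lieGroupType R d) (act : G -> X -> X) (K : set G) (M : R) : analytic_subvariety X ->
  holomorphic_action act -> compact K ->
  exists B : R, forall g u, K g -> nn (set_val u) <= M -> nn (set_val (act g u)) <= B.
Proof.
move=> Xa ha Kc; pose A := X `&` [set z | nn (z - 0) <= M].
have Ac : compact A.
  apply: (@compact_bounded_closed R n A M); last by move=> z [_ /=]; rewrite subr0.
  by apply: closedI; [exact: subvariety_closed|exact: closed_ballC].
have AX : A `<=` X by move=> z [].
have Pc := compact_setX Kc (subspace_compact Ac AX).
have c1 : continuous (fun p : G * X => set_val (act p.1 p.2)).
  by move=> p; apply: continuous_comp; [exact: (act_continuous ha)|exact: set_val_continuous].
have [B hB] := compact_nn_bounded (continuous_compact (continuous_subspaceT c1) Pc).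
exists B => g u Kg uM; apply: hB; exists (g, u) => //; split => //=; split; first exact: set_valP.
by rewrite /= subr0.
Qed.

End Subspace.
End SigmaCompact.

(** * The theorem in dimension at least 2 *)

Section HigherDimension.
Context {R : realType}.
Local Notation C := (R[i]).

Lemma cdiff_direction n (f : 'rV[C]_n -> C) x v : differentiable f x -> cdiff (fun s => f (x + s *: v)) 0 ('d f x v).
Proof.
have E y : y = x -> differentiable f x -> differentiable f y /\ 'd f y v = 'd f x v by move=> ->.
by move=> fx; have [|D <-] := E (x + 0 *: v) _ fx; [rewrite scale0r addr0|exact: cdiff_slice].
Qed.

Section Embedding.
Variables (n : nat) (X : set 'rV[C]_n) (m : nat) (J : 'rV[C]_n -> 'rV[C]_m).
Hypothesis X_analytic : analytic_subvariety X.
Hypothesis J_diff : forall u, X u -> exists2 rho : R, 0 < rho & forall y, nn (y - u) < rho -> differentiable J y.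
Hypothesis J_inj : forall u u', X u -> X u' -> J u = J u' -> u = u'.
Hypothesis J_imm : forall u v, X u -> 'd J u v = 0 -> v = 0.
Hypothesis J_bounded : forall M, exists M' : R, forall u, X u -> nn (J u) <= M -> nn u <= M'.

Let j (u : X) := J (set_val u).

Lemma restriction_holomorphic : holomorphic_map j.
Proof.
move=> x; have [rho rho0 h] := J_diff (set_valP x).
exists [set y | nn (y - set_val x) < rho], J; split => //.
- apply/open_nnP => y /= yx; exists (rho - nn (y - set_val x)); first by rewrite subr_gt0.
  by move=> z zy; have := nn_distD y z (set_val x); lra.
- by rewrite /= subrr nn0.
Qed.

Lemma restriction_proper : proper_map j.
Proof.
move=> K Kc; pose A := X `&` J @^-1` K.
have [M hM] := compact_nn_bounded Kc; have [M' hM'] := J_bounded M.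
have Kcl : closed K by apply: compact_closed => //; exact: norm_hausdorff.
have Ac : compact A.
  apply: (@compact_bounded_closed R n A M'); last by move=> z [Xz /= Kz]; apply: hM' => //; exact: hM.
  rewrite -openC; apply/open_nnP => z nAz.
  have [Xz|nXz] := pselect (X z).
    have nK : (~` K) (J z) by move=> Kz; apply: nAz.
    have [rho rho0 h] := J_diff Xz; have /h/differentiable_continuous Jc : nn (z - z) < rho by rewrite subrr nn0.
    have /Jc/nbhs_nnP[r r0 hr] : nbhs (J z) (~` K) by apply: open_nbhs_nbhs; split => //; exact: closed_openC.
    by exists r => // y /hr yK [_].
  have := subvariety_closed X_analytic; rewrite -openC => /open_nnP/(_ z nXz)[r r0 hr].
  by exists r => // y /hr Xy [].
have -> : j @^-1` K = (set_val : X -> 'rV[C]_n) @^-1` A.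
  by apply/seteqP; split=> u /=; [move=> Ku; split => //; exact: set_valP|case].
by apply: subspace_compact => // z [].
Qed.

(** A local extension [F] may differ from [J], but the coordinates of [J - F] vanish on [X], so
    their differentials vanish on tangent vectors. *)
Lemma restriction_immersive : immersive j.
Proof.
move=> x U F [Uo Ux Fh jF] v tv Fv; apply: (J_imm (set_valP x)).
have [rho rho0 Jd] := J_diff (set_valP x); set p := set_val x in Ux tv Fv Jd *.
have pb : nn (p - p) < rho by rewrite subrr nn0.
have Jp := Jd p pb; have Fp := Fh p Ux.
pose V := U `&` [set y | nn (y - p) < rho].
have Vo : open V.
  apply: openI => //; apply/open_nnP => y /= yx; exists (rho - nn (y - p)); first by rewrite subr_gt0.
  by move=> z zy; have := nn_distD y z p; lra.
apply/rowP => i; rewrite [RHS]mxE.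
pose f (z : 'rV[C]_n) : C := J z 0 i - F z 0 i.
have fV : holomorphic_on V f.
  move=> y [Uy yp]; apply: differentiableB.
    by apply: (@differentiable_comp _ _ _ _ J (fun z : 'rV[C]_m => z 0 i : C)); [exact: Jd|exact: df_coord].
  by apply: (@differentiable_comp _ _ _ _ F (fun z : 'rV[C]_m => z 0 i : C)); [exact: Fh|exact: df_coord].
have f0 : 'd f p v = 0.
  apply: (tv V) => // q Xq [Uq _]; have Xq' : q \in X by exact: mem_set.
  by have := jF (SigSub Xq' : X) Uq; rewrite /j /= /f => ->; rewrite subrr.
have c1 := cdiff_direction v (fV p (conj Ux pb)).
have c2 := cdiffB (cdiff_row v i Jp) (cdiff_row v i Fp).
have aux (a b : C) (w : 'rV[C]_m) : a = b - w 0 i -> a = 0 -> w = 0 -> b = 0.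
  by move=> h a0 w0; move: h; rewrite a0 w0 mxE subr0 => <-.
exact: aux (cdiff_uniq c1 c2) f0 Fv.
Qed.

Lemma restriction_embedding : embedding j.
Proof.
split; [exact: restriction_holomorphic|exact: restriction_proper| |exact: restriction_immersive].
move=> u u' /(J_inj (set_valP u) (set_valP u')); exact: val_inj.
Qed.

End Embedding.

Theorem nonextendable_higher_dimension (n : nat) (X : set 'rV[C]_n.+2)
    (d : nat) (G : lieGroupType R d) (act : G -> X -> X) :
  analytic_subvariety X -> X <> setT -> ~ finite_set X -> holomorphic_action act -> effective act ->
  exists j : X -> 'rV[C]_n.+2, embedding j /\
    forall g : G, g <> 1%g -> ~ exists Phi : 'rV[C]_n.+2 -> 'rV[C]_n.+2,
      holomorphic_automorphism Phi /\ forall x : X, Phi (j x) = j (act g x).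
Proof.
move=> Xa XT Xi ha he.
have [K [Kc KG]] := lie_sigma_compact G.
have hH (sM : nat * R) : exists B : R, forall g u, K sM.1 g -> nn (set_val u) <= sM.2 -> nn (set_val (act g u)) <= B.
  exact: action_bounded Xa ha (Kc sM.1).
have [H hHs] := choice hH.
have [c [e [r [dl [[dl0 r0] out [nes ins] exh rigid]]]]] := @rigid_sequence R n.
have [J [Jd Jinj Jimm Jb Jt]] := embedding_avoiding (fun s M => H (s, M)) Xa XT Xi dl0 r0 out nes ins exh.
exists (fun u => J (set_val u)); split; first exact: restriction_embedding.
move=> g g1 [Phi [[Pd [Psi [Sd PK SK]]] Pj]]; apply: g1; apply: he => x.
have [xs hxs] := choice Jt.
have gK a b u : act a (act b u) = act (a * b)%g u by rewrite (actM ha).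
have gV u : act g (act g^-1%g u) = u by rewrite gK mulgV (act1 ha).
have Vg u : act g^-1%g (act g u) = u by rewrite gK mulVg (act1 ha).
have [s1 hs1] := KG g; have [s2 hs2] := KG g^-1%g.
(* If [J] sent [u] into the [s]-th polydisc, [u] would have norm at most [M], and its translate
   [xs s] norm at most [H (s, M)], which is false. This is used for both [g] and its inverse, once
   the two lie in [K s]. *)
have key s a u : K s a -> set_val (act a u) = xs s -> r s <= nn (J (set_val u) - c s) + dl s.
  move=> Ka ax; rewrite leNgt; apply/negP => lt; have [Xx _ [M HM hM]] := hxs s.
  have := hHs (s, M) a u Ka (hM _ (set_valP u) lt); rewrite ax leNgt; move: HM => /= ->.
  by [].
have xsX s : exists u : X, set_val u = xs s.
  by have [Xx _ _] := hxs s; exists (SigSub (mem_set Xx) : X).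
have FG : aut_pair Phi Psi by split => // z; [exact: Pd|exact: Sd].
have Pid := @rigid (maxn s1 s2) Phi Psi (fun s => J (xs s)) FG.
apply: val_inj; apply: Jinj; try exact: set_valP; rewrite -[LHS]Pj; apply: Pid => s.
  by have [_ h _] := hxs s.
rewrite geq_max => /andP[/hs1 Kg /hs2 Kg']; have [u ux] := xsX s.
split; rewrite -ux.
  by rewrite Pj; apply: key Kg' _; rewrite Vg.
have -> : Psi (J (set_val u)) = J (set_val (act g^-1%g u)) by rewrite -[act _ _ in RHS]Vg gV -[in RHS](PK (J _)) Pj gV.
by apply: key Kg _; rewrite gV.
Qed.

End HigherDimension.

(** * The complex line *)

Section Entire.
Context {R : realType}.
Local Notation C := (R[i]).

Lemma entire_bounded (f : C -> C) (M : R) : (forall a rho, hol a rho f) -> exists B : R, forall z, cn z <= M -> cn (f z) <= B.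
Proof.
move=> fh; have [B hB] : exists B : R, forall z : C, [set z : C | cn (z - 0) <= M] z -> cn (f z) <= B.
  apply: (@compact_ind R C _ (fun A => exists B : R, forall z, A z -> cn (f z) <= B)); first exact: compact_disc.
  - by exists 0.
  - move=> A A' [B hB] [B' hB']; exists (Num.max B B') => z [/hB|/hB'] h; rewrite le_max h ?orbT //.
  - by move=> A A' AA' [B hB]; exists B => z /AA'; exact: hB.
  move=> q _; have [r [B [r0 _ hB]]] := hol_locally_bounded (ltr01 : 0 < 1 :> R) (fh q 1).
  by exists r => //; exists B => z /=; rewrite nn_cn => zq; apply: hB.
by exists B => z zM; apply: hB; rewrite /= subr0.
Qed.

Lemma entire_linear_growth (f : C -> C) (K : R) : 0 <= K -> (forall a rho, hol a rho f) -> (forall z, cn (f z) <= cn z + K) ->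
  forall z, f z = f 0 + cderiv f 0 * z.
Proof.
move=> K0 fh fK z; apply/eqP; rewrite -subr_eq0 opprD addrA; apply/eqP; apply: cn_small => e e0.
pose rho := K + 1 + 16 * cn z + 128 * cn z ^+ 2 / e.
have z0 := cn_ge0 z; have q0 : 0 <= 128 * cn z ^+ 2 / e by rewrite divr_ge0 ?mulr_ge0 ?sqr_ge0 // ltW.
have rho0 : 0 < rho by rewrite /rho; lra.
have fB : bounded_by 0 rho f (2 * rho).
  by move=> w; rewrite subr0 => wr; apply: (le_trans (fK w)); rewrite /rho in wr *; lra.
have zr : cn z < rho / 16 by rewrite /rho; lra.
have := hol_taylor_center rho0 (fh 0 rho) fB zr; rewrite add0r => h; apply: (le_trans h).
have -> : 64 * (2 * rho) / rho ^+ 2 * cn z ^+ 2 = 128 * cn z ^+ 2 / rho by field; rewrite gt_eqF.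
rewrite ler_pdivrMr // [e * _]mulrC -ler_pdivrMr // /rho; lra.
Qed.

(* The quotient (z - a) / f z, where a is the zero of f, is entire without
   zeros and has linear growth, so it is constant. *)
Lemma entire_bijection_affine (f g : C -> C) : (forall a rho, hol a rho f) -> (forall a rho, hol a rho g) ->
  cancel f g -> cancel g f -> exists al be : C, al != 0 /\ forall z, f z = al * z + be.
Proof.
move=> fh gh fK gK; pose a := g 0; have fa : f a = 0 by rewrite /a gK.
have dE z : exists d, cdiff f z d by apply: (fh z 1); rewrite subrr cn0.
have q0 z : divdiff f a z != 0.
  have [->|za] := eqVneq z a; last first.
    have fz : f z != 0 by apply: contra za => /eqP fz; apply/eqP; apply: (can_inj fK); rewrite fz fa.
    by apply: contra fz; rewrite (divdiffE f a z) fa add0r => /eqP ->; rewrite mulr0.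
  have [d fd] := dE a; have [d' gd] : exists d', cdiff g (f a) d' by apply: (gh (f a) 1); rewrite subrr cn0.
  have := cdiff_comp fd gd; have -> : g \o f = id by apply: funext => w; exact: fK.
  move=> /(cdiff_uniq (cdiff_id a)) h; rewrite /divdiff eqxx (cdiff_uniq (cdiff_deriv fd) fd).
  by apply/eqP => d0; move/eqP: h; rewrite d0 mulr0 oner_eq0.
have qh c rho : hol c rho (divdiff f a).
  move=> z _; apply: (@divdiff_hol R a (cn (z - a) + 1) f a) => //; first by rewrite subrr cn0 ltr_wpDl // cn_ge0.
  by rewrite ltrDl.
pose F z := (divdiff f a z)^-1; have Fh c rho : hol c rho F by apply: hol_inv.
have [r0 hr0] := entire_bounded 1 gh; have [B hB] := entire_bounded r0 Fh.
have FK z : cn (F z) <= cn z + (cn a + `|B|).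
  have [zr|zr] := leP (cn z) r0.
    by apply: (le_trans (hB z zr)); have := ler_norm B; have := cn_ge0 z; have := cn_ge0 a; lra.
  have fz : 1 < cn (f z).
    by rewrite ltNge; apply/negP => /hr0; rewrite fK leNgt zr.
  have E : F z * f z = z - a by rewrite (divdiffE f a z) fa add0r mulrCA mulVf // mulr1.
  have : cn (F z) * 1 <= cn (F z) * cn (f z) by apply: ler_wpM2l; [exact: cn_ge0|exact: ltW].
  rewrite mulr1 -cnM E => h; apply: (le_trans h); apply: (le_trans (cnD _ _)); rewrite cnN.
  by have := normr_ge0 B; lra.
have K0 : 0 <= cn a + `|B| by rewrite addr_ge0 // cn_ge0.
have FE := entire_linear_growth K0 Fh FK.
have F0 z : F z != 0 by rewrite invr_eq0.
have D0 : cderiv F 0 = 0.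
  apply/eqP; apply: contraT => D0; have := F0 (- F 0 / cderiv F 0).
  by rewrite FE mulrC divfK // subrr eqxx.
exists (F 0)^-1, (- a / F 0); split; first by rewrite invr_eq0.
move=> z; have E : F z * f z = z - a by rewrite (divdiffE f a z) fa add0r mulrCA mulVf // mulr1.
move: E; rewrite FE D0 mul0r addr0 => E; apply: (mulfI (F0 0)); rewrite E mulrDr mulrA divff // mul1r.
by rewrite mulrCA mulfV // mulr1.
Qed.

(** A strictly increasing map of a set of natural numbers into itself never decreases a number; this
    is applied to [p] and to its inverse [q]. *)
Lemma increasing_self_bijection (I : set nat) (p q : nat -> nat) :
  (forall k, I k -> I (p k)) -> (forall k l, I k -> I l -> (k < l)%N -> (p k < p l)%N) ->
  (forall k, I k -> I (q k)) -> (forall k l, I k -> I l -> (k < l)%N -> (q k < q l)%N) ->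
  (forall k, I k -> p (q k) = k) -> forall k, I k -> p k = k.
Proof.
have ge s : (forall k, I k -> I (s k)) -> (forall k l, I k -> I l -> (k < l)%N -> (s k < s l)%N) -> forall k, I k -> (k <= s k)%N.
  move=> sI sm; elim/ltn_ind => k IH Ik; rewrite leqNgt; apply/negP => sk.
  by have := IH _ sk (sI _ Ik); rewrite leqNgt (sm _ _ (sI _ Ik) Ik sk).
move=> pI pm qI qm pq k Ik; apply/eqP; rewrite eqn_leq; apply/andP; split; last exact: ge.
have qk := ge q qI qm k Ik; rewrite leq_eqVlt in qk; case/orP: qk => [/eqP E|qk].
  by rewrite {1}E pq.
by have := pm _ _ Ik (qI _ Ik) qk; rewrite pq // => /ltnW.
Qed.

(** * Discrete subsets of the complex line *)

Section Line.
Variable X : set 'rV[C]_1.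
Hypothesis X_analytic : analytic_subvariety X.
Hypothesis X_proper : X <> setT.

Let v : 'rV[C]_1 := const_mx 1.

Lemma lineE (z : 'rV[C]_1) : z = z 0 0 *: v.
Proof. by apply/rowP => i; rewrite !mxE mulr1 ord1. Qed.

Lemma nn_line (z : 'rV[C]_1) : nn z = cn (z 0 0).
Proof.
apply/eqP; rewrite eq_le nn_coord andbT; apply: nn_le => [|i]; first exact: cn_ge0.
by rewrite ord1.
Qed.

(** Either some local equation has only isolated zeros near [q], or all of them vanish identically,
    and then [X] is the whole line by [analytic_line]. *)
Lemma line_discrete q : exists2 r : R, 0 < r & forall z, X z -> nn (z - q) < r -> z = q.
Proof.
have hs := analytic_slice X_analytic 0 v.
have [r [k [f [r0 fh fX]]]] := hs (q 0 0).
have [[i hi]|hn] := pselect (exists i, ~ exists2 s : R, 0 < s & forall z, cn (z - q 0 0) < s -> f i z = 0).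
  have [//|[s s0 hs']] := zero_isolated r0 (fh i); exists (Num.min r s); first by rewrite lt_min r0.
  move=> z Xz; rewrite nn_line lt_min !mxE => /andP[zr zs]; rewrite [z]lineE [RHS]lineE; congr (_ *: _).
  apply/eqP; apply: contraT => zq; have := hs' _ zq zs.
  have [h _] := fX _ zr; have := h; rewrite /= add0r -lineE => /(_ Xz i) ->; rewrite eqxx //.
exfalso; apply: X_proper; apply/seteqP; split => // z _.
have [s s0 hs'] : exists2 s : R, 0 < s & forall i z, cn (z - q 0 0) < s -> f i z = 0.
  apply: (@fin_radius R _ (fun i s => forall z, cn (z - q 0 0) < s -> f i z = 0)).
    by move=> i; apply: contrapT => h; apply: hn; exists i.
  by move=> i s s' ss h w ws; apply: h; exact: lt_le_trans ss.
have := @analytic_line R [set w | X (0 + w *: v)] hs (q 0 0) (Num.min r s) _ _ (z 0 0).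
rewrite /= add0r -lineE; apply; first by rewrite lt_min r0.
by move=> w; rewrite lt_min => /andP[wr ws]; apply/fX => // i; exact: hs'.
Qed.

Lemma line_ball_finite (M : R) : finite_set (X `&` [set z | nn (z - 0) <= M]).
Proof.
apply: compact_finite_isolated.
  apply: (@compact_bounded_closed R 1 _ M); last by move=> z [_ /=]; rewrite subr0.
  by apply: closedI; [exact: subvariety_closed|exact: closed_ballC].
by move=> q; have [r r0 hr] := line_discrete q; exists r => // z [Xz _]; exact: hr.
Qed.

Lemma line_countable : exists idx : 'rV[C]_1 -> nat, forall x y, X x -> X y -> idx x = idx y -> x = y.
Proof.
have cX : countable X.
  have -> : X = \bigcup_(N in [set: nat]) (X `&` [set z | nn (z - 0) <= N%:R]).
    apply/seteqP; split=> [z Xz|z [N _ []]] //; exists (Num.bound (nn z)) => //; split => //=.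
    by rewrite subr0; apply: ltW; apply: archi_boundP; exact: nn_ge0.
  by apply: bigcup_countable => // N _; apply: finite_set_countable; exact: line_ball_finite.
have /countable_injP[idx hidx] := cX; exists idx => x y Xx Xy; apply: hidx; exact: mem_set.
Qed.

End Line.

Section LineEmbedding.
Variable X : set 'rV[C]_1.
Hypothesis X_analytic : analytic_subvariety X.
Hypothesis X_proper : X <> setT.
Variable idx : 'rV[C]_1 -> nat.
Hypothesis idx_inj : forall x y, X x -> X y -> idx x = idx y -> x = y.

Let j (u : X) : 'rV[C]_1 := const_mx (idx (set_val u))%:R.

Lemma idx_finite N : finite_set [set u : X | (idx (set_val u) < N)%N].
Proof.
have : finite_set (\bigcup_(k in `I_N) [set u : X | idx (set_val u) = k]).
  apply: bigcup_finite; first exact: finite_II.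
  move=> k _; have [[u0 uk]|hn] := pselect (exists u : X, idx (set_val u) = k).
    apply: (@sub_finite_set _ _ [set u0]) => // u /= uk'.
    by apply: val_inj; apply: idx_inj; [exact: set_valP|exact: set_valP|rewrite uk' uk].
  by apply: (@sub_finite_set _ _ set0) => // u uk; apply: hn; exists u.
by apply: sub_finite_set => u uN; exists (idx (set_val u)).
Qed.

(** On a discrete set every map is holomorphic and all tangent spaces are 0, as the function [f]
    shows; properness only asks that each value bound leaves finitely many points. *)
Lemma line_embedding : embedding j.
Proof.
have ball_open (p : 'rV[C]_1) (r : R) : open [set y | nn (y - p) < r].
  apply/open_nnP => y /= yp; exists (r - nn (y - p)); first by rewrite subr_gt0.
  by move=> z zy; have := nn_distD y z p; clear -zy; lra.
split.
- move=> x; have [r r0 hr] := line_discrete X_analytic X_proper (set_val x).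
  exists [set y | nn (y - set_val x) < r], (fun=> j x); split => //; first by rewrite /= subrr nn0.
  by move=> y /(hr _ (set_valP y)) yx; congr j; exact: val_inj.
- move=> K /compact_nn_bounded[M hM]; apply: finite_compact.
  apply: sub_finite_set (idx_finite (Num.bound `|M|)) => u /= Ku.
  have := hM _ Ku; rewrite nn_line mxE => h; rewrite -(ltr_nat R).
  apply: le_lt_trans (archi_boundP (normr_ge0 M)); apply: le_trans (ler_norm M).
  by apply: le_trans h; rewrite -(rmorph_nat (real_complex R)) cn_real normr_nat.
- move=> u u' /(congr1 (fun z : 'rV[C]_1 => z 0 0)); rewrite !mxE => /eqP; rewrite eqr_nat => /eqP h.
  by apply: val_inj; apply: idx_inj h; exact: set_valP.
move=> x U F _ v tv _; have [r r0 hr] := line_discrete X_analytic X_proper (set_val x).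
pose p : 'rV[C]_1 := set_val x; pose f (z : 'rV[C]_1) : C := z 0 0 - p 0 0.
have fd z : differentiable f z by apply: differentiableB; [exact: df_coord|exact: df_cst].
have : 'd f p v = 0.
  apply: (tv [set y | nn (y - p) < r] f) => //; first by rewrite /= subrr nn0.
  by move=> q Xq /(hr _ Xq) ->; rewrite /f subrr.
have c1 := cdiff_direction v (fd p).
have c2 : cdiff (fun s => f (p + s *: v)) 0 (1 * v 0 0 + 0 * 0).
  have -> : (fun s => f (p + s *: v)) = (fun s => s * v 0 0).
    by apply: funext => s; rewrite /f !mxE; ring.
  exact: cdiffM (cdiff_id 0) (cdiff_cst (v 0 0) 0).
rewrite (cdiff_uniq c1 c2) mul0r addr0 mul1r => v0.
by rewrite [v]lineE v0 scale0r.
Qed.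

Lemma idx_unbounded : ~ finite_set X -> forall N, exists u : X, (N < idx (set_val u))%N.
Proof.
move=> Xi N; apply: contrapT => hn; apply: Xi.
have := finite_image (set_val : X -> 'rV[C]_1) (idx_finite N.+1); apply: sub_finite_set => z Xz.
exists (SigSub (mem_set Xz) : X) => //=; rewrite ltnS leqNgt; apply/negP => h; apply: hn.
by exists (SigSub (mem_set Xz) : X).
Qed.

Lemma line_rigid (s t : X -> X) (Phi : 'rV[C]_1 -> 'rV[C]_1) : ~ finite_set X -> cancel s t -> cancel t s ->
  holomorphic_automorphism Phi -> (forall x, Phi (j x) = j (s x)) -> forall x, s x = x.
Proof.
move=> Xi st ts [Pd [Psi [Sd PK SK]]] Pj.
pose v : 'rV[C]_1 := const_mx 1.
have slice_entire (F : 'rV[C]_1 -> 'rV[C]_1) : holomorphic_on setT F -> forall a rho, hol a rho (fun t => F (t *: v) 0 0).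
  move=> Fd a rho z _; have Fc : differentiable ((fun y : 'rV[C]_1 => y 0 0 : C) \o F) (0 + z *: v).
    by apply: differentiable_comp; [exact: Fd|exact: df_coord].
  have := cdiff_slice Fc; set dd := 'd _ _ _ => h; exists dd.
  have E : (fun t => F (t *: v) 0 0) = (fun w => ((fun y : 'rV[C]_1 => y 0 0 : C) \o F) (0 + w *: v)).
    by apply: funext => w; rewrite /= add0r.
  by rewrite E.
have [||al [be [al0 E]]] := entire_bijection_affine (slice_entire _ Pd) (slice_entire _ Sd).
- by move=> z; rewrite -lineE PK !mxE mulr1.
- by move=> z; rewrite -lineE SK !mxE mulr1.
have Ej x : al * (idx (set_val x))%:R + be = (idx (set_val (s x)))%:R.
  rewrite -E; have -> : (idx (set_val x))%:R *: v = j x by apply/rowP => i; rewrite !mxE mulr1.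
  by rewrite Pj mxE.
have [x0 _] := idx_unbounded Xi 0; have [x1 x01] := idx_unbounded Xi (idx (set_val x0)).
pose n (x : X) : R := (idx (set_val x))%:R.
have nC x : (idx (set_val x))%:R = (n x)%:C by rewrite rmorph_nat.
have rB (y z : R) : (y - z)%:C = y%:C - z%:C by exact: rmorphB.
have n01 : n x1 - n x0 != 0 by rewrite subr_eq0 eqr_nat gtn_eqF.
pose a := (n (s x1) - n (s x0)) / (n x1 - n x0).
have alE : al = a%:C.
  have := Ej x1; have := Ej x0; rewrite !nC => e0 e1.
  have h : al * (n x1 - n x0)%:C = (n (s x1) - n (s x0))%:C by rewrite !rB -e0 -e1; ring.
  have nz : (n x1 - n x0)%:C != 0 by rewrite -(rmorph0 (real_complex R)) (inj_eq (@complexI R)).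
  by apply: (mulIf nz); rewrite h -rmorphM /a divfK.
have nE x y : n (s x) - n (s y) = a * (n x - n y).
  apply: (@complexI R); have := Ej x; have := Ej y; rewrite !nC alE => e0 e1.
  by rewrite rmorphM !rB -e0 -e1; ring.
(* A negative slope would send the points of large index to negative numbers. *)
have a0 : 0 < a.
  rewrite lt_def; apply/andP; split; first by apply: contra al0; rewrite alE => /eqP ->.
  rewrite leNgt; apply/negP => an.
  have [x xb] := idx_unbounded Xi (Num.bound (n (s x0) / - a + n x0)).
  have h1 : n (s x0) / - a + n x0 < n x.
    apply: le_lt_trans (_ : (Num.bound (n (s x0) / - a + n x0))%:R < _); last by rewrite ltr_nat.
    by apply: ltW; apply: archi_boundP; rewrite addr_ge0 ?ler0n // divr_ge0 ?ler0n // oppr_ge0 ltW.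
  have := nE x x0; have : 0 <= n (s x) by exact: ler0n.
  have : n (s x0) / - a < n x - n x0 by lra.
  by rewrite ltr_pdivrMr ?oppr_gt0 // mulrN mulrC; lra.
have smono x y : (idx (set_val x) < idx (set_val y))%N = (idx (set_val (s x)) < idx (set_val (s y)))%N.
  rewrite -!(ltr_nat R) -/(n x) -/(n y) -/(n (s x)) -/(n (s y)) -[RHS]subr_gt0 nE pmulr_rgt0 //.
  by rewrite subr_gt0.
pose I := [set k | exists x : X, idx (set_val x) = k].
have hp (h : X -> X) k : exists m, I k -> exists x : X, idx (set_val x) = k /\ idx (set_val (h x)) = m.
  have [[x xk]|nk] := pselect (I k); first by exists (idx (set_val (h x))) => _; exists x.
  by exists 0%N.
have [p pP] := choice (hp s); have [q qP] := choice (hp t).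
have same (x y : X) : idx (set_val x) = idx (set_val y) -> x = y.
  by move=> h; apply: val_inj; apply: idx_inj h; exact: set_valP.
have pE x : p (idx (set_val x)) = idx (set_val (s x)).
  by have [|y [yx <-]] := pP (idx (set_val x)); [exists x|rewrite (same _ _ yx)].
have qE x : q (idx (set_val x)) = idx (set_val (t x)).
  by have [|y [yx <-]] := qP (idx (set_val x)); [exists x|rewrite (same _ _ yx)].
move=> x; apply: same; rewrite -pE; apply: (@increasing_self_bijection I p q).
- by move=> _ [y <-]; rewrite pE; exists (s y).
- by move=> _ _ [y <-] [z <-]; rewrite !pE smono.
- by move=> _ [y <-]; rewrite qE; exists (t y).
- by move=> _ _ [y <-] [z <-]; rewrite !qE (smono (t y) (t z)) !ts.
- by move=> _ [y <-]; rewrite qE pE ts.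
- by exists x.
Qed.

End LineEmbedding.

End Entire.

Theorem theorem3 (R : realType) (n : nat) (X : set 'rV[R[i]]_n)
    (X_analytic : analytic_subvariety X) (X_proper : X <> setT)
    (X_infinite : ~ finite_set X)
    (d : nat) (G : lieGroupType R d) (act : G -> X -> X)
    (act_hol : holomorphic_action act) (act_eff : effective act) :
  exists j : X -> 'rV[R[i]]_n,
    embedding j /\
    forall g : G, g <> 1%g ->
      ~ exists Phi : 'rV[R[i]]_n -> 'rV[R[i]]_n,
          holomorphic_automorphism Phi /\
          forall x : X, Phi (j x) = j (act g x).
Proof.
case: n X X_analytic X_proper X_infinite act act_hol act_eff => [|[|n]] X Xa XT Xi act ha he.
(* For [n = 0] the ambient space is a single point, so [X] is finite. *)
- by case: Xi; apply: (@sub_finite_set _ _ [set 0]) => // z _ /=; apply/rowP; case.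
- have [idx idx_inj] := line_countable Xa XT.
  exists (fun u => const_mx (idx (set_val u))%:R); split; first exact: line_embedding.
  move=> g g1 [Phi [Pa Pj]]; apply: g1; apply: he.
  have st : cancel (act g) (act g^-1%g) by move=> y; rewrite -(actM ha) mulVg (act1 ha).
  have ts : cancel (act g^-1%g) (act g) by move=> y; rewrite -(actM ha) mulgV (act1 ha).
  exact: (line_rigid idx_inj Xi st ts Pa Pj).
exact: nonextendable_higher_dimension.
Qed.
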